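(* Let $L\neq\mathbb{Q}$ be a number field with absolute discriminant $d_L$. If the Dedekind zeta function $\zeta_L(s)$ admits a real zero $\beta_1\in(0,1)$, then $$1-\beta_1\ge d_L^{-c_3}\quad\text{with } c_3=11.7.$$
   Context: $\zeta_L(s)$ denotes the Dedekind zeta function of $L$. *)

(* Defs.v *)
From HB Require Import structures.
From mathcomp Require Import all_boot all_order all_algebra all_field.
From mathcomp Require Import complex finmap.
From mathcomp Require Import all_classical all_reals all_analysis.
From mathcomp.analysis.showcase Require Import summability.

Set Implicit Arguments.
Unset Strict Implicit.
Unset Printing Implicit Defensive.

Import Order.TTheory GRing.Theory Num.Theory. Import passmx.
Import numFieldNormedType.Exports.

Local Open Scope classical_set_scope.
Local Open Scope ring_scope.

Section NumberField.

Variable L : fieldExtType rat.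

Definition ring_of_integers : set L := integralOver (intr : int -> L).

Definition nonzero_ideal (I : set L) : Prop :=
  [/\ I `<=` ring_of_integers, I 0,
      (forall x y, I x -> I y -> I (x + y)),
      (forall a x, ring_of_integers a -> I x -> I (a * x))
    & exists2 x, I x & x != 0].

(* The carrier of the quotient of the ring of integers by I. *)
Definition ideal_cosets (I : set L) : set (set L) :=
  [set [set a + x | x in I] | a in ring_of_integers].

(* #|` fset_set A| is the cardinality of a finite set A and is 0 for an
   infinite one; the quotient by a nonzero ideal is always finite. *)
Definition ideal_norm (I : set L) : nat := #|` fset_set (ideal_cosets I)|.

Definition field_trace (x : L) : rat :=
  \tr (mxof (vbasis {:L}) (vbasis {:L}) (amull x)).

Definition integral_basis (b : (\dim {:L}).-tuple L) : Prop :=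
  basis_of {:L} b /\
  forall x : L, ring_of_integers x <->
    exists c : 'I_(\dim {:L}) -> int, x = \sum_i (c i)%:~R * b`_i.

Definition basis_disc (b : (\dim {:L}).-tuple L) : rat :=
  \det (\matrix_(i < \dim {:L}, j < \dim {:L}) field_trace (b`_i * b`_j)).

(* Integral bases always exist and share the same discriminant, so neither the
   default value nor the choice made by xget matters. *)
Definition absolute_disc : rat :=
  `|basis_disc (xget [tuple of nseq _ 0] integral_basis)|.

End NumberField.

(* A numFieldType carries the topology of its norm and is a normed module over
   itself; the next two definitions are instantiated at the field R[i]. *)
Definition holomorphic_at (K : numFieldType) (f : K -> K) (z : K) : Prop :=
  derivable f z 1.

(* Unordered summation: convergence along the directed set of the finite
   subsets of I. *)
Definition has_sum (K : numFieldType) (I : choiceType) (x : I -> K) (l : K) :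
    Prop :=
  partial_sum x @ totally --> l.

Section DedekindZeta.

Variable R : realType.

Definition cexp (z : R[i]) : R[i] :=
  (expR (complex.Re z))%:C%C * (cos (complex.Im z) +i* sin (complex.Im z))%C.

(* n ^ (- s) *)
Definition cpow_neg (n : nat) (s : R[i]) : R[i] :=
  cexp (- s * (ln n%:R)%:C%C).

(* Z is the analytic continuation to the complex plane minus 1 of the sum over
   the nonzero ideals I of N(I) ^ (- s), where 1 < Re s.  By the identity
   theorem, these conditions determine Z away from 1; its value at the pole 1
   is left unspecified. *)
Record is_dedekind_zeta (L : fieldExtType rat) (Z : R[i] -> R[i]) : Prop := {
  dedekind_zeta_series : forall s : R[i], 1 < complex.Re s ->
    has_sum
      (fun I : [set I : set L | nonzero_ideal I] =>
         cpow_neg (ideal_norm (val I)) s)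
      (Z s);
  dedekind_zeta_holomorphic : forall s : R[i], s != 1 -> holomorphic_at Z s
}.

End DedekindZeta.

(* Main.v *)
(** For a nonzero ideal J, compare the theta series of the lattice J^-1, for a
    conjugation-invariant weight normalised by N(J), with its main term: for
    0 < t <= 1,
      kappa <= t^(n/2) Theta(t) <= kappa + 32 n^2 (n+2) kappa^-2 t,
    where kappa >= d^(-1/2).  No Poisson summation is used: the lower bound and
    the monotonicity come from the parallelogram law, which gives
    Theta(t)^2 <= 2^n Theta(2t)^2, and the upper bound from the existence of
    short representatives of all classes of J^-1 modulo 2.

    Integrating over the weights and summing over the ideal classes turns these
    series into a function psi whose Laplace transform is zeta_L times the
    transform of a rapidly decreasing phi.  Hence, for some V > 0 and
    rho >= V d^(-1/2), the function zeta_L(s) laplace phi(s) - rho / (s - 1) + V / s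
    is the Laplace transform of a nonnegative function, holomorphic for
    Re s > 1 - 2 / n.  At a real zero beta close to 1 the continued identity reads
      rho / (1 - beta) + V / beta = (that transform at beta) <= V + 32 n^3 (n+2) d V,
    so 1 / (1 - beta) <= 64 d^(11/2) because n <= d.  If beta is not close to 1,
    or if there is no integral basis (never the case), the bound is trivial. *)

Require Import Defs.
From HB Require Import structures.
From mathcomp Require Import all_boot all_order all_algebra all_field.
From mathcomp Require Import complex finmap.
From mathcomp Require Import all_classical all_reals all_analysis.
From mathcomp.analysis.showcase Require Import summability.
From mathcomp Require Import measurable_realfun.
From mathcomp Require Import ring lra zify.

Set Implicit Arguments.
Unset Strict Implicit.
Unset Printing Implicit Defensive.

Import Order.TTheory GRing.Theory Num.Theory. Import passmx.
Import numFieldNormedType.Exports.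

Local Open Scope classical_set_scope.
Local Open Scope ring_scope.

#[local] Arguments Normc.normc {R} x : simpl never.

Import Normc.
Local Notation cRe := complex.Re.
Local Notation cIm := complex.Im.

(** * Holomorphic functions and complex-valued integrals *)

Section HolomorphicAlgebra.
Variable K : numFieldType.
Implicit Types (f g : K -> K) (z c : K).

Lemma holomorphicB f g z : holomorphic_at f z -> holomorphic_at g z ->
  holomorphic_at (fun w => f w - g w) z.
Proof. by move=> hf hg; exact: derivableB. Qed.

Lemma holomorphicD f g z : holomorphic_at f z -> holomorphic_at g z ->
  holomorphic_at (fun w => f w + g w) z.
Proof. by move=> hf hg; exact: derivableD. Qed.

Lemma holomorphicM f g z : holomorphic_at f z -> holomorphic_at g z ->
  holomorphic_at (fun w => f w * g w) z.
Proof. by move=> hf hg; exact: derivableM. Qed.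

Lemma holomorphic_cst c z : holomorphic_at (fun=> c) z.
Proof. exact: derivable_cst. Qed.

Lemma holomorphicZ c f z : holomorphic_at f z -> holomorphic_at (fun w => c * f w) z.
Proof. by apply: holomorphicM; exact: holomorphic_cst. Qed.

Lemma holomorphic_subr c z : holomorphic_at (fun w => w - c) z.
Proof. by apply: holomorphicB; [exact: derivable_id|exact: holomorphic_cst]. Qed.

Lemma holomorphic_inv_subr c z : z != c -> holomorphic_at (fun w => (w - c)^-1) z.
Proof. by move=> zc; apply: derivableV; [rewrite subr_eq0|exact: holomorphic_subr]. Qed.

Lemma holomorphicX f n z : holomorphic_at f z -> holomorphic_at (fun w => f w ^+ n) z.
Proof.
move=> hf; elim: n => [|n IH].
  by under eq_fun do rewrite expr0; exact: holomorphic_cst.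
by under eq_fun do rewrite exprS; exact: holomorphicM.
Qed.

End HolomorphicAlgebra.

Section ComplexModulus.
Variable R : rcfType.
Implicit Types (z w : R[i]) (x : R).

Lemma complex_eq z w : cRe z = cRe w -> cIm z = cIm w -> z = w.
Proof. by case: z => a b; case: w => c d /= -> ->. Qed.

Lemma complexReD z w : cRe (z + w) = cRe z + cRe w.
Proof. by case: z; case: w. Qed.
Lemma complexImD z w : cIm (z + w) = cIm z + cIm w.
Proof. by case: z; case: w. Qed.
Lemma complexReB z w : cRe (z - w) = cRe z - cRe w.
Proof. by case: z; case: w. Qed.
Lemma complexImB z w : cIm (z - w) = cIm z - cIm w.
Proof. by case: z; case: w. Qed.
Lemma complexReM z w : cRe (z * w) = cRe z * cRe w - cIm z * cIm w.
Proof. by case: z; case: w. Qed.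
Lemma complexImM z w : cIm (z * w) = cRe z * cIm w + cIm z * cRe w.
Proof. by case: z; case: w. Qed.

Lemma complex_Re_sum (I : Type) (r : seq I) (P : pred I) (F : I -> R[i]) :
  cRe (\sum_(i <- r | P i) F i) = \sum_(i <- r | P i) cRe (F i).
Proof. exact: (raddf_sum (@complex.Re R)). Qed.

Lemma complex_Im_sum (I : Type) (r : seq I) (P : pred I) (F : I -> R[i]) :
  cIm (\sum_(i <- r | P i) F i) = \sum_(i <- r | P i) cIm (F i).
Proof. exact: (raddf_sum (@complex.Im R)). Qed.

Lemma complex_gt0 z : 0 < z -> z = ((cRe z)%:C)%C /\ 0 < cRe z.
Proof. by case: z => a b; rewrite ltcE/= => /andP[/eqP -> ->]. Qed.

Lemma norm_normc z : `|z| = ((normc z)%:C)%C.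
Proof. by case: z. Qed.

Lemma normc_ge0 z : 0 <= normc z.
Proof. by rewrite -ler0c -norm_normc. Qed.

Lemma normc_gt0 z : (0 < normc z) = (z != 0).
Proof.
rewrite lt_def normc_ge0 andbT; apply/idP/idP; apply: contra => /eqP.
  by move=> ->; rewrite normc0.
by move=> /eq0_normc ->.
Qed.

Lemma normcX z n : normc (z ^+ n) = normc z ^+ n.
Proof.
elim: n => [|n IH]; first by rewrite !expr0 (normc1 R).
by rewrite !exprS normcM IH.
Qed.

Lemma le_normcB z w : normc (z - w) <= normc z + normc w.
Proof. by rewrite (le_trans (le_normcD _ _))// normcN. Qed.

Lemma normc_distC z w : normc (z - w) = normc (w - z).
Proof. by rewrite -normcN opprB. Qed.

Lemma normc_real x : normc (x%:C)%C = `|x|.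
Proof. by rewrite /normc /= expr0n addr0 sqrtr_sqr. Qed.

Lemma normc_imag x : normc (Complex 0 x) = `|x|.
Proof. by rewrite /normc /= expr0n add0r sqrtr_sqr. Qed.

Lemma normc_i : normc ('i%C : R[i]) = 1.
Proof. by rewrite normc_imag normr1. Qed.

Lemma normc_conj z : normc (z^* )%C = normc z.
Proof. by case: z => a b; rewrite /normc /= sqrrN. Qed.

Lemma sqr_normc_ReIm z : normc z ^+ 2 = cRe z ^+ 2 + cIm z ^+ 2.
Proof. by case: z => x y; rewrite /normc /= sqr_sqrtr// addr_ge0// sqr_ge0. Qed.

Lemma normr_Re_le z : `|cRe z| <= normc z.
Proof.
case: z => a b; rewrite /normc /= -sqrtr_sqr ler_wsqrtr// lerDl.
exact: sqr_ge0.
Qed.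

Lemma normr_Im_le z : `|cIm z| <= normc z.
Proof.
case: z => a b; rewrite /normc /= -sqrtr_sqr ler_wsqrtr// lerDr.
exact: sqr_ge0.
Qed.

Lemma normc_le_ReIm z : normc z <= `|cRe z| + `|cIm z|.
Proof.
rewrite -ler_sqr ?nnegrE ?normc_ge0 ?addr_ge0// sqr_normc_ReIm.
rewrite -[cRe z ^+ 2]real_normK ?num_real// -[cIm z ^+ 2]real_normK ?num_real//.
by rewrite sqrrD lerD2r lerDl mulrn_wge0// mulr_ge0.
Qed.

Lemma normc_lt z x : 0 <= x -> cRe z ^+ 2 + cIm z ^+ 2 < x ^+ 2 -> normc z < x.
Proof. by move=> x0 h; rewrite -ltr_sqr ?nnegrE ?normc_ge0// sqr_normc_ReIm. Qed.

Lemma complex_eq0_small z (e0 B : R) : 0 < e0 ->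
  (forall e, 0 < e < e0 -> normc z <= e * B) -> z = 0.
Proof.
move=> e00 small; apply/eqP; rewrite -[_ == 0]negbK -normc_gt0; apply/negP => z0.
pose e := Num.min (e0 / 2) (normc z / (2 * (`|B| + 1))).
have e_gt0 : 0 < e by rewrite /e lt_min !divr_gt0.
have e_lt : e < e0 by rewrite gt_min ltr_pdivrMr// ltr_pMr// ltr1n.
have e_le : e * (2 * (`|B| + 1)) <= normc z by rewrite -ler_pdivlMr// /e ge_min lexx orbT.
have := small e; rewrite e_gt0 e_lt => /(_ isT); have := ler_norm B.
move: e_le z0; nra.
Qed.

End ComplexModulus.

Section ComplexDerivative.
Variable R : realType.
Implicit Types (f g : R[i] -> R[i]) (z w h D : R[i]).

Definition has_complex_derivative f z D := forall e : R, 0 < e ->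
  exists2 eta : R, 0 < eta &
    forall h, normc h < eta -> normc (f (z + h) - f z - D * h) <= e * normc h.

Definition complex_continuous f z := forall e : R, 0 < e ->
  exists2 eta : R, 0 < eta & forall h, normc h < eta -> normc (f (z + h) - f z) <= e.

Lemma holomorphic_atP f z :
  holomorphic_at f z <-> exists D, has_complex_derivative f z D.
Proof.
split.
  move=> /cvg_ex[D /cvgrPdist_le fD]; exists D => e e0.
  have eC0 : 0 < (e%:C)%C :> R[i] by rewrite ltcR.
  have /nbhs_ballP[r r0 near_fD] := fD _ eC0.
  have [rE rp] := complex_gt0 r0.
  exists (cRe r) => // h hr.
  have [->|h0] := eqVneq h 0; first by rewrite addr0 subrr mulr0 subr0 normc0 mulr0.
  have := near_fD h; rewrite -ball_normE/= sub0r normrN norm_normc rE ltcR => /(_ hr h0).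
  rewrite norm_normc lecR => quotient_le.
  have -> : f (z + h) - f z - D * h = - (D - h^-1 *: (f (h *: 1 + z) - f z)) * h.
    rewrite /GRing.scale/= mulr1 [h + z]addrC mulNr mulrBl mulrAC mulVf// mul1r.
    by rewrite opprB.
  by rewrite normcM normcN ler_wpM2r// normc_ge0.
move=> [D fD]; apply/cvg_ex; exists D; apply/cvgrPdist_le => e e0.
have [eE ep] := complex_gt0 e0.
have [eta eta0 near_fD] := fD _ ep.
apply/nbhs_ballP; exists (eta%:C)%C; first by rewrite /= ltcR.
move=> h; rewrite -ball_normE/= sub0r normrN norm_normc ltcR => h_lt h0.
rewrite eE norm_normc lecR.
have := near_fD _ h_lt; rewrite -ler_pdivrMr ?normc_gt0//; apply: le_trans.
rewrite -normcV -normcM -normcN opprB le_eqVlt; apply/predU1l; congr normc.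
rewrite /GRing.scale/= mulr1 [h + z]addrC mulrBl mulfK//.
by rewrite [h^-1 * _]mulrC.
Qed.

Lemma holomorphic_eq_near f g z (r : R) : 0 < r ->
  (forall h, normc h < r -> f (z + h) = g (z + h)) ->
  holomorphic_at f z -> holomorphic_at g z.
Proof.
move=> r0 fg /holomorphic_atP[D fD]; apply/holomorphic_atP; exists D => e /fD[eta eta0 near_fD].
exists (Num.min r eta); first by rewrite lt_min r0.
move=> h; rewrite lt_min => /andP[hr heta].
rewrite -fg// (_ : g z = f z); first exact: near_fD.
by have := fg 0; rewrite normc0 addr0 => ->.
Qed.

Lemma holomorphic_continuous f z : holomorphic_at f z -> complex_continuous f z.
Proof.
move=> /holomorphic_atP[D fD] e e0; have [eta eta0 near_fD] := fD 1 ltr01.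
exists (Num.min eta (e / (1 + normc D))).
  by rewrite lt_min eta0 divr_gt0// ltr_wpDr ?normc_ge0.
move=> h; rewrite lt_min => /andP[h_eta h_e].
rewrite -[f (z + h) - f z](subrK (D * h)) (le_trans (le_normcD _ _))//.
rewrite normcM (le_trans (lerD (near_fD _ h_eta) (lexx _)))//.
by rewrite -mulrDl mulrC -ler_pdivlMr ?ltW// ltr_wpDr ?normc_ge0.
Qed.

Lemma complex_continuousB f g z : complex_continuous f z -> complex_continuous g z ->
  complex_continuous (fun w => f w - g w) z.
Proof.
move=> cf cg e e0; have half_e : 0 < e / 2 by rewrite divr_gt0.
have [a a0 near_f] := cf _ half_e; have [b b0 near_g] := cg _ half_e.
exists (Num.min a b); first by rewrite lt_min a0.
move=> h; rewrite lt_min => /andP[/near_f hf /near_g hg].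
have -> : f (z + h) - g (z + h) - (f z - g z) =
   (f (z + h) - f z) - (g (z + h) - g z) by ring.
by rewrite (le_trans (le_normcB _ _))// (splitr e) lerD.
Qed.

End ComplexDerivative.

Section ComplexIntegral.
Context d (T : measurableType d) (R : realType) (mu : {measure set T -> \bar R}).
Variable D : set T.
Implicit Types (F G : T -> R[i]) (u v : T -> R) (k : R[i]) (r : R).

Definition cmeasurable F := measurable_fun D (fun t => cRe (F t)) /\
  measurable_fun D (fun t => cIm (F t)).

Definition cintegrable F := mu.-integrable D (EFin \o (fun t => cRe (F t))) /\
  mu.-integrable D (EFin \o (fun t => cIm (F t))).

Definition cintegral F : R[i] :=
  Complex (\int[mu]_(t in D) cRe (F t)) (\int[mu]_(t in D) cIm (F t)).

Lemma eq_cintegral F G : (forall t, D t -> F t = G t) -> cintegral F = cintegral G.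
Proof.
by move=> FG; rewrite /cintegral; congr Complex; apply: eq_Rintegral => t;
  rewrite inE => /FG ->.
Qed.

Hypothesis mD : measurable D.

Lemma cmeasurableM F G : cmeasurable F -> cmeasurable G ->
  cmeasurable (fun t => F t * G t).
Proof.
move=> [F1 F2] [G1 G2]; split.
  by under eq_fun do rewrite complexReM; apply: measurable_funB; exact: measurable_funM.
by under eq_fun do rewrite complexImM; apply: measurable_funD; exact: measurable_funM.
Qed.

Lemma cmeasurable_real u : measurable_fun D u -> cmeasurable (fun t => ((u t)%:C)%C).
Proof. by move=> mu'; split => //=; exact: measurable_cst. Qed.

Lemma integrable_EFinZl u r : mu.-integrable D (EFin \o u) ->
  mu.-integrable D (EFin \o (fun t => r * u t)).
Proof. by move=> iu; have := integrableZl mD r iu. Qed.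

Lemma integrable_EFinD u v : mu.-integrable D (EFin \o u) ->
  mu.-integrable D (EFin \o v) -> mu.-integrable D (EFin \o (fun t => u t + v t)).
Proof. by move=> iu iv; have := integrableD mD iu iv. Qed.

Lemma integrable_EFinB u v : mu.-integrable D (EFin \o u) ->
  mu.-integrable D (EFin \o v) -> mu.-integrable D (EFin \o (fun t => u t - v t)).
Proof. by move=> iu iv; have := integrableB mD iu iv. Qed.

Lemma cintegrableB F G : cintegrable F -> cintegrable G ->
  cintegrable (fun t => F t - G t).
Proof.
move=> [F1 F2] [G1 G2]; split; rewrite /comp.
  by under eq_fun do rewrite complexReB; exact: integrable_EFinB.
by under eq_fun do rewrite complexImB; exact: integrable_EFinB.
Qed.

Lemma cintegrableZ k F : cintegrable F -> cintegrable (fun t => k * F t).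
Proof.
move=> [F1 F2]; split; rewrite /comp.
  under eq_fun do rewrite complexReM.
  by apply: integrable_EFinB; exact: integrable_EFinZl.
under eq_fun do rewrite complexImM.
by apply: integrable_EFinD; exact: integrable_EFinZl.
Qed.

Lemma cintegrable_le F u : cmeasurable F -> mu.-integrable D (EFin \o u) ->
  (forall t, D t -> normc (F t) <= u t) -> cintegrable F.
Proof.
move=> [m1 m2] iu Fu; split; apply: (le_integrable mD _ _ iu) => //=.
- exact/measurable_EFinP.
- by move=> t Dt; rewrite lee_fin (le_trans (normr_Re_le _))// (le_trans (Fu t Dt))// ler_norm.
- exact/measurable_EFinP.
- by move=> t Dt; rewrite lee_fin (le_trans (normr_Im_le _))// (le_trans (Fu t Dt))// ler_norm.
Qed.

Lemma cintegralB F G : cintegrable F -> cintegrable G ->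
  cintegral (fun t => F t - G t) = cintegral F - cintegral G.
Proof.
move=> [F1 F2] [G1 G2]; apply: complex_eq; rewrite ?complexReB ?complexImB/=.
  by rewrite -RintegralB//; apply: eq_Rintegral => t _; rewrite complexReB.
by rewrite -RintegralB//; apply: eq_Rintegral => t _; rewrite complexImB.
Qed.

Lemma cintegralD F G : cintegrable F -> cintegrable G ->
  cintegral (fun t => F t + G t) = cintegral F + cintegral G.
Proof.
move=> [F1 F2] [G1 G2]; apply: complex_eq; rewrite ?complexReD ?complexImD/=.
  by rewrite -RintegralD//; apply: eq_Rintegral => t _; rewrite complexReD.
by rewrite -RintegralD//; apply: eq_Rintegral => t _; rewrite complexImD.
Qed.

Lemma cintegralZ k F : cintegrable F -> cintegral (fun t => k * F t) = k * cintegral F.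
Proof.
move=> [F1 F2]; apply: complex_eq; rewrite ?complexReM ?complexImM/=.
  rewrite -!RintegralZl// -RintegralB//; [|exact: integrable_EFinZl..].
  by apply: eq_Rintegral => t _; rewrite complexReM.
rewrite -!RintegralZl// -RintegralD//; [|exact: integrable_EFinZl..].
by apply: eq_Rintegral => t _; rewrite complexImM.
Qed.

(* The constant 2 comes from bounding the real and imaginary parts separately. *)
Lemma normc_cintegral_le F u : cintegrable F -> mu.-integrable D (EFin \o u) ->
  (forall t, D t -> normc (F t) <= u t) ->
  normc (cintegral F) <= 2 * \int[mu]_(t in D) u t.
Proof.
move=> [F1 F2] iu Fu.
have part_le v : mu.-integrable D (EFin \o v) -> (forall t, D t -> `|v t| <= u t) ->
    `|\int[mu]_(t in D) v t| <= \int[mu]_(t in D) u t.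
  move=> iv vu; apply: (le_trans (le_normr_Rintegral mD iv)).
  by apply: le_Rintegral => //; exact: (integrable_abse iv).
rewrite (le_trans (normc_le_ReIm _))//= mulr_natl mulr2n.
apply: lerD; apply: part_le => // t Dt; apply: le_trans (Fu t Dt).
  exact: normr_Re_le.
exact: normr_Im_le.
Qed.

End ComplexIntegral.

Section SegmentIntegral.
Variable R : realType.
Local Notation mu := (@lebesgue_measure R).
Implicit Types (a b m r x y : R) (g k : R -> R[i]) (f : R[i] -> R[i]) (u : R -> R).
Local Notation seg_integral a b := (cintegral mu `[a, b]%classic).

Definition path_continuous a b g := forall x, a <= x <= b ->
  {for x, continuous (fun t => cRe (g t))} /\ {for x, continuous (fun t => cIm (g t))}.

Lemma path_continuousB a b g k : path_continuous a b g -> path_continuous a b k ->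
  path_continuous a b (fun x => g x - k x).
Proof.
move=> cg ck x xab; have [g1 g2] := cg x xab; have [k1 k2] := ck x xab; split.
  rewrite (_ : (fun t => _) = (fun t => cRe (g t)) \- (fun t => cRe (k t))).
    exact: continuousB.
  by apply/funext => t /=; rewrite complexReB.
rewrite (_ : (fun t => _) = (fun t => cIm (g t)) \- (fun t => cIm (k t))).
  exact: continuousB.
by apply/funext => t /=; rewrite complexImB.
Qed.

Lemma path_continuousZ a b (c : R[i]) g : path_continuous a b g ->
  path_continuous a b (fun x => c * g x).
Proof.
move=> cg x xab; have [g1 g2] := cg x xab.
have cM r u : {for x, continuous u} -> {for x, continuous (fun t => r * u t)}.
  by move=> cu; apply: continuousM => //; exact: cst_continuous.
split.
  rewrite (_ : (fun t => _) = (fun t => cRe c * cRe (g t)) \- (fun t => cIm c * cIm (g t))).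
    by apply: continuousB; exact: cM.
  by apply/funext => t /=; rewrite complexReM.
rewrite (_ : (fun t => _) = (fun t => cRe c * cIm (g t)) \+ (fun t => cIm c * cRe (g t))).
  by apply: continuousD; exact: cM.
by apply/funext => t /=; rewrite complexImM.
Qed.

Lemma path_continuous_comp a b f (p : R -> R[i]) :
  (forall s t, normc (p s - p t) = `|s - t|) ->
  (forall x, a <= x <= b -> complex_continuous f (p x)) ->
  path_continuous a b (fun x => f (p x)).
Proof.
move=> p_isom cf x xab.
have near_x e : 0 < e -> \forall t \near x, normc (f (p x) - f (p t)) <= e.
  move=> e0; have [eta eta0 near_f] := cf x xab e e0.
  apply/nbhs_ballP; exists eta => // t xt; rewrite normc_distC.
  have := near_f (p t - p x); rewrite [p x + _]addrC subrK; apply.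
  by rewrite p_isom distrC; exact: xt.
split; apply/cvgrPdist_le => e /near_x; apply: filterS => t; apply: le_trans.
  by rewrite -complexReB; exact: normr_Re_le.
by rewrite -complexImB; exact: normr_Im_le.
Qed.

Lemma path_continuous_horizontal a b y f :
  (forall x, a <= x <= b -> complex_continuous f (Complex x y)) ->
  path_continuous a b (fun x => f (Complex x y)).
Proof.
apply: path_continuous_comp => s t.
by rewrite [X in normc X](_ : _ = ((s - t)%:C)%C) ?normc_real//; apply: complex_eq => /=; ring.
Qed.

Lemma path_continuous_vertical a b x f :
  (forall y, a <= y <= b -> complex_continuous f (Complex x y)) ->
  path_continuous a b (fun y => f (Complex x y)).
Proof.
apply: path_continuous_comp => s t.
by rewrite [X in normc X](_ : _ = Complex 0 (s - t)) ?normc_imag//; apply: complex_eq => /=; ring.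
Qed.

Lemma continuous_segment_integrable a b u :
  (forall x, a <= x <= b -> {for x, continuous u}) ->
  mu.-integrable `[a, b] (EFin \o u).
Proof.
move=> cu; apply: continuous_compact_integrable; first exact: segment_compact.
by apply: continuous_in_subspaceT => x; rewrite inE/= in_itv/=; exact: cu.
Qed.

Lemma path_continuous_integrable a b g : path_continuous a b g ->
  cintegrable mu `[a, b]%classic g.
Proof. by move=> cg; split; apply: continuous_segment_integrable => x /cg[]. Qed.

Lemma Rintegral_segment_cst a b r : a <= b -> \int[mu]_(x in `[a, b]) r = r * (b - a).
Proof.
move=> ab; rewrite Rintegral_cst//; congr (_ * _).
have := @lebesgue_measure_itv R `[a, b]; rewrite /= lte_fin => /(congr1 fine) /= h.
apply: (etrans h); case: ltP => // ba.
by have -> : a = b; [apply/le_anti; rewrite ab|rewrite subrr].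
Qed.

Lemma Rintegral_segment_ge a b u r : a <= b ->
  mu.-integrable `[a, b] (EFin \o u) ->
  (forall x, a <= x <= b -> r <= u x) -> r * (b - a) <= \int[mu]_(x in `[a, b]) u x.
Proof.
move=> ab iu ru; rewrite -Rintegral_segment_cst//; apply: le_Rintegral => //=.
by apply: continuous_segment_integrable => x _; exact: cst_continuous.
Qed.

Lemma Rintegral_segment_split a m b u : a <= m -> m <= b ->
  mu.-integrable `[a, b] (EFin \o u) ->
  \int[mu]_(x in `[a, b]) u x = \int[mu]_(x in `[a, m]) u x + \int[mu]_(x in `[m, b]) u x.
Proof.
move=> am mb iu; have := @Rintegral_itvB R u (BLeft a) (BRight b) m iu.
rewrite !bnd_simp => /(_ am mb) /eqP; rewrite subr_eq => /eqP ->.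
rewrite addrC; congr (_ + _); rewrite Rintegral_itv_obnd_cbnd//.
apply: (integrableS _ _ _ iu) => // x; rewrite /= !in_itv/= => /andP[mx xb].
by rewrite xb andbT (le_trans am)// ltW.
Qed.

Lemma seg_integral_cst a b (c : R[i]) : a <= b ->
  seg_integral a b (fun=> c) = ((b - a)%:C)%C * c.
Proof.
move=> ab; rewrite /cintegral !Rintegral_segment_cst//; case: c => c1 c2 /=.
by apply: complex_eq => /=; ring.
Qed.

Lemma seg_integralB a b g k : path_continuous a b g -> path_continuous a b k ->
  seg_integral a b (fun x => g x - k x) = seg_integral a b g - seg_integral a b k.
Proof. by move=> cg ck; rewrite cintegralB//; exact: path_continuous_integrable. Qed.

Lemma seg_integralZ a b (c : R[i]) g : path_continuous a b g ->
  seg_integral a b (fun x => c * g x) = c * seg_integral a b g.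
Proof. by move=> cg; rewrite cintegralZ//; exact: path_continuous_integrable. Qed.

Lemma seg_integral_split a m b g : a <= m -> m <= b -> path_continuous a b g ->
  seg_integral a b g = seg_integral a m g + seg_integral m b g.
Proof.
move=> am mb /path_continuous_integrable[g1 g2]; rewrite /cintegral [RHS]/GRing.add/=.
by congr Complex; exact: Rintegral_segment_split.
Qed.

Lemma normc_seg_integral_le a b g (M : R) : a <= b -> path_continuous a b g ->
  (forall x, a <= x <= b -> normc (g x) <= M) ->
  normc (seg_integral a b g) <= 2 * (M * (b - a)).
Proof.
move=> ab cg gM; rewrite -Rintegral_segment_cst//; apply: normc_cintegral_le => //.
  exact: path_continuous_integrable.
by apply: continuous_segment_integrable => x _; exact: cst_continuous.
Qed.

Lemma path_continuous_bounded a b g : a <= b -> path_continuous a b g ->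
  exists2 M : R, 0 <= M & forall x, a <= x <= b -> normc (g x) <= M.
Proof.
move=> ab cg.
have norm_cont u : (forall x, a <= x <= b -> {for x, continuous u}) ->
    {within `[a, b], continuous (fun x => `|u x|)}.
  move=> cu; apply: continuous_in_subspaceT => x; rewrite inE/= in_itv/= => /cu ux.
  by apply: continuous_comp => //; exact: norm_continuous.
have [x1 _ Re_le] := EVT_max ab (norm_cont _ (fun x xab => (cg x xab).1)).
have [x2 _ Im_le] := EVT_max ab (norm_cont _ (fun x xab => (cg x xab).2)).
exists (`|cRe (g x1)| + `|cIm (g x2)|) => [|x xab]; first by rewrite addr_ge0.
by rewrite (le_trans (normc_le_ReIm _))// lerD//; [apply: Re_le|apply: Im_le]; rewrite in_itv.
Qed.

End SegmentIntegral.

(** * Rectangle integrals and Cauchy estimates *)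

Section RectangleIntegral.
Variable R : realType.
Local Notation mu := (@lebesgue_measure R).
Local Notation seg_integral a b := (cintegral mu `[a, b]%classic).
Implicit Types (f g : R[i] -> R[i]) (z w k : R[i]) (a b c d m e M : R).

Record rectangle := Rectangle { rleft : R; rright : R; rbot : R; rtop : R }.
Implicit Types P Q : rectangle.

Definition proper Q := (rleft Q <= rright Q) && (rbot Q <= rtop Q).

Lemma proper_Rectangle a b c d : a <= b -> c <= d -> proper (Rectangle a b c d).
Proof. by rewrite /proper => -> ->. Qed.

Definition in_rect Q z := (rleft Q <= cRe z <= rright Q) && (rbot Q <= cIm z <= rtop Q).

Definition in_interior Q z := (rleft Q < cRe z < rright Q) && (rbot Q < cIm z < rtop Q).

Definition on_boundary Q z := in_rect Q z &&
  [|| cRe z == rleft Q, cRe z == rright Q, cIm z == rbot Q | cIm z == rtop Q].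

Definition subrect P Q :=
  [&& rleft Q <= rleft P, rright P <= rright Q, rbot Q <= rbot P & rtop P <= rtop Q].

Definition half_perimeter Q := (rright Q - rleft Q) + (rtop Q - rbot Q).

(* The smallest of the distances from z to the lines bounding Q. *)
Definition rect_depth Q z := Num.min
  (Num.min (cRe z - rleft Q) (rright Q - cRe z)) (Num.min (cIm z - rbot Q) (rtop Q - cIm z)).

Definition square z e := Rectangle (cRe z - e) (cRe z + e) (cIm z - e) (cIm z + e).

Lemma on_boundary_in_rect Q z : on_boundary Q z -> in_rect Q z.
Proof. by case/andP. Qed.

Lemma in_interior_in_rect Q z : in_interior Q z -> in_rect Q z.
Proof.
by move=> /andP[/andP[z1 z2] /andP[z3 z4]]; rewrite /in_rect !ltW.
Qed.

Lemma in_interior_proper Q z : in_interior Q z -> proper Q.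
Proof.
move=> /andP[/andP[/ltW z1 /ltW z2] /andP[/ltW z3 /ltW z4]].
by rewrite /proper (le_trans z1) ?(le_trans z3).
Qed.

Lemma subrect_in_rect P Q z : subrect P Q -> in_rect P z -> in_rect Q z.
Proof.
move=> /and4P[left right bottom top] /andP[/andP[left_z z_right] /andP[bottom_z z_top]].
by rewrite /in_rect (le_trans left left_z) (le_trans z_right right) (le_trans bottom bottom_z)
  (le_trans z_top top).
Qed.

Lemma subrect_refl Q : subrect Q Q.
Proof. by rewrite /subrect !lexx. Qed.

Lemma subrect_trans P Q S : subrect P Q -> subrect Q S -> subrect P S.
Proof.
move=> /and4P[p1 p2 p3 p4] /and4P[q1 q2 q3 q4].
by rewrite /subrect (le_trans q1) ?(le_trans p2) ?(le_trans q3) ?(le_trans p4).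
Qed.

Lemma half_perimeter_ge0 Q : proper Q -> 0 <= half_perimeter Q.
Proof. by move=> /andP[lr bt]; rewrite addr_ge0 ?subr_ge0. Qed.

Lemma in_rect_dist Q z w : in_rect Q z -> in_rect Q w -> normc (z - w) <= half_perimeter Q.
Proof.
move=> /andP[/andP[z1 z2] /andP[z3 z4]] /andP[/andP[w1 w2] /andP[w3 w4]].
rewrite (le_trans (normc_le_ReIm _))// complexReB complexImB.
by apply: lerD; rewrite ler_norml; apply/andP; split; lra.
Qed.

Lemma rect_depth_gt0 Q z : in_interior Q z -> 0 < rect_depth Q z.
Proof. by move=> /andP[/andP[z1 z2] /andP[z3 z4]]; rewrite !lt_min !subr_gt0 z1 z2 z3. Qed.

Lemma rect_depth_le Q z w : on_boundary Q w -> rect_depth Q z <= normc (w - z).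
Proof.
have [Re_le Im_le] := (normr_Re_le (w - z), normr_Im_le (w - z)).
rewrite complexReB in Re_le; rewrite complexImB in Im_le.
case/andP => _ /or4P[] /eqP edge; rewrite edge in Re_le Im_le.
- by apply: le_trans Re_le; rewrite ler_normr opprB !ge_min lexx orbT.
- by apply: le_trans Re_le; rewrite ler_normr !ge_min lexx orbT.
- by apply: le_trans Im_le; rewrite ler_normr opprB !ge_min lexx !orbT.
- by apply: le_trans Im_le; rewrite ler_normr !ge_min lexx !orbT.
Qed.

Lemma in_rect_square z e w : in_rect (square z e) w ->
  `|cRe (w - z)| <= e /\ `|cIm (w - z)| <= e.
Proof.
rewrite complexReB complexImB => /andP[/andP[/= r1 r2] /andP[/= i1 i2]].
by rewrite !ler_norml; split; apply/andP; split; lra.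
Qed.

Lemma in_interior_square z e w : normc (w - z) < e -> in_interior (square z e) w.
Proof.
move=> we; have := le_lt_trans (normr_Re_le _) we; have := le_lt_trans (normr_Im_le _) we.
by rewrite complexReB complexImB !ltr_norml /in_interior/=; lra.
Qed.

Lemma rect_depth_square z e : rect_depth (square z e) z = e.
Proof. by rewrite /rect_depth/= !subKr !(addrAC _ e) !subrr !add0r !minxx. Qed.

Lemma proper_square z e : 0 <= e -> proper (square z e).
Proof. by move=> e0; rewrite /proper/=; lra. Qed.

Lemma half_perimeter_square z e : half_perimeter (square z e) = 4 * e.
Proof. by rewrite /half_perimeter/=; ring. Qed.

Definition boundary_continuous f Q := forall z, on_boundary Q z -> complex_continuous f z.

Lemma boundary_continuousB f g Q : boundary_continuous f Q -> boundary_continuous g Q ->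
  boundary_continuous (fun z => f z - g z) Q.
Proof. by move=> cf cg z Qz; apply: complex_continuousB; [exact: cf|exact: cg]. Qed.

Lemma holomorphic_boundary_continuous f Q :
  (forall z, on_boundary Q z -> holomorphic_at f z) -> boundary_continuous f Q.
Proof. by move=> hf z /hf; exact: holomorphic_continuous. Qed.

Lemma boundary_path_continuous f Q : proper Q -> boundary_continuous f Q ->
  [/\ path_continuous (rleft Q) (rright Q) (fun x => f (Complex x (rbot Q))),
      path_continuous (rleft Q) (rright Q) (fun x => f (Complex x (rtop Q))),
      path_continuous (rbot Q) (rtop Q) (fun y => f (Complex (rleft Q) y)) &
      path_continuous (rbot Q) (rtop Q) (fun y => f (Complex (rright Q) y))].
Proof.
move=> /andP[lr bt] cf; split;
  [apply: path_continuous_horizontal|apply: path_continuous_horizontal|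
   apply: path_continuous_vertical|apply: path_continuous_vertical] => t ht; apply: cf;
  by rewrite /on_boundary /in_rect/= ht ?lexx ?lr ?bt ?eqxx ?orbT.
Qed.

(* The contour integral along the boundary, counterclockwise. *)
Definition rect_int f Q : R[i] :=
  seg_integral (rleft Q) (rright Q)
    (fun x => f (Complex x (rbot Q)) - f (Complex x (rtop Q))) +
  'i%C * seg_integral (rbot Q) (rtop Q)
    (fun y => f (Complex (rright Q) y) - f (Complex (rleft Q) y)).

Lemma eq_rect_int f g Q : proper Q -> (forall z, on_boundary Q z -> f z = g z) ->
  rect_int f Q = rect_int g Q.
Proof.
move=> /andP[lr bt] fg; rewrite /rect_int; congr (_ + _ * _); apply: eq_cintegral => t;
  rewrite /= in_itv/= => ht; congr (_ - _); apply: fg;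
  by rewrite /on_boundary /in_rect/= ht ?lexx ?lr ?bt ?eqxx ?orbT.
Qed.

Lemma rect_intB f g Q : proper Q -> boundary_continuous f Q -> boundary_continuous g Q ->
  rect_int (fun z => f z - g z) Q = rect_int f Q - rect_int g Q.
Proof.
move=> pQ cf cg; have [f1 f2 f3 f4] := boundary_path_continuous pQ cf.
have [g1 g2 g3 g4] := boundary_path_continuous pQ cg.
by rewrite /rect_int/= !seg_integralB//; [ring|apply: path_continuousB..].
Qed.

Lemma rect_intZ k f Q : proper Q -> boundary_continuous f Q ->
  rect_int (fun z => k * f z) Q = k * rect_int f Q.
Proof.
move=> pQ cf; have [f1 f2 f3 f4] := boundary_path_continuous pQ cf.
rewrite /rect_int mulrDr mulrCA -!(@seg_integralZ _ _ _ k); [|exact: path_continuousB..].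
by congr (_ + _ * _); apply: eq_cintegral => t _; rewrite mulrBr.
Qed.

Lemma normc_rect_int_le f Q M : proper Q -> boundary_continuous f Q ->
  (forall z, on_boundary Q z -> normc (f z) <= M) ->
  normc (rect_int f Q) <= 4 * M * half_perimeter Q.
Proof.
move=> pQ cf fM; have [f1 f2 f3 f4] := boundary_path_continuous pQ cf.
have /andP[lr bt] := pQ.
rewrite /rect_int (le_trans (le_normcD _ _))// normcM normc_i mul1r mulrDr.
rewrite (_ : 4 * M = 2 * (M + M)); last by ring.
rewrite -!mulrA; apply: lerD; apply: normc_seg_integral_le => //; try exact: path_continuousB;
  move=> t ht; rewrite (le_trans (le_normcB _ _))// lerD// fM//;
  by rewrite /on_boundary /in_rect/= ht ?lexx ?lr ?bt ?eqxx ?orbT.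
Qed.

Lemma rect_int_affine p q z0 Q : proper Q -> rect_int (fun w => p + q * (w - z0)) Q = 0.
Proof.
case: Q => a b c d /andP[/= ab cd]; rewrite /rect_int /=.
rewrite (@eq_cintegral _ _ _ _ _ _ (fun=> q * Complex 0 (c - d))); last first.
  move=> x _; transitivity (q * (Complex x c - Complex x d)); first by ring.
  by congr (_ * _); rewrite /GRing.add/= subrr.
rewrite (@eq_cintegral _ _ _ _ _ (fun y => _ - _) (fun=> q * ((b - a)%:C)%C)); last first.
  move=> y _; transitivity (q * (Complex b y - Complex a y)); first by ring.
  by congr (_ * _); rewrite /GRing.add/= subrr.
rewrite !seg_integral_cst// (_ : Complex 0 (c - d) = - ('i%C * ((d - c)%:C)%C)); first by ring.
by apply: complex_eq => /=; ring.
Qed.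

Lemma rect_int_vsplit f a m b c d : a <= m -> m <= b -> c <= d ->
  boundary_continuous f (Rectangle a m c d) -> boundary_continuous f (Rectangle m b c d) ->
  rect_int f (Rectangle a b c d) =
    rect_int f (Rectangle a m c d) + rect_int f (Rectangle m b c d).
Proof.
move=> am mb cd cl cr; have ab := le_trans am mb.
have [/= l1 l2 l3 l4] := boundary_path_continuous (proper_Rectangle am cd) cl.
have [/= r1 r2 r3 r4] := boundary_path_continuous (proper_Rectangle mb cd) cr.
have cab y : y = c \/ y = d -> path_continuous a b (fun x => f (Complex x y)).
  move=> hy; apply: path_continuous_horizontal => x /andP[ax xb].
  have [xm|mx] := leP x m; [apply: cl|apply: cr];
    rewrite /on_boundary /in_rect/= ?ax ?xb ?xm ?(ltW mx)/=;
    by case: hy => ->; rewrite ?lexx ?cd ?eqxx ?orbT.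
have c_ab := cab c (or_introl erefl); have d_ab := cab d (or_intror erefl).
rewrite /rect_int/= !seg_integralB//.
by rewrite (seg_integral_split am mb c_ab) (seg_integral_split am mb d_ab); ring.
Qed.

Lemma rect_int_hsplit f a b c m d : a <= b -> c <= m -> m <= d ->
  boundary_continuous f (Rectangle a b c m) -> boundary_continuous f (Rectangle a b m d) ->
  rect_int f (Rectangle a b c d) =
    rect_int f (Rectangle a b c m) + rect_int f (Rectangle a b m d).
Proof.
move=> ab cm md cl cu; have cd := le_trans cm md.
have [/= l1 l2 l3 l4] := boundary_path_continuous (proper_Rectangle ab cm) cl.
have [/= u1 u2 u3 u4] := boundary_path_continuous (proper_Rectangle ab md) cu.
have ccd x : x = a \/ x = b -> path_continuous c d (fun y => f (Complex x y)).
  move=> x_edge; apply: path_continuous_vertical => y /andP[cy yd].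
  have [ym|my] := leP y m; [apply: cl|apply: cu];
    rewrite /on_boundary /in_rect/= ?cy ?yd ?ym ?(ltW my)/=;
    by case: x_edge => ->; rewrite ?lexx ?ab ?eqxx ?orbT.
have a_cd := ccd a (or_introl erefl); have b_cd := ccd b (or_intror erefl).
rewrite /rect_int/= !seg_integralB//.
by rewrite (seg_integral_split cm md a_cd) (seg_integral_split cm md b_cd); ring.
Qed.

Lemma boundary_bounded f Q : proper Q -> boundary_continuous f Q ->
  exists2 M, 0 <= M & forall z, on_boundary Q z -> normc (f z) <= M.
Proof.
move=> pQ /(boundary_path_continuous pQ)[cont_b cont_t cont_l cont_r]; have /andP[lr bt] := pQ.
have [Mb Mb0 le_Mb] := path_continuous_bounded lr cont_b.
have [Mt Mt0 le_Mt] := path_continuous_bounded lr cont_t.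
have [Ml Ml0 le_Ml] := path_continuous_bounded bt cont_l.
have [Mr Mr0 le_Mr] := path_continuous_bounded bt cont_r.
exists (Mb + Mt + Ml + Mr); first by rewrite !addr_ge0.
move=> [x y] /andP[/andP[/= x_lr y_bt]] /or4P[] /eqP edge.
- by have := le_Ml y y_bt; rewrite -edge; lra.
- by have := le_Mr y y_bt; rewrite -edge; lra.
- by have := le_Mb x x_lr; rewrite -edge; lra.
- by have := le_Mt x x_lr; rewrite -edge; lra.
Qed.

End RectangleIntegral.

Section CauchyTheory.
Variable R : realType.
Implicit Types (f g : R[i] -> R[i]) (z w D : R[i]) (P Q : rectangle R) (e r M : R).

Lemma nested_segments (a b : nat -> R) : nondecreasing_seq a -> nonincreasing_seq b ->
  (forall n, a n <= b n) -> exists x, forall n, a n <= x <= b n.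
Proof.
move=> a_nd b_ni ab.
have a_le_b n m : a n <= b m.
  apply: (le_trans (a_nd _ _ (leq_maxl n m))); apply: (le_trans (ab _)).
  by apply: b_ni; exact: leq_maxr.
have a_sup : has_sup (range a).
  by split; [exists (a 0%N), 0%N|exists (b 0%N) => _ [n _ <-]].
exists (sup (range a)) => n; apply/andP; split.
  by apply: ub_le_sup; [exact: a_sup.2|exists n].
by apply: ge_sup; [exact: a_sup.1|move=> _ [m _ <-]].
Qed.

Lemma nested_rectangles (S : nat -> rectangle R) : (forall n, proper (S n)) ->
  (forall n, subrect (S n.+1) (S n)) -> exists z, forall n, in_rect (S n) z.
Proof.
move=> pS sS.
have [||n|x Sx] := @nested_segments (fun n => rleft (S n)) (fun n => rright (S n)).
- by apply/nondecreasing_seqP => n; have /and4P[] := sS n.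
- by apply/nonincreasing_seqP => n; have /and4P[] := sS n.
- by have /andP[] := pS n.
have [||n|y Sy] := @nested_segments (fun n => rbot (S n)) (fun n => rtop (S n)).
- by apply/nondecreasing_seqP => n; have /and4P[] := sS n.
- by apply/nonincreasing_seqP => n; have /and4P[] := sS n.
- by have /andP[] := pS n.
by exists (Complex x y) => n; rewrite /in_rect Sx Sy.
Qed.

Lemma large_quadrant f Q : proper Q -> (forall z, in_rect Q z -> complex_continuous f z) ->
  exists P, [/\ proper P, subrect P Q, half_perimeter P = half_perimeter Q / 2 &
    normc (rect_int f Q) / 4 <= normc (rect_int f P)].
Proof.
case: Q => a b c d /andP[/= ab cd] cf; set Q := Rectangle a b c d in cf *.
pose m := (a + b) / 2; pose k := (c + d) / 2.
have [am mb] : a <= m /\ m <= b by rewrite /m; lra.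
have [ck kd] : c <= k /\ k <= d by rewrite /k; lra.
have [ma bm] : m - a = (b - a) / 2 /\ b - m = (b - a) / 2 by rewrite /m; lra.
have [kc dk] : k - c = (d - c) / 2 /\ d - k = (d - c) / 2 by rewrite /k; lra.
apply: contrapT => no_large.
have small P : proper P -> subrect P Q -> half_perimeter P = half_perimeter Q / 2 ->
    normc (rect_int f P) < normc (rect_int f Q) / 4.
  by move=> pP PQ hP; rewrite ltNge; apply/negP => large; apply: no_large; exists P.
have bc P : subrect P Q -> boundary_continuous f P.
  by move=> PQ z /on_boundary_in_rect/(subrect_in_rect PQ); exact: cf.
have sub a' b' c' d' : a <= a' -> b' <= b -> c <= c' -> d' <= d ->
    subrect (Rectangle a' b' c' d') Q by rewrite /subrect /= => -> -> -> ->.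
have split_Q : rect_int f Q =
    (rect_int f (Rectangle a m c k) + rect_int f (Rectangle m b c k)) +
    (rect_int f (Rectangle a m k d) + rect_int f (Rectangle m b k d)).
  rewrite (rect_int_hsplit ab ck kd); [|by apply: bc; apply: sub..].
  by rewrite (rect_int_vsplit am mb ck) ?(rect_int_vsplit am mb kd)//; apply: bc; apply: sub.
have hp a' b' c' d' : b' - a' = (b - a) / 2 -> d' - c' = (d - c) / 2 ->
    half_perimeter (Rectangle a' b' c' d') = half_perimeter Q / 2.
  by rewrite /half_perimeter /Q /= => -> ->; rewrite -mulrDl.
have sw := small _ (proper_Rectangle am ck) (sub a m c k (lexx _) mb (lexx _) kd)
  (hp _ _ _ _ ma kc).
have se := small _ (proper_Rectangle mb ck) (sub m b c k am (lexx _) (lexx _) kd)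
  (hp _ _ _ _ bm kc).
have nw := small _ (proper_Rectangle am kd) (sub a m k d (lexx _) mb ck (lexx _))
  (hp _ _ _ _ ma dk).
have ne := small _ (proper_Rectangle mb kd) (sub m b k d am (lexx _) ck (lexx _))
  (hp _ _ _ _ bm dk).
have := le_lt_trans (le_normcD _ _) (ltrD
  (le_lt_trans (le_normcD _ _) (ltrD sw se)) (le_lt_trans (le_normcD _ _) (ltrD nw ne))).
by rewrite -split_Q; lra.
Qed.

Lemma goursat_sequence f Q : proper Q -> (forall z, in_rect Q z -> complex_continuous f z) ->
  exists S : nat -> rectangle R, forall n,
    [/\ proper (S n), subrect (S n) Q, subrect (S n.+1) (S n),
      half_perimeter (S n) = half_perimeter Q / 2 ^+ n &
      normc (rect_int f Q) / 4 ^+ n <= normc (rect_int f (S n))].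
Proof.
move=> pQ cf.
pose large P' P := [/\ proper P', subrect P' P, half_perimeter P' = half_perimeter P / 2 &
  normc (rect_int f P) / 4 <= normc (rect_int f P')].
have [|next nextP] := @choice _ _ (fun P P' => proper P -> subrect P Q -> large P' P).
  move=> P; have [[pP PQ]|nP] := pselect (proper P /\ subrect P Q); last first.
    by exists P => pP PQ; case: nP.
  have [|P' P'P] := large_quadrant (f := f) pP; last by exists P'.
  by move=> z /(subrect_in_rect PQ); exact: cf.
pose S n := iter n next Q; exists S.
suff S_inv n : [/\ proper (S n), subrect (S n) Q, half_perimeter (S n) = half_perimeter Q / 2 ^+ n &
    normc (rect_int f Q) / 4 ^+ n <= normc (rect_int f (S n))].
  by move=> n; have [pS SQ hS bS] := S_inv n; have [_ S' _ _] := nextP _ pS SQ.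
elim: n => [|n [pS SQ hS bS]]; first by rewrite /S /= !expr0 !divr1 subrect_refl.
have [pS' SS' hS' bS'] := nextP _ pS SQ; rewrite /S /= -/(S n); split => //.
- exact: subrect_trans SQ.
- by rewrite hS' hS exprSr invfM mulrA.
- by apply: le_trans bS'; rewrite exprSr invfM mulrA ler_wpM2r// invr_ge0.
Qed.

Lemma rect_int_remainder_le f z0 D e Q : proper Q -> boundary_continuous f Q ->
  (forall z, on_boundary Q z -> normc (f z - f z0 - D * (z - z0)) <= e) ->
  normc (rect_int f Q) <= 4 * e * half_perimeter Q.
Proof.
move=> pQ cf fe; pose affine w := f z0 + D * (w - z0).
have caff : boundary_continuous affine Q.
  apply: holomorphic_boundary_continuous => z _; apply: holomorphicD.
    exact: holomorphic_cst.
  by apply: holomorphicZ; exact: holomorphic_subr.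
have -> : rect_int f Q = rect_int (fun w => f w - affine w) Q.
  by rewrite rect_intB// [X in _ - X]rect_int_affine// subr0.
apply: normc_rect_int_le => //; first exact: boundary_continuousB.
by move=> z /fe; rewrite /affine opprD addrA.
Qed.

Lemma goursat f Q : proper Q -> (forall z, in_rect Q z -> holomorphic_at f z) ->
  rect_int f Q = 0.
Proof.
move=> pQ hf.
have cf z : in_rect Q z -> complex_continuous f z by move=> /hf; exact: holomorphic_continuous.
have [S SP] := goursat_sequence pQ cf.
have [n|n|z0 Sz0] := @nested_rectangles S; [by have [] := SP n|by have [] := SP n|].
have [_ S0Q _ _ _] := SP 0%N.
have /holomorphic_atP[D fD] := hf _ (subrect_in_rect S0Q (Sz0 0%N)).
have hp0 := half_perimeter_ge0 pQ.
apply: (complex_eq0_small ltr01 (B := 4 * half_perimeter Q ^+ 2)) => e /andP[e0 _].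
have [eta eta0 near_fD] := fD e e0.
have [n n_eta] : exists n, half_perimeter Q / 2 ^+ n < eta.
  have [n _ hn] := near_infty_natSinv_expn_lt (PosNum (divr_gt0 eta0 (ltr_pwDr ltr01 hp0))).
  exists n; have := hn n (leqnn n) => /=.
  rewrite ltr_pdivlMr ?ltr_pwDr//; apply: le_lt_trans.
  by rewrite mulrC mul1r ler_wpM2l ?invr_ge0 ?exprn_ge0// lerDl.
have [pS SQ _ hS bS] := SP n.
have /(le_trans bS) : normc (rect_int f (S n)) <=
    4 * (e * half_perimeter (S n)) * half_perimeter (S n).
  apply: (rect_int_remainder_le (z0 := z0) (D := D)) => // [z|z].
    by move=> /on_boundary_in_rect/(subrect_in_rect SQ); exact: cf.
  move=> /on_boundary_in_rect Sz; have zz0 := in_rect_dist Sz (Sz0 n).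
  have := near_fD (z - z0); rewrite addrCA subrr addr0.
  move=> /(_ (le_lt_trans zz0 _)); rewrite hS => /(_ n_eta)/le_trans; apply.
  by rewrite ler_pM2l// -hS.
rewrite ler_pdivrMr ?exprn_gt0// hS => /le_trans; apply; rewrite le_eqVlt; apply/predU1l.
rewrite (_ : 4 ^+ n = 2 ^+ n * 2 ^+ n :> R); last by rewrite -exprMn; congr (_ ^+ _); ring.
by field; rewrite expf_neq0.
Qed.

Lemma rect_int_deform f P Q : proper P -> subrect P Q ->
  (forall z, in_rect Q z -> ~~ in_interior P z -> holomorphic_at f z) ->
  rect_int f Q = rect_int f P.
Proof.
case: P Q => [a' b' c' d'] [a b c d] /andP[/= ab' cd'] /and4P[/= aa bb cc dd] hf.
have [a'b ab'' c'd cd''] : [/\ a' <= b, a <= b', c' <= d & c <= d'] by split; lra.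
have cd : c <= d := le_trans cd'' dd.
have hf' z : in_rect (Rectangle a b c d) z ->
    [|| cRe z <= a', b' <= cRe z, cIm z <= c' | d' <= cIm z] -> holomorphic_at f z.
  move=> Qz out; apply: hf => //; apply/negP => /andP[/andP[/= ? ?] /andP[/= ? ?]].
  by case/or4P: out; lra.
have edges_continuous a1 b1 c1 d1 : a <= a1 -> b1 <= b -> c <= c1 -> d1 <= d ->
    (a1 <= a') || (b' <= a1) -> (b1 <= a') || (b' <= b1) ->
    (c1 <= c') || (d' <= c1) -> (d1 <= c') || (d' <= d1) ->
    boundary_continuous f (Rectangle a1 b1 c1 d1).
  move=> a1a b1b c1c d1d left_out right_out bot_out top_out.
  apply: holomorphic_boundary_continuous => z /andP[Pz edge].
  apply: hf'; first by apply: subrect_in_rect Pz; rewrite /subrect/= a1a b1b c1c.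
  case/or4P: edge => /= /eqP ->; rewrite ?bot_out ?top_out ?orbT// orbA;
    by rewrite ?left_out ?right_out.
have zero a1 b1 c1 d1 : a <= a1 -> b1 <= b -> c <= c1 -> d1 <= d -> a1 <= b1 -> c1 <= d1 ->
    [|| b1 <= a', b' <= a1, d1 <= c' | d' <= c1] -> rect_int f (Rectangle a1 b1 c1 d1) = 0.
  move=> a1a b1b c1c d1d ab1 cd1 out; apply: goursat; first exact: proper_Rectangle.
  move=> z Pz; apply: hf'; first by apply: subrect_in_rect Pz; rewrite /subrect/= a1a b1b c1c.
  move: Pz => /andP[/andP[/= z1 z2] /andP[/= z3 z4]]; apply/or4P.
  by case/or4P: out => out;
    [constructor 1|constructor 2|constructor 3|constructor 4]; lra.
pose ordered := (aa, bb, cc, dd, a'b, ab'', c'd, cd'', lexx, orbT).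
rewrite (rect_int_vsplit aa a'b cd); [|by apply: edges_continuous; rewrite ?ordered..].
rewrite zero ?ordered// add0r.
rewrite (rect_int_vsplit ab' bb cd); [|by apply: edges_continuous; rewrite ?ordered..].
rewrite [X in _ + X]zero ?ordered// addr0.
rewrite (rect_int_hsplit ab' cc c'd); [|by apply: edges_continuous; rewrite ?ordered..].
rewrite zero ?ordered// add0r.
rewrite (rect_int_hsplit ab' cd' dd); [|by apply: edges_continuous; rewrite ?ordered..].
by rewrite [X in _ + X]zero ?ordered// addr0.
Qed.

Lemma goursat_punctured f Q z1 M r : in_interior Q z1 ->
  (forall z, in_rect Q z -> z != z1 -> holomorphic_at f z) ->
  0 < r -> (forall h, 0 < normc h < r -> normc (f (z1 + h)) <= M) ->
  rect_int f Q = 0.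
Proof.
move=> z1Q hf r0 fM; have depth0 := rect_depth_gt0 z1Q.
have e0_gt0 : 0 < Num.min (r / 2) (rect_depth Q z1) by rewrite lt_min divr_gt0.
apply: (complex_eq0_small e0_gt0 (B := 16 * M)) => e /andP[e0].
rewrite !lt_min => /andP[er /andP[/andP[eleft eright] /andP[ebot etop]]].
have sub : subrect (square z1 e) Q by rewrite /subrect/=; apply/and4P; split; lra.
have psq := proper_square z1 (ltW e0).
have off_center z : on_boundary (square z1 e) z -> z != z1.
  by move=> /(rect_depth_le z1); rewrite rect_depth_square -subr_eq0 -normc_gt0; exact: lt_le_trans.
rewrite (rect_int_deform psq sub); last first.
  move=> z Qz nz; apply: hf => //; apply: contraNneq nz => ->.
  by apply: in_interior_square; rewrite subrr normc0.
have -> : e * (16 * M) = 4 * M * half_perimeter (square z1 e).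
  by rewrite half_perimeter_square; ring.
apply: normc_rect_int_le => // [|z zsq].
  apply: holomorphic_boundary_continuous => z zsq; apply: hf; last exact: off_center.
  exact: subrect_in_rect sub (on_boundary_in_rect zsq).
rewrite -[z](subrK z1) addrC; apply: fM; rewrite normc_gt0 subr_eq0 off_center//=.
have [Re_le Im_le] := in_rect_square (on_boundary_in_rect zsq).
by apply: (le_lt_trans (normc_le_ReIm _)); lra.
Qed.

Lemma winding_gt0 Q z1 : in_interior Q z1 ->
  0 < cIm (rect_int (fun z => (z - z1)^-1) Q).
Proof.
case: Q z1 => a b c d [x1 y1] z1Q; have /andP[/andP[/= ax xb] /andP[/= cy yd]] := z1Q.
have pQ : proper (Rectangle a b c d) by apply: proper_Rectangle; lra.
have hc : boundary_continuous (fun z => (z - Complex x1 y1)^-1) (Rectangle a b c d).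
  apply: holomorphic_boundary_continuous => z /(rect_depth_le (Complex x1 y1)) far.
  apply: holomorphic_inv_subr; rewrite -subr_eq0 -normc_gt0.
  exact: lt_le_trans (rect_depth_gt0 z1Q) far.
have [/= f1 f2 f3 f4] := boundary_path_continuous pQ hc.
rewrite /rect_int/= mul0r add0r mul1r; apply: ltr_wpDl.
  rewrite -[leLHS](mul0r (b - a)); apply: Rintegral_segment_ge; first by lra.
    by have [] := path_continuous_integrable (path_continuousB f1 f2).
  move=> x hx; rewrite opprK -mulNr; apply: addr_ge0; apply: mulr_ge0;
    by [lra|rewrite invr_ge0 addr_ge0 ?sqr_ge0].
pose m := (b - x1) / ((b - x1) ^+ 2 + ((d - c) ^+ 2)).
have den_gt0 y : 0 < (b - x1) ^+ 2 + y ^+ 2.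
  by rewrite ltr_pwDl// ?exprn_gt0 ?sqr_ge0//; lra.
have m0 : 0 < m by rewrite divr_gt0//; lra.
apply: (@lt_le_trans _ _ (m * (d - c))); first by rewrite mulr_gt0//; lra.
apply: Rintegral_segment_ge; first by lra.
  by have [] := path_continuous_integrable (path_continuousB f4 f3).
move=> y hy; rewrite -[leLHS]addr0; apply: lerD; last first.
  by rewrite -mulNr; apply: mulr_ge0; [lra|rewrite invr_ge0 addr_ge0 ?sqr_ge0].
rewrite /m ler_pM2l; last by lra.
by rewrite lef_pV2 ?posrE// lerD2l -subr_ge0 subr_sqr mulr_ge0//; lra.
Qed.

Lemma rect_int_residue f Q z1 : in_interior Q z1 ->
  (forall z, in_rect Q z -> holomorphic_at f z) ->
  rect_int (fun z => f z * (z - z1)^-1) Q = f z1 * rect_int (fun z => (z - z1)^-1) Q.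
Proof.
move=> z1Q hf; have Qz1 := in_interior_in_rect z1Q.
have pQ := in_interior_proper z1Q.
have hinv z : on_boundary Q z -> holomorphic_at (fun w => (w - z1)^-1) z.
  move=> /(rect_depth_le z1) far; apply: holomorphic_inv_subr; rewrite -subr_eq0 -normc_gt0.
  exact: lt_le_trans (rect_depth_gt0 z1Q) far.
rewrite -rect_intZ//; last exact: holomorphic_boundary_continuous.
apply/eqP; rewrite -subr_eq0 -rect_intB//; last 2 first.
- apply: holomorphic_boundary_continuous => z Qz; apply: holomorphicM; last exact: hinv.
  exact/hf/on_boundary_in_rect.
- by apply: holomorphic_boundary_continuous => z /hinv; exact: holomorphicZ.
rewrite (@eq_rect_int _ _ (fun z => (f z - f z1) * (z - z1)^-1))//; last first.
  by move=> z _; rewrite mulrBl.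
have /holomorphic_atP[D fD] := hf _ Qz1; have [eta eta0 near_fD] := fD 1 ltr01.
apply/eqP/(@goursat_punctured _ _ z1 (1 + normc D) eta) => // [z Qz zz1|h /andP[h0 h_eta]].
  apply: holomorphicM; last exact: holomorphic_inv_subr.
  by apply: holomorphicB; [exact: hf|exact: holomorphic_cst].
rewrite [z1 + h - z1]addrAC subrr add0r normcM normcV ler_pdivrMr// mulrDl.
rewrite -[f _ - f z1](subrK (D * h)) (le_trans (le_normcD _ _))// normcM lerD2r.
exact: near_fD.
Qed.

Lemma cauchy_estimate Q z1 : in_interior Q z1 ->
  exists2 B : R, 0 <= B & forall f M, (forall z, in_rect Q z -> holomorphic_at f z) ->
    (forall z, on_boundary Q z -> normc (f z) <= M) -> normc (f z1) <= B * M.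
Proof.
move=> z1Q; set W := rect_int (fun z => (z - z1)^-1) Q.
have W0 : 0 < cIm W by exact: winding_gt0.
have d0 := rect_depth_gt0 z1Q; set depth := rect_depth Q z1 in d0.
have pQ := in_interior_proper z1Q.
exists (4 / depth * half_perimeter Q / cIm W).
  by rewrite divr_ge0 ?mulr_ge0 ?half_perimeter_ge0 ?invr_ge0 ?ltW.
move=> f M hf fM.
have far z : on_boundary Q z -> depth <= normc (z - z1) by exact: rect_depth_le.
have := @normc_rect_int_le _ (fun z => f z * (z - z1)^-1) Q (M / depth) pQ.
rewrite rect_int_residue// -/W normcM => bound.
rewrite mulrAC ler_pdivlMr//; apply: (@le_trans _ _ (normc (f z1) * normc W)).
  by rewrite ler_wpM2l ?normc_ge0// (le_trans (ler_norm _))// normr_Im_le.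
rewrite (_ : 4 / depth * _ * M = 4 * (M / depth) * half_perimeter Q); last by ring.
apply: bound => [|z Qz].
  apply: holomorphic_boundary_continuous => z Qz; apply: holomorphicM.
    exact/hf/on_boundary_in_rect.
  by apply: holomorphic_inv_subr; rewrite -subr_eq0 -normc_gt0 (lt_le_trans d0 (far z Qz)).
rewrite normcM normcV ler_pM ?normc_ge0 ?invr_ge0 ?normc_ge0 ?fM//.
by rewrite lef_pV2 ?posrE ?far// (lt_le_trans d0 (far z Qz)).
Qed.

Section VanishingNearCenter.
Variables (f : R[i] -> R[i]) (z0 : R[i]) (r e : R).
Hypotheses (e0 : 0 < e) (hf : forall z, in_rect (square z0 r) z -> holomorphic_at f z).
Hypothesis f0 : forall h, normc h < e -> f (z0 + h) = 0.

Lemma holomorphic_quotient n z : in_rect (square z0 r) z ->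
  holomorphic_at (fun w => f w * (w - z0)^-1 ^+ n) z.
Proof.
move=> Qz; have [->|zz0] := eqVneq z z0; last first.
  by apply: holomorphicM; [exact: hf|apply: holomorphicX; exact: holomorphic_inv_subr].
apply: (@holomorphic_eq_near _ (fun=> 0) _ _ e) => //; last exact: holomorphic_cst.
by move=> h he; rewrite f0// mul0r.
Qed.

(* Apply the Cauchy estimate to f / (z - z0) ^ n and let n tend to infinity. *)
Lemma holomorphic_eq0_disc z1 : normc (z1 - z0) < r -> f z1 = 0.
Proof.
move=> z1r; have r0 : 0 < r := le_lt_trans (normc_ge0 _) z1r.
have psq := proper_square z0 (ltW r0).
have [B B0 estimate] := cauchy_estimate (in_interior_square z1r).
have [|M M0 fM] := @boundary_bounded _ f (square z0 r) psq.
  by apply: holomorphic_boundary_continuous => z /on_boundary_in_rect; exact: hf.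
have [->|z10] := eqVneq z1 z0; first by rewrite -[z0]addr0 f0// normc0.
pose q := normc (z1 - z0) / r.
have q0 : 0 <= q by rewrite divr_ge0 ?normc_ge0 ?ltW.
have geometric n : normc (f z1) <= B * M * q ^+ n.
  have /= := estimate _ (M * r^-1 ^+ n) (@holomorphic_quotient n).
  rewrite normcM normcX normcV [X in _ -> _ * X <= _]exprVn.
  rewrite ler_pdivrMr ?exprn_gt0 ?normc_gt0 ?subr_eq0// => le_fz1.
  apply: (le_trans (le_fz1 _)) => [z zsq|]; last first.
    by rewrite le_eqVlt; apply/predU1l; rewrite /q expr_div_n exprVn; ring.
  have far : r <= normc (z - z0) by have := rect_depth_le z0 zsq; rewrite rect_depth_square.
  rewrite normcM normcX normcV ler_pM ?normc_ge0 ?exprn_ge0 ?invr_ge0 ?normc_ge0 ?fM//.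
  by rewrite lerXn2r ?nnegrE ?invr_ge0 ?normc_ge0 ?(ltW r0)// lef_pV2 ?posrE// (lt_le_trans r0).
have lim0 : (fun n => B * M * q ^+ n) @ \oo --> (0 : R).
  rewrite -(mulr0 (B * M)); apply: cvgMr; apply: cvg_expr.
  by rewrite ger0_norm// ltr_pdivrMr// mul1r.
apply: eq0_normc; apply/le_anti; rewrite normc_ge0 andbT.
by apply: (cvgr_to_ge lim0); exact: nearW.
Qed.

End VanishingNearCenter.

End CauchyTheory.

(** * Laplace transforms *)

Section LebesgueInvariance.
Variable R : realType.
Local Notation mu := (@lebesgue_measure R).
Implicit Types (f : R -> \bar R) (u : R -> R) (a : R).

Lemma ge0_integral_lebesgue_invariant (T : R -> R) f : measurable_fun setT T ->
  (forall p q, mu (T @^-1` `]p, q]%classic) = mu `]p, q]%classic) ->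
  measurable_fun setT f -> (forall x, 0 <= f x)%E ->
  (\int[mu]_x f (T x) = \int[mu]_x f x)%E.
Proof.
move=> mT T_itv mf f0.
pose mT' : measurable_fun [set: measurableTypeR R]
  (T : measurableTypeR R -> measurableTypeR R) := mT.
pose pushed : {measure set (measurableTypeR R) -> \bar R} :=
  measure_function_pushforward__canonical__measure_function_Measure mu mT'.
have := @ge0_integral_pushforward _ _ (measurableTypeR R) (measurableTypeR R) R T mT'
  (mu : {measure set (measurableTypeR R) -> \bar R}) setT f measurableT mf (fun y _ => f0 y).
rewrite preimage_setT => <-; apply: eq_measure_integral => A mA _; symmetry.
by apply: (@lebesgue_measure_unique R pushed) => // X [[p q] /= _ <-]; rewrite -T_itv.
Qed.

Lemma measurable_shift a : measurable_fun [set: R] (fun x : R => x + a).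
Proof. exact: measurable_funD. Qed.

Lemma ge0_integral_shift f a : measurable_fun [set: R] f -> (forall x, 0 <= f x)%E ->
  (\int[mu]_x f (x + a)%R = \int[mu]_x f x)%E.
Proof.
apply: (ge0_integral_lebesgue_invariant (measurable_shift a)) => p q.
have -> : (fun x : R => x + a) @^-1` `]p, q]%classic = `]p - a, q - a]%classic.
  by apply/seteqP; split => x /=; rewrite !in_itv/= ltrBlDr lerBrDr.
have mu_pq := @lebesgue_measure_itv R `]p, q].
have mu_shift := @lebesgue_measure_itv R `]p - a, q - a].
apply: (etrans mu_shift); apply: etrans (esym mu_pq) => /=.
rewrite !lte_fin ltrD2r; case: ifP => // _.
by rewrite -!EFinB opprB addrA subrK.
Qed.

Lemma integral_shift f a : measurable_fun [set: R] f ->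
  (\int[mu]_x f (x + a)%R = \int[mu]_x f x)%E.
Proof.
move=> mf; rewrite integralE [RHS]integralE; congr (_ - _)%E.
  apply: etrans (ge0_integral_shift a (measurable_funepos mf) _); last by [].
  by apply: eq_integral => x _; rewrite !funeposE.
apply: etrans (ge0_integral_shift a (measurable_funeneg mf) _); last by [].
by apply: eq_integral => x _; rewrite !funenegE.
Qed.

Lemma integrable_shift u a : mu.-integrable setT (EFin \o u) ->
  mu.-integrable setT (EFin \o (fun x => u (x + a))).
Proof.
move=> /integrableP[mu1 fu]; apply/integrableP; split.
  by apply: (measurableT_comp mu1); exact: measurable_shift.
by rewrite (ge0_integral_shift (f := fun x => `|(EFin \o u) x|%E))//; exact: measurableT_comp.
Qed.

Lemma cintegral_shift (F : R -> R[i]) a : cintegrable mu setT F ->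
  cintegral mu setT (fun x => F (x + a)) = cintegral mu setT F.
Proof.
by move=> [/integrableP[m1 _] /integrableP[m2 _]]; congr Complex;
  rewrite /Rintegral; congr fine; [exact: (integral_shift _ m1)|exact: (integral_shift _ m2)].
Qed.

Lemma cintegrable_shift (F : R -> R[i]) a : cintegrable mu setT F ->
  cintegrable mu setT (fun x => F (x + a)).
Proof. by move=> [i1 i2]; split; [exact: (integrable_shift a i1)|exact: (integrable_shift a i2)]. Qed.

End LebesgueInvariance.

Section ComplexExponential.
Variable R : realType.
Local Notation mu := (@lebesgue_measure R).
Implicit Types (s z w : R[i]) (x y a b : R).

Lemma MVT_from0 (f df : R -> R) : (forall x, is_derive x 1 f (df x)) ->
  forall y, exists2 c, `|c| <= `|y| & f y - f 0 = df c * y.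
Proof.
move=> dfP y.
have cf p q : {within `[p, q], continuous f}.
  apply: continuous_subspaceT => x.
  by apply: differentiable_continuous; apply/derivable1_diffP; have [] := dfP x.
have [y0|y0] := leP 0 y.
  have [c] := MVT_segment y0 (fun x _ => dfP x) (cf 0 y).
  rewrite in_itv/= => /andP[c0 cy] fE; exists c; last by rewrite fE subr0.
  by rewrite !ger0_norm.
have [c] := MVT_segment (ltW y0) (fun x _ => dfP x) (cf y 0).
rewrite in_itv/= => /andP[c0 cy] fE; exists c; last by rewrite -opprB fE; ring.
by rewrite !ler0_norm// ?lerN2// ltW.
Qed.

Lemma normr_sin_le y : `|sin y| <= `|y|.
Proof.
have [c _] := MVT_from0 (@is_derive_sin R) y; rewrite sin0 subr0 => ->.
by rewrite normrM ler_piMl// cos_max.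
Qed.

Lemma normr_cosB1_le y : `|cos y - 1| <= y ^+ 2.
Proof.
have [c hc] := MVT_from0 (@is_derive_cos R) y; rewrite cos0 => ->.
rewrite normrM normrN -real_normK ?num_real// expr2 ler_wpM2r//.
exact: le_trans (normr_sin_le _) hc.
Qed.

Lemma normr_sinB_le y : `|sin y - y| <= y ^+ 2.
Proof.
have [c hc] := MVT_from0 (@is_derive_sin R) y; rewrite sin0 subr0 => ->.
rewrite -[X in _ - X]mul1r -mulrBl normrM -[leRHS]real_normK ?num_real// expr2 ler_wpM2r//.
have [c' hc'] := MVT_from0 (@is_derive_cos R) c; rewrite cos0 => ->.
rewrite normrM normrN (le_trans _ hc)// ler_piMl//; exact: sin_max.
Qed.

Lemma normr_expRB1_le x : `|expR x - 1| <= `|x| * expR `|x|.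
Proof.
have ge_1Dx := expR_ge1Dx x; have ge_1Bx := expR_ge1Dx (- x).
have [x0|x0] := leP 0 x.
  rewrite (ger0_norm x0) ger0_norm; last lra.
  have : expR x * (1 - x) <= expR x * expR (- x) by rewrite ler_pM2l ?expR_gt0.
  rewrite expRxMexpNx_1; lra.
have expR_le1 : expR x <= 1 by rewrite -expR0 ler_expR ltW.
rewrite (ltr0_norm x0) ler0_norm; last lra.
have : 1 <= expR (- x) by lra.
nra.
Qed.

Lemma normr_expRB1x_le x : `|expR x - 1 - x| <= x ^+ 2 * expR `|x|.
Proof.
have ge_1Dx := expR_ge1Dx x; have ge_1Bx := expR_ge1Dx (- x).
rewrite ger0_norm; last lra.
have mul_le1 : expR x * (1 - x) <= 1.
  by rewrite -[leRHS](expRxMexpNx_1 x) ler_pM2l ?expR_gt0.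
apply: (@le_trans _ _ (x * (expR x - 1))); first by lra.
apply: (le_trans (ler_norm _)); rewrite normrM.
rewrite -[X in X ^+ 2 * _]/x -real_normK ?num_real// expr2 -mulrA.
by rewrite ler_wpM2l// normr_expRB1_le.
Qed.

Lemma Re_cexp z : cRe (cexp z) = expR (cRe z) * cos (cIm z).
Proof. by rewrite /cexp complexReM/= mul0r subr0. Qed.

Lemma Im_cexp z : cIm (cexp z) = expR (cRe z) * sin (cIm z).
Proof. by rewrite /cexp complexImM/= mul0r addr0. Qed.

Lemma cexp0 : cexp (0 : R[i]) = 1.
Proof. by apply: complex_eq; rewrite ?Re_cexp ?Im_cexp/= expR0 ?cos0 ?sin0 mul1r. Qed.

Lemma cexpD z w : cexp (z + w) = cexp z * cexp w.
Proof.
apply: complex_eq.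
  rewrite Re_cexp complexReM !Re_cexp !Im_cexp complexReD complexImD expRD cosD; ring.
rewrite Im_cexp complexImM !Re_cexp !Im_cexp complexReD complexImD expRD sinD; ring.
Qed.

Lemma normc_cexp z : normc (cexp z) = expR (cRe z).
Proof.
rewrite /cexp normcM normc_real ger0_norm ?expR_ge0//.
by rewrite /normc cos2Dsin2 sqrtr1 mulr1.
Qed.

Lemma cexp_real x : cexp (x%:C)%C = ((expR x)%:C)%C :> R[i].
Proof. by apply: complex_eq; rewrite ?Re_cexp ?Im_cexp /= ?cos0 ?sin0 ?mulr1 ?mulr0. Qed.

Lemma Re_cexp_mulr s x : cRe (cexp (s * (x%:C)%C)) = expR (cRe s * x) * cos (cIm s * x).
Proof. by rewrite Re_cexp complexReM complexImM /= !mulr0 subr0 add0r. Qed.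

Lemma Im_cexp_mulr s x : cIm (cexp (s * (x%:C)%C)) = expR (cRe s * x) * sin (cIm s * x).
Proof. by rewrite Im_cexp complexReM complexImM /= !mulr0 subr0 add0r. Qed.

Lemma normc_cexpB1x_le z : normc (cexp z - 1 - z) <= 4 * normc z ^+ 2 * expR (normc z).
Proof.
have Re_le := normr_Re_le z; have Im_le := normr_Im_le z.
set m := normc z in Re_le Im_le *; have m0 : 0 <= m := normc_ge0 z.
set x := cRe z in Re_le *; set y := cIm z in Im_le *.
have exp_m : 1 <= expR m by rewrite -expR0 ler_expR.
have exp_x : expR x <= expR m by rewrite ler_expR (le_trans (ler_norm _)).
have exp_absx : expR `|x| <= expR m by rewrite ler_expR.
have x2 : x ^+ 2 <= m ^+ 2 by rewrite -real_normK ?num_real// ler_sqr ?nnegrE.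
have y2 : y ^+ 2 <= m ^+ 2 by rewrite -real_normK ?num_real// ler_sqr ?nnegrE.
have m20 := sqr_ge0 m.
apply: (le_trans (normc_le_ReIm _)).
have -> : 4 * m ^+ 2 * expR m = 2 * (m ^+ 2 * expR m) + 2 * (m ^+ 2 * expR m) by ring.
apply: lerD.
  have -> : cRe (cexp z - 1 - z) = (expR x - 1 - x) + expR x * (cos y - 1).
    by rewrite !complexReB Re_cexp/= -/x -/y; ring.
  apply: (le_trans (ler_normD _ _)); rewrite mulr_natl mulr2n; apply: lerD.
    apply: (le_trans (normr_expRB1x_le x)).
    by apply: ler_pM => //; exact: sqr_ge0.
  rewrite normrM (ger0_norm (expR_ge0 x)) [leRHS]mulrC; apply: ler_pM => //.
  exact: le_trans (normr_cosB1_le _) y2.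
have -> : cIm (cexp z - 1 - z) = (expR x - 1) * sin y + (sin y - y).
  by rewrite !complexImB Im_cexp/= -/x -/y; ring.
apply: (le_trans (ler_normD _ _)); rewrite mulr_natl mulr2n; apply: lerD.
  rewrite normrM; apply: (@le_trans _ _ ((m * expR m) * m)); last by rewrite mulrAC expr2.
  apply: ler_pM => //; last exact: le_trans (normr_sin_le _) Im_le.
  by apply: (le_trans (normr_expRB1_le x)); apply: ler_pM.
by apply: (le_trans (normr_sinB_le y)); apply: (le_trans y2); rewrite ler_peMr.
Qed.

Lemma continuous_affine_comp (f : R -> R) (k : R) : continuous f ->
  continuous (fun x => f (k * x)).
Proof.
move=> cf x; apply: continuous_comp; last exact: cf.
by apply: cvgMr; exact: cvg_id.
Qed.

Lemma path_continuous_cexp s a b : path_continuous a b (fun x => cexp (s * (x%:C)%C)).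
Proof.
move=> x _; rewrite (funext (Re_cexp_mulr s)) (funext (Im_cexp_mulr s)).
split; apply: continuousM; apply: continuous_affine_comp.
- exact: continuous_expR.
- exact: continuous_cos.
- exact: continuous_expR.
- exact: continuous_sin.
Qed.

Lemma cmeasurable_cexp s : cmeasurable setT (fun x => cexp (s * (x%:C)%C)).
Proof.
by split; apply: continuous_measurable_fun => x;
  have [] := @path_continuous_cexp s x x x (introT andP (conj (lexx x) (lexx x))).
Qed.

Lemma is_derive_affine_comp (f : R -> R) (k df : R) x : is_derive (k * x) 1 f df ->
  is_derive x 1 (fun t => f (k * t)) (k * df).
Proof.
move=> fP; have kP : is_derive x 1 (fun t : R => k * t) k.
  by apply: is_derive_eq; rewrite scaler1.
by rewrite mulrC; exact: (is_derive1_comp (f := f) fP kP).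
Qed.

Lemma is_derive_Re_cexp s x :
  is_derive x 1 (fun t => cRe (cexp (s * (t%:C)%C))) (cRe (s * cexp (s * (x%:C)%C))).
Proof.
rewrite (funext (Re_cexp_mulr s)).
have eP := @is_derive_affine_comp expR (cRe s) _ x (is_derive_expR _).
have cP := @is_derive_affine_comp cos (cIm s) _ x (is_derive_cos _).
apply: (is_derive_eq (is_deriveM eP cP)).
by rewrite complexReM Re_cexp_mulr Im_cexp_mulr /GRing.scale/=; ring.
Qed.

Lemma is_derive_Im_cexp s x :
  is_derive x 1 (fun t => cIm (cexp (s * (t%:C)%C))) (cIm (s * cexp (s * (x%:C)%C))).
Proof.
rewrite (funext (Im_cexp_mulr s)).
have eP := @is_derive_affine_comp expR (cRe s) _ x (is_derive_expR _).
have sP := @is_derive_affine_comp sin (cIm s) _ x (is_derive_sin _).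
apply: (is_derive_eq (is_deriveM eP sP)).
by rewrite complexImM Re_cexp_mulr Im_cexp_mulr /GRing.scale/=; ring.
Qed.

Lemma Rintegral_segment_FTC (f F : R -> R) a b : a < b ->
  (forall x, {for x, continuous f}) -> (forall x, is_derive x 1 F (f x)) ->
  \int[mu]_(x in `[a, b]) f x = F b - F a.
Proof.
move=> ab cf FP.
have cF x : {for x, continuous F}.
  by apply: differentiable_continuous; apply/derivable1_diffP; have [] := FP x.
rewrite /Rintegral (@continuous_FTC2 R f F)//; first exact: continuous_subspaceT.
  split => [x _| |]; first by have [] := FP x.
    exact/cvg_at_right_filter/cF.
  exact/cvg_at_left_filter/cF.
by move=> x _; rewrite derive1E; have [_ ->] := FP x.
Qed.

Lemma seg_integral_cexp s a b : a < b ->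
  s * cintegral mu `[a, b]%classic (fun x => cexp (s * (x%:C)%C)) =
  cexp (s * (b%:C)%C) - cexp (s * (a%:C)%C).
Proof.
move=> ab; rewrite -seg_integralZ; last exact: path_continuous_cexp.
have cont x := @path_continuousZ _ x x s _ (@path_continuous_cexp s x x) x
  (introT andP (conj (lexx x) (lexx x))).
apply: complex_eq; rewrite ?complexReB ?complexImB.
  apply: (@Rintegral_segment_FTC _ (fun x => cRe (cexp (s * (x%:C)%C)))) => // x.
    by have [] := cont x.
  exact: is_derive_Re_cexp.
apply: (@Rintegral_segment_FTC _ (fun x => cIm (cexp (s * (x%:C)%C)))) => // x.
  by have [] := cont x.
exact: is_derive_Im_cexp.
Qed.

End ComplexExponential.

Section LaplaceTransform.
Variable R : realType.
Local Notation mu := (@lebesgue_measure R).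
Implicit Types (F G : R -> R[i]) (h : R -> R) (s z : R[i]) (a b e sg w : R).

Lemma integral_expR_abs (k : R) : 0 < k ->
  (\int[mu]_x (expR (- (k * `|x|)))%:E < +oo)%E.
Proof.
move=> k0.
have c : continuous (fun x : R => expR (- (k * `|x|))).
  move=> x; apply: continuous_comp; last exact: continuous_expR.
  by apply: cvgN; apply: cvgMr; exact: norm_continuous.
rewrite (@ge0_symfun_integralT R (fun x => expR (- (k * `|x|))))//; last first.
  by move=> x /=; rewrite normrN.
rewrite lte_mul_pinfty//.
apply: (@le_lt_trans _ _ (\int[mu]_x (k^-1 * exponential_pdf k x)%:E)%E).
  rewrite integral_mkcond; apply: ge0_le_integral => //.
  - by move=> x _; rewrite patchE; case: ifP => // _; rewrite lee_fin expR_ge0.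
  - apply/(measurable_restrictT _ _).1.
      by rewrite (_ : [set x | _] = `[0%R, +oo[%classic)//; apply/seteqP; split => x/=; rewrite in_itv/= andbT.
    apply/measurable_EFinP/measurable_funTS; exact: continuous_measurable_fun.
  - by apply/measurable_EFinP; apply: measurable_funM => //; exact: measurable_exponential_pdf.
  - move=> x _; rewrite patchE; case: ifPn; last first.
      by move=> _; rewrite lee_fin mulr_ge0 ?invr_ge0 ?(ltW k0)// exponential_pdf_ge0// ltW.
    rewrite inE /= => x0; rewrite lee_fin exponential_pdfE//= mulrA mulVf ?gt_eqF// mul1r.
    by rewrite ger0_norm// mulNr.
under eq_integral do rewrite EFinM.
rewrite ge0_integralZl//; last 3 first.
- by apply/measurable_EFinP; exact: measurable_exponential_pdf.
- by move=> x _; rewrite lee_fin exponential_pdf_ge0// ltW.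
- by rewrite lee_fin invr_ge0 ltW.
by rewrite integral_exponential_pdf// mule1 ltry.
Qed.

(* The sign is that of a Mellin transform in the variable exp w. *)
Definition laplace_integrand h s w : R[i] := ((h w)%:C)%C * cexp (s * (w%:C)%C).

Definition laplace h s : R[i] := cintegral mu setT (laplace_integrand h s).

Definition laplace_integrable h sg :=
  mu.-integrable setT (EFin \o (fun w => h w * expR (sg * w))).

Lemma normc_laplace_integrand h s w :
  normc (laplace_integrand h s w) = `|h w * expR (cRe s * w)|.
Proof.
rewrite normcM normc_real normc_cexp complexReM/= mulr0 subr0.
by rewrite normrM (ger0_norm (expR_ge0 _)).
Qed.

Lemma measurable_expR_affine sg : measurable_fun setT (fun w : R => expR (sg * w)).
Proof. by apply: measurableT_comp => //; exact: measurable_funM. Qed.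

Lemma measurable_laplace_integrable h sg : laplace_integrable h sg -> measurable_fun setT h.
Proof.
move=> /integrableP[/measurable_EFinP mh _].
rewrite (_ : h = (fun w => h w * expR (sg * w) * expR (- sg * w))).
  by apply: measurable_funM => //; exact: measurable_expR_affine.
by apply/funext => w; rewrite -mulrA -expRD mulNr subrr expR0 mulr1.
Qed.

Lemma eq_laplace_integrable h g sg : (forall w, g w = h w * expR (sg * w)) ->
  mu.-integrable setT (EFin \o g) -> laplace_integrable h sg.
Proof. by move=> /funext ->. Qed.

Lemma laplace_integrable_le h g sg : measurable_fun setT h ->
  (forall w, `|h w| <= g w) -> laplace_integrable g sg -> laplace_integrable h sg.
Proof.
move=> mh hg; apply: le_integrable => //=.
  by apply/measurable_EFinP; apply: measurable_funM => //; exact: measurable_expR_affine.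
move=> w _ /=; rewrite lee_fin !normrM ler_wpM2r//.
exact: le_trans (hg w) (ler_norm _).
Qed.

Lemma laplace_integrable_exp_decay h sg (B k : R) : measurable_fun setT h -> 0 < k ->
  (forall w, `|h w| * expR (sg * w) <= B * expR (- (k * `|w|))) -> laplace_integrable h sg.
Proof.
move=> mh k0 hB.
have iE : mu.-integrable setT (EFin \o (fun w : R => expR (- (k * `|w|)))).
  apply/integrableP; split.
    apply/measurable_EFinP/measurableT_comp => //; apply: measurableT_comp => //.
    by apply: measurable_funM => //; exact: measurableT_comp.
  under eq_integral => w _ do rewrite /= ger0_norm ?expR_ge0//.
  exact: integral_expR_abs.
apply: (le_integrable measurableT _ _ (integrable_EFinZl measurableT B iE)) => /=.
  by apply/measurable_EFinP; apply: measurable_funM => //; exact: measurable_expR_affine.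
move=> w _ /=; rewrite lee_fin normrM (ger0_norm (expR_ge0 _)).
exact: le_trans (hB w) (ler_norm _).
Qed.

Lemma laplace_integrableD h g sg : laplace_integrable h sg -> laplace_integrable g sg ->
  laplace_integrable (fun w => h w + g w) sg.
Proof.
move=> ih ig; apply: (eq_laplace_integrable _ (integrable_EFinD measurableT ih ig)) => w.
by rewrite mulrDl.
Qed.

Lemma laplace_integrableB h g sg : laplace_integrable h sg -> laplace_integrable g sg ->
  laplace_integrable (fun w => h w - g w) sg.
Proof.
move=> ih ig; apply: (eq_laplace_integrable _ (integrable_EFinB measurableT ih ig)) => w.
by rewrite mulrBl.
Qed.

Lemma laplace_integrableZ h sg (c : R) : laplace_integrable h sg ->
  laplace_integrable (fun w => c * h w) sg.
Proof.
move=> ih; apply: (eq_laplace_integrable _ (integrable_EFinZl measurableT c ih)) => w.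
by rewrite mulrA.
Qed.

Lemma laplace_integrable_expR h sg (c : R) : laplace_integrable h (sg + c) ->
  laplace_integrable (fun w => h w * expR (c * w)) sg.
Proof.
by move=> ih; apply: (eq_laplace_integrable _ ih) => w; rewrite -mulrA -expRD mulrDl addrC.
Qed.

Lemma laplace_integrable_shift h sg a : laplace_integrable h sg ->
  laplace_integrable (fun w => h (w + a)) sg.
Proof.
move=> ih; apply: (eq_laplace_integrable _
  (integrable_EFinZl measurableT (expR (- (sg * a))) (integrable_shift a ih))) => w.
by rewrite mulrCA -expRD; congr (_ * expR _); ring.
Qed.

Lemma integral_laplace_integrable h sg : laplace_integrable h sg ->
  (\int[mu]_w (h w * expR (sg * w))%:E = (\int[mu]_w (h w * expR (sg * w)))%:E)%E.
Proof. by move=> ih; rewrite /Rintegral fineK// integrable_fin_num. Qed.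

Lemma cintegrable_laplace h s : laplace_integrable h (cRe s) ->
  cintegrable mu setT (laplace_integrand h s).
Proof.
move=> ih; apply: (cintegrable_le measurableT _ (integrable_abse ih)) => [|w _].
  apply: cmeasurableM => //; last exact: cmeasurable_cexp.
  by apply: cmeasurable_real; exact: measurable_laplace_integrable ih.
by rewrite normc_laplace_integrand.
Qed.

Lemma normc_laplace_le h s : laplace_integrable h (cRe s) ->
  normc (laplace h s) <= 2 * \int[mu]_w `|h w * expR (cRe s * w)|.
Proof.
move=> ih; apply: (normc_cintegral_le measurableT (cintegrable_laplace ih) (integrable_abse ih)).
by move=> w _; rewrite normc_laplace_integrand.
Qed.

Lemma laplace_real h (x : R) : laplace h (x%:C)%C = ((\int[mu]_w (h w * expR (x * w)))%:C)%C.
Proof.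
rewrite /laplace (_ : laplace_integrand _ _ = fun w => ((h w * expR (x * w))%:C)%C); last first.
  by apply/funext => w; rewrite /laplace_integrand -rmorphM cexp_real -rmorphM.
by congr Complex; rewrite /Rintegral integral0.
Qed.

Lemma laplaceD h g s : laplace_integrable h (cRe s) -> laplace_integrable g (cRe s) ->
  laplace (fun w => h w + g w) s = laplace h s + laplace g s.
Proof.
move=> ih ig; rewrite -cintegralD//; [|exact: cintegrable_laplace..].
by apply: eq_cintegral => w _; rewrite -mulrDl -rmorphD.
Qed.

Lemma laplaceB h g s : laplace_integrable h (cRe s) -> laplace_integrable g (cRe s) ->
  laplace (fun w => h w - g w) s = laplace h s - laplace g s.
Proof.
move=> ih ig; rewrite -cintegralB//; [|exact: cintegrable_laplace..].
by apply: eq_cintegral => w _; rewrite -mulrBl -rmorphB.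
Qed.

Lemma laplaceZ h (c : R) s : laplace_integrable h (cRe s) ->
  laplace (fun w => c * h w) s = (c%:C)%C * laplace h s.
Proof.
move=> ih; rewrite -cintegralZ//; last exact: cintegrable_laplace.
by apply: eq_cintegral => w _; rewrite mulrA -rmorphM.
Qed.

Lemma laplace_expR h (c : R) s :
  laplace (fun w => h w * expR (c * w)) s = laplace h (s + (c%:C)%C).
Proof.
apply: eq_cintegral => w _.
by rewrite /laplace_integrand mulrDl cexpD -[(c%:C)%C * _]rmorphM cexp_real rmorphM; ring.
Qed.

Lemma laplace_shift h a s : laplace_integrable h (cRe s) ->
  laplace (fun w => h (w + a)) s = cexp (- s * (a%:C)%C) * laplace h s.
Proof.
move=> ih; have iF := cintegrable_laplace ih.
rewrite /laplace -(cintegral_shift a iF) -cintegralZ//; last exact: cintegrable_shift.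
apply: eq_cintegral => w _; rewrite /laplace_integrand rmorphD/= mulrDr cexpD.
have cancel : cexp (- s * (a%:C)%C) * cexp (s * (a%:C)%C) = 1.
  by rewrite -cexpD mulNr addNr cexp0.
by rewrite -[LHS]mulr1 -cancel; ring.
Qed.

Lemma expR_norm_le (x : R) : expR `|x| <= expR x + expR (- x).
Proof.
by have [x0|x0] := leP 0 x; rewrite ?(ger0_norm x0) ?(ltr0_norm x0) ?lerDl ?lerDr ?expR_ge0.
Qed.

Lemma sqr_le_expR e w : 0 < e -> w ^+ 2 <= 2 / e ^+ 2 * expR (e * `|w|).
Proof.
move=> e0; have ew : 0 <= e * `|w| by rewrite mulr_ge0// ltW.
have := expR_ge1Dxn 1 ew; rewrite (_ : 2`!%:R = 2)//.
rewrite -[w ^+ 2]real_normK ?num_real// exprMn => taylor.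
by rewrite mulrAC ler_pdivlMr ?exprn_gt0//; lra.
Qed.

Section LaplaceDerivative.
Variables (h : R -> R) (s : R[i]) (e : R).
Hypotheses (e0 : 0 < e) (ih_up : laplace_integrable h (cRe s + 2 * e)).
Hypotheses (ih : laplace_integrable h (cRe s)) (ih_lo : laplace_integrable h (cRe s - 2 * e)).

Let majorant w := `|h w * expR ((cRe s + 2 * e) * w)| + `|h w * expR ((cRe s - 2 * e) * w)|.

Let integrable_majorant : mu.-integrable setT (EFin \o majorant).
Proof.
apply: integrable_EFinD => //.
  exact: (integrable_abse ih_up).
exact: (integrable_abse ih_lo).
Qed.

Let le_majorant w : `|h w * expR (cRe s * w)| * expR (2 * e * `|w|) <= majorant w.
Proof.
rewrite /majorant !normrM !(ger0_norm (expR_ge0 _)) -[leLHS]mulrA -mulrDr ler_wpM2l//.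
have -> : 2 * e * `|w| = `|2 * e * w| by rewrite normrM ger0_norm// mulr_ge0// ltW.
apply: (le_trans (ler_wpM2l (expR_ge0 _) (expR_norm_le _))).
by rewrite mulrDr -!expRD !mulrBl !mulrDl.
Qed.

Let cmeasurable_integrand z : cmeasurable setT (laplace_integrand h z).
Proof.
apply: cmeasurableM => //; last exact: cmeasurable_cexp.
by apply: cmeasurable_real; exact: measurable_laplace_integrable ih.
Qed.

Let moment w := laplace_integrand h s w * (w%:C)%C.

Let cmeasurable_moment : cmeasurable setT moment.
Proof. by apply: cmeasurableM => //; exact: cmeasurable_real. Qed.

Let cintegrable_moment : cintegrable mu setT moment.
Proof.
have e20 : 0 < 2 * e by rewrite mulr_gt0.
apply: (cintegrable_le measurableT _
  (integrable_EFinZl measurableT (2 * e)^-1 integrable_majorant)) => [|w _].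
  exact: cmeasurable_moment.
rewrite normcM normc_laplace_integrand normc_real ler_pdivlMl//.
apply: le_trans (le_majorant w); rewrite mulrCA ler_wpM2l//.
by apply: le_trans (expR_ge1Dx _); rewrite lerDr.
Qed.

Lemma laplace_integrand_remainder_le z w : normc z <= e ->
  normc (laplace_integrand h (s + z) w - laplace_integrand h s w - z * moment w) <=
  8 / e ^+ 2 * normc z ^+ 2 * majorant w.
Proof.
move=> ze.
have -> : laplace_integrand h (s + z) w - laplace_integrand h s w - z * moment w =
    laplace_integrand h s w * (cexp (z * (w%:C)%C) - 1 - z * (w%:C)%C).
  by rewrite /moment /laplace_integrand mulrDl cexpD; ring.
rewrite normcM normc_laplace_integrand.
have coef0 : 0 <= 8 / e ^+ 2 * normc z ^+ 2.
  by rewrite mulr_ge0 ?divr_ge0 ?exprn_ge0 ?normc_ge0 ?(ltW e0).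
apply: le_trans (ler_wpM2l coef0 (le_majorant w)); rewrite [leRHS]mulrCA ler_wpM2l//.
apply: (le_trans (normc_cexpB1x_le _)).
rewrite normcM normc_real exprMn real_normK ?num_real//.
have exp_le : expR (normc z * `|w|) <= expR (e * `|w|) by rewrite ler_expR ler_wpM2r.
have -> : 8 / e ^+ 2 * normc z ^+ 2 * expR (2 * e * `|w|) =
    4 * (normc z ^+ 2 * (2 / e ^+ 2 * expR (e * `|w|))) * expR (e * `|w|).
  by rewrite (_ : 2 * e * `|w| = e * `|w| + e * `|w|) ?expRD; ring.
apply: ler_pM => //; first by rewrite mulr_ge0// mulr_ge0 ?sqr_ge0.
by rewrite ler_wpM2l// ler_wpM2l ?sqr_ge0// sqr_le_expR.
Qed.

Lemma laplace_remainder_le z : normc z <= e ->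
  normc (laplace h (s + z) - laplace h s - cintegral mu setT moment * z) <=
  16 / e ^+ 2 * (\int[mu]_w majorant w) * normc z ^+ 2.
Proof.
move=> ze; have iF := cintegrable_laplace ih.
have iFz : cintegrable mu setT (laplace_integrand h (s + z)).
  apply: (cintegrable_le measurableT _ integrable_majorant) => [|w _].
    exact: cmeasurable_integrand.
  apply: le_trans (le_majorant w); rewrite normc_laplace_integrand complexReD mulrDl expRD.
  rewrite mulrA normrM ler_wpM2l// (ger0_norm (expR_ge0 _)) ler_expR.
  rewrite (le_trans (ler_norm _))// normrM ler_wpM2r// (le_trans (normr_Re_le z))//.
  by rewrite (le_trans ze)// mulr_natl mulr2n lerDl ltW.
have -> : laplace h (s + z) - laplace h s - cintegral mu setT moment * z =
    cintegral mu setT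
      (fun w => laplace_integrand h (s + z) w - laplace_integrand h s w - z * moment w).
  rewrite cintegralB//; [|exact: cintegrableB|exact: cintegrableZ].
  by rewrite cintegralB// cintegralZ// mulrC.
have iM := integrable_EFinZl measurableT (8 / e ^+ 2 * normc z ^+ 2) integrable_majorant.
apply: (le_trans (normc_cintegral_le measurableT _ iM _)) => [|w _|].
- by apply: cintegrableB => //; [exact: cintegrableB|exact: cintegrableZ].
- exact: laplace_integrand_remainder_le.
by rewrite RintegralZl// le_eqVlt; apply/predU1l; ring.
Qed.

Lemma laplace_holomorphic_interior : holomorphic_at (laplace h) s.
Proof.
apply/holomorphic_atP; exists (cintegral mu setT moment) => eps eps0.
pose I := \int[mu]_w majorant w; pose K := 16 / e ^+ 2 * I + 1.
have I0 : 0 <= I by apply: Rintegral_ge0 => w _; rewrite addr_ge0.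
have K0 : 0 < K by rewrite ltr_wpDl// mulr_ge0// divr_ge0// exprn_ge0// ltW.
exists (Num.min e (eps / K)); first by rewrite lt_min e0 divr_gt0.
move=> z; rewrite lt_min => /andP[/ltW/laplace_remainder_le rem].
rewrite ltr_pdivlMr// => zK; apply: (le_trans rem).
rewrite expr2 mulrA ler_wpM2r ?normc_ge0// -/I (le_trans _ (ltW zK))// mulrC.
by rewrite ler_wpM2l ?normc_ge0// lerDl.
Qed.

End LaplaceDerivative.

Lemma laplace_holomorphic h a b s : (forall sg, a < sg < b -> laplace_integrable h sg) ->
  a < cRe s < b -> holomorphic_at (laplace h) s.
Proof.
move=> ih /andP[as_ sb]; pose e := Num.min (cRe s - a) (b - cRe s) / 4.
have e0 : 0 < e by rewrite divr_gt0// lt_min !subr_gt0 as_.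
have ea : 4 * e <= cRe s - a by rewrite mulrC divfK// ge_min lexx.
have eb : 4 * e <= b - cRe s by rewrite mulrC divfK// ge_min lexx orbT.
by apply: (@laplace_holomorphic_interior h s e) => //; apply: ih; lra.
Qed.

Definition neg_indic w : R := ((w < 0)%R : bool)%:R.

Lemma neg_indicE w : neg_indic w = \1_(`]-oo, 0[%classic : set R) w.
Proof. by rewrite /neg_indic indicE mem_setE in_itv. Qed.

Lemma measurable_neg_indic : measurable_fun setT neg_indic.
Proof. by rewrite (funext neg_indicE); exact: measurable_indic. Qed.

Lemma neg_indic_ge0 w : 0 <= neg_indic w.
Proof. by rewrite ler0n. Qed.

Lemma neg_indic1 w : w < 0 -> neg_indic w = 1.
Proof. by rewrite /neg_indic => ->. Qed.

Lemma neg_indic0 w : 0 <= w -> neg_indic w = 0.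
Proof. by rewrite /neg_indic ltNge => ->. Qed.

Lemma laplace_integrable_neg_indic sg : 0 < sg -> laplace_integrable neg_indic sg.
Proof.
move=> sg0; apply: (@laplace_integrable_exp_decay _ _ 1 _ measurable_neg_indic sg0) => w.
rewrite mul1r (ger0_norm (neg_indic_ge0 _)); have [w0|w0] := ltP w 0.
  by rewrite neg_indic1// mul1r (ltr0_norm w0) mulrN opprK.
by rewrite neg_indic0// mul0r.
Qed.

Lemma neg_indic_unit_step (u : R -> R) w :
  (neg_indic w - neg_indic (w + 1)) * u w = (u \_ `[-1, 0[%classic) w.
Proof.
rewrite patchE mem_setE in_itv/= /neg_indic.
have [w1|w1] := leP (-1) w; have [w0|w0] := leP 0 w; rewrite ?(ltNge w) ?w0/=;
  have [] := leP 0 (w + 1); rewrite ?subr0 ?sub0r ?mul1r ?mul0r ?subrr ?mul0r//; lra.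
Qed.

Lemma laplace_neg_indic_unit_step s : laplace (fun w => neg_indic w - neg_indic (w + 1)) s =
  cintegral mu `[-1, 0]%classic (fun w => cexp (s * (w%:C)%C)).
Proof.
have stepE (u : R -> R) : mu.-integrable `[-1, 0]%classic (EFin \o u) ->
    \int[mu]_w ((neg_indic w - neg_indic (w + 1)) * u w) = \int[mu]_(w in `[-1, 0]) u w.
  move=> iu; rewrite -[RHS]Rintegral_itv_bndo_bndc; last first.
    by apply: integrableS iu => // w /=; rewrite !in_itv/= => /andP[-> /ltW ->].
  by rewrite [RHS]Rintegral_mkcond; apply: eq_Rintegral => w _; exact: neg_indic_unit_step.
have [iRe iIm] := path_continuous_integrable (@path_continuous_cexp R s (-1) 0).
rewrite /laplace /cintegral; congr Complex; rewrite -stepE//;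
  by apply: eq_Rintegral => w _; rewrite /laplace_integrand/= ?mul0r ?subr0 ?addr0.
Qed.

(* Shifting by 1 multiplies the transform by exp (- s), and only the unit step is left to integrate. *)
Lemma laplace_neg_indic s : 0 < cRe s -> laplace neg_indic s = s^-1.
Proof.
move=> s0; have ih := laplace_integrable_neg_indic s0.
have s_neq0 : s != 0 by apply: contraTneq s0 => ->; rewrite ltxx.
have exp_neq1 : 1 - cexp (- s) != 0.
  have : normc (cexp (- s)) < normc (1 : R[i]).
    by rewrite normc1 normc_cexp raddfN/= expR_lt1 oppr_lt0.
  by rewrite subr_eq0; apply: contraTneq => <-; rewrite ltxx.
have := laplaceB ih (laplace_integrable_shift 1 ih).
rewrite laplace_shift// laplace_neg_indic_unit_step.
move=> /(congr1 ( *%R s)); rewrite seg_integral_cexp ?ltrN10//.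
have unit1 : ((1 : R)%:C)%C = 1 by [].
rewrite rmorphN unit1 mulr1 mulr0 mulrN1 cexp0 -[X in _ = s * (X - _)](mul1r (laplace _ _)) -mulrBl.
rewrite mulrCA -[LHS]mulr1 => /(mulfI exp_neq1) e; apply: (mulfI s_neq0).
by rewrite mulfV.
Qed.

End LaplaceTransform.

(** * Lattice theta series *)

Section EsumExtra.
Variable R : realType.
Local Open Scope ereal_scope.

Lemma esum_le_ub (T : choiceType) (A : set T) (f : T -> \bar R) (M : \bar R) :
  (forall F, fsets A F -> \sum_(x \in F) f x <= M) -> \esum_(x in A) f x <= M.
Proof. by move=> FM; apply: ge_ereal_sup => _ [F AF <-]; exact: FM. Qed.

Lemma fsets_sum_le_esum (T : choiceType) (A F : set T) (f : T -> \bar R) :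
  fsets A F -> \sum_(x \in F) f x <= \esum_(x in A) f x.
Proof. by move=> AF; apply: ereal_sup_ubound; exists F. Qed.

Lemma esumZl_le (T : choiceType) (A : set T) (f : T -> \bar R) (k : R) : (0 <= k)%R ->
  (forall x, A x -> 0 <= f x) ->
  \esum_(x in A) (k%:E * f x) <= k%:E * \esum_(x in A) f x.
Proof.
move=> k0 f0; apply: esum_le_ub => F [fF FA].
rewrite fsbig_finite//= big_seq -ge0_sume_distrr; last first.
  by move=> x; rewrite in_fset_set// inE => /FA /f0.
rewrite -big_seq; apply: lee_wpmul2l; first by rewrite lee_fin.
by rewrite -fsbig_finite//; exact: fsets_sum_le_esum.
Qed.

Lemma esumZl (T : choiceType) (A : set T) (f : T -> \bar R) (k : R) : (0 <= k)%R ->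
  (forall x, A x -> 0 <= f x) ->
  \esum_(x in A) (k%:E * f x) = k%:E * \esum_(x in A) f x.
Proof.
move=> k0 f0; apply/eqP; rewrite eq_le esumZl_le//=.
have [->|kn0] := eqVneq k 0%R.
  by rewrite mul0e; apply: esum_ge0 => x _; rewrite mul0e.
have {}k0 : (0 < k)%R by rewrite lt_def kn0.
have kf0 x : A x -> 0 <= k%:E * f x.
  by move=> /f0 fx0; apply: mule_ge0 => //; rewrite lee_fin ltW.
have kV0 : (0 <= k^-1)%R by rewrite invr_ge0 ltW.
have := esumZl_le kV0 kf0.
under eq_esum do rewrite muleA -EFinM mulVf ?gt_eqF// mul1e.
by rewrite lee_pdivlMl.
Qed.

Lemma esum_setS (T : choiceType) (A B : set T) (f : T -> \bar R) : A `<=` B ->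
  \esum_(x in A) f x <= \esum_(x in B) f x.
Proof.
move=> AB; apply: esum_le_ub => F [fF FA]; apply: fsets_sum_le_esum; split => //.
exact: subset_trans AB.
Qed.

Lemma esum_setU (T : choiceType) (A B : set T) (f : T -> \bar R) :
  (forall x, 0 <= f x) -> [disjoint A & B] ->
  \esum_(x in A `|` B) f x = \esum_(x in A) f x + \esum_(x in B) f x.
Proof.
move=> f0 dAB; rewrite (esumID A)//; congr (_ + _).
  congr (esum _ _); apply/seteqP; split => x; first by case.
  by move=> Ax; split => //; left.
congr (esum _ _); rewrite setIUl setICr set0U; apply: setIidl => x Bx Ax.
by move/disj_set2P: dAB => /seteqP[+ _] => /(_ x (conj Ax Bx)).
Qed.

Lemma esum_EFin (T : choiceType) (A : set T) (f : T -> \bar R) (M : R) :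
  (forall x, A x -> 0 <= f x) -> \esum_(x in A) f x <= M%:E ->
  exists2 r : R, (0 <= r)%R & \esum_(x in A) f x = r%:E.
Proof.
move=> f0 leM; have sum0 : 0 <= \esum_(x in A) f x by exact: esum_ge0.
exists (fine (\esum_(x in A) f x)); first exact: fine_ge0.
by rewrite fineK// ge0_fin_numE// (le_lt_trans leM)// ltry.
Qed.

Lemma esum_int (f : int -> \bar R) : (forall c, 0 <= f c) ->
  \esum_(c in [set: int]) f c = \sum_(k <oo) f (Posz k) + \sum_(k <oo) f (Negz k).
Proof.
move=> f0.
have -> : [set: int] = [set Posz k | k in [set: nat]] `|` [set Negz k | k in [set: nat]].
  by apply/seteqP; split => // -[k|k] _; [left|right]; exists k.
have disjoint_signs : [disjoint [set Posz k | k in [set: nat]] & [set Negz k | k in [set: nat]]].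
  by apply/disj_set2P/seteqP; split => // x [[k _ <-] [l _]].
by rewrite esum_setU// !esum_image ?nneseries_esumT//; move=> a b _ _ [].
Qed.

End EsumExtra.

Section IntegralTest.
Variable R : realType.
Local Notation mu := (@lebesgue_measure R).
Variable f : R -> R.
Hypotheses (f_ge0 : forall x, 0 <= f x) (mf : measurable_fun setT f).
Hypothesis f_noninc : forall x y, 0 <= x -> x <= y -> f y <= f x.

Let unit_step (k : nat) : set R := `[k%:R, k.+1%:R[%classic.

Lemma trivIset_unit_step : trivIset [set: nat] unit_step.
Proof.
apply/trivIsetP => i j _ _ ij; apply/seteqP; split => // x [].
rewrite /unit_step/= !in_itv/= => /andP[ix xi] /andP[jx xj].
have : (i < j.+1)%N by rewrite -(ltr_nat R) (le_lt_trans ix).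
have : (j < i.+1)%N by rewrite -(ltr_nat R) (le_lt_trans jx).
by rewrite !ltnS => ji le_ij; move: ij; rewrite eqn_leq ji le_ij.
Qed.

Lemma itv0y_bigcup_unit_step : `[0%R, +oo[%classic = \bigcup_k unit_step k.
Proof.
apply/seteqP; split => x /=.
  rewrite in_itv/= andbT => x0; exists (Num.truncn x) => //=.
  by rewrite /unit_step/= in_itv/=; exact: truncn_itv.
move=> [k _]; rewrite /unit_step/= !in_itv/= andbT => /andP[kx _].
exact: le_trans kx.
Qed.

Lemma integral0y_unit_steps :
  (\int[mu]_(x in `[0%R, +oo[) (f x)%:E = \sum_(k <oo) \int[mu]_(x in unit_step k) (f x)%:E)%E.
Proof.
rewrite itv0y_bigcup_unit_step ge0_integral_bigcup//; last exact: trivIset_unit_step.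
- by move=> k; exact: measurable_itv.
- exact/measurable_EFinP/measurable_funTS.
- by move=> x _; rewrite lee_fin.
Qed.

Lemma integral_unit_step_cst k (c : R) : (\int[mu]_(x in unit_step k) c%:E = c%:E)%E.
Proof.
rewrite integral_cst; last exact: measurable_itv.
rewrite -[RHS]mule1; congr (_ * _)%E.
apply: etrans (@lebesgue_measure_itv R `[k%:R, k.+1%:R[) _.
by rewrite /= lte_fin ltr_nat ltnSn -EFinB -natrB// subSnn.
Qed.

Lemma integral_unit_step_bounds k :
  ((f k.+1%:R)%:E <= \int[mu]_(x in unit_step k) (f x)%:E <= (f k%:R)%:E)%E.
Proof.
have mEf : measurable_fun (unit_step k) (EFin \o f) by exact/measurable_EFinP/measurable_funTS.
apply/andP; split.
- rewrite -[leLHS](integral_unit_step_cst k); apply: ge0_le_integral => //=.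
  + exact: measurable_itv.
  + by move=> x _; rewrite lee_fin.
  + rewrite /unit_step/= => x; rewrite in_itv/= => /andP[kx xk].
    by rewrite lee_fin f_noninc ?(ltW xk)// (le_trans _ kx).
- rewrite -[leRHS](integral_unit_step_cst k); apply: ge0_le_integral => //=.
  + exact: measurable_itv.
  + by move=> x _; rewrite lee_fin.
  + by rewrite /unit_step/= => x; rewrite in_itv/= => /andP[kx _]; rewrite lee_fin f_noninc.
Qed.

Lemma nneseries_shift_bounds (I y : R) :
  (\int[mu]_(x in `[0%R, +oo[) (f x)%:E = I%:E)%E -> 0 <= y <= 1 ->
  exists2 r, (\sum_(k <oo) (f (k%:R + y))%:E = r%:E)%E & `|r - I| <= f 0.
Proof.
move=> intI /andP[y0 y1].
have f0E x : (0 <= (f x)%:E)%E by rewrite lee_fin.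
have sum_recl : (\sum_(k <oo) (f k%:R)%:E = (f 0)%:E + \sum_(k <oo) (f k.+1%:R)%:E)%E.
  rewrite (@nneseries_recl R xpredT (fun k => (f k%:R)%:E))//; congr (_ + _)%E.
  rewrite -(@nneseries_addn R (fun k => (f k%:R)%:E) 1%N)//.
  by apply: eq_eseriesr => k _; rewrite addn1.
have succ_le : (\sum_(k <oo) (f k.+1%:R)%:E <= I%:E)%E.
  rewrite -intI integral0y_unit_steps; apply: lee_nneseries => // k _.
  by have /andP[] := integral_unit_step_bounds k.
have le_sum : (I%:E <= \sum_(k <oo) (f k%:R)%:E)%E.
  rewrite -intI integral0y_unit_steps; apply: lee_nneseries => [k _ _|k _].
    by apply: integral_ge0 => x _.
  by have /andP[] := integral_unit_step_bounds k.
set S := (\sum_(k <oo) (f (k%:R + y))%:E)%E.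
have S_lo : ((I - f 0)%:E <= S)%E.
  apply: (@le_trans _ _ (\sum_(k <oo) (f k.+1%:R)%:E)%E); last first.
    by apply: lee_nneseries => // k _; rewrite lee_fin f_noninc ?addr_ge0// -natr1 lerD2l.
  by rewrite EFinB leeBlDl// -sum_recl.
have S_up : (S <= (I + f 0)%:E)%E.
  apply: (@le_trans _ _ (\sum_(k <oo) (f k%:R)%:E)%E).
    by apply: lee_nneseries => // k _; rewrite lee_fin f_noninc ?lerDl.
  by rewrite sum_recl EFinD addeC; exact: leeD.
have S_fin : S \is a fin_num.
  by rewrite fin_real// (lt_le_trans _ S_lo) ?ltNyr//= (le_lt_trans S_up) ?ltry.
exists (fine S); first by rewrite fineK.
move: S_lo S_up; rewrite -(fineK S_fin) !lee_fin ler_norml; lra.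
Qed.

End IntegralTest.

Section GaussianSum.
Variable R : realType.
Local Notation mu := (@lebesgue_measure R).
Implicit Types (A x y : R).

Definition gaussian A x : R := expR (- (pi * A * x ^+ 2)).

Lemma gaussian_ge0 A x : 0 <= gaussian A x.
Proof. exact: expR_ge0. Qed.

Lemma gaussian0 A : gaussian A 0 = 1.
Proof. by rewrite /gaussian expr0n mulr0 oppr0 expR0. Qed.

Lemma gaussian_nonincreasing A x y : 0 <= A -> 0 <= x -> x <= y -> gaussian A y <= gaussian A x.
Proof.
move=> A0 x0 xy; rewrite ler_expR lerN2 ler_wpM2l ?mulr_ge0 ?pi_ge0//.
by rewrite ler_sqr ?nnegrE// (le_trans x0).
Qed.

Lemma gaussianN A x : gaussian A (- x) = gaussian A x.
Proof. by rewrite /gaussian sqrrN. Qed.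

Lemma continuous_gaussian A : continuous (gaussian A).
Proof.
move=> x; apply: continuous_comp; last exact: continuous_expR.
apply: cvgN; apply: cvgMr; exact: exprn_continuous.
Qed.

Lemma measurable_gaussian A : measurable_fun setT (gaussian A).
Proof. by apply: continuous_measurable_fun; exact: continuous_gaussian. Qed.

Lemma integral_gaussian A : 0 < A ->
  (\int[mu]_x (gaussian A x)%:E = (Num.sqrt A)^-1%:E)%E.
Proof.
move=> A0; pose s := Num.sqrt (2 * pi * A)^-1.
have pA : 0 < 2 * pi * A by rewrite !mulr_gt0// pi_gt0.
have s0 : 0 < s by rewrite sqrtr_gt0 invr_gt0.
have s2 : s ^+ 2 = (2 * pi * A)^-1 by rewrite sqr_sqrtr// invr_ge0 ltW.
have pi0 : pi != 0 :> R by rewrite gt_eqF// pi_gt0.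
have An0 : A != 0 by rewrite gt_eqF.
have normal_fun_gaussian x : normal_fun 0 s x = gaussian A x.
  rewrite /normal_fun /gaussian subr0 -mulr_natr s2; congr expR.
  by move: (pi) pi0 => p p0; field; rewrite ?p0 ?An0.
have peak0 : 0 < normal_peak s by rewrite normal_peak_gt0// gt_eqF.
have peakE : (normal_peak s)^-1 = (Num.sqrt A)^-1.
  rewrite /normal_peak invrK s2 -mulr_natr -sqrtrV ?(ltW A0)//; congr Num.sqrt.
  by move: (pi) pi0 => p p0; field; rewrite ?p0 ?An0.
have := @integral_normal_pdf R 0 s.
under eq_integral do rewrite normal_pdfE ?gt_eqF// normal_fun_gaussian EFinM.
rewrite ge0_integralZl//; last 3 first.
- by apply/measurable_EFinP; exact: measurable_gaussian.
- by move=> x _; rewrite lee_fin gaussian_ge0.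
- by rewrite lee_fin ltW.
move=> /(congr1 (mule (normal_peak s)^-1%:E)).
by rewrite muleA -EFinM mulVf ?gt_eqF// mul1e mule1 peakE.
Qed.

Lemma integral0y_gaussian A : 0 < A ->
  (\int[mu]_(x in `[0%R, +oo[) (gaussian A x)%:E = ((Num.sqrt A)^-1 / 2)%:E)%E.
Proof.
move=> A0; have := integral_gaussian A0.
rewrite (@ge0_symfun_integralT R (gaussian A)); last 3 first.
- by move=> x; exact: gaussian_ge0.
- exact: continuous_gaussian.
- by move=> x /=; rewrite gaussianN.
rewrite (_ : [set x | (0 <= x)%R] = `[0%R, +oo[%classic); last first.
  by apply/seteqP; split => x/=; rewrite in_itv/= andbT.
move=> /(congr1 (mule 2^-1%:E)).
by rewrite muleA -EFinM mulVf// mul1e => ->; rewrite -EFinM mulrC.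
Qed.

Lemma gaussian_nneseries A y : 0 < A -> 0 <= y <= 1 ->
  exists2 r, (\sum_(k <oo) (gaussian A (k%:R + y))%:E = r%:E)%E &
    `|r - (Num.sqrt A)^-1 / 2| <= 1.
Proof.
move=> A0 y01; have noninc x z := @gaussian_nonincreasing A x z (ltW A0).
have [r rE] := nneseries_shift_bounds (@gaussian_ge0 A) (@measurable_gaussian A) noninc
  (integral0y_gaussian A0) y01.
by rewrite gaussian0; exists r.
Qed.

Lemma gaussian_esum_int A y : 0 < A -> exists2 r : R,
  (\esum_(c in [set: int]) (gaussian A (c%:~R + y))%:E)%E = r%:E &
  `|r - (Num.sqrt A)^-1| <= 2.
Proof.
move=> A0; pose m := Num.floor y; pose z := y - m%:~R.
have z01 : 0 <= z <= 1.
  have /andP[my ym] := floor_itv y.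
  by rewrite subr_ge0 my lerBlDl (le_trans (ltW ym))// intrD1 addrC.
have -> : (\esum_(c in [set: int]) (gaussian A (c%:~R + y))%:E =
   \esum_(c in [set: int]) (gaussian A (c%:~R + z))%:E)%E.
  rewrite (@reindex_esum R _ _ setT setT (fun c : int => c - m)).
    by apply: eq_esum => c _; rewrite intrB -addrA [- _ + y]addrC.
  split => //; first by move=> a b _ _ /= /addIr.
  by move=> c _; exists (c + m) => //; rewrite addrK.
rewrite esum_int => [|c]; last by rewrite lee_fin gaussian_ge0.
have negE : (\sum_(k <oo) (gaussian A ((Negz k)%:~R + z))%:E =
   \sum_(k <oo) (gaussian A (k%:R + (1 - z)))%:E)%E.
  apply: eq_eseriesr => k _; rewrite -gaussianN; congr ((gaussian A _)%:E).
  by rewrite NegzE mulrNz -pmulrn -natr1; lra.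
have z01' : 0 <= 1 - z <= 1 by move: z01; lra.
have [r1 r1E r1le] := gaussian_nneseries A0 z01.
have [r2 r2E r2le] := gaussian_nneseries A0 z01'.
exists (r1 + r2); first by rewrite EFinD -r1E -r2E -negE.
by move: r1le r2le; rewrite !ler_norml; lra.
Qed.

End GaussianSum.

Section QuadraticForm.
Variable R : realType.

Definition qform n (S : 'M[R]_n) (v : 'rV[R]_n) : R := (v *m S *m v^T) 0 0.

Definition posdef n (S : 'M[R]_n) := S^T = S /\ forall v, v != 0 -> 0 < qform S v.

Lemma qform_block n (a x : R) (b u : 'rV[R]_n) (S : 'M[R]_n) :
  qform (block_mx a%:M b b^T S) (row_mx x%:M u) =
  a * x ^+ 2 + 2 * x * (b *m u^T) 0 0 + qform S u.
Proof.
have flip : (u *m b^T) 0 0 = (b *m u^T) 0 0.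
  by rewrite -[RHS]/((b *m u^T) 0 0) -[b in RHS]trmxK -trmx_mul [RHS]mxE.
rewrite /qform mul_row_block tr_row_mx mul_row_col tr_scalar_mx.
rewrite !mulmxDl !mul_scalar_mx !mul_mx_scalar -!scalemxAl.
rewrite !(mxE, eqxx, mulr1n) in flip *; rewrite flip; ring.
Qed.

Lemma qform_scalel_outer n (a : R) (l u : 'rV[R]_n) :
  qform (a *: (l^T *m l)) u = a * ((l *m u^T) 0 0) ^+ 2.
Proof.
rewrite /qform -scalemxAr -scalemxAl mxE (_ : u *m _ *m _ = u *m l^T *m (l *m u^T)).
  have -> : u *m l^T = ((l *m u^T) 0 0)%:M.
    rewrite -[u in LHS]trmxK -trmx_mul; apply/matrixP => i j.
    by rewrite !ord1 !mxE eqxx mulr1n.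
  by rewrite mul_scalar_mx mxE expr2.
by rewrite !mulmxA.
Qed.

Lemma qformB n (S T : 'M[R]_n) u : qform (S - T) u = qform S u - qform T u.
Proof. by rewrite /qform mulmxBr mulmxBl !mxE. Qed.

Lemma qform_complete_square n (a x : R) (b u : 'rV[R]_n) (S : 'M[R]_n) : a != 0 ->
  let l := a^-1 *: b in
  qform (block_mx a%:M b b^T S) (row_mx x%:M u) =
  a * (x + (l *m u^T) 0 0) ^+ 2 + qform (S - a *: (l^T *m l)) u.
Proof.
move=> a0 l; rewrite qform_block qformB qform_scalel_outer.
have -> : (b *m u^T) 0 0 = a * (l *m u^T) 0 0.
  by rewrite /l -scalemxAl [in RHS]mxE mulVKf.
ring.
Qed.

Lemma det_schur_block n (a : R) (b : 'rV[R]_n) (S : 'M[R]_n) : a != 0 ->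
  let l := a^-1 *: b in
  \det (block_mx a%:M b b^T S) = a * \det (S - a *: (l^T *m l)).
Proof.
move=> a0 l; have al : a *: l = b by rewrite /l scalerA mulfV ?scale1r.
have -> : block_mx a%:M b b^T S = block_mx 1%:M 0 l^T 1%:M *m
    block_mx a%:M 0 0 (S - a *: (l^T *m l)) *m block_mx 1%:M l 0 1%:M.
  rewrite !mulmx_block !mul0mx !mulmx0 !mul1mx !mulmx1 !addr0 !add0r.
  congr block_mx.
  - by rewrite mul_scalar_mx al.
  - by rewrite mul_mx_scalar -al linearZ.
  - by rewrite mul_mx_scalar -scalemxAl addrC subrK.
by rewrite !det_mulmx det_lblock !det_ublock !det1 !mul1r mulr1 det_scalar1.
Qed.

Lemma schur_complement n (S : 'M[R]_(1 + n)) : posdef S ->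
  exists (a : R) (l : 'rV[R]_n) (S' : 'M[R]_n), [/\ 0 < a, posdef S', \det S = a * \det S' &
    forall (x : R) (u : 'rV[R]_n),
      qform S (row_mx x%:M u) = a * (x + (l *m u^T) 0 0) ^+ 2 + qform S' u].
Proof.
move=> [symS posS].
pose a := S 0 0; pose b : 'rV[R]_n := ursubmx S; pose S0 : 'M[R]_n := drsubmx S.
have ulE : ulsubmx S = a%:M.
  by apply/matrixP => i j; rewrite !ord1 !mxE eqxx mulr1n /a; congr (S _ _); exact/val_inj.
have dlE : dlsubmx S = b^T by rewrite /b -[in LHS]symS trmx_ursub -?trmx_dlsub.
have SE : S = block_mx a%:M b b^T S0 by rewrite -ulE -dlE submxK.
have symS0 : S0^T = S0 by rewrite /S0 trmx_drsub symS.
have a0 : 0 < a.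
  have := posS (row_mx 1%:M 0); rewrite SE qform_block trmx0 mulmx0 /qform mul0mx mul0mx.
  rewrite !mxE mulr0 !addr0 expr1n mulr1; apply.
  apply/eqP => /(congr1 lsubmx)/matrixP/(_ 0 0); rewrite row_mxKl !mxE eqxx => /eqP.
  by rewrite oner_eq0.
have an0 : a != 0 by rewrite gt_eqF.
pose l : 'rV[R]_n := a^-1 *: b; pose S' := S0 - a *: (l^T *m l).
have square x u : qform S (row_mx x%:M u) = a * (x + (l *m u^T) 0 0) ^+ 2 + qform S' u.
  by rewrite SE qform_complete_square.
exists a, l, S'; split => //; last by rewrite SE det_schur_block.
split; first by rewrite /S' linearB linearZ /= trmx_mul trmxK symS0.
move=> u u0; have := posS (row_mx (- (l *m u^T) 0 0)%:M u).
rewrite square addNr expr0n mulr0 add0r; apply.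
by apply: contraNneq u0 => /(congr1 rsubmx); rewrite row_mxKr linear0 => ->.
Qed.

End QuadraticForm.

Section LatticeTheta.
Variable R : realType.

Definition lattice_theta n (S : 'M[R]_n) (t : R) (y : 'rV[R]_n) : \bar R :=
  (\esum_(c in [set: 'rV[int]_n]) (expR (- (pi * t * qform S (map_mx intr c + y))))%:E)%E.

Lemma lattice_theta_ge0 n (S : 'M[R]_n) t y : (0 <= lattice_theta S t y)%E.
Proof. by apply: esum_ge0 => c _; rewrite lee_fin expR_ge0. Qed.

Lemma lattice_theta_dim0 (S : 'M[R]_0) t y : lattice_theta S t y = 1%:E.
Proof.
rewrite /lattice_theta (_ : [set: 'rV[int]_0] = [set 0]); last first.
  by apply/seteqP; split => // c _ /=; apply/matrixP => i [].
by rewrite esum_set1 ?lee_fin ?expR_ge0// /qform mxE big_ord0 mulr0 oppr0 expR0.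
Qed.

Lemma row_mx_scalar_rsubmx (T : pzSemiRingType) n (y : 'rV[T]_(1 + n)) :
  row_mx (y 0 0)%:M (rsubmx y) = y.
Proof.
rewrite -[RHS]hsubmxK; congr row_mx; apply/matrixP => i j.
by rewrite !ord1 !mxE eqxx mulr1n; congr (y _ _); exact/val_inj.
Qed.

Section Fibration.
Variables (n : nat) (S : 'M[R]_(1 + n)) (a : R) (l : 'rV[R]_n) (S' : 'M[R]_n) (t : R).
Hypotheses (a0 : 0 < a) (t0 : 0 < t).
Hypothesis S_square : forall x u,
  qform S (row_mx x%:M u) = a * (x + (l *m u^T) 0 0) ^+ 2 + qform S' u.
Variables (y0 : R) (y' : 'rV[R]_n).

Let base (c : 'rV[int]_n) := expR (- (pi * t * qform S' (map_mx intr c + y'))).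
Let fiber_shift (c : 'rV[int]_n) := y0 + (l *m (map_mx intr c + y')^T) 0 0.
Let fiber c : \bar R := (\esum_(k in [set: int]) (gaussian (t * a) (k%:~R + fiber_shift c))%:E)%E.

Lemma lattice_theta_fibration : lattice_theta S t (row_mx y0%:M y') =
  (\esum_(c in [set: 'rV[int]_n]) ((base c)%:E * fiber c))%E.
Proof.
have -> : (\esum_(c in [set: 'rV[int]_n]) ((base c)%:E * fiber c) =
  \esum_(c in [set: 'rV[int]_n]) \esum_(k in [set: int])
    ((base c)%:E * (gaussian (t * a) (k%:~R + fiber_shift c))%:E))%E.
  by apply: eq_esum => c _; rewrite esumZl ?expR_ge0// => k _; rewrite lee_fin gaussian_ge0.
rewrite esum_esum; last first.
  by move=> c k _ _; rewrite -EFinM lee_fin mulr_ge0 ?expR_ge0 ?gaussian_ge0.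
rewrite /lattice_theta (@reindex_esum R _ _ ([set: 'rV[int]_n] `*`` (fun=> [set: int])) setT
  (fun k : 'rV[int]_n * int => row_mx (k.2)%:M k.1 : 'rV[int]_(1 + n))).
  apply: eq_esum => -[c k] _ /=; rewrite map_row_mx map_scalar_mx/= add_row_mx -raddfD/=.
  rewrite S_square /base /gaussian /fiber_shift -EFinM -expRD; congr ((expR _)%:E); ring.
split => //.
- move=> [u1 x1] [u2 x2] _ _ /= /eq_row_mx[/matrixP/(_ 0 0) + ->].
  by rewrite !mxE eqxx !mulr1n => ->.
- move=> c _; exists (@rsubmx _ 1 1 n c, c 0 0) => //=; exact: row_mx_scalar_rsubmx.
Qed.

Lemma lattice_theta_fibration_le : (lattice_theta S t (row_mx y0%:M y') <=
  ((Num.sqrt (t * a))^-1 + 2)%:E * lattice_theta S' t y')%E.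
Proof.
rewrite lattice_theta_fibration /lattice_theta -esumZl; last 2 first.
- by rewrite addr_ge0// invr_ge0 sqrtr_ge0.
- by move=> c _; rewrite lee_fin expR_ge0.
apply: le_esum => c _; have [r rE] := gaussian_esum_int (fiber_shift c) (mulr_gt0 t0 a0).
rewrite ler_norml /fiber rE => rle; rewrite -!EFinM lee_fin mulrC.
by rewrite ler_wpM2r ?expR_ge0//; lra.
Qed.

Lemma lattice_theta_fibration_ge (k : R) : 0 <= k -> k <= (Num.sqrt (t * a))^-1 - 2 ->
  (k%:E * lattice_theta S' t y' <= lattice_theta S t (row_mx y0%:M y'))%E.
Proof.
move=> k0 kle; rewrite lattice_theta_fibration /lattice_theta -esumZl//.
apply: le_esum => c _; have [r rE] := gaussian_esum_int (fiber_shift c) (mulr_gt0 t0 a0).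
rewrite ler_norml /fiber rE => rle; rewrite -!EFinM lee_fin [leRHS]mulrC.
by rewrite ler_wpM2r ?expR_ge0//; lra.
Qed.

End Fibration.

Lemma normalized_fibration_error (sa st D r r' C : R) :
  0 < sa -> 0 < st <= 1 -> 0 <= D -> 0 <= r' -> 0 <= C ->
  ((sa * st)^-1 - 2) * r' <= r <= ((sa * st)^-1 + 2) * r' -> `|D * r' - 1| <= C * st ->
  `|sa * st * D * r - 1| <= (C + 2 * sa * (1 + C)) * st.
Proof.
move=> sa0 /andP[st0 st1] D0 r'0 C0 /andP[r_lo r_up] r'_err.
pose w := sa * st; have w0 : 0 < w by rewrite mulr_gt0.
pose X := D * r'; have X0 : 0 <= X by rewrite mulr_ge0.
have X_le : X <= 1 + C.
  by move: r'_err; rewrite -/X ler_norml => /andP[_ h]; have := ler_wpM2l C0 st1; lra.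
have wD0 : 0 <= w * D by rewrite mulr_ge0// ltW.
have up := ler_wpM2l wD0 r_up; have lo := ler_wpM2l wD0 r_lo.
have upE : w * D * ((sa * st)^-1 + 2) * r' = X + 2 * w * X.
  by rewrite /X /w; field; rewrite !gt_eqF.
have loE : w * D * ((sa * st)^-1 - 2) * r' = X - 2 * w * X.
  by rewrite /X /w; field; rewrite !gt_eqF.
have err : 2 * w * X <= 2 * w * (1 + C) by rewrite ler_wpM2l// mulr_ge0// ltW.
rewrite mulrA upE in up; rewrite mulrA loE in lo.
have errE : 2 * w * (1 + C) = 2 * sa * (1 + C) * st by rewrite /w; ring.
move: r'_err; rewrite -/X -/w !ler_norml; lra.
Qed.

Lemma lattice_theta_asymp n (S : 'M[R]_n) : posdef S -> 0 < \det S /\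
  exists2 C : R, 0 <= C & forall (t : R) (y : 'rV[R]_n), 0 < t <= 1 ->
    exists2 r : R, lattice_theta S t y = r%:E &
      `|Num.sqrt (t ^+ n * \det S) * r - 1| <= C * Num.sqrt t.
Proof.
elim: n S => [|n IH] S posS.
  split; first by rewrite det_mx00.
  exists 0 => // t y _; exists 1; first exact: lattice_theta_dim0.
  by rewrite det_mx00 expr0 mul1r sqrtr1 mul1r subrr normr0 mul0r.
have [a [l [S' [a0 /IH[d0 [C C0 S'_asymp]] detS S_square]]]] := schur_complement posS.
split; first by rewrite detS mulr_gt0.
exists (C + 2 * Num.sqrt a * (1 + C)).
  by rewrite addr_ge0// !mulr_ge0 ?sqrtr_ge0 ?addr_ge0.
move=> t y t01; have /andP[t0 t1] := t01.
rewrite -[y](@row_mx_scalar_rsubmx _ n); set y0 := y 0 0; set y' := @rsubmx _ 1 1 n y.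
have [r' r'E r'_err] := S'_asymp t y' t01.
have r'0 : 0 <= r' by rewrite -lee_fin -r'E lattice_theta_ge0.
have upE := lattice_theta_fibration_le a0 t0 S_square y0 y'.
rewrite r'E -EFinM in upE.
have [r r0 rE] : exists2 r : R, 0 <= r & lattice_theta S t (row_mx y0%:M y') = r%:E.
  by apply: esum_EFin upE => c _; rewrite lee_fin expR_ge0.
exists r => //; rewrite rE lee_fin in upE.
have wE : Num.sqrt (t * a) = Num.sqrt a * Num.sqrt t by rewrite mulrC sqrtrM// ltW.
have lo : ((Num.sqrt (t * a))^-1 - 2) * r' <= r.
  have [neg|pos] := leP ((Num.sqrt (t * a))^-1 - 2) 0.
    by apply: le_trans r0; rewrite mulr_le0_ge0.
  rewrite -lee_fin -rE EFinM -r'E.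
  by apply: (lattice_theta_fibration_ge a0 t0 S_square) => //; exact: ltW.
have -> : Num.sqrt (t ^+ n.+1 * \det S) =
    Num.sqrt a * Num.sqrt t * Num.sqrt (t ^+ n * \det S').
  by rewrite -wE -sqrtrM ?mulr_ge0 ?ltW//; congr Num.sqrt; rewrite detS exprS; ring.
rewrite wE in lo upE; apply: normalized_fibration_error r'_err; rewrite ?sqrtr_gt0 ?sqrtr_ge0//.
- by rewrite t0 -sqrtr1 ler_wsqrtr.
- by rewrite lo.
Qed.

End LatticeTheta.

(** * Translation-invariant integration *)

Section CountableSums.
Context d (T : measurableType d) (R : realType) (mu : {measure set T -> \bar R}).
Local Open Scope ereal_scope.

Lemma countable_esum_nneseries (I : choiceType) (A : set I) : countable A ->
  exists2 enum : nat -> option I, (forall k i, enum k = Some i -> A i) &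
  forall a : I -> \bar R, (forall i, A i -> 0 <= a i) ->
    \esum_(i in A) a i = \sum_(k <oo) oapp a 0 (enum k).
Proof.
move=> /countable_injP[f fI].
pose code k i := A i /\ f i = k.
pose enum k := if pselect (exists i, code k i) is left e then Some (projT1 (cid e)) else None.
have enum_code k i : enum k = Some i -> code k i.
  by rewrite /enum; case: pselect => // e [<-]; case: (cid e).
have enumK i : A i -> enum (f i) = Some i.
  move=> Ai; rewrite /enum; case: pselect => [e|]; last by case; exists i.
  by case: (cid e) => j /= [Aj fj]; congr Some; apply: fI; rewrite ?inE.
exists enum; first by move=> k i /enum_code[].
move=> a a0; pose b k := oapp a 0 (enum k).
have b0 k : 0 <= b k.
  by rewrite /b; case e : (enum k) => [i|//]; apply: a0; have [] := enum_code _ _ e.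
rewrite nneseries_esumT// -/b.
have -> : \esum_(i in A) a i = \esum_(k in f @` A) b k.
  rewrite (@reindex_esum R _ _ A (f @` A) f).
    by apply: eq_esum => i Ai; rewrite /b enumK.
  by split => //; move=> i Ai; exists i.
rewrite [RHS](esumID (f @` A) _ b (fun k _ => b0 k)) !setTI [X in _ + X]esum1 ?adde0// => k notin_fA.
rewrite /b; case e : (enum k) => [i|//]; exfalso; apply: notin_fA.
by have [Ai fi] := enum_code _ _ e; exists i.
Qed.

Lemma measurable_esum (I : choiceType) (A : set I) (f : I -> T -> \bar R) : countable A ->
  (forall i, A i -> measurable_fun setT (f i)) -> (forall i t, A i -> 0 <= f i t) ->
  measurable_fun setT (fun t => \esum_(i in A) f i t).
Proof.
move=> /countable_esum_nneseries[enum enumA sumE] mf f0.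
have -> : (fun t => \esum_(i in A) f i t) =
   (fun t => \sum_(k <oo) oapp (f^~ t) 0 (enum k)).
  by apply/funext => t; apply: sumE => i; exact: f0.
apply: ge0_emeasurable_sum => [k t _ _|k _].
  by case e : (enum k) => [i|//]; apply: f0; exact: enumA e.
by case e : (enum k) => [i|]; [apply: mf; exact: enumA e|exact: measurable_cst].
Qed.

Lemma integral_esum (I : choiceType) (A : set I) (f : I -> T -> \bar R) : countable A ->
  (forall i, A i -> measurable_fun setT (f i)) -> (forall i t, A i -> 0 <= f i t) ->
  \int[mu]_t (\esum_(i in A) f i t) = \esum_(i in A) \int[mu]_t f i t.
Proof.
move=> /countable_esum_nneseries[enum enumA sumE] mf f0.
rewrite sumE => [|i Ai]; last by apply: integral_ge0 => t _; exact: f0.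
have sum_fE t : \esum_(i in A) f i t = \sum_(k <oo) oapp (f^~ t) 0 (enum k).
  by apply: sumE => i; exact: f0.
under eq_integral do rewrite sum_fE.
rewrite integral_nneseries//.
- by apply: eq_eseriesr => k _; case: (enum k) => [i //|]; exact: integral0.
- by move=> k; case e : (enum k) => [i|]; [apply: mf; exact: enumA e|exact: measurable_cst].
- by move=> k t _; case e : (enum k) => [i|//]; apply: f0; exact: enumA e.
Qed.

Lemma integral_gt0 (f : T -> \bar R) : measurable_fun setT f -> (forall t, 0 < f t) ->
  0 < mu setT -> 0 < \int[mu]_t f t.
Proof.
move=> mf f0 m0; rewrite lt_def integral_ge0 ?andbT => [|t _]; last exact/ltW.
apply/eqP => int0.
have /ae_eq_integral_abs : \int[mu]_t `|f t| = 0.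
  by rewrite -[RHS]int0; apply: eq_integral => t _; rewrite gee0_abs// ltW.
move=> /(_ measurableT mf) [A [mA A0 sub_A]].
have AT : A = setT.
  apply/seteqP; split => // t _; apply: sub_A => /= /(_ I) ft0.
  by have := f0 t; rewrite ft0 ltxx.
by move: m0; rewrite -AT A0 ltxx.
Qed.

End CountableSums.

Section SigmaFiniteProduct.
Context d1 d2 (T1 : measurableType d1) (T2 : measurableType d2) (R : realType).
Variables (m1 : {sigma_finite_measure set T1 -> \bar R})
  (m2 : {sigma_finite_measure set T2 -> \bar R}).

(* A new head constant, because instance search on [m1 \x m2] only finds the
   structures of a product of finite measures. *)
Definition sigma_finite_prod := product_measure1 m1 m2.

HB.instance Definition _ := Measure.on sigma_finite_prod.

Lemma sigma_finite_prodT : sigma_finite setT sigma_finite_prod.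
Proof.
have /sigma_finiteP[F [FT ndF finF]] := sigma_finiteT m1.
have /sigma_finiteP[G [GT ndG finG]] := sigma_finiteT m2.
exists (fun k => F k `*` G k).
  rewrite -setXTT FT GT; apply/seteqP; split => [[x y] [/= [i _ Fx] [j _ Gy]]|].
    exists (maxn i j) => //; split.
      by move: x Fx; exact/subsetPset/ndF/leq_maxl.
    by move: y Gy; exact/subsetPset/ndG/leq_maxr.
  by move=> [x y] [k _ [Fx Gy]]; split; exists k.
move=> k; have [mF Ff] := finF k; have [mG Gf] := finG k.
split; first exact: measurableX.
by rewrite /sigma_finite_prod product_measure1E// lte_mul_pinfty ?ge0_fin_numE.
Qed.

HB.instance Definition _ :=
  Measure_isSigmaFinite.Build _ _ _ sigma_finite_prod sigma_finite_prodT.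

End SigmaFiniteProduct.

Section TranslationSpace.
Variable R : realType.
Local Notation mu := (@lebesgue_measure R).

(* R^n with Lebesgue measure, kept abstract: only the coordinates and the
   translations are needed, and the space is built by induction on n. *)
Record translation_space (n : nat) := TranslationSpace {
  ts_disp : measure_display;
  ts_type : measurableType ts_disp;
  ts_measure : {sigma_finite_measure set ts_type -> \bar R};
  ts_coord : 'I_n -> ts_type -> R;
  ts_translate : ('I_n -> R) -> ts_type -> ts_type;
  measurable_ts_coord : forall i, measurable_fun setT (ts_coord i);
  measurable_ts_translate : forall a, measurable_fun setT (ts_translate a);
  ts_coord_translate : forall a t i, ts_coord i (ts_translate a t) = ts_coord i t + a i;
  ts_integral_translate : forall a (F : ts_type -> \bar R), measurable_fun setT F ->
    (forall t, 0%E <= F t)%E ->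
    (\int[ts_measure]_t F (ts_translate a t) = \int[ts_measure]_t F t)%E;
  ts_integral_expR_abs : forall k : R, 0 < k ->
    (\int[ts_measure]_t (expR (- (k * \sum_i `|ts_coord i t|)))%:E < +oo)%E;
  ts_measure_gt0 : (0 < ts_measure setT)%E }.

Definition translation_space0 : translation_space 0.
Proof.
refine (@TranslationSpace 0 _ unit (\d_ tt) (fun _ _ => 0) (fun _ t => t) _ _ _ _ _ _) => //.
- by move=> a t [].
- by move=> k k0; rewrite integral_dirac//= diracT mul1e ltry.
- by rewrite [X in (_ < X)%E](_ : _ = 1%E) ?lte01//; exact: diracT.
Defined.

Section Product.
Variables (n : nat) (X : translation_space n).
Local Notation T := (measurableTypeR R * ts_type X)%type.
Let m : {sigma_finite_measure set T -> \bar R} := sigma_finite_prod mu (ts_measure X).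
Implicit Types (t : T) (a : 'I_n.+1 -> R) (F : T -> \bar R).

Let coord (i : 'I_n.+1) t : R := if unlift ord0 i is Some j then ts_coord j t.2 else t.1.

Let translate a t : T := (t.1 + a ord0, ts_translate (fun j => a (lift ord0 j)) t.2).

Let measurable_coord i : measurable_fun setT (coord i).
Proof.
rewrite /coord; case: unliftP => [j _|_]; last exact: measurable_fst.
exact: (measurableT_comp (measurable_ts_coord j) measurable_snd).
Qed.

Let measurable_translate a : measurable_fun setT (translate a).
Proof.
apply/measurable_fun_pairP; split.
  apply: (measurableT_comp (f := fun x : R => x + a ord0)) => //.
  exact: measurable_shift.
exact: (measurableT_comp (measurable_ts_translate (fun j => a (lift ord0 j))) measurable_snd).
Qed.

Let coord_translate a t i : coord i (translate a t) = coord i t + a i.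
Proof. by rewrite /coord; case: unliftP => [j ->|->] //=; exact: ts_coord_translate. Qed.

Let integral_translate a F : measurable_fun setT F -> (forall t, 0%E <= F t)%E ->
  (\int[m]_t F (translate a t) = \int[m]_t F t)%E.
Proof.
move=> mF F0; have mFt : measurable_fun setT (F \o translate a) by exact: measurableT_comp.
rewrite (@fubini_tonelli1 _ _ _ _ _ _ _ (F \o translate a))//=.
rewrite (@fubini_tonelli1 _ _ _ _ _ _ _ F)//=.
rewrite -(@ge0_integral_shift R (fubini_F (ts_measure X) F) (a ord0)); last 2 first.
- exact: measurable_fun_fubini_tonelli_F.
- by move=> x; apply: integral_ge0 => y _; exact: F0.
apply: eq_integral => x _; rewrite /fubini_F /=.
rewrite -(@ts_integral_translate _ X (fun j => a (lift ord0 j)) (fun y => F (x + a ord0, y)))//.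
by apply: measurableT_comp => //; exact: measurable_pair1.
Qed.

Lemma ge0_integral_tensor (f : measurableTypeR R -> \bar R) (g : ts_type X -> \bar R) :
  measurable_fun setT f -> measurable_fun setT g ->
  (forall x, 0 <= f x)%E -> (forall y, 0 <= g y)%E -> (\int[ts_measure X]_y g y < +oo)%E ->
  (\int[m]_t (f t.1 * g t.2) = \int[mu]_x f x * \int[ts_measure X]_y g y)%E.
Proof.
move=> mf mg f0 g0 g_fin; have int_g0 : (0 <= \int[ts_measure X]_y g y)%E by exact: integral_ge0.
rewrite (@fubini_tonelli1 _ _ _ _ _ _ _ (fun t : T => f t.1 * g t.2)%E)/=; last 2 first.
- apply: emeasurable_funM; first exact: (measurableT_comp mf measurable_fst).
  exact: (measurableT_comp mg measurable_snd).
- by move=> t; rewrite mule_ge0.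
rewrite -[X in (_ * X)%E]fineK ?ge0_fin_numE// -ge0_integralZr ?lee_fin ?fine_ge0//.
by apply: eq_integral => x _; rewrite /fubini_F/= ge0_integralZl// fineK ?ge0_fin_numE.
Qed.

Let integral_expR_abs_coord (k : R) : 0 < k ->
  (\int[m]_t (expR (- (k * \sum_i `|coord i t|)))%:E < +oo)%E.
Proof.
move=> k0.
have -> : (fun t : T => (expR (- (k * \sum_i `|coord i t|)))%:E) = (fun t =>
    (expR (- (k * `|t.1|)))%:E * (expR (- (k * \sum_i `|ts_coord i t.2|)))%:E)%E.
  apply/funext => t; rewrite -EFinM -expRD; congr ((expR _)%:E).
  rewrite big_ord_recl /coord unlift_none mulrDr opprD; congr (_ - _ * _).
  by apply: eq_bigr => j _; rewrite liftK.
rewrite (@ge0_integral_tensor (fun x => (expR (- (k * `|x|)))%:E)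
  (fun y => (expR (- (k * \sum_i `|ts_coord i y|)))%:E)).
- apply: lte_mul_pinfty; last exact: ts_integral_expR_abs.
    by apply: integral_ge0 => x _; rewrite lee_fin expR_ge0.
  by rewrite ge0_fin_numE ?integral_expR_abs// integral_ge0// => x _; rewrite lee_fin expR_ge0.
- apply/measurable_EFinP; apply: measurableT_comp => //; apply: measurableT_comp => //.
  by apply: measurable_funM => //; exact: measurableT_comp.
- apply/measurable_EFinP; apply: measurableT_comp => //; apply: measurableT_comp => //.
  apply: measurable_funM => //; apply: measurable_sum => i; apply: measurableT_comp => //.
  exact: measurable_ts_coord.
- by move=> x; rewrite lee_fin expR_ge0.
- by move=> y; rewrite lee_fin expR_ge0.
- exact: ts_integral_expR_abs.
Qed.

Let measure_gt0 : (0 < m setT)%E.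
Proof.
have -> : m setT = (mu setT * ts_measure X setT)%E.
  by rewrite -setXTT; exact: product_measure1E.
rewrite mule_gt0 ?ts_measure_gt0//.
rewrite (lt_le_trans (y := mu `[0%R, 1%R]%classic))//; last by apply: le_measure => //; rewrite inE.
rewrite [X in (_ < X)%E](_ : _ = 1%E) ?lte01//.
apply: etrans (@lebesgue_measure_itv R `[0%R, 1%R]) _.
by rewrite /= lte_fin ltr01 -EFinB subr0.
Qed.

Definition translation_spaceS : translation_space n.+1 :=
  TranslationSpace measurable_coord measurable_translate coord_translate integral_translate
    integral_expR_abs_coord measure_gt0.

End Product.

Fixpoint translation_spaceN n : translation_space n :=
  if n is k.+1 then translation_spaceS (translation_spaceN k) else translation_space0.

End TranslationSpace.

(** * Complex embeddings and densities *)

Section RingOfIntegers.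
Variable L : fieldExtType rat.
Implicit Types x y : L.

Lemma roiM x y : ring_of_integers x -> ring_of_integers y -> ring_of_integers (x * y).
Proof. exact: integral_mul. Qed.

Lemma roiB x y : ring_of_integers x -> ring_of_integers y -> ring_of_integers (x - y).
Proof. exact: integral_sub. Qed.

Lemma roiD x y : ring_of_integers x -> ring_of_integers y -> ring_of_integers (x + y).
Proof. exact: integral_add. Qed.

Lemma roi_int (z : int) : @ring_of_integers L z%:~R.
Proof. exact: integral_id. Qed.

Lemma roi0 : @ring_of_integers L 0. Proof. exact: (roi_int 0). Qed.

Lemma roi1 : @ring_of_integers L 1. Proof. exact: (roi_int 1). Qed.

Lemma roiN x : ring_of_integers x -> ring_of_integers (- x).
Proof. by move=> Ox; rewrite -sub0r; apply: roiB => //; exact: roi0. Qed.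

Lemma roiX x k : ring_of_integers x -> ring_of_integers (x ^+ k).
Proof. by move=> Ox; elim: k => [|k IH]; rewrite ?expr0 ?exprS; [exact: roi1|exact: roiM]. Qed.

End RingOfIntegers.

Section ComplexEmbeddings.
Variables (R : realType) (L : fieldExtType rat).
Local Notation C := R[i].
Local Notation n := (\dim {:L}).

Lemma rmorph_ratC (f : {rmorphism L -> C}) (q : rat) : f q%:A = ratr q.
Proof. exact: (fmorph_eq_rat (f \o in_alg L)). Qed.

Lemma rmorph_scaleC (f : {rmorphism L -> C}) (q : rat) x : f (q *: x) = ratr q * f x.
Proof. by rewrite -mulr_algl rmorphM rmorph_ratC. Qed.

Lemma ratrC (q : rat) : ratr q = ((ratr q)%:C)%C :> C.
Proof. by rewrite -(fmorph_eq_rat (real_complex R \o ratr)). Qed.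

Lemma conjc_ratr (q : rat) : ((ratr q : C)^* )%C = ratr q.
Proof. exact: (fmorph_eq_rat (@conjc R \o ratr)). Qed.

Lemma conjc_horner_ratr (q : {poly rat}) (z : C) :
  ((map_poly ratr q).[z]^* )%C = (map_poly ratr q).[(z^* )%C].
Proof.
rewrite -[LHS]horner_map -map_poly_comp; congr horner; apply: eq_map_poly => c.
exact: conjc_ratr.
Qed.

Record embedding_system := EmbeddingSystem {
  embedding :> 'I_n -> {rmorphism L -> C};
  conj_index : 'I_n -> 'I_n;
  embedding_conj : forall i x, embedding (conj_index i) x = ((embedding i x)^* )%C;
  separating_elt : L;
  embedding_separating : injective (fun i => embedding i separating_elt) }.

Lemma primitive_elementP : exists (th : L) (p : {poly rat}), [/\ <<1; th>>%VS = {:L}%VS,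
  minPoly 1 th = map_poly (in_alg L) p, p \is monic, size p = n.+1 & separable_poly p].
Proof.
have pchar0 : [pchar L] =i pred0 by move=> p; rewrite (pchar_lalg L) pchar_num.
have sepL : separable 1%AS {:L} by apply/separableP => y _; exact: pcharf0_separable.
pose th := separable_generator 1%VS ({:L}%VS : {vspace L}).
have thE : <<1; th>>%VS = {:L}%VS.
  by rewrite -(@eq_adjoin_separable_generator _ _ {:L}%AS 1%AS)// subvf.
have /polyOver1P[p pE] := minPolyOver 1%AS th.
exists th, p; split => //.
- by rewrite -(map_monic (in_alg L)) -pE monic_minPoly.
- rewrite -(size_map_poly (in_alg L)) -pE size_minPoly.
  by rewrite -[in RHS]thE (dim_Fadjoin 1%AS th) dimv1 muln1.
- by rewrite -(separable_map (in_alg L)) -pE; exact: pcharf0_separable.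
Qed.

Section Conjugates.
Variables (th : L) (p : {poly rat}).
Hypotheses (th_gen : <<1; th>>%VS = {:L}%VS) (minPoly_th : minPoly 1 th = map_poly (in_alg L) p).
Implicit Types (q : {poly rat}) (x : C).

Lemma horner_primitive (y : L) : exists q, y = (map_poly (in_alg L) q).[th].
Proof.
have /Fadjoin_polyP[q /polyOver1P[q0 ->] ->] : y \in <<1%AS; th>>%VS by rewrite th_gen memvf.
by exists q0.
Qed.

Lemma eq_horner_conjugate q1 q2 x : root (map_poly ratr p) x ->
  (map_poly (in_alg L) q1).[th] = (map_poly (in_alg L) q2).[th] ->
  (map_poly ratr q1).[x] = (map_poly ratr q2).[x].
Proof.
move=> px eq_th; apply/eqP; rewrite -subr_eq0 -hornerN -hornerD -rmorphB -/(root _ _).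
suff /dvdpP[u eu] : map_poly ratr p %| (map_poly ratr (q1 - q2) : {poly C}).
  by rewrite -[X in root X]/(map_poly ratr _) eu rootM px orbT.
rewrite dvdp_map -(dvdp_map (in_alg L)) -minPoly_th.
apply: minPoly_dvdp; first by apply/polyOver1P; exists (q1 - q2).
by rewrite /root rmorphB hornerD hornerN eq_th subrr.
Qed.

Lemma embedding_of_root x : root (map_poly ratr p) x -> {f : {rmorphism L -> C} |
  forall q, f (map_poly (in_alg L) q).[th] = (map_poly ratr q).[x]}.
Proof.
move=> px; pose repr y := projT1 (cid (horner_primitive y)).
have reprE y : (map_poly (in_alg L) (repr y)).[th] = y by rewrite -(projT2 (cid (horner_primitive y))).
pose f y := (map_poly ratr (repr y)).[x].
have fE q : f (map_poly (in_alg L) q).[th] = (map_poly ratr q).[x].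
  by apply: eq_horner_conjugate => //; rewrite reprE.
have fB : zmod_morphism f.
  move=> u v; rewrite -[u]reprE -[v]reprE -hornerN -hornerD -rmorphB !fE.
  by rewrite rmorphB hornerD hornerN.
have fM : monoid_morphism f.
  split; first by rewrite -[1](hornerC 1 th) -[1%:P](rmorph1 (map_poly (in_alg L))) fE rmorph1 hornerC.
  by move=> u v; rewrite -[u]reprE -[v]reprE -hornerM -rmorphM !fE rmorphM hornerM.
pose F : {rmorphism L -> C} := HB.pack f
  (GRing.isZmodMorphism.Build L C f fB) (GRing.isMonoidMorphism.Build L C f fM).
by exists F.
Qed.

End Conjugates.

Lemma separable_roots (p : {poly rat}) : p \is monic -> separable_poly p ->
  exists r : seq C, [/\ uniq r, (size r).+1 = size p &
    forall x, (x \in r) = root (map_poly ratr p) x].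
Proof.
move=> p_monic p_sep; have [r rE] := closed_field_poly_normal (map_poly ratr p : {poly C}).
have P_monic : map_poly ratr p \is @monic C by rewrite map_monic.
rewrite (monicP P_monic) scale1r in rE; exists r; split.
- by rewrite -separable_prod_XsubC -rE separable_map.
- by rewrite -(size_prod_XsubC r id) -rE size_map_poly.
- by move=> x; rewrite rE root_prod_XsubC.
Qed.

Lemma embedding_system_exists : inhabited embedding_system.
Proof.
have [th [p [th_gen p_min p_monic p_size p_sep]]] := primitive_elementP.
have [r [r_uniq]] := separable_roots p_monic p_sep; rewrite p_size => -[r_size] rE.
have root_r (i : 'I_n) : root (map_poly ratr p) r`_i.
  by rewrite -rE mem_nth ?r_size.
pose sg i := projT1 (embedding_of_root th_gen p_min (root_r i)).
have sgE i q : sg i (map_poly (in_alg L) q).[th] = (map_poly ratr q).[r`_i].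
  by rewrite /sg; case: embedding_of_root.
have sg_th i : sg i th = r`_i by have := sgE i 'X; rewrite !map_polyX !hornerX.
have conj_root (i : 'I_n) : exists j : 'I_n, r`_j = ((r`_i)^* )%C.
  have : ((r`_i)^* )%C \in r by rewrite rE /root -conjc_horner_ratr (eqP (root_r i)) rmorph0.
  by move=> /(nthP 0)[j]; rewrite r_size => jn rj; exists (Ordinal jn).
pose cj i := projT1 (cid (conj_root i)).
have sg_cj i x : sg (cj i) x = ((sg i x)^* )%C.
  have [q ->] := horner_primitive th_gen x.
  by rewrite !sgE conjc_horner_ratr; congr horner; rewrite /cj; case: cid.
have sg_inj : injective (fun i => sg i th).
  move=> i j /=; rewrite !sg_th => /eqP; rewrite nth_uniq ?r_size// => /eqP eq_ij.
  exact/val_inj.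
exact: (inhabits (EmbeddingSystem sg_cj sg_inj)).
Qed.

Variable E : embedding_system.

Lemma conj_index_inj : injective (conj_index E).
Proof.
move=> i j eq_ij; apply: (@embedding_separating E) => /=; apply: (can_inj (@conjcK R)).
by rewrite -!embedding_conj eq_ij.
Qed.

Lemma conj_indexK : involutive (conj_index E).
Proof. by move=> i; apply: (@embedding_separating E); rewrite !embedding_conj conjcK. Qed.

Definition embedding_mx (e : n.-tuple L) : 'M[C]_n := \matrix_(k, i) E i e`_k.

Lemma Vandermonde_separating_unit :
  Vandermonde n (\row_i E i (separating_elt E)) \in unitmx.
Proof.
rewrite unitmxE det_Vandermonde unitfE; apply/prodf_neq0 => i _; apply/prodf_neq0 => j ij.
rewrite !mxE subr_eq0; apply: contraTneq ij => /(@embedding_separating E) ->.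
by rewrite ltnn.
Qed.

Lemma embedding_mx_unit (e : n.-tuple L) : basis_of {:L} e -> embedding_mx e \in unitmx.
Proof.
move=> eB; rewrite -unitmx_tr -row_free_unit; apply: inj_row_free => v ve.
have v_ker x : \sum_i v 0 i * E i x = 0.
  rewrite (coord_basis eB (memvf x)).
  under eq_bigr => i _ do rewrite rmorph_sum big_distrr/=.
  rewrite exchange_big/= big1// => k _.
  have /matrixP/(_ 0 k) := ve; rewrite !mxE => vek.
  transitivity (ratr (coord e k x) * \sum_j v 0 j * (embedding_mx e)^T j k); last by rewrite vek mulr0.
  rewrite big_distrr/=.
  by apply: eq_bigr => i _; rewrite rmorph_scaleC !mxE mulrCA.
have := Vandermonde_separating_unit; set V := Vandermonde _ _ => V_unit.
have vV : v *m V^T = 0.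
  apply/matrixP => i k; rewrite !mxE -[RHS](v_ker (separating_elt E ^+ k)).
  by apply: eq_bigr => j _; rewrite !mxE rmorphXn/= ord1.
by rewrite -[v](mulmxK (_ : V^T \in unitmx)) ?unitmx_tr// vV mul0mx.
Qed.

Lemma mxtrace_embeddings (e : n.-tuple L) (A : 'M[rat]_n) (x : L) : basis_of {:L} e ->
  (forall k : 'I_n, x * e`_k = \sum_l A k l *: e`_l) -> ratr (\tr A) = \sum_i E i x.
Proof.
move=> eB A_mul; have e_unit := embedding_mx_unit eB.
pose D : 'M[C]_n := diag_mx (\row_i E i x).
have diagonalize : map_mx ratr A *m embedding_mx e = embedding_mx e *m D.
  apply/matrixP => k i; rewrite mul_mx_diag !mxE -rmorphM mulrC A_mul rmorph_sum.
  by apply: eq_bigr => l _; rewrite !mxE rmorph_scaleC.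
have -> : \sum_i E i x = \tr D by rewrite mxtrace_diag; apply: eq_bigr => i _; rewrite mxE.
rewrite -[D](mulKmx e_unit) -diagonalize mulmxA mxtrace_mulC mulmxA mulmxV// mul1mx.
by rewrite /mxtrace rmorph_sum; apply: eq_bigr => i _; rewrite mxE.
Qed.

Lemma field_trace_embeddings x : ratr (field_trace x) = \sum_i E i x.
Proof.
have vB : basis_of {:L} (vbasis {:L}) := vbasisP _.
rewrite /field_trace; apply: (mxtrace_embeddings vB) => k.
have -> : x * (vbasis {:L})`_k = amull x (vecof (vbasis {:L}) (delta_mx 0 k)).
  by rewrite vecof_delta lfunE.
by rewrite (hom_vecof (vbasis {:L}) vB) /vecof; apply: eq_bigr => l _; rewrite -rowE mxE.
Qed.

Lemma basis_disc_embeddings (e : n.-tuple L) : basis_of {:L} e ->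
  ratr (basis_disc e) = (\det (embedding_mx e)) ^+ 2.
Proof.
move=> eB; rewrite expr2 -{2}det_tr -det_mulmx /basis_disc -det_map_mx; congr (\det _).
apply/matrixP => k l; rewrite [RHS]mxE mxE mxE -[LHS]/(ratr _) field_trace_embeddings.
by apply: eq_bigr => i _; rewrite !mxE rmorphM.
Qed.

Lemma basis_disc_neq0 (e : n.-tuple L) : basis_of {:L} e -> basis_disc e != 0.
Proof.
move=> eB; have := basis_disc_embeddings eB; apply: contra_eq_neq => ->; rewrite rmorph0 eq_sym.
by rewrite expf_neq0// -unitfE -unitmxE embedding_mx_unit.
Qed.

Lemma integral_basis_roi (e : n.-tuple L) (k : 'I_n) : integral_basis e -> ring_of_integers e`_k.
Proof.
move=> [_ e_int]; apply/e_int; exists (fun l => (l == k)%:Z).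
rewrite (bigD1 k)//= eqxx mul1r big1 ?addr0// => l /negPf ->.
by rewrite mul0r.
Qed.

Lemma field_trace_roi (e : n.-tuple L) (x : L) : integral_basis e -> ring_of_integers x ->
  exists z : int, field_trace x = z%:~R.
Proof.
move=> e_int Ox; have coords (k : 'I_n) : exists c : 'I_n -> int, x * e`_k = \sum_l (c l)%:~R * e`_l.
  by apply: (e_int.2 _).1; apply: roiM => //; exact: integral_basis_roi.
pose c k := projT1 (cid (coords k)).
have A_mul (k : 'I_n) : x * e`_k = \sum_l (\matrix_(k, l) (c k l)%:~R : 'M[rat]_n) k l *: e`_l.
  rewrite (projT2 (cid (coords k))); apply: eq_bigr => l _.
  by rewrite mxE -mulr_algl; congr (_ * _); rewrite -[RHS]/(in_alg L _) rmorph_int.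
exists (\sum_k c k k).
apply: (@fmorph_inj _ _ (ratr : {rmorphism rat -> C})).
rewrite [LHS]field_trace_embeddings -(mxtrace_embeddings e_int.1 A_mul); congr ratr.
by rewrite /mxtrace rmorph_sum; apply: eq_bigr => k _; rewrite mxE.
Qed.

Lemma integral_basis_disc_nat (e : n.-tuple L) : integral_basis e ->
  exists2 N : nat, (0 < N)%N & `|basis_disc e| = N%:R.
Proof.
move=> e_int; have traces (k l : 'I_n) : exists z : int, field_trace (e`_k * e`_l) = z%:~R.
  by apply: (field_trace_roi e_int); apply: roiM; exact: integral_basis_roi.
pose B : 'M[int]_n := \matrix_(k, l) projT1 (cid (traces k l)).
have discE : basis_disc e = (\det B)%:~R.
  rewrite /basis_disc -det_map_mx; congr (\det _); apply/matrixP => k l; rewrite !mxE.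
  exact: projT2 (cid (traces k l)).
exists `|\det B|%N; last by rewrite discE -intr_norm -abszE.
by rewrite absz_gt0; have := basis_disc_neq0 e_int.1; rewrite discE intr_eq0.
Qed.

End ComplexEmbeddings.

Section SubgroupsAndCosets.
Variable L : fieldExtType rat.
Implicit Types (A B : set L) (s : seq L) (x y a : L).

Definition subgroup A := A 0 /\ forall x y, A x -> A y -> A (x - y).

Lemma subgroupN A x : subgroup A -> A x -> A (- x).
Proof. by move=> [A0 AB] Ax; rewrite -sub0r; exact: AB. Qed.

Lemma subgroupD A x y : subgroup A -> A x -> A y -> A (x + y).
Proof. by move=> sA Ax Ay; rewrite -[y]opprK; apply: sA.2 => //; exact: subgroupN. Qed.

Lemma subgroup_mulrn A x k : subgroup A -> A x -> A (x *+ k).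
Proof. by move=> sA Ax; elim: k => [|k IH]; [exact: sA.1|rewrite mulrS; exact: subgroupD]. Qed.

Lemma subgroup_mulrz A x (z : int) : subgroup A -> A x -> A (x *~ z).
Proof.
move=> sA Ax; case: z => k; first exact: subgroup_mulrn.
by rewrite NegzE mulrNz; apply: subgroupN => //; exact: subgroup_mulrn.
Qed.

Lemma subgroup_sum (I : Type) (r : seq I) (P : pred I) (f : I -> L) A : subgroup A ->
  (forall i, P i -> A (f i)) -> A (\sum_(i <- r | P i) f i).
Proof. by move=> sA Af; elim/big_ind: _ => //; [exact: sA.1|move=> x y; exact: subgroupD]. Qed.

Definition dilate x A : set L := [set x * y | y in A].

Lemma dilateA x y A : dilate x (dilate y A) = dilate (x * y) A.
Proof.
apply/seteqP; split => [_ [_ [z Az <-] <-]|_ [z Az <-]]; first by exists z => //; rewrite mulrA.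
by exists (y * z); [exists z|rewrite mulrA].
Qed.

Lemma dilate1 A : dilate 1 A = A.
Proof.
by apply/seteqP; split => [_ [z Az <-]|z Az]; [rewrite mul1r|exists z; rewrite ?mul1r].
Qed.

Lemma subgroup_dilate A x : subgroup A -> subgroup (dilate x A).
Proof.
move=> [A0 AB]; split; first by exists 0; rewrite ?mulr0.
by move=> _ _ [y Ay <-] [z Az <-]; exists (y - z); [exact: AB|rewrite mulrBr].
Qed.

Lemma dilate2_sub A : subgroup A -> dilate 2 A `<=` A.
Proof. by move=> sA _ [x Ax <-]; rewrite mulr_natl; exact: subgroup_mulrn. Qed.

Definition incongruent B s := pairwise (fun a a' => `[< ~ B (a - a') >]) s.

Definition cosets B s : set L := [set x | exists2 a, a \in s & B (x - a)].

Lemma mem_cosets B s a : subgroup B -> a \in s -> cosets B s a.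
Proof. by move=> sB as_; exists a => //; rewrite subrr; exact: sB.1. Qed.

Lemma cosets_nil B : cosets B [::] = set0.
Proof. by apply/seteqP; split => // x []. Qed.

Lemma cosets_cons B a s : cosets B (a :: s) = [set a + x | x in B] `|` cosets B s.
Proof.
apply/seteqP; split => x.
  move=> [a']; rewrite inE => /predU1P[->|a's] Bxa; last by right; exists a'.
  by left; exists (x - a) => //; rewrite addrC subrK.
case; first by move=> [y By <-]; exists a; rewrite ?mem_head// addrC addKr.
by move=> [a' a's Bxa]; exists a' => //; rewrite inE a's orbT.
Qed.

Lemma incongruent_consP B a s : subgroup B -> incongruent B (a :: s) ->
  incongruent B s /\ [disjoint [set a + x | x in B] & cosets B s].
Proof.
move=> sB; rewrite /incongruent/= => /andP[/allP a_new ->]; split => //.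
apply/disj_set2P/seteqP; split => // _ [[y By <-] [a' a's Bya]].
have /asboolP := a_new _ a's; apply.
by rewrite (_ : a - a' = (a + y - a') - y); [exact: sB.2|rewrite addrAC addrK].
Qed.

Lemma incongruent_cons B a s : incongruent B s -> ~ cosets B s a -> incongruent B (a :: s).
Proof.
move=> s_inc a_new; rewrite /incongruent/=; apply/andP; split => //.
by apply/allP => a' a's; apply/asboolP => Baa'; apply: a_new; exists a'.
Qed.

Lemma cosets_sub A B s : subgroup A -> B `<=` A -> (forall a, a \in s -> A a) -> cosets B s `<=` A.
Proof. by move=> sA BA As x [a /As Aa /BA Axa]; rewrite -(subrK a x); exact: subgroupD. Qed.

Lemma incongruent_thin B s : subgroup B ->
  exists s', [/\ incongruent B s', (size s' <= size s)%N & cosets B s `<=` cosets B s'].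
Proof.
move=> sB; elim: s => [|a s [s' [s'_inc s's sub]]]; first by exists [::]; split.
have [s'a|s'a] := pselect (cosets B s' a).
  exists s'; split => //; first exact: leqW.
  rewrite cosets_cons => x [[y By <-]|/sub//].
  have [a' a's Baa'] := s'a; exists a' => //.
  by rewrite addrAC; exact: subgroupD.
exists (a :: s'); split; [exact: incongruent_cons|by []|].
by rewrite !cosets_cons => x [xa|/sub]; [left|right].
Qed.

Lemma incongruent_size B s S : subgroup B -> incongruent B s ->
  (forall a, a \in s -> cosets B S a) -> (size s <= size S)%N.
Proof.
move=> sB s_inc sS; pose f a := xget 0 [set c | c \in S /\ B (a - c)].
have fP a : a \in s -> f a \in S /\ B (a - f a).
  by move=> /sS [c cS Bc]; apply: (@xgetPex _ 0 [set c | c \in S /\ B (a - c)]); exists c.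
rewrite -(size_map f); apply: uniq_leq_size; last by move=> _ /mapP[a /fP[fa _] ->].
elim: s fP s_inc {sS} => [//|a s IH] fP; rewrite /incongruent /= => /andP[/allP a_new s_inc].
rewrite IH ?andbT//; last by move=> b bs; apply: fP; rewrite inE bs orbT.
apply/mapP => -[b bs eq_f]; have /asboolP := a_new _ bs; apply.
have [_ Ba] := fP a (mem_head _ _).
have [_ Bb] : f b \in S /\ B (b - f b) by apply: fP; rewrite inE bs orbT.
by rewrite (_ : a - b = (a - f a) - (b - f b)); [exact: sB.2|rewrite eq_f; ring].
Qed.

Lemma transversal_bounded A B N : subgroup A -> subgroup B -> B `<=` A ->
  (forall s, incongruent B s -> (forall a, a \in s -> A a) -> (size s <= N)%N) ->
  exists s, incongruent B s /\ A = cosets B s.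
Proof.
move=> sA sB BA le_N; apply: contrapT => no_transversal.
have long k : exists s, [/\ incongruent B s, (forall a, a \in s -> A a) & size s = k].
  elim: k => [|k [s [s_inc As sk]]]; first by exists [::].
  have [a Aa a_new] : exists2 a, A a & ~ cosets B s a.
    apply: contrapT => all_old; apply: no_transversal; exists s; split => //.
    apply/seteqP; split; last exact: cosets_sub.
    by move=> x Ax; apply: contrapT => x_new; apply: all_old; exists x.
  exists (a :: s); split => /=; [exact: incongruent_cons| |by rewrite sk].
  by move=> a'; rewrite inE => /predU1P[->//|/As].
have [s [s_inc As sN]] := long N.+1.
by have := le_N s s_inc As; rewrite sN ltnn.
Qed.

Variable R : realType.

Lemma esum_cosets B s (f : L -> \bar R) : subgroup B -> (forall x, 0%E <= f x)%E ->
  incongruent B s ->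
  (\esum_(x in cosets B s) f x = \sum_(a <- s) \esum_(x in B) f (a + x)%R)%E.
Proof.
move=> sB f0; elim: s => [_|a s IH]; first by rewrite big_nil cosets_nil esum_set0.
move=> /(incongruent_consP sB)[s_inc disj]; rewrite cosets_cons big_cons -IH// esum_setU//.
by congr (_ + _)%E; rewrite esum_image//; move=> x y _ _ /addrI.
Qed.

Lemma esum_subgroup_shift B a (f : L -> \bar R) : subgroup B -> B a ->
  (\esum_(x in B) f (a + x)%R = \esum_(x in B) f x)%E.
Proof.
move=> sB Ba; rewrite [RHS](@reindex_esum R _ _ B B (fun x => a + x))//; split.
- by move=> x Bx; exact: subgroupD.
- by move=> x y _ _ /addrI.
- by move=> x Bx; exists (x - a); [exact: sB.2|rewrite addrC subrK].
Qed.

Lemma esum_subgroup_opp B (f : L -> \bar R) : subgroup B ->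
  (\esum_(x in B) f (- x)%R = \esum_(x in B) f x)%E.
Proof.
move=> sB; rewrite [RHS](@reindex_esum R _ _ B B (fun x => - x))//; split.
- by move=> x; exact: subgroupN.
- by move=> x y _ _ /oppr_inj.
- by move=> x Bx; exists (- x); [exact: subgroupN|rewrite opprK].
Qed.

End SubgroupsAndCosets.

Section Density.
Variables (R : realType) (L : fieldExtType rat) (E : embedding_system R L).
Local Notation n := (\dim {:L}).
Implicit Types (tau : 'I_n -> R) (x y v a : L) (A B : set L) (s : seq L).

Definition sqnorm tau x : R := \sum_i tau i * normc (E i x) ^+ 2.
Definition absnorm x : R := \prod_i normc (E i x).
Definition weight tau := (forall i, 0 < tau i) /\ (forall i, tau (conj_index E i) = tau i).
Definition twist tau x : 'I_n -> R := fun i => tau i * normc (E i x) ^+ 2.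
Definition rescale (t : R) tau : 'I_n -> R := fun i => t * tau i.
Definition theta tau A v : \bar R := (\esum_(x in A) (expR (- (pi * sqnorm tau (x + v))))%:E)%E.
Definition covol tau : R := Num.sqrt (\prod_i tau i).
Definition normalized_theta tau A v : \bar R := ((covol tau)%:E * theta tau A v)%E.
(* c is the number of points of A per unit of volume, i.e. the inverse of the
   covolume when A is a lattice; indices of subgroups are quotients of it. *)
Definition has_density A (c : R) := forall tau v, weight tau ->
  (fun k => normalized_theta (rescale (2^-1 ^+ k) tau) A v) @ \oo --> c%:E.

Lemma normc_embedding_gt0 i x : x != 0 -> 0 < normc (E i x).
Proof. by move=> x0; rewrite normc_gt0 fmorph_eq0. Qed.

Lemma absnorm_gt0 x : x != 0 -> 0 < absnorm x.
Proof. by move=> x0; apply: prodr_gt0 => i _; exact: normc_embedding_gt0. Qed.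

Lemma weight1 : weight (fun=> 1).
Proof. by split. Qed.

Lemma weight_rescale t tau : 0 < t -> weight tau -> weight (rescale t tau).
Proof. by move=> t0 [tau0 tauJ]; split => i; rewrite /rescale ?mulr_gt0// tauJ. Qed.

Lemma weight_twist tau x : x != 0 -> weight tau -> weight (twist tau x).
Proof.
move=> x0 [tau0 tauJ]; split => i; rewrite /twist.
  by rewrite mulr_gt0// exprn_gt0// normc_embedding_gt0.
by rewrite tauJ embedding_conj normc_conj.
Qed.

Lemma sqnorm_twist tau x y : sqnorm tau (x * y) = sqnorm (twist tau x) y.
Proof. by apply: eq_bigr => i _; rewrite rmorphM normcM exprMn mulrA. Qed.

Lemma sqnorm_rescale t tau x : sqnorm (rescale t tau) x = t * sqnorm tau x.
Proof. by rewrite /sqnorm big_distrr/=; apply: eq_bigr => i _; rewrite /rescale mulrA. Qed.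

Lemma rescaleA t u tau : rescale t (rescale u tau) = rescale (t * u) tau.
Proof. by apply/funext => i; rewrite /rescale mulrA. Qed.

Lemma rescale_twist t tau x : twist (rescale t tau) x = rescale t (twist tau x).
Proof. by apply/funext => i; rewrite /twist /rescale mulrA. Qed.

Lemma covol_ge0 tau : 0 <= covol tau.
Proof. exact: sqrtr_ge0. Qed.

Lemma covol_twist tau x : weight tau -> covol (twist tau x) = covol tau * absnorm x.
Proof.
move=> [tau0 _]; rewrite /covol /twist big_split/= sqrtrM; last first.
  by apply: prodr_ge0 => i _; rewrite ltW.
by rewrite prodrXl sqrtr_sqr ger0_norm//; apply: prodr_ge0 => i _; exact: normc_ge0.
Qed.

Lemma sqrtrX (t : R) k : 0 <= t -> Num.sqrt (t ^+ k) = Num.sqrt t ^+ k.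
Proof. by move=> t0; elim: k => [|k IH]; rewrite ?expr0 ?sqrtr1// !exprS sqrtrM// IH. Qed.

Lemma covol_rescale t tau : 0 <= t -> covol (rescale t tau) = Num.sqrt t ^+ n * covol tau.
Proof.
move=> t0; rewrite /covol /rescale big_split/= prodr_const card_ord sqrtrM ?exprn_ge0//.
by rewrite sqrtrX.
Qed.

Lemma theta_ge0 tau A v : (0 <= theta tau A v)%E.
Proof. by apply: esum_ge0 => x _; rewrite lee_fin expR_ge0. Qed.

Lemma normalized_theta_setS tau A B v : A `<=` B ->
  (normalized_theta tau A v <= normalized_theta tau B v)%E.
Proof. by move=> AB; apply: lee_wpmul2l; rewrite ?lee_fin ?covol_ge0//; exact: esum_setS. Qed.

Lemma normalized_theta_setU tau A B v : [disjoint A & B] ->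
  normalized_theta tau (A `|` B) v = (normalized_theta tau A v + normalized_theta tau B v)%E.
Proof.
move=> dAB; rewrite /normalized_theta -ge0_muleDr ?theta_ge0//; congr (_ * _)%E.
by apply: esum_setU => // x; rewrite lee_fin expR_ge0.
Qed.

Lemma theta_shift tau A a v : theta tau [set a + x | x in A] v = theta tau A (a + v).
Proof.
rewrite /theta esum_image; last by move=> x y _ _ /addrI.
by apply: eq_esum => x _; rewrite addrCA addrA.
Qed.

Lemma theta_dilate tau A x v : x != 0 -> theta tau (dilate x A) v = theta (twist tau x) A (v / x).
Proof.
move=> x0; rewrite /theta esum_image; last by move=> y z _ _ /(mulfI x0).
by apply: eq_esum => y _; rewrite -sqnorm_twist mulrDr mulrCA mulfV// mulr1.
Qed.

Lemma has_density_dilate A c x : x != 0 -> has_density A c ->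
  has_density (dilate x A) (c / absnorm x).
Proof.
move=> x0 densA tau v wt; have N0 := absnorm_gt0 x0.
have dilateE k : normalized_theta (rescale (2^-1 ^+ k) tau) (dilate x A) v =
   ((absnorm x)^-1%:E * normalized_theta (rescale (2^-1 ^+ k) (twist tau x)) A (v / x))%E.
  have k0 : 0 < 2^-1 ^+ k :> R by rewrite exprn_gt0.
  rewrite /normalized_theta theta_dilate// rescale_twist muleA -EFinM; congr (_%:E * _)%E.
  rewrite -rescale_twist covol_twist; last exact: weight_rescale.
  by rewrite mulrCA mulVf ?mulr1// gt_eqF.
under eq_fun do rewrite dilateE.
by rewrite mulrC EFinM; apply: cvgeZl => //; apply: densA; exact: weight_twist.
Qed.

Lemma has_density_le A B c c' : A `<=` B -> has_density A c -> has_density B c' -> c <= c'.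
Proof.
move=> AB densA densB; have limA := densA _ 0 weight1; have limB := densB _ 0 weight1.
rewrite -lee_fin -(cvg_lim (@ereal_hausdorff R) limA) -(cvg_lim (@ereal_hausdorff R) limB).
apply: lee_lim; [by apply/cvg_ex; exists c%:E|by apply/cvg_ex; exists c'%:E|].
by apply: nearW => k; exact: normalized_theta_setS.
Qed.

Lemma has_density_unique A c c' : has_density A c -> has_density A c' -> c = c'.
Proof.
by move=> cA c'A; apply/le_anti; rewrite (has_density_le _ cA c'A)// (has_density_le _ c'A cA).
Qed.

Lemma has_density_shift A c a : has_density A c -> has_density [set a + x | x in A] c.
Proof.
move=> densA tau v wt; under eq_fun do rewrite /normalized_theta theta_shift.
exact: densA.
Qed.

Lemma has_density_setU A B c c' : [disjoint A & B] -> has_density A c -> has_density B c' ->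
  has_density (A `|` B) (c + c').
Proof.
move=> dAB densA densB tau v wt; under eq_fun do rewrite normalized_theta_setU//.
by rewrite EFinD; apply: cvgeD => //; [exact: densA|exact: densB].
Qed.

Lemma has_density_set0 : has_density set0 0.
Proof.
move=> tau v _; under eq_fun do rewrite /normalized_theta /theta esum_set0 mule0.
exact: cvg_cst.
Qed.

Definition density A : R := xget 0 [set c | has_density A c].

Lemma densityE A c : has_density A c -> density A = c.
Proof.
move=> densA; apply: has_density_unique (densA).
by apply: (@xgetPex _ 0 [set c | has_density A c]); exists c.
Qed.

Lemma has_density_gt0 A : 0 < density A -> has_density A (density A).
Proof.
have [[c densA]|no_dens] := pselect (exists c, has_density A c); first by rewrite (densityE densA).
by rewrite /density xgetPN ?ltxx// => c densA; apply: no_dens; exists c.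
Qed.

Lemma has_density_cosets B s c : subgroup B -> has_density B c -> incongruent B s ->
  has_density (cosets B s) ((size s)%:R * c).
Proof.
move=> sB densB; elim: s => [_|a s IH]; first by rewrite mul0r cosets_nil; exact: has_density_set0.
move=> /(incongruent_consP sB)[s_inc disj]; rewrite cosets_cons -natr1 mulrDl mul1r addrC.
by apply: has_density_setU; [|exact: has_density_shift|exact: IH].
Qed.

Lemma incongruent_bound A B s c c' : subgroup B -> has_density B c -> incongruent B s ->
  cosets B s `<=` A -> has_density A c' -> (size s)%:R * c <= c'.
Proof.
move=> sB densB s_inc sA; apply: has_density_le; first exact: sA.
exact: has_density_cosets.
Qed.

Lemma has_density_between A B D c c' : subgroup A -> subgroup B -> B `<=` A -> A `<=` D ->
  has_density B c -> 0 < c -> has_density D c' ->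
  exists s, [/\ incongruent B s, A = cosets B s, (0 < size s)%N &
    has_density A ((size s)%:R * c)].
Proof.
move=> sA sB BA AD densB c0 densD.
have [s s_inc As|s [s_inc AE]] := @transversal_bounded L A B (Num.truncn (c' / c)) sA sB BA.
  have : (size s)%:R * c <= c'.
    apply: (incongruent_bound sB densB s_inc _ densD).
    exact: subset_trans (cosets_sub sA BA As) AD.
  rewrite -ler_pdivlMr// => size_le; rewrite -ltnS -(ltr_nat R).
  exact: le_lt_trans (truncnS_gt _).
exists s; split => //; last by rewrite AE; exact: has_density_cosets.
by case: (s) AE => // AE; have := sA.1; rewrite AE => -[].
Qed.

(* An infinite family of classes modulo B would give A infinite density. *)
Lemma density_pigeonhole A B c c' (f : nat -> L) : subgroup B -> has_density B c -> 0 < c ->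
  has_density A c' -> (forall x y, A x -> B y -> A (x + y)) -> (forall k, A (f k)) ->
  exists i j, (i < j)%N /\ B (f j - f i).
Proof.
move=> sB densB c0 densA AB Af; apply: contrapT => no_pair.
have inc m l : incongruent B [seq f i | i <- iota m l].
  elim: l m => [//|l IH] m; rewrite /incongruent /= -/(incongruent _ _) IH andbT.
  apply/allP => _ /mapP[i + ->]; rewrite mem_iota => /andP[mi _]; apply/asboolP => Bmi.
  by apply: no_pair; exists m, i; split => //; rewrite -opprB; exact: subgroupN.
have : (size [seq f i | i <- iota 0 (Num.truncn (c' / c)).+1])%:R * c <= c'.
  apply: (incongruent_bound sB densB (inc _ _) _ densA) => x [_ /mapP[i _ ->] Bx].
  by rewrite -(subrK (f i) x) addrC; exact: AB.
rewrite -ler_pdivlMr// size_map size_iota leNgt => /negP; apply.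
exact: truncnS_gt.
Qed.

End Density.

Section IntegralBasisDensity.
Variables (R : realType) (L : fieldExtType rat) (E : embedding_system R L).
Local Notation C := R[i].
Local Notation n := (\dim {:L}).
Variable b : n.-tuple L.
Hypothesis bP : integral_basis b.
Implicit Types tau : 'I_n -> R.

Definition gram tau : 'M[R]_n := \matrix_(k, l) \sum_i
  tau i * (cRe (E i b`_k) * cRe (E i b`_l) + cIm (E i b`_k) * cIm (E i b`_l)).

Definition lincomb (c : 'rV[R]_n) i : C := \sum_k ((c 0 k)%:C)%C * E i b`_k.

Lemma qform_gram tau c : qform (gram tau) c = \sum_i tau i * normc (lincomb c i) ^+ 2.
Proof.
have ReE i : cRe (lincomb c i) = \sum_k c 0 k * cRe (E i b`_k).
  by rewrite complex_Re_sum; apply: eq_bigr => k _; rewrite complexReM /= mul0r subr0.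
have ImE i : cIm (lincomb c i) = \sum_k c 0 k * cIm (E i b`_k).
  by rewrite complex_Im_sum; apply: eq_bigr => k _; rewrite complexImM /= mul0r addr0.
transitivity (\sum_i \sum_k \sum_l tau i * (c 0 k * cRe (E i b`_k) * (c 0 l * cRe (E i b`_l)) +
   c 0 k * cIm (E i b`_k) * (c 0 l * cIm (E i b`_l)))).
  rewrite /qform mxE.
  under eq_bigr => l _ do rewrite mxE big_distrl/=.
  rewrite [RHS]exchange_big/= exchange_big/=; apply: eq_bigr => k _.
  rewrite [RHS]exchange_big/=; apply: eq_bigr => l _.
  rewrite !mxE big_distrr big_distrl/=; apply: eq_bigr => i _; ring.
apply: eq_bigr => i _; rewrite sqr_normc_ReIm ReE ImE !expr2 !big_distrlr/= -big_split/= big_distrr/=.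
by apply: eq_bigr => k _; rewrite -big_split big_distrr.
Qed.

Lemma gram_embedding_mx tau : weight E tau -> map_mx (real_complex R) (gram tau) =
  embedding_mx E b *m diag_mx (\row_i ((tau i)%:C)%C) *m (map_mx (@conjc R) (embedding_mx E b))^T.
Proof.
move=> [_ tauJ]; apply/matrixP => k l; rewrite mul_mx_diag !mxE.
under [RHS]eq_bigr => i _ do rewrite !mxE.
apply: complex_eq.
  rewrite complex_Re_sum /=; apply: eq_bigr => i _.
  by case: (E i b`_k) => x y; case: (E i b`_l) => z w /=; ring.
rewrite complex_Im_sum /=.
pose F i := cIm (E i b`_k * ((tau i)%:C)%C * ((E i b`_l)^* )%C).
rewrite -/(\sum_i F i); apply/eqP; rewrite eq_sym; apply/eqP.
have : \sum_i F i = - \sum_i F i.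
  rewrite [LHS](reindex_inj (@conj_index_inj _ _ E))/= -sumrN; apply: eq_bigr => i _.
  rewrite /F tauJ !embedding_conj; case: (E i b`_k) => x y; case: (E i b`_l) => z w /=; ring.
by move: (\sum_i F i) => s; lra.
Qed.

Lemma mulc_conj_normc (z : C) : z * (z^* )%C = ((normc z ^+ 2)%:C)%C.
Proof. by rewrite sqr_normc_ReIm; apply: complex_eq; case: z => x y /=; ring. Qed.

Lemma det_gram tau : weight E tau ->
  \det (gram tau) = (\prod_i tau i) * ratr `|basis_disc b|.
Proof.
move=> wt; have := congr1 (fun M => \det M) (gram_embedding_mx wt).
rewrite det_map_mx !det_mulmx det_diag det_tr det_map_mx.
have -> : \prod_i (\row_i ((tau i)%:C)%C : 'rV[C]_n) 0 i = ((\prod_i tau i)%:C)%C.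
  by rewrite rmorph_prod; apply: eq_bigr => i _; rewrite mxE.
rewrite mulrAC mulc_conj_normc expr2 -normcM -expr2 -(basis_disc_embeddings E bP.1).
by rewrite ratrC normc_real -ratr_norm mulrC -rmorphM => /(congr1 (@cRe _)).
Qed.

Lemma posdef_gram tau : weight E tau -> posdef (gram tau).
Proof.
move=> [tau0 _]; split; first by apply/matrixP => k l; rewrite !mxE; apply: eq_bigr => i _; ring.
move=> v v0; rewrite qform_gram.
have term0 i : 0 <= tau i * normc (lincomb v i) ^+ 2 by rewrite mulr_ge0 ?sqr_ge0// ltW.
rewrite lt_def sumr_ge0// andbT; apply: contraNneq v0 => /eqP.
rewrite psumr_eq0// => /allP all0.
have lincomb0 i : lincomb v i = 0.
  have /implyP/(_ isT) := all0 i (mem_index_enum i).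
  by rewrite mulf_eq0 gt_eqF//= sqrf_eq0 => /eqP/eq0_normc.
have : map_mx (real_complex R) v *m embedding_mx E b = 0.
  apply/matrixP => i j; rewrite !mxE -[RHS](lincomb0 j); apply: eq_bigr => k _.
  by rewrite !mxE !ord1.
move=> /(congr1 (mulmx^~ (invmx (embedding_mx E b)))).
rewrite mul0mx mulmxK ?(embedding_mx_unit E bP.1)// => /matrixP v_eq0.
by apply/eqP/matrixP => i j; have := v_eq0 i j; rewrite !mxE => /(congr1 (@cRe _)).
Qed.

Definition int_lincomb (c : 'rV[int]_n) : L := \sum_k (c 0 k)%:~R * b`_k.

Lemma int_lincombE c : int_lincomb c = \sum_k ((c 0 k)%:~R : rat) *: b`_k.
Proof.
apply: eq_bigr => k _; rewrite -mulr_algl; congr (_ * _).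
by rewrite -[RHS]/(in_alg L _) rmorph_int.
Qed.

Lemma int_lincomb_bij : set_bij setT (@ring_of_integers L) int_lincomb.
Proof.
split.
- by move=> c _; apply: (bP.2 _).2; exists (fun k => c 0 k).
- move=> c c' _ _; rewrite !int_lincombE => eq_cc'; apply/matrixP => i k; rewrite ord1.
  have := congr1 (coord b k) eq_cc'; rewrite !coord_sum_free; try exact: (basis_free bP.1).
  by move=> /intr_inj.
- move=> x /(bP.2 _).1 [c ->]; exists (\row_k c k) => //.
  by apply: eq_bigr => k _; rewrite mxE.
Qed.

Lemma theta_roi tau (t : R) (v : L) : theta E (rescale t tau) (@ring_of_integers L) v =
  lattice_theta (gram tau) t (\row_k ratr (coord b k v)).
Proof.
rewrite /theta (reindex_esum _ _ _ _ int_lincomb_bij); apply: eq_esum => c _.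
rewrite sqnorm_rescale mulrA qform_gram; congr ((expR (- (_ * _)))%:E).
apply: eq_bigr => i _; congr (_ * normc _ ^+ 2).
rewrite int_lincombE {1}(coord_basis bP.1 (memvf v)) -big_split/= rmorph_sum.
apply: eq_bigr => k _; rewrite -scalerDl rmorph_scaleC; congr (_ * _).
by rewrite !mxE ratrC rmorphD/= ratr_int.
Qed.

Local Notation D := (ratr `|basis_disc b| : R).

Lemma disc_gt0 : 0 < D.
Proof. by rewrite ltr0q normr_gt0 (basis_disc_neq0 E bP.1). Qed.

Lemma normalized_theta_roi_asymp tau v : weight E tau ->
  exists K : R, forall t, 0 < t <= 1 ->
    exists2 r : R, normalized_theta E (rescale t tau) (@ring_of_integers L) v = r%:E &
      `|r - (Num.sqrt D)^-1| <= K * Num.sqrt t.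
Proof.
move=> wt; have [_ [K _ asymp]] := lattice_theta_asymp (posdef_gram wt).
have sD0 : 0 < Num.sqrt D by rewrite sqrtr_gt0 disc_gt0.
exists (K / Num.sqrt D) => t t01; have /andP[t0 _] := t01.
have [r rE r_err] := asymp _ (\row_k ratr (coord b k v)) t01.
have prod0 : 0 <= \prod_i tau i by apply: prodr_ge0 => i _; exact: ltW (wt.1 i).
rewrite /normalized_theta theta_roi rE -EFinM; eexists; first by [].
rewrite covol_rescale ?(ltW t0)// -[leRHS]mulrAC ler_pdivlMr//.
rewrite -[X in `|_| * X](ger0_norm (sqrtr_ge0 D)) -normrM mulrBl mulVf ?gt_eqF//.
have covolE : Num.sqrt (t ^+ n * \det (gram tau)) = Num.sqrt t ^+ n * covol tau * Num.sqrt D.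
  rewrite det_gram// mulrA sqrtrM ?mulr_ge0 ?exprn_ge0 ?(ltW t0)//.
  by rewrite sqrtrM ?exprn_ge0 ?(ltW t0)// sqrtrX ?(ltW t0).
by move: r_err; rewrite covolE mulrAC.
Qed.

Lemma cvg_geometric_error (u : nat -> \bar R) (l K q : R) : 0 <= q < 1 ->
  (forall k, exists2 r, u k = r%:E & `|r - l| <= K * q ^+ k) -> u @ \oo --> l%:E.
Proof.
move=> /andP[q0 q1] u_err; apply: cvg_EFin; first by apply: nearW => k; have [r ->] := u_err k.
have geo : (fun k => K * q ^+ k) @ \oo --> 0.
  by rewrite -(mulr0 K); apply: cvgMr; apply: cvg_expr; rewrite ger0_norm.
apply: (@squeeze_cvgr _ _ _ _ (fun k => l - K * q ^+ k) (fun k => l + K * q ^+ k)).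
- apply: nearW => k /=; have [r -> /=] := u_err k; rewrite ler_norml; lra.
- by rewrite -[X in _ --> X]subr0; apply: cvgB => //; exact: cvg_cst.
- by rewrite -[X in _ --> X]addr0; apply: cvgD => //; exact: cvg_cst.
Qed.

Theorem has_density_roi : has_density E (@ring_of_integers L) (Num.sqrt D)^-1.
Proof.
move=> tau v wt; have [K asymp] := normalized_theta_roi_asymp v wt.
apply: (@cvg_geometric_error _ _ K (Num.sqrt 2^-1)) => [|k].
  by rewrite sqrtr_ge0 -[ltRHS]sqrtr1 ltr_sqrt//; lra.
rewrite -sqrtrX//; apply: asymp; rewrite exprn_gt0//= exprn_ile1//; lra.
Qed.

End IntegralBasisDensity.

(** * Ideals of the ring of integers *)

Section IdealAlgebra.
Variable L : fieldExtType rat.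
Local Notation O := (@ring_of_integers L).
Implicit Types (I J K P M : set L) (x y z a p q u : L).

Definition fractional M := [/\ subgroup M, (forall a x, O a -> M x -> M (a * x)),
  (exists2 x, M x & x != 0) & (exists2 y, y != 0 & forall x, M x -> O (y * x))].

Lemma roi_subgroup : subgroup O.
Proof. by split; [exact: roi0|exact: roiB]. Qed.

Lemma nonzero_ideal_fractional I : nonzero_ideal I -> fractional I.
Proof.
move=> [IO I0 ID IM [x Ix x0]]; split => //; last 2 first.
- by exists x.
- by exists 1; [exact: oner_neq0|move=> y /IO; rewrite mul1r].
split => // u v Iu Iv; apply: ID => //; rewrite -mulN1r; apply: IM => //.
by apply: roiN; exact: roi1.
Qed.

Lemma roi_ideal : nonzero_ideal O.
Proof.
split => //; [exact: roi0|by move=> x y; exact: roiD|by move=> a x; exact: roiM|].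
by exists 1; [exact: roi1|exact: oner_neq0].
Qed.

Lemma roi_fractional : fractional O.
Proof. exact: nonzero_ideal_fractional roi_ideal. Qed.

Lemma fractional_between M : fractional M -> exists x y, [/\ x != 0, y != 0,
  dilate x O `<=` M & M `<=` dilate y O].
Proof.
move=> [_ OM [x Mx x0] [y y0 yM]]; exists x, y^-1; split; rewrite ?invr_eq0//.
  by move=> _ [z Oz <-]; rewrite mulrC; exact: OM.
by move=> z /yM Oyz; exists (y * z) => //; rewrite mulKf.
Qed.

Lemma nonzero_ideal_dilate I x : nonzero_ideal I -> x != 0 -> (forall z, I z -> O (x * z)) ->
  nonzero_ideal (dilate x I).
Proof.
move=> [IO I0 ID IM [y Iy y0]] x0 xI; split.
- by move=> _ [z Iz <-]; exact: xI.
- by exists 0; rewrite ?mulr0.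
- by move=> _ _ [u Iu <-] [v Iv <-]; exists (u + v); [exact: ID|rewrite mulrDr].
- by move=> a _ Oa [u Iu <-]; exists (a * u); [exact: IM|rewrite mulrCA].
- by exists (x * y); [exists y|rewrite mulf_neq0].
Qed.

Lemma fractional_dilate M x : fractional M -> x != 0 -> fractional (dilate x M).
Proof.
move=> [sM OM [z Mz z0] [y y0 yM]] x0; split.
- exact: subgroup_dilate.
- by move=> a _ Oa [u Mu <-]; exists (a * u); [exact: OM|rewrite mulrCA].
- by exists (x * z); [exists z|rewrite mulf_neq0].
- exists (y / x); first by rewrite mulf_neq0 ?invr_eq0.
  by move=> _ [u Mu <-]; rewrite -mulrA mulKf//; exact: yM.
Qed.

Definition ideal_add_mul I y K : set L := [set u + y * v | u in I & v in K].

Lemma sub_ideal_add_mul I y K : K 0 -> I `<=` ideal_add_mul I y K.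
Proof. by move=> K0 u Iu; exists u => //; exists 0; rewrite ?mulr0 ?addr0. Qed.

Lemma mem_ideal_add_mul I y K v : I 0 -> K v -> ideal_add_mul I y K (y * v).
Proof. by move=> I0 Kv; exists 0 => //; exists v; rewrite ?add0r. Qed.

Lemma self_ideal_add_mul I y : I 0 -> ideal_add_mul I y O y.
Proof. by move=> I0; have := mem_ideal_add_mul y I0 (roi1 L); rewrite mulr1. Qed.

Lemma nonzero_ideal_add_mul I y K : nonzero_ideal I -> nonzero_ideal K ->
  (forall v, K v -> O (y * v)) -> nonzero_ideal (ideal_add_mul I y K).
Proof.
move=> [IO I0 ID IM [x Ix x0]] [_ K0 KD KM _] yK; split.
- by move=> _ [u Iu [v Kv <-]]; apply: roiD; [exact: IO|exact: yK].
- exact: sub_ideal_add_mul.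
- move=> _ _ [u Iu [v Kv <-]] [u' Iu' [v' Kv' <-]]; exists (u + u'); first exact: ID.
  by exists (v + v'); [exact: KD|rewrite mulrDr addrACA].
- move=> r _ Or [u Iu [v Kv <-]]; exists (r * u); first exact: IM.
  by exists (r * v); [exact: KM|rewrite mulrDr [y * _]mulrCA].
- by exists x => //; exact: sub_ideal_add_mul.
Qed.

Definition inv_ideal J : set L := [set x | forall z, J z -> O (x * z)].

Lemma inv_ideal_setS I J : I `<=` J -> inv_ideal J `<=` inv_ideal I.
Proof. by move=> IJ x xJ z /IJ; exact: xJ. Qed.

Lemma inv_ideal_roi : inv_ideal O = O.
Proof.
apply/seteqP; split => x; first by move=> /(_ _ (roi1 L)); rewrite mulr1.
by move=> Ox z Oz; exact: roiM.
Qed.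

Lemma inv_ideal_fractional J : nonzero_ideal J -> fractional (inv_ideal J).
Proof.
move=> [JO _ _ _ [x Jx x0]]; split.
- split; first by move=> z _; rewrite mul0r; exact: roi0.
  by move=> u v uJ vJ z Jz; rewrite mulrBl; apply: roiB; [exact: uJ|exact: vJ].
- by move=> a u Oa uJ z Jz; rewrite -mulrA; apply: roiM => //; exact: uJ.
- by exists 1; [move=> z /JO; rewrite mul1r|exact: oner_neq0].
- by exists x => // u /(_ _ Jx); rewrite mulrC.
Qed.

Definition maxideal P := [/\ nonzero_ideal P, ~ P 1 &
  forall I, nonzero_ideal I -> P `<=` I -> ~ I 1 -> I `<=` P].

Lemma maxideal_unit P a : maxideal P -> O a -> ~ P a -> exists2 c, O c & P (1 - a * c).
Proof.
move=> [nP P1 maxP] Oa Pa.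
have nI : nonzero_ideal (ideal_add_mul P a O).
  by apply: nonzero_ideal_add_mul (roi_ideal) _ => // v; exact: roiM.
have [_ P0 _ _ _] := nP.
have [[p Pp [c Oc pac]]|I1] := pselect (ideal_add_mul P a O 1).
  by exists c => //; rewrite -pac addrK.
exfalso; apply: Pa; apply: (maxP _ nI _ I1); first exact: sub_ideal_add_mul (roi0 L).
exact: self_ideal_add_mul.
Qed.

Lemma maxideal_prime P a b : maxideal P -> O a -> O b -> P (a * b) -> P a \/ P b.
Proof.
move=> maxP Oa Ob Pab; have [|Pa] := pselect (P a); [by left|right].
have [c Oc Pc] := maxideal_unit maxP Oa Pa.
have [[_ _ PD PM _] _ _] := maxP.
rewrite (_ : b = b * (1 - a * c) + c * (a * b)); last by ring.
by apply: PD; apply: PM.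
Qed.

Lemma maxideal_incomparable P Q : maxideal P -> maxideal Q -> P != Q -> exists2 p, P p & ~ Q p.
Proof.
move=> [nP P1 maxP] [nQ Q1 _] /eqP PQ; apply: contrapT => no_elt; apply: PQ.
have sub : P `<=` Q by move=> p Pp; apply: contrapT => Qp; apply: no_elt; exists p.
by apply/seteqP; split => //; exact: maxP.
Qed.

(* The product of the ideals ps is contained in I, stated without forming the product. *)
Fixpoint contains_prod (ps : seq (set L)) I : Prop :=
  if ps is P :: ps' then forall p, P p -> contains_prod ps' [set x | I (p * x)] else I 1.

Lemma contains_prod_setS ps I J : I `<=` J -> contains_prod ps I -> contains_prod ps J.
Proof.
elim: ps I J => [|P ps IH] I J IJ /=; first exact: IJ.
by move=> prodI p /prodI; apply: IH => x; exact: IJ.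
Qed.

Lemma contains_prod_cat ps1 ps2 I1 I : contains_prod ps1 I1 ->
  (forall x, I1 x -> contains_prod ps2 [set y | I (x * y)]) -> contains_prod (ps1 ++ ps2) I.
Proof.
elim: ps1 I1 I => [|P ps1 IH] I1 I /=.
  by move=> I11 /(_ _ I11); apply: contains_prod_setS => y /=; rewrite mul1r.
move=> prod1 prod2 p Pp; apply: (IH _ _ (prod1 _ Pp)) => x /= /prod2.
by apply: contains_prod_setS => y /=; rewrite mulrA.
Qed.

Lemma contains_prod_remove ps1 P ps2 I p : contains_prod (ps1 ++ P :: ps2) I -> P p ->
  contains_prod (ps1 ++ ps2) [set x | I (p * x)].
Proof.
elim: ps1 I => [|Q ps1 IH] I /=; first by move=> prodI; exact: prodI.
move=> prodI Pp q Qq; have := IH _ (prodI _ Qq) Pp.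
by apply: contains_prod_setS => x /=; rewrite mulrCA.
Qed.

Lemma not_contains_prod ps I : ~ contains_prod ps I ->
  exists z, ~ I z /\ forall J, contains_prod ps J -> J z.
Proof.
elim: ps I => [|P ps IH] I /=; first by exists 1.
move=> no_prod; have [p Pp no_prod_p] : exists2 p, P p & ~ contains_prod ps [set x | I (p * x)].
  apply: contrapT => all_prod; apply: no_prod => p Pp; apply: contrapT => no_prod_p.
  by apply: all_prod; exists p.
have [z [Iz prod_z]] := IH _ no_prod_p; exists (p * z); split => // J prodJ.
exact: (prod_z [set x | J (p * x)] (prodJ _ Pp)).
Qed.

Lemma maxideal_mem_prod P ps c : maxideal P -> (forall Q, Q \in ps -> maxideal Q) ->
  O c -> ~ P c -> contains_prod ps [set x | P (c * x)] ->
  exists ps1 ps2, ps = ps1 ++ P :: ps2.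
Proof.
move=> maxP; elim: ps c => [|Q ps IH] c maxps Oc Pc /=; first by rewrite mulr1.
move=> prodP; have [->|QP] := eqVneq Q P; first by exists [::], ps.
have maxQ : maxideal Q by apply: maxps; rewrite mem_head.
have [[QO _ _ _ _] _ _] := maxQ.
have [q Qq Pq] := maxideal_incomparable maxQ maxP QP.
have [||||ps1 [ps2 ->]] := IH (c * q).
- by move=> Q' Q'ps; apply: maxps; rewrite inE Q'ps orbT.
- by apply: roiM => //; exact: QO.
- by move=> /(maxideal_prime maxP Oc (QO _ Qq)) [].
- by apply: contains_prod_setS (prodP _ Qq) => x /=; rewrite mulrA.
by exists (Q :: ps1), ps2.
Qed.

Lemma ideal_norm_cosets I s : nonzero_ideal I -> incongruent I s -> O = cosets I s ->
  ideal_norm I = size s.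
Proof.
move=> nI s_inc OE; have [sI _ _ _] := nonzero_ideal_fractional nI.
pose coset a := [set a + x | x in I].
have coset_eq a a' : I (a - a') -> coset a = coset a'.
  move=> Iaa'; apply/seteqP; split => _ [x Ix <-].
    by exists (a - a' + x); [exact: subgroupD|rewrite addrA [a' + _]addrC subrK].
  exists (x - (a - a')); first exact: sI.2.
  by rewrite opprB addrCA [a + _]addrC subrK addrC.
have coset_inj a a' : coset a = coset a' -> I (a - a').
  move=> eq_coset; have : coset a a by exists 0; rewrite ?addr0//; exact: sI.1.
  by rewrite eq_coset => -[x Ix <-]; rewrite addrC addKr.
have cosetsE : ideal_cosets I = [set` [fset x in [seq coset a | a <- s]]%fset].
  apply/seteqP; split => A /=; rewrite !inE.
    by move=> [a]; rewrite OE => -[a' a's Iaa'] <-; apply/mapP; exists a' => //; exact: coset_eq.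
  by move=> /mapP[a as_ ->]; exists a => //; rewrite OE; exact: mem_cosets.
rewrite /ideal_norm cosetsE set_fsetK card_fseq undup_id ?size_map//.
elim: (s) s_inc => [//|a t IH] /=; rewrite /incongruent /= => /andP[/allP a_new t_inc].
rewrite IH// andbT; apply/mapP => -[a' a't /coset_inj].
by have /asboolP := a_new _ a't.
Qed.

End IdealAlgebra.

Section IdealDensity.
Variables (R : realType) (L : fieldExtType rat) (E : embedding_system R L).
Local Notation O := (@ring_of_integers L).
Local Notation density := (density E).
Hypothesis O_dens : 0 < density O.
Implicit Types (I J P M : set L) (x y z a p q : L) (s : seq L).

Lemma principal_density x : x != 0 -> has_density E (dilate x O) (density O / absnorm E x).
Proof. by move=> x0; apply: has_density_dilate => //; exact: has_density_gt0. Qed.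

Lemma principal_density_gt0 x : x != 0 -> 0 < density O / absnorm E x.
Proof. by move=> x0; rewrite divr_gt0 ?absnorm_gt0. Qed.

Lemma fractional_density_gt0 M : fractional M -> 0 < density M.
Proof.
move=> fM; have [x [y [x0 y0 xM My]]] := fractional_between fM; have [sM _ _ _] := fM.
have [s [_ _ s0 densM]] := has_density_between sM (subgroup_dilate x (roi_subgroup L)) xM My
  (principal_density x0) (principal_density_gt0 x0) (principal_density y0).
by rewrite (densityE densM) mulr_gt0 ?ltr0n// principal_density_gt0.
Qed.

Lemma fractional_has_density M : fractional M -> has_density E M (density M).
Proof. by move=> fM; apply: has_density_gt0; exact: fractional_density_gt0. Qed.

Lemma fractional_index M M' : fractional M -> fractional M' -> M `<=` M' ->
  exists s, [/\ incongruent M s, M' = cosets M s & density M' = (size s)%:R * density M].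
Proof.
move=> fM fM' MM'; have [sM _ _ _] := fM; have [sM' _ _ _] := fM'.
have [s [s_inc M'E _ densM']] := has_density_between sM' sM MM' (@subset_refl _ _)
  (fractional_has_density fM) (fractional_density_gt0 fM) (fractional_has_density fM').
by exists s; split => //; exact: densityE.
Qed.

Lemma fractional_index_ge M M' s : fractional M -> fractional M' -> incongruent M s ->
  cosets M s `<=` M' -> (size s)%:R * density M <= density M'.
Proof.
move=> fM fM' s_inc sM'; have [sM _ _ _] := fM.
exact: (incongruent_bound sM (fractional_has_density fM) s_inc sM' (fractional_has_density fM')).
Qed.

Lemma fractional_index_le M M' s : fractional M -> fractional M' -> M' `<=` cosets M s ->
  density M' <= (size s)%:R * density M.
Proof.
move=> fM fM' M's; have [sM _ _ _] := fM.
have [s' [s'_inc s's sub]] := incongruent_thin s sM.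
apply: (@le_trans _ _ ((size s')%:R * density M)); last first.
  by rewrite ler_wpM2r ?ler_nat// ltW// fractional_density_gt0.
apply: has_density_le (fractional_has_density fM')
  (has_density_cosets sM (fractional_has_density fM) s'_inc).
exact: subset_trans sub.
Qed.

Lemma density_dilate M x : fractional M -> x != 0 ->
  density (dilate x M) = density M / absnorm E x.
Proof.
by move=> fM x0; apply: densityE; apply: has_density_dilate => //; exact: fractional_has_density.
Qed.

Lemma ideal_norm_density I : nonzero_ideal I -> (ideal_norm I)%:R * density I = density O.
Proof.
move=> nI; have [IO _ _ _ _] := nI.
have [s [s_inc OE ->]] := fractional_index (nonzero_ideal_fractional nI) (roi_fractional L) IO.
by rewrite (ideal_norm_cosets nI s_inc OE).
Qed.

Lemma ideal_norm_gt0 I : nonzero_ideal I -> (0 < ideal_norm I)%N.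
Proof.
move=> /ideal_norm_density normE; rewrite lt0n; apply: contraTneq O_dens => norm0.
by rewrite -normE norm0 mul0r ltxx.
Qed.

Lemma ideal_norm_roi : ideal_norm O = 1%N.
Proof.
have /eqP := ideal_norm_density (roi_ideal L); rewrite -{2}[density O]mul1r -subr_eq0 -mulrBl.
by rewrite mulf_eq0 (gt_eqF O_dens) orbF subr_eq0 pnatr_eq1 => /eqP.
Qed.

Lemma ideal_norm_lt I J x : nonzero_ideal I -> nonzero_ideal J -> J `<=` I -> I x -> ~ J x ->
  (ideal_norm I < ideal_norm J)%N.
Proof.
move=> nI nJ JI Ix Jx.
have fI := nonzero_ideal_fractional nI; have fJ := nonzero_ideal_fractional nJ.
have [sI _ _ _] := fI.
have pair_inc : incongruent J [:: x; 0] by rewrite /incongruent /= subr0 !andbT; apply/asboolP.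
have sub : cosets J [:: x; 0] `<=` I.
  by apply: cosets_sub => // a; rewrite !inE => /orP[] /eqP -> //; exact: sI.1.
have /= twice_le := fractional_index_ge fJ fI pair_inc sub.
have dJ := fractional_density_gt0 fJ.
rewrite -(ltr_nat R) -(ltr_pM2r dJ) ideal_norm_density// -(ideal_norm_density nI).
rewrite ltr_pM2l ?ltr0n ?ideal_norm_gt0//.
by apply: lt_le_trans twice_le; rewrite mulrDl mul1r ltrDl.
Qed.

Lemma ideal_norm_dilate I x : nonzero_ideal I -> x != 0 -> nonzero_ideal (dilate x I) ->
  (ideal_norm (dilate x I))%:R = absnorm E x * (ideal_norm I)%:R :> R.
Proof.
move=> nI x0 nxI; have fI := nonzero_ideal_fractional nI.
have dI0 : density I != 0 by rewrite gt_eqF// fractional_density_gt0.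
have := ideal_norm_density nxI; rewrite density_dilate// -(ideal_norm_density nI) => normE.
by apply: (mulIf dI0); rewrite -mulrA -normE; field; rewrite gt_eqF// absnorm_gt0.
Qed.

Lemma stabilizer_integral M y : fractional M -> (forall x, M x -> M (y * x)) -> O y.
Proof.
move=> fM yM; have [sM OM [a Ma a0] _] := fM.
have yX k : M (y ^+ k * a).
  by elim: k => [|k IH]; rewrite ?expr0 ?mul1r// exprS -mulrA; exact: yM.
have [i [j [ij [c Oc acE]]]] : exists i j, (i < j)%N /\ dilate a O (y ^+ j * a - y ^+ i * a).
  apply: (density_pigeonhole (subgroup_dilate a (roi_subgroup L)) (principal_density a0)
    (principal_density_gt0 a0) (fractional_has_density fM)) => //.
  by move=> u _ Mu [z Oz <-]; apply: subgroupD => //; rewrite mulrC; exact: OM.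
have cE : c = y ^+ j - y ^+ i by apply: (mulfI a0); rewrite acE -mulrBl mulrC.
pose p : {poly L} := 'X^j - ('X^i + c%:P).
have lower_size : (size ('X^i + c%:P : {poly L})%R < size ('X^j : {poly L})%R)%N.
  rewrite size_polyXn ltnS (leq_trans (size_polyD _ _))// geq_max size_polyXn ij.
  by rewrite (leq_trans (size_polyC_leq1 _))// (leq_trans _ ij).
apply: (@integral_root_monic _ _ intr y p).
- by rewrite monicE lead_coefDl ?size_polyN// lead_coefXn.
- by rewrite /root /p !hornerE cE [y ^+ i + _]addrC subrK subrr.
- move=> _ /(nthP 0)[k _ <-]; rewrite /p coefB coefD coefXn coefXn coefC.
  apply: roiB; first exact: (roi_int L (k == j)%:Z).
  apply: roiD; first exact: (roi_int L (k == i)%:Z).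
  by case: ifP => // _; exact: roi0.
Qed.

Lemma maxideal_above J : nonzero_ideal J -> ~ J 1 -> exists2 P, maxideal P & J `<=` P.
Proof.
have [m] := ubnP (ideal_norm J); elim: m J => // m IH J Jm nJ J1.
have [maxJ|maxJ] := pselect (maxideal J); first by exists J.
have [I nI [JI I1] nIJ] : exists2 I, nonzero_ideal I & [/\ J `<=` I, ~ I 1 & ~ (I `<=` J)].
  apply: contrapT => no_larger; apply: maxJ; split => // I nI JI I1; apply: contrapT => nIJ.
  by apply: no_larger; exists I.
have [x Ix Jx] : exists2 x, I x & ~ J x.
  by apply: contrapT => all_J; apply: nIJ => x Ix; apply: contrapT => Jx; apply: all_J; exists x.
have norm_lt := ideal_norm_lt nI nJ JI Ix Jx.
have [P maxP IP] := IH I (leq_trans norm_lt Jm) nI I1.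
by exists P => //; exact: subset_trans IP.
Qed.

Lemma prime_ideal_maximal I : nonzero_ideal I -> ~ I 1 ->
  (forall a b, O a -> O b -> I (a * b) -> I a \/ I b) -> maxideal I.
Proof.
move=> nI I1 prime; split => // J nJ IJ J1 x Jx; apply: contrapT => Ix.
have [IO _ _ _ _] := nI; have [JO _ _ JM _] := nJ.
have fI := nonzero_ideal_fractional nI.
have [sI _ _ _] := fI; have [sJ _ _ _] := nonzero_ideal_fractional nJ.
have Ox := JO _ Jx.
have [i [j [ij Iij]]] : exists i j, (i < j)%N /\ I (x ^+ j - x ^+ i).
  apply: (density_pigeonhole sI (fractional_has_density fI) (fractional_density_gt0 fI)
    (has_density_gt0 O_dens)) => [u v Ou /IO|k]; [exact: roiD|exact: roiX].
have xX k : ~ I (x ^+ k).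
  elim: k => [|k IHk]; rewrite ?expr0// exprS => /(prime _ _ Ox (roiX k Ox)) [].
    exact: Ix.
  exact: IHk.
have : I (x ^+ i * (x ^+ (j - i) - 1)) by rewrite mulrBr mulr1 -exprD subnKC// ltnW.
move=> /prime; case; [exact: roiX|by apply: roiB; [exact: roiX|exact: roi1]|exact: xX|].
move=> /IJ Jx1; apply: J1; rewrite (_ : 1 = x ^+ (j - i) - (x ^+ (j - i) - 1)).
  by apply: sJ.2 => //; rewrite -(subnSK ij) exprS mulrC; apply: JM => //; exact: roiX.
by rewrite opprB addrC subrK.
Qed.

Lemma contains_prod_exists I : nonzero_ideal I ->
  exists2 ps, (forall P, P \in ps -> maxideal P) & contains_prod ps I.
Proof.
have [m] := ubnP (ideal_norm I); elim: m I => // m IH I Im nI.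
have [I1|I1] := pselect (I 1); first by exists [::].
have [IO I0 ID IM _] := nI.
have [[a [b [[Oa Ob] [Ia Ib] Iab]]]|prime] :=
    pselect (exists a b, [/\ O a /\ O b, ~ I a /\ ~ I b & I (a * b)]); last first.
  exists [:: I]; last by move=> p Ip /=; rewrite mulr1.
  move=> P; rewrite inE => /eqP ->; apply: prime_ideal_maximal => // a b Oa Ob Iab.
  have [|Ia] := pselect (I a); [by left|right].
  by apply: contrapT => Ib; apply: prime; exists a, b.
have larger c : O c -> ~ I c -> exists2 ps, (forall P, P \in ps -> maxideal P) &
    contains_prod ps (ideal_add_mul I c O).
  move=> Oc Ic; have nJ : nonzero_ideal (ideal_add_mul I c O).
    by apply: nonzero_ideal_add_mul (roi_ideal L) _ => // v; exact: roiM.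
  apply: (IH _ _ nJ); apply: (@leq_trans (ideal_norm I)); last by rewrite -ltnS.
  apply: (ideal_norm_lt nJ nI _ _ Ic); first exact: sub_ideal_add_mul (roi0 L).
  exact: self_ideal_add_mul.
have [ps1 max1 prod1] := larger _ Oa Ia; have [ps2 max2 prod2] := larger _ Ob Ib.
exists (ps1 ++ ps2); first by move=> P; rewrite mem_cat => /orP[/max1|/max2].
apply: (contains_prod_cat prod1) => _ [u Iu [r Or <-]].
apply: contains_prod_setS prod2 => _ [v Iv [r' Or' <-]] /=.
have -> : (u + a * r) * (v + b * r') =
    (v + b * r') * u + (a * r * v + r * r' * (a * b)) by ring.
apply: (ID); first by apply: IM => //; apply: roiD; [exact: IO|exact: roiM].
by apply: (ID); apply: (IM) => //; exact: roiM.
Qed.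

(* With ps a shortest list of maximal ideals whose product lies in a O, where a is in P,
   the list contains P, and any z in the product of the others but not in a O works. *)
Lemma maxideal_inverse P : maxideal P -> exists2 y, ~ O y & forall p, P p -> O (y * p).
Proof.
move=> maxP; have [nP P1 _] := maxP; have [PO _ _ PM [a Pa a0]] := nP.
have naO : nonzero_ideal (dilate a O).
  by apply: nonzero_ideal_dilate (roi_ideal L) a0 _ => z; apply: roiM; exact: PO.
pose prod_of_size m := `[< exists ps,
  [/\ size ps = m, (forall Q, Q \in ps -> maxideal Q) & contains_prod ps (dilate a O)] >].
have ex_size : exists m, prod_of_size m.
  have [ps maxps prod_ps] := contains_prod_exists naO; exists (size ps).
  by apply/asboolP; exists ps.
case: (ex_minnP ex_size) => m /asboolP[ps [size_ps maxps prod_ps]] min_m.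
have aO_P : dilate a O `<=` P by move=> _ [c Oc <-]; rewrite mulrC; exact: PM.
have [ps1 [ps2 psE]] : exists ps1 ps2, ps = ps1 ++ P :: ps2.
  apply: (maxideal_mem_prod maxP maxps (roi1 L) P1).
  by apply: contains_prod_setS prod_ps => x /aO_P /=; rewrite mul1r.
have not_shorter : ~ contains_prod (ps1 ++ ps2) (dilate a O).
  move=> shorter; have /min_m : prod_of_size (size (ps1 ++ ps2)).
    apply/asboolP; exists (ps1 ++ ps2); split => // Q; rewrite mem_cat => Qps.
    by apply: maxps; rewrite psE mem_cat inE; case/orP: Qps => ->; rewrite ?orbT.
  by rewrite -size_ps psE !size_cat /= addnS ltnn.
have [z [aOz prod_z]] := not_contains_prod not_shorter.
exists (z / a).
  by move=> Oy; apply: aOz; exists (z / a) => //; rewrite mulrCA mulfV// mulr1.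
move=> p Pp; rewrite psE in prod_ps.
have [c Oc acE] := prod_z _ (contains_prod_remove prod_ps Pp).
by rewrite mulrAC [z * p]mulrC -acE mulrAC mulfV// mul1r.
Qed.

(* J^-1 J is contained in no maximal ideal, stated without forming the product. *)
Definition locally_invertible J :=
  forall P, maxideal P -> exists a b, [/\ inv_ideal J a, J b & ~ P (a * b)].

Section InverseDescent.
Variables (J P : set L) (y : L).
Hypotheses (nJ : nonzero_ideal J) (maxP : maxideal P) (JP : J `<=` P).
Hypotheses (Oy : ~ O y) (yP : forall p, P p -> O (y * p)).

Let J' := ideal_add_mul J y J.

Lemma maxideal_inverse_unit : exists p q, [/\ P p, P q & 1 = p + y * q].
Proof.
have [nP P1 maxP'] := maxP; have [_ P0 _ _ _] := nP.
have nI : nonzero_ideal (ideal_add_mul P y P) by exact: nonzero_ideal_add_mul.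
have [[p Pp [q Pq pyq]]|I1] := pselect (ideal_add_mul P y P 1); first by exists p, q.
exfalso; apply: Oy; apply: (stabilizer_integral (nonzero_ideal_fractional nP)) => x Px.
apply: (maxP' _ nI _ I1); first exact: sub_ideal_add_mul.
exact: mem_ideal_add_mul.
Qed.

Lemma descent_ideal : nonzero_ideal J'.
Proof. by apply: nonzero_ideal_add_mul => // v /JP; exact: yP. Qed.

Lemma descent_sub : J `<=` J'.
Proof. by apply: sub_ideal_add_mul; have [_ J0 _ _ _] := nJ. Qed.

Lemma descent_mem v : J v -> J' (y * v).
Proof. by apply: mem_ideal_add_mul; have [_ J0 _ _ _] := nJ. Qed.

Lemma descent_norm_lt : (ideal_norm J' < ideal_norm J)%N.
Proof.
have [z Jz Jyz] : exists2 z, J z & ~ J (y * z).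
  apply: contrapT => stable; apply: Oy.
  apply: (stabilizer_integral (nonzero_ideal_fractional nJ)) => z Jz.
  by apply: contrapT => Jyz; apply: stable; exists z.
exact: ideal_norm_lt descent_ideal nJ descent_sub (descent_mem Jz) Jyz.
Qed.

Lemma descent_mulP u x : P u -> J' x -> J (u * x).
Proof.
have [nP _ _] := maxP; have [PO _ _ _ _] := nP; have [_ _ JD JM _] := nJ.
move=> Pu [v Jv [w Jw <-]]; rewrite mulrDr; apply: JD; first by apply: JM => //; exact: PO.
by rewrite mulrA [u * y]mulrC; apply: JM => //; exact: yP.
Qed.

Lemma descent_inv_mul x : inv_ideal J' x -> inv_ideal J (y * x).
Proof.
have [p [q [Pp Pq pq]]] := maxideal_inverse_unit.
move=> xJ' w Jw.
have -> : y * x * w = (y * p) * (x * w) + (y * q) * (x * (y * w)).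
  by rewrite -[LHS]mulr1 pq; ring.
have Oxw : O (x * w) by apply: xJ'; exact: descent_sub.
have Oxyw : O (x * (y * w)) by apply: xJ'; exact: descent_mem.
by apply: roiD; apply: roiM => //; exact: yP.
Qed.

Lemma descent_inv_sub : inv_ideal J' `<=` inv_ideal J.
Proof. exact: inv_ideal_setS descent_sub. Qed.

Variable t : seq L.
Hypotheses (t_inc : incongruent P t) (OE : O = cosets P t).

Lemma descent_density_le : locally_invertible J' -> density J' <= (size t)%:R * density J.
Proof.
move=> /(_ P maxP)[a [b [aJ' J'b Pab]]]; have nJ' := descent_ideal.
have [_ _ JD _ _] := nJ; have [_ _ _ J'M _] := nJ'.
have Oab : O (a * b) by exact: aJ'.
have [r Or Pabr] := maxideal_unit maxP Oab Pab.
rewrite -(size_map (fun c => c * (r * b)) t).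
apply: fractional_index_le; try exact: nonzero_ideal_fractional.
move=> x J'x; have : O (a * x) by exact: aJ'.
rewrite OE => -[c ct Pc]; exists (c * (r * b)); first by apply/mapP; exists c.
have -> : x - c * (r * b) = (1 - a * b * r) * x + (a * x - c) * (r * b) by ring.
apply: JD; first exact: descent_mulP.
by apply: descent_mulP => //; exact: J'M.
Qed.

Let conductor x : set L := [set c | O c /\ inv_ideal J' (c * x)].

Lemma conductor_sub x : inv_ideal J x -> ~ inv_ideal J' x -> conductor x `<=` P.
Proof.
move=> xJ xJ'; have [nP _ maxP'] := maxP; have [PO P0 PD PM [p Pp p0]] := nP.
have [sJ' J'M _ _] := inv_ideal_fractional descent_ideal.
have PK : P `<=` conductor x.
  move=> u Pu; split; first exact: PO.
  by move=> w J'w; rewrite [u * x]mulrC -mulrA; apply: xJ; exact: descent_mulP.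
apply: maxP' => // [|[_]]; last by rewrite mul1r.
split.
- by move=> c [].
- exact: PK.
- move=> u v [Ou uJ'] [Ov vJ']; split; first exact: roiD.
  by rewrite mulrDl; exact: (subgroupD sJ' uJ' vJ').
- by move=> r u Or [Ou uJ']; split; [exact: roiM|rewrite -mulrA; exact: J'M].
- by exists p => //; exact: PK.
Qed.

Lemma descent_inv_density_ge : (size t)%:R * density (inv_ideal J') <= density (inv_ideal J).
Proof.
have fiJ' := inv_ideal_fractional descent_ideal; have fiJ := inv_ideal_fractional nJ.
have [sJ JM _ _] := fiJ; have [nP _ _] := maxP; have [sP _ _ _] := nonzero_ideal_fractional nP.
have [x xJ xJ'] : exists2 x, inv_ideal J x & ~ inv_ideal J' x.
  apply: contrapT => all_J'; apply: Oy; apply: (stabilizer_integral fiJ') => x /descent_inv_mul yxJ.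
  by apply: contrapT => xJ'; apply: all_J'; exists (y * x).
have Ot c : c \in t -> O c by move=> ct; rewrite OE; exact: mem_cosets.
rewrite -(size_map (fun c => c * x) t); apply: fractional_index_ge => //.
  elim: (t) t_inc Ot => [//|c s IHs] /=; rewrite /incongruent /= => /andP[/allP c_new s_inc] Os.
  apply/andP; split; last by apply: IHs => // c' c's; apply: Os; rewrite inE c's orbT.
  apply/allP => _ /mapP[c' c's ->]; apply/asboolP => cc'J'.
  have /asboolP := c_new _ c's; apply; apply: (conductor_sub xJ xJ'); split.
    by apply: roiB; apply: Os; rewrite ?mem_head// inE c's orbT.
  by rewrite mulrBl.
apply: cosets_sub => //; first exact: descent_inv_sub.
by move=> _ /mapP[c ct ->]; apply: JM => //; exact: Ot.
Qed.

Lemma descent_locally_invertible : locally_invertible J' -> locally_invertible J.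
Proof.
move=> lJ' P' maxP'; have [a [b [aJ' J'b P'ab]]] := lJ' P' maxP'.
have [[PO _ _ _ _] _ _] := maxP; have Oab : O (a * b) by exact: aJ'.
have [PP'|PP'] := eqVneq P P'; last first.
  have [c Pc P'c] := maxideal_incomparable maxP maxP' PP'.
  exists a, (c * b); split; [exact: descent_inv_sub|exact: descent_mulP|].
  by rewrite mulrCA => /(maxideal_prime maxP' (PO _ Pc) Oab) [].
have [p [q [Pp Pq pq]]] := maxideal_inverse_unit.
have [[_ _ PD PM _] _ _] := maxP.
exists (y * a), (q * b); split; [exact: descent_inv_mul|exact: descent_mulP|].
rewrite -PP' in P'ab *; move=> Pyaqb; apply: P'ab.
rewrite (_ : a * b = a * b * p + y * a * (q * b)); last by rewrite -[LHS]mulr1 pq; ring.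
by apply: PD => //; exact: PM.
Qed.

End InverseDescent.

(* Descend from J to J + y J, where y is non-integral and y P is integral for a
   maximal ideal P containing J; local invertibility is what makes the density of
   J + y J small enough. *)
Lemma inv_ideal_density J : nonzero_ideal J ->
  density O ^+ 2 <= density J * density (inv_ideal J) /\ locally_invertible J.
Proof.
have [m] := ubnP (ideal_norm J); elim: m J => // m IH J Jm nJ.
have [JO _ _ JM _] := nJ; have [J1|J1] := pselect (J 1).
  have -> : J = O by apply/seteqP; split => // x Ox; rewrite -[x]mulr1; exact: JM.
  rewrite inv_ideal_roi expr2; split => // P [_ P1 _].
  by exists 1, 1; rewrite inv_ideal_roi mulr1; split => //; exact: roi1.
have [P maxP JP] := maxideal_above nJ J1; have [nP _ _] := maxP; have [PO _ _ _ _] := nP.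
have [y Oy yP] := maxideal_inverse maxP.
have [t [t_inc OE _]] := fractional_index (nonzero_ideal_fractional nP) (roi_fractional L) PO.
have nJ' := descent_ideal nJ JP yP.
have [dens_ge lJ'] := IH _ (leq_trans (descent_norm_lt nJ JP Oy yP) Jm) nJ'.
split; last exact: (descent_locally_invertible nJ maxP Oy yP lJ').
have J0 := fractional_density_gt0 (nonzero_ideal_fractional nJ).
have iJ'0 := fractional_density_gt0 (inv_ideal_fractional nJ').
apply: (le_trans dens_ge).
apply: le_trans (ler_wpM2r (ltW iJ'0) (descent_density_le nJ maxP JP yP OE lJ')) _.
rewrite mulrAC mulrC ler_wpM2l ?(ltW J0)//.
exact: (descent_inv_density_ge nJ maxP JP Oy yP t_inc OE).
Qed.

End IdealDensity.

(** * Growth of theta functions *)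

Section QuadraticThetaSeries.
Variables (R : realType) (L : fieldExtType rat) (E : embedding_system R L).
Local Notation n := (\dim {:L}).
Variable tau : 'I_n -> R.
Hypothesis tau_gt0 : forall i, 0 < tau i.
Local Notation Q := (sqnorm E tau).
Implicit Types (A B G : set L) (t u K : R) (x y a : L) (s : seq L).

Lemma two_neq0 : (2 : L) != 0.
Proof. by rewrite -[2](rmorph_nat (in_alg L)) fmorph_eq0. Qed.

Lemma sqr_sum_le (I : Type) (r : seq I) (f : I -> R) :
  (\sum_(i <- r) f i) ^+ 2 <= (size r)%:R * \sum_(i <- r) f i ^+ 2.
Proof.
elim: r => [|i r IH]; first by rewrite !big_nil mulr0 expr0n.
rewrite !big_cons /= -natr1; set S := \sum_(_ <- r) _ in IH *; set T := \sum_(_ <- r) _ in IH *.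
have T0 : 0 <= T by apply: sumr_ge0 => j _; exact: sqr_ge0.
case: (size r) IH => [|k] IH.
  move: IH; rewrite mul0r => IH; have /eqP : S ^+ 2 = 0 by apply/le_anti; rewrite IH sqr_ge0.
  by rewrite sqrf_eq0 => /eqP ->; rewrite add0r mul1r addr0 lerDl.
have k0 : 0 < k.+1%:R :> R by rewrite ltr0n.
have cross : 2 * S * f i <= k.+1%:R * f i ^+ 2 + T.
  by rewrite -(ler_pM2l k0); have := sqr_ge0 (S - k.+1%:R * f i); rewrite sqrrB; nra.
have -> : (f i + S) ^+ 2 = f i ^+ 2 + 2 * S * f i + S ^+ 2 by ring.
have -> : (k.+1%:R + 1) * (f i ^+ 2 + T) = k.+1%:R * f i ^+ 2 + k.+1%:R * T + f i ^+ 2 + T by ring.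
by move: cross IH; lra.
Qed.

Lemma sqnorm_ge0 x : 0 <= Q x.
Proof. by apply: sumr_ge0 => i _; rewrite mulr_ge0 ?sqr_ge0// ltW. Qed.

Lemma sqnorm0 : Q 0 = 0.
Proof. by rewrite /sqnorm big1// => i _; rewrite rmorph0 normc0 expr0n mulr0. Qed.

Lemma sqnorm_parallelogram x y : Q (x + y) + Q (x - y) = 2 * Q x + 2 * Q y.
Proof.
rewrite /sqnorm !big_distrr -!big_split/=; apply: eq_bigr => i _.
rewrite rmorphD rmorphB !sqr_normc_ReIm.
by case: (E i x) => a b; case: (E i y) => c d /=; ring.
Qed.

Lemma sqnormZ (q : rat) x : Q (q *: x) = ratr q ^+ 2 * Q x.
Proof.
rewrite /sqnorm big_distrr/=; apply: eq_bigr => i _.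
by rewrite rmorph_scaleC normcM ratrC normc_real exprMn real_normK ?num_real// mulrCA.
Qed.

Lemma sqnorm_mul2 x : Q (2 * x) = 4 * Q x.
Proof. by rewrite mulr_natl -scaler_nat sqnormZ ratr_nat -natrX. Qed.

Lemma normc_sum_le (I : Type) (r : seq I) (f : I -> R[i]) :
  normc (\sum_(i <- r) f i) <= \sum_(i <- r) normc (f i).
Proof.
elim: r => [|j r IH]; first by rewrite !big_nil normc0.
by rewrite !big_cons (le_trans (le_normcD _ _))// lerD2l.
Qed.

Lemma sqnorm_sum_le (I : Type) (r : seq I) (f : I -> L) :
  Q (\sum_(i <- r) f i) <= (size r)%:R * \sum_(i <- r) Q (f i).
Proof.
rewrite /sqnorm exchange_big/= big_distrr/=; apply: ler_sum => i _.
rewrite -mulr_sumr [leRHS]mulrCA ler_wpM2l ?(ltW (tau_gt0 i))//.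
apply: le_trans (sqr_sum_le _ _); rewrite ler_sqr ?nnegrE ?normc_ge0 ?sumr_ge0// => [|*].
  by rewrite rmorph_sum normc_sum_le.
exact: normc_ge0.
Qed.

Definition theta_term t x : R := expR (- (pi * t * Q x)).
Definition theta_series A t : \bar R := (\esum_(x in A) (theta_term t x)%:E)%E.
Definition theta_fun A t : R := fine (theta_series A t).
Definition theta_finite A := forall t, 0 < t -> (theta_series A t < +oo)%E.

Lemma theta_term_ge0 t x : 0 <= theta_term t x. Proof. exact: expR_ge0. Qed.

Lemma theta_term0 t : theta_term t 0 = 1.
Proof. by rewrite /theta_term sqnorm0 mulr0 oppr0 expR0. Qed.

Lemma theta_series_ge0 A t : (0 <= theta_series A t)%E.
Proof. by apply: esum_ge0 => x _; rewrite lee_fin theta_term_ge0. Qed.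

Lemma theta_rescale0 A t : theta E (rescale t tau) A 0 = theta_series A t.
Proof. by apply: eq_esum => x _; rewrite addr0 sqnorm_rescale mulrA. Qed.

Lemma theta_series_nonincreasing A t t' : t <= t' -> (theta_series A t' <= theta_series A t)%E.
Proof.
move=> tt'; apply: le_esum => x _; rewrite lee_fin ler_expR lerN2 ler_wpM2r ?sqnorm_ge0//.
by rewrite ler_wpM2l// pi_ge0.
Qed.

Lemma theta_finite_setS A B : A `<=` B -> theta_finite B -> theta_finite A.
Proof. by move=> AB finB t t0; apply: le_lt_trans (finB t t0); exact: esum_setS. Qed.

Lemma theta_fun_ge0 A t : 0 <= theta_fun A t.
Proof. by rewrite fine_ge0 ?theta_series_ge0. Qed.

Lemma theta_seriesE A t : theta_finite A -> 0 < t -> theta_series A t = (theta_fun A t)%:E.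
Proof. by move=> finA t0; rewrite /theta_fun fineK// ge0_fin_numE ?theta_series_ge0// finA. Qed.

Lemma theta_fun_nonincreasing A t t' : theta_finite A -> 0 < t -> t <= t' ->
  theta_fun A t' <= theta_fun A t.
Proof.
move=> finA t0 tt'; rewrite -lee_fin -!theta_seriesE ?(lt_le_trans t0 tt')//.
exact: theta_series_nonincreasing.
Qed.

Lemma theta_fun_setS A B t : A `<=` B -> theta_finite B -> 0 < t -> theta_fun A t <= theta_fun B t.
Proof.
move=> AB finB t0; rewrite -lee_fin -(theta_seriesE finB t0).
by rewrite -(theta_seriesE (theta_finite_setS AB finB) t0); exact: esum_setS.
Qed.

(* Arithmetic-geometric mean, combined with the parallelogram law. *)
Lemma theta_term_mean t a x :
  2 * (theta_term t a * theta_term t x) <= theta_term t (a + x) + theta_term t (a - x).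
Proof.
rewrite /theta_term -expRD; have par := sqnorm_parallelogram a x.
set p := - (pi * t * Q (a + x)); set q := - (pi * t * Q (a - x)).
have -> : - (pi * t * Q a) - pi * t * Q x = p / 2 + q / 2.
  by rewrite /p /q -mulrDl -!opprD -!mulrDr par; field.
rewrite expRD {2}(_ : p = p / 2 + p / 2); last by field.
rewrite {2}(_ : q = q / 2 + q / 2); last by field.
by rewrite !expRD; have := sqr_ge0 (expR (p / 2) - expR (q / 2)); rewrite sqrrB; nra.
Qed.

Section SubgroupTheta.
Variables (A : set L) (s : seq L).
Hypotheses (sA : subgroup A) (finA : theta_finite A).
Let A2 := dilate 2 A.
Hypotheses (s_inc : incongruent A2 s) (AE : A = cosets A2 s).

Let sA2 : subgroup A2. Proof. exact: subgroup_dilate. Qed.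

Let sub_s a : a \in s -> A a. Proof. by move=> as_; rewrite AE; exact: mem_cosets. Qed.

Let sum_diff_bij : set_bij (A `*`` (fun=> A)) (A `*`` (fun=> A2))
  (fun k => (k.1 + k.2, - (2 * k.2))).
Proof.
split.
- move=> [x y] [/= Ax Ay]; split => /=; first exact: subgroupD.
  by exists (- y); [exact: subgroupN|rewrite mulrN].
- move=> [x y] [x' y'] _ _ /= [sumE /oppr_inj dblE].
  by move: sumE; rewrite (mulfI two_neq0 dblE) => /addIr ->.
- move=> [u w] [/= Au [y Ay <-]]; exists (u + y, - y) => /=.
    by split => /=; [exact: subgroupD|exact: subgroupN].
  by rewrite addrK mulrN opprK.
Qed.

Lemma theta_series_sqr t : 0 < t ->
  (\esum_(x in A) ((theta_term t x)%:E * \esum_(y in A2) (theta_term t (x + y)%R)%:E) =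
  theta_series A (2 * t) * theta_series A (2 * t))%E.
Proof.
move=> t0; have t20 : 0 < 2 * t by rewrite mulr_gt0.
have nested B B' (f g : L -> L -> R) : (forall x y, 0 <= f x y) -> (forall x y, 0 <= g x y) ->
  (\esum_(x in B) \esum_(y in B') ((f x y)%:E * (g x y)%:E) =
   \esum_(k in B `*`` (fun=> B')) ((f k.1 k.2)%:E * (g k.1 k.2)%:E))%E.
  by move=> f0 g0; rewrite esum_esum// => x y _ _; rewrite -EFinM lee_fin mulr_ge0.
have term0 v x : (0 <= (theta_term v x)%:E)%E by rewrite lee_fin theta_term_ge0.
transitivity (\esum_(x in A) \esum_(y in A2) ((theta_term t x)%:E * (theta_term t (x + y)%R)%:E))%E.
  by apply: eq_esum => x _; rewrite esumZl ?theta_term_ge0.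
rewrite (nested _ _ (fun x _ => theta_term t x) (fun x y => theta_term t (x + y))); try by
  move=> *; exact: theta_term_ge0.
rewrite (reindex_esum _ _ _ _ sum_diff_bij).
transitivity (\esum_(x in A) \esum_(y in A)
    ((theta_term (2 * t) x)%:E * (theta_term (2 * t) y)%:E))%E; last first.
  rewrite {1}(theta_seriesE finA t20) -esumZl ?theta_fun_ge0//.
  apply: eq_esum => x _; rewrite esumZl ?theta_term_ge0// muleC.
  by rewrite -(theta_seriesE finA t20).
rewrite (nested _ _ (fun x _ => theta_term (2 * t) x) (fun _ y => theta_term (2 * t) y)); try by
  move=> *; exact: theta_term_ge0.
apply: eq_esum => -[x y] [_ _] /=; rewrite -!EFinM -!expRD; congr ((expR _)%:E).
have -> : x + y - 2 * y = x - y by ring.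
by rewrite -!opprD -!mulrDr sqnorm_parallelogram; ring.
Qed.

(* After Cauchy-Schwarz over the classes modulo 2 A there remains the sum over
   the congruent pairs; these are the (x + y, x - y), and the parallelogram law
   factors it. *)
Lemma theta_fun_double t : 0 < t ->
  theta_fun A t ^+ 2 <= (size s)%:R * theta_fun A (2 * t) ^+ 2.
Proof.
move=> t0; have t20 : 0 < 2 * t by rewrite mulr_gt0.
have term0 x : (0 <= (theta_term t x)%:E)%E by rewrite lee_fin theta_term_ge0.
pose S a := (\esum_(x in A2) (theta_term t (a + x)%R)%:E)%E.
have S0 a : (0 <= S a)%E by exact: esum_ge0.
have S_fin a : a \in s -> S a = (fine (S a))%:E.
  move=> /sub_s Aa; rewrite fineK// ge0_fin_numE//; apply: le_lt_trans (finA t0).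
  rewrite -[leRHS](esum_subgroup_shift (fun x => (theta_term t x)%:E) sA Aa).
  by apply: esum_setS; exact: dilate2_sub.
have sum_classes : theta_fun A t = \sum_(a <- s) fine (S a).
  apply: EFin_inj; rewrite -theta_seriesE// /theta_series {1}AE esum_cosets//.
  by rewrite -sumEFin big_seq [RHS]big_seq; apply: eq_bigr => a as_; exact: S_fin.
have sum_sqr_classes : \sum_(a <- s) (fine (S a)) ^+ 2 = theta_fun A (2 * t) ^+ 2.
  apply: EFin_inj; rewrite expr2 EFinM -theta_seriesE// -theta_series_sqr// {1}AE esum_cosets//.
    rewrite -sumEFin big_seq [RHS]big_seq; apply: eq_bigr => a as_.
    transitivity (\esum_(x in A2) ((fine (S a))%:E * (theta_term t (a + x)%R)%:E))%E.
      by rewrite esumZl ?fine_ge0// -/(S a) S_fin// expr2 EFinM.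
    apply: eq_esum => x A2x; rewrite muleC; congr (_ * _)%E; rewrite -S_fin//.
    rewrite -[LHS](esum_subgroup_shift (fun w => (theta_term t (a + w)%R)%:E) sA2 A2x).
    by apply: eq_esum => w _; rewrite addrA.
  by move=> x; rewrite mule_ge0// esum_ge0.
by rewrite sum_classes -sum_sqr_classes; exact: sqr_sum_le.
Qed.

Lemma esum_dilate2_theta_term t : 0 < t ->
  (\esum_(x in A2) (theta_term t x)%:E = (theta_fun A (4 * t))%:E)%E.
Proof.
move=> t0; rewrite -theta_seriesE ?mulr_gt0// /A2 /dilate esum_image; last first.
  by move=> x y _ _; apply: mulfI; exact: two_neq0.
by apply: eq_esum => x _; rewrite /theta_term sqnorm_mul2; congr ((expR _)%:E); ring.
Qed.

(* Average over x and - x. *)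
Lemma theta_class_ge t a a' : 0 < t -> A2 (a - a') ->
  ((theta_term t a' * theta_fun A (4 * t))%:E <= \esum_(x in A2) (theta_term t (a + x)%R)%:E)%E.
Proof.
move=> t0 aa'; have term0 x : (0 <= (theta_term t x)%:E)%E by rewrite lee_fin theta_term_ge0.
have -> : (\esum_(x in A2) (theta_term t (a + x)%R)%:E =
    \esum_(x in A2) (theta_term t (a' + x)%R)%:E)%E.
  rewrite -[RHS](esum_subgroup_shift (fun w => (theta_term t (a' + w)%R)%:E) sA2 aa').
  by apply: eq_esum => w _; rewrite addrA [a' + _]addrC subrK.
set S := (\esum_(x in A2) _)%E; have S0 : (0 <= S)%E by exact: esum_ge0.
have SN : S = (\esum_(x in A2) (theta_term t (a' - x)%R)%:E)%E.
  by rewrite (esum_subgroup_opp (fun x => (theta_term t (a' + x))%:E) sA2).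
have : (2%:E * (theta_term t a' * theta_fun A (4 * t))%:E <= S + S)%E.
  rewrite {2}SN -esumD// [(_ * theta_fun _ _)%:E]EFinM muleA.
  rewrite -esum_dilate2_theta_term// -EFinM -esumZl; last 2 first.
  - by rewrite mulr_ge0 ?theta_term_ge0.
  - by move=> x _.
  by apply: le_esum => x _; rewrite -EFinM -EFinD lee_fin -mulrA theta_term_mean.
clearbody S; case: S S0 {SN} => [r _|_ _|]; [|by rewrite leey|by []].
by rewrite -EFinM -EFinD !lee_fin; lra.
Qed.

Lemma theta_fun_quadruple t K : 0 < t ->
  (forall a, A a -> exists2 a', A2 (a - a') & Q a' <= K) ->
  (size s)%:R * expR (- (pi * t * K)) * theta_fun A (4 * t) <= theta_fun A t.
Proof.
move=> t0 short; have term0 x : (0 <= (theta_term t x)%:E)%E by rewrite lee_fin theta_term_ge0.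
rewrite -lee_fin -theta_seriesE// /theta_series {2}AE esum_cosets// -mulrA.
rewrite (_ : (size s)%:R * _ = \sum_(a <- s) (expR (- (pi * t * K)) * theta_fun A (4 * t))).
  rewrite -sumEFin big_seq [leRHS]big_seq; apply: lee_sum => a /sub_s /short[a' aa' Qa'].
  apply: le_trans (theta_class_ge t0 aa'); rewrite lee_fin ler_wpM2r ?theta_fun_ge0//.
  by rewrite ler_expR lerN2 ler_wpM2l// mulr_ge0 ?pi_ge0// ltW.
by rewrite big_const_seq count_predT iter_addr_0 mulr_natl.
Qed.

End SubgroupTheta.

End QuadraticThetaSeries.

Section IndexTwo.
Variable L : fieldExtType rat.
Implicit Types (G : set L) (gs : seq L) (m : bitseq) (V : {vspace L}).

Lemma free_int_relations gs : let X := in_tuple gs in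
  (forall z : 'I_(size gs) -> int, \sum_i (z i)%:~R *: X`_i = 0 -> forall i, z i = 0) -> free gs.
Proof.
move=> X int_free; apply/(@freeP _ _ _ X) => k k_rel i.
pose D := \prod_(j < size gs) denq (k j).
have D0 : D != 0 by apply/prodf_neq0 => j _; exact: denq_neq0.
pose z j := numq (k j) * \prod_(l < size gs | l != j) denq (k l).
have zE j : (z j)%:~R = D%:~R * k j :> rat.
  have DE : D = denq (k j) * \prod_(l < size gs | l != j) denq (k l) by rewrite /D (bigD1 j).
  rewrite DE /z !intrM [X in _ = _ * X](esym (divq_num_den (k j))).
  have : (denq (k j))%:~R != 0 :> rat by rewrite intr_eq0 denq_neq0.
  by move=> den0; field.
have := int_free z; rewrite (eq_bigr (fun j => D%:~R *: (k j *: X`_j))); last first.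
  by move=> j _; rewrite zE scalerA.
rewrite -scaler_sumr k_rel scaler0 => /(_ erefl i) /(congr1 (fun x : int => x%:~R : rat)).
by rewrite zE => /eqP; rewrite mulf_eq0 intr_eq0 (negPf D0) /= => /eqP.
Qed.

Definition parity_free G gs := (forall g, g \in gs -> G g) /\
  forall m, size m = size gs -> has id m -> ~ dilate 2 G (\sum_(g <- mask m gs) g).

Lemma divz2_parity (z : int) : z = (z %/ 2)%Z * 2 + (~~ (2 %| z)%Z)%:Z.
Proof.
rewrite [LHS](divz_eq _ 2); congr (_ + _).
have mod_ge0 : (0 <= z %% 2)%Z by rewrite modz_ge0.
have mod_lt2 : (z %% 2 < 2)%Z by rewrite ltz_pmod.
have -> : (2 %| z)%Z = ((z %% 2)%Z == 0) by apply/dvdz_mod0P/eqP.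
by move: mod_ge0 mod_lt2; case: (z %% 2)%Z => [[|[|k]]|k].
Qed.

Lemma parity_free_even G gs (z : 'I_(size gs) -> int) : subgroup G -> parity_free G gs ->
  \sum_i (z i)%:~R *: (in_tuple gs)`_i = 0 -> forall i, (2 %| z i)%Z.
Proof.
move=> sG [Ggs odd_sums]; set X := in_tuple gs => z_rel.
apply/forallP; apply: contraT => /forallPn/=[i0 z_odd]; exfalso.
pose m := [seq ~~ (2 %| z i)%Z | i <- enum 'I_(size gs)].
apply: (odd_sums m); first by rewrite size_map size_enum_ord.
  by apply/hasP; exists true => //; apply/mapP; exists i0; rewrite ?mem_enum ?z_odd.
have -> : \sum_(g <- mask m gs) g = \sum_(i | ~~ (2 %| z i)%Z) X`_i.
  have gsE : gs = [seq X`_i | i : 'I_(size gs) <- enum 'I_(size gs)].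
    by rewrite -[LHS](mkseq_nth 0) /mkseq -val_enum_ord -map_comp.
  by rewrite [X in mask m X]gsE -map_mask big_map /m -filter_mask big_filter big_enum_cond.
exists (- \sum_(i < size gs) X`_i *~ (z i %/ 2)%Z).
  apply: subgroupN => //; apply: subgroup_sum => // i _.
  by apply: subgroup_mulrz => //; apply: Ggs; rewrite mem_nth.
rewrite mulrN; apply/eqP; rewrite eq_sym -subr_eq0 opprK; apply/eqP.
rewrite big_mkcond/= -[RHS]z_rel mulr_sumr -big_split/=; apply: eq_bigr => i _.
rewrite [in RHS](divz2_parity (z i)) intrD scalerDl addrC; congr (_ + _).
  by rewrite mulr_natl intrM mulrC -scalerA !scaler_int pmulrn.
by case: ifP => _; rewrite ?scale1r ?scale0r.
Qed.

(* Infinite descent: an integral relation has even coefficients, so it can be halved. *)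
Lemma parity_free_free G gs : subgroup G -> parity_free G gs -> free gs.
Proof.
move=> sG gs_free; apply: free_int_relations => z.
have [N] := ubnP (\sum_i `|z i|)%N; elim: N z => // N IH z zN z_rel.
have z2 i : z i = (z i %/ 2)%Z * 2 by rewrite divzK//; exact: parity_free_even gs_free z_rel i.
have sum_half : (\sum_i `|z i| = (\sum_i `|(z i %/ 2)%Z|) * 2)%N.
  by rewrite big_distrl/=; apply: eq_bigr => i _; rewrite {1}z2 abszM.
have half0 i : (z i %/ 2)%Z = 0.
  have [sum0|sum_neq0] := eqVneq (\sum_i `|(z i %/ 2)%Z|)%N 0%N.
    by move/eqP: sum0; rewrite sum_nat_eq0 => /forallP/(_ i) /=; rewrite absz_eq0 => /eqP.
  apply: (IH (fun i => (z i %/ 2)%Z) _ _ i).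
    by rewrite -ltnS (leq_trans _ zN)// sum_half ltnS muln2 -addnn -addn1 leq_add2l lt0n.
  have rat2 : (2%:R : rat) != 0 by [].
  apply: (scalerI rat2); rewrite scaler0 -[RHS]z_rel scaler_sumr; apply: eq_bigr => k _.
  by rewrite scalerA [in RHS]z2 intrM mulrC.
by move=> i; rewrite z2 half0 mul0r.
Qed.

Lemma parity_free_cons G gs g : subgroup G -> parity_free G gs -> G g ->
  ~ (exists2 m, size m = size gs & dilate 2 G (g - \sum_(h <- mask m gs) h)) ->
  parity_free G (g :: gs).
Proof.
move=> sG [Ggs odd_sums] Gg g_new; split; first by move=> h; rewrite inE => /predU1P[->|/Ggs].
move=> [//|[] m] /= [size_m]; last by move=> m_odd; exact: odd_sums.
move=> _; rewrite big_cons => g_sum; apply: g_new; exists m => //; set S := \sum_(_ <- _) _ in g_sum *.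
have GS : G S by rewrite /S big_seq; apply: subgroup_sum => // h /mem_mask /Ggs.
rewrite (_ : g - S = (g + S) - 2 * S); last by ring.
by apply: (subgroup_dilate 2 sG).2 => //; exists S.
Qed.

Definition two_transversal G s := incongruent (dilate 2 G) s /\ G = cosets (dilate 2 G) s.

(* The subset sums of a maximal parity-free family represent all classes modulo 2. *)
Lemma two_transversal_exists G V : subgroup G -> (forall g, G g -> g \in V) ->
  exists2 s, two_transversal G s & (size s <= 2 ^ \dim V)%N.
Proof.
move=> sG GV; have sG2 := subgroup_dilate 2 sG; have G2G := dilate2_sub sG.
pose has_family r := `[< exists2 gs, size gs = r & parity_free G gs >].
have ex_family : exists r, has_family r.
  by exists 0%N; apply/asboolP; exists [::] => //; split => // m /size0nil ->.
have family_le r : has_family r -> (r <= \dim V)%N.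
  move=> /asboolP[gs <- gs_free]; have /eqP <- : free gs := parity_free_free sG gs_free.
  by apply: dimvS; apply/span_subvP => g /gs_free.1/GV.
case: (ex_maxnP ex_family family_le) => r /[dup] r_family /asboolP[gs size_gs gs_free] r_max.
pose S := [seq \sum_(g <- mask (tval b) gs) g | b <- enum {: r.-tuple bool}].
have size_S : (size S <= 2 ^ \dim V)%N.
  by rewrite size_map -cardE card_tuple card_bool leq_exp2l// family_le.
have cover g : G g -> cosets (dilate 2 G) S g.
  move=> Gg; apply: contrapT => g_new; suff /r_max : has_family r.+1 by rewrite ltnn.
  apply/asboolP; exists (g :: gs); first by rewrite /= size_gs.
  apply: parity_free_cons => // -[m size_m g_sum]; apply: g_new.
  have tm : size m == r by rewrite size_m size_gs.
  exists (\sum_(h <- mask m gs) h) => //.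
  by apply/mapP; exists (Tuple tm); rewrite ?mem_enum.
have le_S s : incongruent (dilate 2 G) s -> (forall a, a \in s -> G a) -> (size s <= size S)%N.
  by move=> s_inc Gs; apply: (incongruent_size sG2 s_inc) => a /Gs; exact: cover.
have [s [s_inc GE]] := transversal_bounded sG sG2 G2G le_S.
exists s; first by split.
by apply: leq_trans size_S; apply: le_S => // a as_; rewrite GE; exact: mem_cosets.
Qed.

Lemma maximal_free_family (P : L -> Prop) : exists ys : seq L, [/\ free ys,
  (forall y, y \in ys -> P y) & forall x, P x -> x \in <<ys>>%VS].
Proof.
pose has_family r := `[< exists ys : seq L, [/\ free ys, size ys = r & forall y, y \in ys -> P y] >].
have ex_family : exists r, has_family r.
  by exists 0%N; apply/asboolP; exists [::]; split => //; exact: nil_free.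
have family_le r : has_family r -> (r <= \dim {:L})%N.
  move=> /asboolP[ys [ys_free <- _]]; have /eqP <- : \dim <<ys>> == size ys by [].
  exact: (dimvS (subvf _)).
case: (ex_maxnP ex_family family_le) => r /asboolP[ys [ys_free size_ys Pys]] r_max.
exists ys; split => // x Px; apply: contraT => x_new.
suff /r_max : has_family r.+1 by rewrite ltnn.
apply/asboolP; exists (x :: ys); split => /=; [by rewrite free_cons x_new|by rewrite size_ys|].
by move=> y; rewrite inE => /predU1P[->|/Pys].
Qed.

End IndexTwo.

Section NumericalBounds.
Variable R : realType.

Lemma pi_ge3 : 3 <= pi :> R.
Proof.
have cos_double (x : R) : 0 <= x -> 1 - x ^+ 2 * 2 <= cos (x *+ 2).
  move=> x0; rewrite cos_mulr2n cos2sin2 -[sin _ ^+ 2]real_normK ?num_real// -mulr_natr.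
  have := normr_sin_le x; rewrite [X in _ <= X]ger0_norm//.
  have := normr_ge0 (sin x); move: `|sin x| => u u0 ux.
  have : u ^+ 2 <= x ^+ 2 by apply: lerXn2r; rewrite ?nnegrE.
  lra.
have cos34 : 1 - (3 / 8) ^+ 2 * 2 <= cos (3 / 4) :> R.
  have x0 : 0 <= 3 / 8 :> R by lra.
  by have := cos_double _ x0; rewrite (_ : (3 / 8) *+ 2 = 3 / 4 :> R)// -mulr_natr; field.
have cos32 : 0 < cos (3 / 2) :> R.
  rewrite (_ : 3 / 2 = (3 / 4) *+ 2); last by rewrite -mulr_natr; field.
  by rewrite cos_mulr2n -mulr_natr; move: (cos (3 / 4 : R)) cos34 => u; nra.
rewrite leNgt; apply/negP => pi_lt3; have pi2 := pi_ge2 R.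
have : cos (3 / 2) < cos (pi / 2) :> R.
  by rewrite ltr_cos ?in_itv/=; [lra|apply/andP; split; lra|apply/andP; split; lra].
by rewrite cos_pihalf => /(lt_trans cos32); rewrite ltxx.
Qed.

Lemma expR_3half : 4 < expR (3 / 2) :> R.
Proof.
have exp_ge : 1 + 3 / 32 <= expR (3 / 32) :> R by exact: expR_ge1Dx.
have base0 : 0 <= 1 + 3 / 32 :> R by lra.
rewrite (_ : 3 / 2 = 16%:R * (3 / 32)); last by field.
rewrite expRM_natl; apply: (@lt_le_trans _ _ ((1 + 3 / 32) ^+ 16)); last first.
  by apply: lerXn2r; rewrite ?nnegrE ?expR_ge0.
have sqr_ge (u v w : R) : 0 <= u -> u <= v -> w <= u ^+ 2 -> w <= v ^+ 2.
  move=> u0 uv w_le; apply: (le_trans w_le).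
  by apply: lerXn2r; rewrite ?nnegrE// (le_trans u0).
rewrite (_ : 16 = 2 * (2 * (2 * 2)))%N// !exprM.
have pow2 : 119 / 100 <= (1 + 3 / 32) ^+ 2 :> R by lra.
have pow4 : 141 / 100 <= ((1 + 3 / 32) ^+ 2) ^+ 2 :> R by apply: (sqr_ge _ _ _ _ pow2); lra.
have pow8 : 198 / 100 <= (((1 + 3 / 32) ^+ 2) ^+ 2) ^+ 2 :> R by apply: (sqr_ge _ _ _ _ pow4); lra.
have pow8' : 203 / 100 <= (((1 + 3 / 32) ^+ 2) ^+ 2) ^+ 2 :> R by lra.
apply: (@lt_le_trans _ _ ((203 / 100) ^+ 2)); first by lra.
by apply: (sqr_ge _ _ _ _ pow8'); lra.
Qed.

Lemma expR_pi4_sqrt2_lt1 : expR (- (pi / 4)) * Num.sqrt 2 < 1 :> R.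
Proof.
have e0 : 0 < expR (- (pi / 4)) :> R by exact: expR_gt0.
rewrite -(@ltr_pXn2r _ 4)// ?nnegrE ?mulr_ge0 ?(ltW e0) ?sqrtr_ge0//.
rewrite expr1n exprMn -expRM_natl (_ : 4%:R * - (pi / 4) = - pi); last by field.
have -> : Num.sqrt 2 ^+ 4 = 4 :> R by rewrite (_ : 4 = 2 * 2)%N// exprM sqr_sqrtr//; ring.
rewrite expRN ltr_pdivrMl ?expR_gt0// mulr1 (lt_le_trans expR_3half)// ler_expR.
by have := pi_ge3; lra.
Qed.

Lemma expR_pi8_sqrt2_le1 : expR (- (pi / 8)) * Num.sqrt 2 <= 1 :> R.
Proof.
rewrite -(@expr_le1 _ 2)// exprMn sqr_sqrtr// -expRM_natl.
rewrite (_ : 2%:R * - (pi / 8) = - (pi / 4)); last by field.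
rewrite expRN ler_pdivrMl ?expR_gt0// mulr1 -ler_sqr ?nnegrE ?expR_ge0// -expRM_natl.
rewrite (_ : 2%:R * (pi / 4) = pi / 2); last by field.
apply: (@le_trans _ _ (expR (3 / 2))); first by rewrite (le_trans _ (ltW expR_3half))//; lra.
by rewrite ler_expR; have := pi_ge3; lra.
Qed.

Lemma expR_pi4_sqrt2X_lt d : (2 <= d)%N ->
  expR (- (pi * d%:R / 4)) * Num.sqrt 2 ^+ d < 1 / 2 :> R.
Proof.
move=> d2; have -> : expR (- (pi * d%:R / 4)) = expR (- (pi / 4)) ^+ d :> R.
  by rewrite -expRM_natl; congr expR; field.
rewrite -exprMn; set q := expR _ * _.
have q0 : 0 <= q by rewrite mulr_ge0 ?expR_ge0 ?sqrtr_ge0.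
apply: (@le_lt_trans _ _ (q ^+ 2)); first by rewrite ler_wiXn2l// ltW// expR_pi4_sqrt2_lt1.
rewrite /q exprMn sqr_sqrtr// -expRM_natl (_ : 2%:R * - (pi / 4) = - (pi / 2)); last by field.
rewrite expRN mulrC ltr_pdivrMr ?expR_gt0//.
have : expR (3 / 2) <= expR (pi / 2) :> R by rewrite ler_expR; have := pi_ge3; lra.
have := expR_3half; lra.
Qed.

Lemma expR_tail_sqrt2X_le d (x : R) : (d + 2)%:R / 4 <= x ->
  expR (- (pi / 2 * x)) * Num.sqrt 2 ^+ d <= 1 / 2.
Proof.
move=> x_ge; apply: (@le_trans _ _ (expR (- (pi * (d + 2)%:R / 8)) * Num.sqrt 2 ^+ d)).
  rewrite ler_wpM2r ?exprn_ge0 ?sqrtr_ge0// ler_expR lerN2.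
  rewrite (_ : pi * (d + 2)%:R / 8 = pi / 2 * ((d + 2)%:R / 4)); last by field.
  by rewrite ler_wpM2l// divr_ge0// pi_ge0.
have -> : expR (- (pi * (d + 2)%:R / 8)) * Num.sqrt 2 ^+ d =
    (expR (- (pi / 8)) * Num.sqrt 2) ^+ (d + 2) / 2 :> R.
  rewrite exprMn -expRM_natl [Num.sqrt 2 ^+ (_ + _)]exprD sqr_sqrtr// !mulrA mulfK//.
  by congr (expR _ * _); rewrite mulrN; congr (- _); field.
by rewrite ler_pdivrMr// div1r mulVf// exprn_ile1 ?expR_pi8_sqrt2_le1.
Qed.

Lemma expR_le1D3x (u : R) : 0 <= u <= 1 -> expR u <= 1 + 3 * u.
Proof.
move=> /andP[u0 u1]; have sqr0 : 0 < (1 - u / 2) ^+ 2 by rewrite exprn_gt0//; lra.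
rewrite -(ler_pM2r sqr0).
have sqr_le : (1 - u / 2) ^+ 2 <= expR (- u).
  rewrite (_ : - u = 2%:R * - (u / 2)); last by field.
  rewrite expRM_natl; apply: lerXn2r; rewrite ?nnegrE ?expR_ge0//; first by lra.
  exact: expR_ge1Dx.
apply: (@le_trans _ _ 1).
  apply: (@le_trans _ _ (expR u * expR (- u))); first by rewrite ler_wpM2l// expR_ge0.
  by rewrite -expRD subrr expR0.
have -> : (1 + 3 * u) * (1 - u / 2) ^+ 2 = 1 + u * ((1 - u) * (2 - 3 / 4 * u)) by field.
by rewrite lerDl mulr_ge0// mulr_ge0//; lra.
Qed.

Lemma sqr_sqrtrX (t : R) k : 0 <= t -> (Num.sqrt t ^+ k) ^+ 2 = t ^+ k.
Proof. by move=> t0; rewrite -exprM mulnC exprM sqr_sqrtr. Qed.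

Lemma pow2_between (x : R) : 1 < x -> exists j, 2 ^+ j <= x < 2 ^+ j.+1.
Proof.
move=> x1; have ex_pow : exists m : nat, x < 2 ^+ m.
  exists (Num.truncn x).+1; apply: (lt_le_trans (truncnS_gt x)).
  by rewrite -natrX ler_nat ltnW// ltn_expl.
case: (ex_minnP ex_pow) => [[|j]] x_lt min_j; first by move: x_lt; rewrite expr0; lra.
by exists j; rewrite x_lt andbT leNgt; apply/negP => /min_j; rewrite ltnn.
Qed.

End NumericalBounds.

Section MinimalLattice.
Variables (R : realType) (L : fieldExtType rat) (E : embedding_system R L).
Local Notation n := (\dim {:L}).
Variable tau : 'I_n -> R.
Hypothesis tau_gt0 : forall i, 0 < tau i.
Local Notation Q := (sqnorm E tau).
Local Notation theta_fun := (theta_fun E tau).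
Local Notation theta_series := (theta_series E tau).
Implicit Types (A G : set L) (t u K e : R) (x y a : L) (s : seq L) (d : nat).

Definition scaled_theta d A t := Num.sqrt t ^+ d * theta_fun A t.

Record minimal_lattice d A (kappa : R) : Prop := MinimalLattice {
  minimal_subgroup : subgroup A;
  minimal_finite : theta_finite E tau A;
  minimal_index : exists2 s, two_transversal A s & size s = (2 ^ d)%N;
  minimal_sqnorm : forall x, A x -> x != 0 -> d%:R <= Q x;
  minimal_gt0 : 0 < kappa;
  minimal_lim : forall t, 0 < t ->
    (fun k => scaled_theta d A (t * 2^-1 ^+ k)) @ \oo --> kappa }.

Lemma theta_fun_half A s d t : subgroup A -> theta_finite E tau A -> two_transversal A s ->
  (size s <= 2 ^ d)%N -> 0 < t -> theta_fun A t <= Num.sqrt 2 ^+ d * theta_fun A (2 * t).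
Proof.
move=> sA finA [s_inc AE] size_s t0.
have th0 := theta_fun_ge0 E tau A.
rewrite -ler_sqr ?nnegrE//; last by rewrite mulr_ge0 ?exprn_ge0 ?sqrtr_ge0.
rewrite exprMn sqr_sqrtrX//; apply: (le_trans (theta_fun_double sA finA s_inc AE t0)).
by rewrite ler_wpM2r ?sqr_ge0// -natrX ler_nat.
Qed.

Lemma scaled_theta_ge0 d A t : 0 <= scaled_theta d A t.
Proof. by rewrite mulr_ge0 ?exprn_ge0 ?sqrtr_ge0 ?theta_fun_ge0. Qed.

Lemma theta_fun_decay d A t0 t : subgroup A -> theta_finite E tau A ->
  (forall x, A x -> x != 0 -> d%:R <= Q x) -> 0 < t0 -> t0 <= t ->
  theta_fun A t <= 1 + expR (- (pi * d%:R * (t - t0))) * (theta_fun A t0 - 1).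
Proof.
move=> sA finA minQ t00 tt; have t_gt0 : 0 < t by exact: lt_le_trans tt.
pose A' := A `\ 0.
have nonzeroE u : 0 < u -> theta_series A' u = (theta_fun A u - 1)%:E.
  move=> u0; rewrite EFinB -(theta_seriesE finA u0) /theta_series {1}(_ : A = [set 0] `|` A').
    rewrite esum_setU ?esum_set1 ?lee_fin ?theta_term_ge0 ?theta_term0//.
    - by rewrite addeAC subee// add0e.
    - by move=> x; rewrite lee_fin theta_term_ge0.
    - by apply/disj_set2P; rewrite /A' setDE setICA setICr setI0.
  apply/seteqP; split => x; last by case=> [->|[]//]; exact: sA.1.
  by move=> Ax; have [->|x0] := eqVneq x 0; [left|right; split => //; exact/eqP].
rewrite -lerBlDl -lee_fin EFinM -!nonzeroE// -esumZl ?expR_ge0//; last first.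
  by move=> x _; rewrite lee_fin theta_term_ge0.
apply: le_esum => x [Ax x0]; rewrite -EFinM lee_fin /theta_term -expRD ler_expR.
have Qx := minQ x Ax (introN eqP x0).
have : 0 <= pi * (t - t0) * (Q x - d%:R) by rewrite mulr_ge0 ?mulr_ge0 ?pi_ge0 ?subr_ge0.
nra.
Qed.

Lemma short_representative A (ys : seq L) (B : R) : subgroup A -> free ys -> size ys = n ->
  (forall y, y \in ys -> A y /\ Q y <= B) ->
  forall a, A a -> exists2 a', dilate 2 A (a - a') & Q a' <= n%:R ^+ 2 * B.
Proof.
move=> sA ys_free size_ys ysP a Aa.
have size_ysP : size ys == n by rewrite size_ys.
pose X : n.-tuple L := Tuple size_ysP.
have X_basis : basis_of {:L} X by rewrite basisEfree ys_free subvf /= size_ys.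
pose q (i : 'I_n) : rat := coord X i a.
pose m (i : 'I_n) := Num.floor ((q i + 1) / 2).
pose r (i : 'I_n) : rat := q i - 2 * (m i)%:~R.
have r_le1 i : `|r i| <= 1.
  have /andP[lo up] := floor_itv ((q i + 1) / 2); rewrite -/(m i) intrD in up.
  by rewrite ler_norml /r; move: lo up; lra.
have Xys (i : 'I_n) : X`_i \in ys by rewrite mem_nth// size_ys.
exists (\sum_(i < n) r i *: X`_i).
  exists (\sum_(i < n) X`_i *~ m i).
    by apply: subgroup_sum => // i _; apply: subgroup_mulrz => //; exact: (ysP _ (Xys i)).1.
  rewrite {1}(coord_basis X_basis (memvf a)) -sumrB mulr_sumr; apply: eq_bigr => i _.
  by rewrite -scalerBl /r opprB addrC subrK -scalerA scaler_int scaler_nat mulr_natl.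
apply: (le_trans (sqnorm_sum_le E tau_gt0 _ _)).
have -> : size (index_enum 'I_n) = n by rewrite /index_enum -enumT size_enum_ord.
rewrite expr2 -mulrA ler_wpM2l//.
rewrite (_ : n%:R * B = \sum_(i < n) B); last by rewrite sumr_const card_ord mulr_natl.
apply: ler_sum => i _; rewrite sqnormZ.
have sqr_le1 : (ratr (r i) : R) ^+ 2 <= 1.
  rewrite -real_normK ?num_real// exprn_ile1// -ratr_norm.
  by rewrite -[leRHS](rmorph1 (ratr : {rmorphism rat -> R})) ler_rat.
have QX := (ysP _ (Xys i)).2; have QX0 := sqnorm_ge0 E tau_gt0 X`_i.
by have := sqr_ge0 (ratr (r i) : R); nra.
Qed.

Section Growth.
Variables (d : nat) (A : set L) (kappa : R).
Hypotheses (mA : minimal_lattice d A kappa) (d2 : (2 <= d)%N).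
Local Notation g := (scaled_theta d A).

Let sA : subgroup A := minimal_subgroup mA.
Let finA : theta_finite E tau A := minimal_finite mA.
Let kappa_gt0 : 0 < kappa := minimal_gt0 mA.

Let theta_fun_half_minimal t : 0 < t -> theta_fun A t <= Num.sqrt 2 ^+ d * theta_fun A (2 * t).
Proof.
have [s s2 size_s] := minimal_index mA.
by apply: theta_fun_half sA finA s2 _; rewrite size_s.
Qed.

Lemma scaled_theta_half_le t : 0 < t -> g (t / 2) <= g t.
Proof.
move=> t0; have t20 : 0 < t / 2 by rewrite divr_gt0.
have half := theta_fun_half_minimal t20.
rewrite (_ : 2 * (t / 2) = t) in half; last by field.
apply: (@le_trans _ _ (Num.sqrt (t / 2) ^+ d * (Num.sqrt 2 ^+ d * theta_fun A t))).
  by rewrite ler_wpM2l// exprn_ge0// sqrtr_ge0.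
by rewrite mulrA -exprMn -sqrtrM ?(ltW t20)// (_ : t / 2 * 2 = t)//; field.
Qed.

Lemma scaled_theta_halves_le t k : 0 < t -> g (t * 2^-1 ^+ k) <= g t.
Proof.
move=> t0; elim: k => [|k IH]; first by rewrite expr0 mulr1.
apply: le_trans IH; rewrite exprSr mulrA; apply: scaled_theta_half_le.
by rewrite mulr_gt0// exprn_gt0.
Qed.

Lemma kappa_le_scaled_theta t : 0 < t -> kappa <= g t.
Proof.
move=> t0; apply: (cvgr_to_le (minimal_lim mA t0)).
by apply: nearW => k; exact: scaled_theta_halves_le.
Qed.

Lemma scaled_theta_quadruple_le K t : 0 < t ->
  (forall a, A a -> exists2 a', dilate 2 A (a - a') & Q a' <= K) ->
  g (4 * t) <= expR (pi * t * K) * g t.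
Proof.
move=> t0 short; have [s [s_inc AE] size_s] := minimal_index mA.
have := theta_fun_quadruple sA finA s_inc AE t0 short; rewrite size_s natrX => quad.
have sqrt4 : Num.sqrt (4 * t) = 2 * Num.sqrt t.
  by rewrite sqrtrM// (_ : 4 = 2 ^+ 2) ?sqrtr_sqr ?ger0_norm//; ring.
rewrite /scaled_theta sqrt4 exprMn; set X := expR (pi * t * K).
have {}quad : 2 ^+ d * theta_fun A (4 * t) <= X * theta_fun A t.
  by move: quad; rewrite expRN -/X mulrAC ler_pdivrMr ?expR_gt0// [_ * X]mulrC.
rewrite [X * _]mulrCA [2 ^+ d * _]mulrC -mulrA ler_wpM2l// exprn_ge0// sqrtr_ge0.
Qed.

Lemma scaled_theta_le K t : 0 <= K -> 0 < t ->
  (forall a, A a -> exists2 a', dilate 2 A (a - a') & Q a' <= K) ->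
  g t <= kappa * expR (pi * K / 3 * t).
Proof.
move=> K0 t0 short; set c := pi * K / 3 * t.
have c0 : 0 <= c by rewrite !mulr_ge0 ?invr_ge0 ?pi_ge0// ltW.
have iterate j : g t <= expR (c * (1 - 4^-1 ^+ j)) * g (t * 4^-1 ^+ j).
  elim: j => [|j IH]; first by rewrite expr0 subrr mulr0 expR0 mul1r mulr1.
  have tj : 0 < t * 4^-1 ^+ j.+1 by rewrite mulr_gt0// exprn_gt0.
  have := scaled_theta_quadruple_le tj short.
  rewrite (_ : 4 * _ = t * 4^-1 ^+ j); last by rewrite exprS; field.
  move=> /(ler_wpM2l (expR_ge0 (c * (1 - 4^-1 ^+ j)))) /(le_trans IH) /le_trans; apply.
  rewrite [leLHS]mulrA -expRD le_eqVlt; apply/predU1l.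
  by congr (expR _ * _); rewrite /c exprS; field.
rewrite mulrC -ler_pdivrMl ?expR_gt0//.
apply: (cvgr_to_ge (minimal_lim mA t0)); apply: nearW => k.
rewrite ler_pdivrMl ?expR_gt0//; apply: (le_trans (iterate k)).
have four_two : 4^-1 ^+ k = 2^-1 ^+ k * 2^-1 ^+ k :> R.
  by rewrite -exprMn; congr (_ ^+ _); field.
apply: ler_pM; rewrite ?expR_ge0 ?scaled_theta_ge0//.
  by rewrite ler_expR ler_piMr// gerBl exprn_ge0.
by rewrite four_two mulrA scaled_theta_halves_le// mulr_gt0// exprn_gt0.
Qed.

Lemma theta_fun_half_lt2 : theta_fun A (1 / 2) < 2.
Proof.
have t0 : 0 < 1 / 4 :> R by lra.
have t_le : 1 / 4 <= 1 / 2 :> R by lra.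
have decay := theta_fun_decay sA finA (minimal_sqnorm mA) t0 t_le.
have half := theta_fun_half_minimal t0.
rewrite (_ : 2 * (1 / 4) = 1 / 2) in half; last by field.
set a := expR (- (pi * d%:R / 4)) : R.
have a0 : 0 < a by exact: expR_gt0.
rewrite (_ : pi * d%:R * (1 / 2 - 1 / 4) = pi * d%:R / 4) -/a in decay; last by field.
have := @expR_pi4_sqrt2X_lt R d d2; rewrite -/a => contraction.
set T := theta_fun A (1 / 2) in decay half *; set T' := theta_fun A (1 / 4) in decay half.
have aT' : a * T' <= a * Num.sqrt 2 ^+ d * T by rewrite -mulrA ler_wpM2l// ltW.
have T0 : 0 <= T by exact: theta_fun_ge0.
have : a * Num.sqrt 2 ^+ d * T <= 1 / 2 * T by rewrite ler_wpM2r// ltW.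
by move: decay; rewrite mulrBr mulr1; lra.
Qed.

Lemma theta_fun_decay_half t : 1 / 2 <= t ->
  theta_fun A t <= 1 + expR (- (pi * d%:R * (t - 1 / 2))).
Proof.
move=> t_ge; have half0 : 0 < 1 / 2 :> R by lra.
apply: (le_trans (theta_fun_decay sA finA (minimal_sqnorm mA) half0 t_ge)).
by rewrite lerD2l ler_piMr ?expR_ge0// lerBlDr ltW// theta_fun_half_lt2.
Qed.

Lemma kappa_sqrt2X_lt : kappa * Num.sqrt 2 ^+ d < 2.
Proof.
have t0 : 0 < 1 / 2 :> R by lra.
apply: le_lt_trans theta_fun_half_lt2.
have S0 : 0 < Num.sqrt 2 ^+ d :> R by rewrite exprn_gt0// sqrtr_gt0.
have := kappa_le_scaled_theta t0; rewrite -(ler_pM2r S0) => /le_trans; apply.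
rewrite /scaled_theta mulrAC -exprMn -sqrtrM//.
by rewrite (_ : 1 / 2 * 2 = 1) ?sqrtr1 ?expr1n ?mul1r//; field.
Qed.

Lemma kappa_lt1 : kappa < 1.
Proof.
have := kappa_sqrt2X_lt; have : 2 <= Num.sqrt 2 ^+ d :> R.
  apply: (@le_trans _ _ (Num.sqrt 2 ^+ 2)); first by rewrite sqr_sqrtr.
  by rewrite ler_weXn2l// -[leLHS]sqrtr1 ler_sqrt// ler1n.
move: (Num.sqrt 2 ^+ d) => S S2 kS; rewrite ltNge; apply/negP => k1.
have : 1 * 2 <= kappa * S by apply: ler_pM.
by rewrite mul1r leNgt kS.
Qed.

Lemma scaled_theta_le2 t : 0 < t <= 1 -> g t <= 2.
Proof.
move=> /andP[t0 t1].
have dyadic k u : 2^-1 ^+ k.+1 <= u -> u <= 1 -> g u <= 2.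
  elim: k u => [|k IH] u.
    rewrite expr1 => u2 u1; rewrite -[leRHS]mul1r; apply: ler_pM.
    - by rewrite exprn_ge0// sqrtr_ge0.
    - exact: theta_fun_ge0.
    - by rewrite exprn_ile1 ?sqrtr_ge0// -[leRHS]sqrtr1 ler_wsqrtr.
    - by apply: ltW; apply: le_lt_trans theta_fun_half_lt2; apply: theta_fun_nonincreasing => //; lra.
  move=> u2 u1; have [u_ge|u_lt] := leP (1 / 2) u.
    apply: (IH _ _ u1); apply: le_trans u_ge; rewrite div1r exprS ler_piMr ?invr_ge0//.
    by rewrite exprn_ile1 ?invr_ge0// invf_le1// ler1n.
  have u0 : 0 < u by apply: lt_le_trans u2; rewrite exprn_gt0.
  have u20 : 0 < 2 * u by rewrite mulr_gt0.
  have := scaled_theta_half_le u20; rewrite (_ : 2 * u / 2 = u); last by field.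
  move=> /le_trans; apply; apply: IH; last by lra.
  by move: u2; rewrite [_ ^+ k.+2]exprS; lra.
apply: (dyadic (Num.truncn t^-1)) => //; set k := Num.truncn _.
have : t^-1 < k.+1%:R by exact: truncnS_gt.
rewrite invf_plt ?posrE ?ltr0n// => /ltW; apply: le_trans.
by rewrite exprVn lef_pV2 ?posrE ?exprn_gt0 ?ltr0n// -natrX ler_nat ltnW// ltn_expl.
Qed.

Lemma subspace_theta_le (V : {vspace L}) j : (\dim V <= d.-1)%N ->
  theta_fun (A `&` [set` V]) (1 / 2 * 2^-1 ^+ j) <= (Num.sqrt 2 ^+ d.-1) ^+ j * 2.
Proof.
move=> dimV; set G := A `&` _.
have GA : G `<=` A by move=> x [].
have finG : theta_finite E tau G := theta_finite_setS GA finA.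
have sG : subgroup G.
  split; first by split; [exact: sA.1|exact: mem0v].
  by move=> x y [Ax xV] [Ay yV]; split; [exact: sA.2|exact: rpredB].
have [s s2 size_s] := two_transversal_exists sG (fun x => @proj2 _ (x \in V)).
elim: j => [|j IH].
  rewrite !expr0 mulr1 [leRHS]mul1r; apply: le_trans (ltW theta_fun_half_lt2).
  by apply: theta_fun_setS => //; lra.
have tj : 0 < 1 / 2 * 2^-1 ^+ j.+1 :> R by rewrite mulr_gt0// exprn_gt0.
have size_s' : (size s <= 2 ^ d.-1)%N by rewrite (leq_trans size_s)// leq_exp2l.
apply: (le_trans (theta_fun_half sG finG s2 size_s' tj)).
rewrite (_ : 2 * (1 / 2 * _) = 1 / 2 * 2^-1 ^+ j); last by rewrite exprS; field.
by rewrite [(_ ^+ d.-1) ^+ j.+1]exprS -[leRHS]mulrA ler_wpM2l// exprn_ge0// sqrtr_ge0.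
Qed.

Lemma theta_fun_outside_le G (B t : R) : G `<=` A -> (forall x, A x -> Q x <= B -> G x) -> 0 < t ->
  theta_fun A t <= theta_fun G t + expR (- (pi / 2 * (t * B))) * theta_fun A (t / 2).
Proof.
move=> GA short t0; have t20 : 0 < t / 2 by rewrite divr_gt0.
have finG : theta_finite E tau G := theta_finite_setS GA finA.
have term0 u x : (0 <= (theta_term E tau u x)%:E)%E by rewrite lee_fin theta_term_ge0.
rewrite -lee_fin EFinD EFinM -(theta_seriesE finA t0).
rewrite -(theta_seriesE finG t0) -(theta_seriesE finA t20).
rewrite /theta_series {1}(_ : A = G `|` (A `\` G)); last first.
  apply/seteqP; split => x; last by case=> [/GA|[]].
  by move=> Ax; have [Gx|Gx] := pselect (G x); [left|right].
rewrite esum_setU//; last by apply/disj_set2P; rewrite setDE setICA setICr setI0.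
apply: leeD2l; apply: (@le_trans _ _ (\esum_(x in A `\` G)
    ((expR (- (pi / 2 * (t * B))))%:E * (theta_term E tau (t / 2) x)%:E))%E); last first.
  rewrite esumZl ?expR_ge0//.
  by apply: lee_wpmul2l; [rewrite lee_fin expR_ge0|apply: esum_setS => x []].
apply: le_esum => x [Ax Gx]; rewrite -EFinM lee_fin /theta_term -expRD ler_expR.
have BQ : B < Q x by rewrite ltNge; apply/negP => Qx; apply: Gx; exact: short.
have : 0 <= pi * t * (Q x - B).
  by rewrite mulr_ge0 ?mulr_ge0 ?pi_ge0 ?subr_ge0 ?(ltW t0) ?(ltW BQ).
nra.
Qed.

Lemma theta_fun_outside_le2 G (B t : R) : G `<=` A -> (forall x, A x -> Q x <= B -> G x) -> 0 < t ->
  (d + 2)%:R / 4 <= t * B -> theta_fun A t <= 2 * theta_fun G t.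
Proof.
move=> GA short t0 tB; have t20 : 0 < t / 2 by rewrite divr_gt0.
have outside := theta_fun_outside_le GA short t0; have half := theta_fun_half_minimal t20.
rewrite (_ : 2 * (t / 2) = t) in half; last by field.
have A0 : 0 <= theta_fun A t by exact: theta_fun_ge0.
set c := expR _ in outside; have c0 : 0 <= c by exact: expR_ge0.
have : c * theta_fun A (t / 2) <= c * Num.sqrt 2 ^+ d * theta_fun A t.
  by rewrite -mulrA ler_wpM2l.
have : c * Num.sqrt 2 ^+ d * theta_fun A t <= 1 / 2 * theta_fun A t.
  by rewrite ler_wpM2r// expR_tail_sqrt2X_le.
by lra.
Qed.

Lemma kappa_dyadic_le j : kappa <= Num.sqrt (2 ^+ j.+1)^-1 ^+ d * (4 * (Num.sqrt 2 ^+ d.-1) ^+ j) ->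
  kappa ^+ 2 * 2 ^+ j.+1 <= 16.
Proof.
move=> kappa_le; have two0 k : 0 < (2 : R) ^+ k by rewrite exprn_gt0.
have : kappa ^+ 2 <= (2 ^+ j.+1)^-1 ^+ d * (16 * 2 ^+ (d.-1 * j)).
  have -> : (2 ^+ j.+1)^-1 ^+ d * (16 * 2 ^+ (d.-1 * j)) =
      (Num.sqrt (2 ^+ j.+1)^-1 ^+ d * (4 * (Num.sqrt 2 ^+ d.-1) ^+ j)) ^+ 2 :> R.
    rewrite exprMn sqr_sqrtrX ?invr_ge0 ?(ltW (two0 _))// exprMn -[(_ ^+ d.-1) ^+ j]exprM.
    by rewrite sqr_sqrtrX// (_ : 4 ^+ 2 = 16 :> R)//; ring.
  by apply: lerXn2r => //; rewrite nnegrE ?(ltW kappa_gt0)// (le_trans (ltW kappa_gt0) kappa_le).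
rewrite exprVn -exprM ler_pdivlMl// mulrC => kappa2_le.
rewrite -(ler_pM2r (two0 (d.-1 * j)%N)); apply: le_trans kappa2_le.
rewrite -mulrA -exprD ler_wpM2l ?sqr_ge0// ler_weXn2l ?ler1n//.
by case: (d) d2 => [|[|k]]//= _; lia.
Qed.

(* Otherwise the short vectors lie in a hyperplane, whose lattice has too few
   classes modulo 2 for theta_fun to grow like t ^ (- n / 2). *)
Lemma short_basis : d = n -> exists ys : seq L, [/\ free ys, size ys = n &
  forall y, y \in ys -> A y /\ Q y <= 8 * (d + 2)%:R / kappa ^+ 2].
Proof.
move=> d_dim; set B := 8 * _ / _.
have [ys [ys_free ysP ys_span]] := maximal_free_family (fun x => A x /\ Q x <= B).
exists ys; split => //; apply/eqP; rewrite eqn_leq.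
have /eqP <- : free ys := ys_free; rewrite dimvS ?subvf//=; set V := <<ys>>%VS in ys_span *.
rewrite -ltnS ltnNge; apply/negP => dimV.
have {}dimV : (\dim V <= d.-1)%N by move: d2 dimV; rewrite d_dim; lia.
have kappa20 : 0 < kappa ^+ 2 by rewrite exprn_gt0.
have ratio1 : 1 < 16 / kappa ^+ 2.
  rewrite ltr_pdivlMr// mul1r (@lt_trans _ _ 1)//; last by lra.
  by rewrite expr_lt1 ?(ltW kappa_gt0) ?kappa_lt1.
have [j /andP[j_lo j_up]] := pow2_between ratio1.
pose t : R := 1 / 2 * 2^-1 ^+ j.
have tE : t = (2 ^+ j.+1)^-1 by rewrite /t exprVn exprS; field; rewrite expf_neq0.
have t0 : 0 < t by rewrite tE invr_gt0 exprn_gt0.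
have tB : (d + 2)%:R / 4 <= t * B.
  have : 1 <= t * (2 * (16 / kappa ^+ 2)).
    by rewrite tE ler_pdivlMl ?exprn_gt0// mulr1 exprS ler_wpM2l.
  have -> : t * B = t * (2 * (16 / kappa ^+ 2)) * ((d + 2)%:R / 4).
    by rewrite /B; field; rewrite gt_eqF.
  by move=> one_le; rewrite -[leLHS]mul1r ler_wpM2r// divr_ge0.
have GA : A `&` [set` V] `<=` A by move=> x [].
have short x : A x -> Q x <= B -> (A `&` [set` V]) x.
  by move=> Ax Qx; split => //; exact: ys_span.
have A_le := theta_fun_outside_le2 GA short t0 tB.
have G_le := subspace_theta_le j dimV; rewrite -/t in G_le.
have : kappa <= Num.sqrt t ^+ d * (4 * (Num.sqrt 2 ^+ d.-1) ^+ j).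
  apply: (le_trans (kappa_le_scaled_theta t0)).
  by rewrite ler_wpM2l ?exprn_ge0 ?sqrtr_ge0//; move: A_le G_le; lra.
rewrite tE => /kappa_dyadic_le; rewrite leNgt => /negP; apply.
by rewrite mulrC -ltr_pdivrMr.
Qed.

Lemma scaled_theta_bounds t : d = n -> 0 < t <= 1 ->
  kappa <= g t <= kappa + 32 * d%:R ^+ 2 * (d + 2)%:R / kappa ^+ 2 * t.
Proof.
move=> d_dim /andP[t0 t1]; rewrite kappa_le_scaled_theta//=.
have [ys [ys_free size_ys ysP]] := short_basis d_dim.
have short := short_representative sA ys_free size_ys ysP; rewrite -d_dim in short.
set K := _ * _ in short.
have kappa20 : 0 < kappa ^+ 2 by rewrite exprn_gt0.
have K0 : 0 <= K by rewrite mulr_ge0 ?exprn_ge0// divr_ge0 ?mulr_ge0// ltW.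
set u := pi * K / 3 * t.
have g_le : g t <= kappa * expR u by exact: scaled_theta_le.
have u0 : 0 <= u by rewrite !mulr_ge0 ?invr_ge0 ?pi_ge0// ltW.
apply: (@le_trans _ _ (kappa + 3 * u)); last first.
  rewrite lerD2l (_ : 3 * u = pi * (K * t)); last by rewrite /u; field.
  rewrite (_ : 32 * _ * _ / _ * t = 4 * (K * t)); last by rewrite /K; field; rewrite gt_eqF.
  have Kt : 0 <= K * t by rewrite mulr_ge0// ltW.
  by rewrite ler_wpM2r//; have := pihalf_lt2 R; lra.
have [u1|u1] := leP u 1.
  apply: (le_trans g_le); have u01 : 0 <= u <= 1 by rewrite u0.
  have := ler_wpM2l (ltW kappa_gt0) (expR_le1D3x u01).
  have : kappa * u <= 1 * u by rewrite ler_wpM2r// ltW// kappa_lt1.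
  rewrite (_ : kappa * (1 + 3 * u) = kappa + 3 * (kappa * u)); last by ring.
  by rewrite mul1r; lra.
have t01 : 0 < t <= 1 by rewrite t0.
by have := scaled_theta_le2 t01; have := kappa_gt0; lra.
Qed.

End Growth.

End MinimalLattice.

Section InverseIdealLattices.
Variables (R : realType) (L : fieldExtType rat) (E : embedding_system R L).
Local Notation n := (\dim {:L}).
Local Notation O := (@ring_of_integers L).
Local Notation density := (density E).
Implicit Types (A J : set L) (tau : 'I_n -> R) (x : L) (t c : R).

Lemma absnorm2 : absnorm E 2 = 2 ^+ n.
Proof.
rewrite /absnorm; under eq_bigr => i _ do
  rewrite rmorph_nat -[2](rmorph_nat (real_complex R)) normc_real ger0_norm//.
by rewrite prodr_const card_ord.
Qed.

Lemma sqnorm_ge_dim tau x : (forall i, 0 < tau i) -> 1 <= absnorm E x ^+ 2 * \prod_i tau i ->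
  n%:R <= sqnorm E tau x.
Proof.
move=> tau_gt0 norm_ge1; have n0 : (0 < n)%N := adim_gt0 {:L}.
pose F i := tau i * normc (E i x) ^+ 2.
have F0 i : 0 <= F i by rewrite mulr_ge0 ?sqr_ge0// ltW.
have AGM := (leif_AGM (A := 'I_n) (E := F) (fun i _ => F0 i)).1; rewrite card_ord in AGM.
have : 1 <= ((\sum_i F i) / n%:R) ^+ n.
  by apply: le_trans AGM; rewrite big_split/= prodrXl mulrC.
by rewrite expr_ge1 ?divr_ge0 ?sumr_ge0// ler_pdivlMr ?ltr0n// mul1r.
Qed.

Lemma covol_gt0 tau : weight E tau -> 0 < covol tau.
Proof. by move=> [tau_gt0 _]; rewrite sqrtr_gt0; apply: prodr_gt0. Qed.

Lemma normalized_theta_rescale0 tau A t : 0 <= t -> normalized_theta E (rescale t tau) A 0 =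
  ((Num.sqrt t ^+ n * covol tau)%:E * theta_series E tau A t)%E.
Proof. by move=> t0; rewrite /normalized_theta theta_rescale0 covol_rescale. Qed.

Section DensityTheta.
Variables (tau : 'I_n -> R) (A : set L) (c : R).
Hypotheses (wt : weight E tau) (densA : has_density E A c).

Let dyadic_gt0 t k : 0 < t -> 0 < t * 2^-1 ^+ k.
Proof. by move=> t0; rewrite mulr_gt0// exprn_gt0. Qed.

Let cvg_theta_dyadic t : 0 < t -> (fun k => ((Num.sqrt (t * 2^-1 ^+ k) ^+ n * covol tau)%:E *
  theta_series E tau A (t * 2^-1 ^+ k))%E) @ \oo --> c%:E.
Proof.
move=> t0; apply: cvg_trans (densA 0 (weight_rescale t0 wt)); apply: near_eq_cvg; apply: nearW => k.
by rewrite rescaleA [_ * t]mulrC normalized_theta_rescale0// ltW// dyadic_gt0.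
Qed.

Lemma has_density_theta_finite : theta_finite E tau A.
Proof.
move=> t t0; move/fine_cvgP: (cvg_theta_dyadic t0) => [[k _ /(_ k (leqnn k))/= fin] _].
have scale_gt0 : 0 < Num.sqrt (t * 2^-1 ^+ k) ^+ n * covol tau.
  by rewrite mulr_gt0 ?covol_gt0// exprn_gt0// sqrtr_gt0 dyadic_gt0.
have le_dyadic : t * 2^-1 ^+ k <= t.
  by rewrite ler_piMr ?(ltW t0)// exprn_ile1 ?invr_ge0// invf_le1// ler1n.
apply: le_lt_trans (theta_series_nonincreasing E wt.1 A le_dyadic) _.
move: fin (theta_series_ge0 E tau A (t * 2^-1 ^+ k)).
case: (theta_series _ _ _ _) => [r _ _| |//]; first exact: ltry.
by rewrite mulry gtr0_sg// mul1e.
Qed.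

Lemma has_density_cvg_scaled_theta t : 0 < t ->
  (fun k => scaled_theta E tau n A (t * 2^-1 ^+ k)) @ \oo --> c / covol tau.
Proof.
move=> t0; have /fine_cvgP[_ fine_cvg] := cvg_theta_dyadic t0.
apply: cvg_trans (cvgM fine_cvg (cvg_cst (covol tau)^-1)); apply: near_eq_cvg; apply: nearW => k.
rewrite /= (theta_seriesE has_density_theta_finite (dyadic_gt0 k t0)) -EFinM /=.
by rewrite /scaled_theta mulrAC mulfK// gt_eqF// covol_gt0.
Qed.

End DensityTheta.

Hypothesis O_dens : 0 < density O.

Let N_gt0 J : nonzero_ideal J -> 0 < (ideal_norm J)%:R :> R.
Proof. by move=> nJ; rewrite ltr0n (ideal_norm_gt0 O_dens). Qed.

Definition kappa J : R := density (inv_ideal J) / (ideal_norm J)%:R.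

Lemma kappa_ge J : nonzero_ideal J -> density O <= kappa J.
Proof.
move=> nJ; have [dens_le _] := inv_ideal_density O_dens nJ.
have J0 := fractional_density_gt0 O_dens (nonzero_ideal_fractional nJ).
rewrite /kappa ler_pdivlMr ?N_gt0// -(ler_pM2l J0); apply: le_trans dens_le.
by rewrite mulrCA [density J * _]mulrC (ideal_norm_density O_dens).
Qed.

Lemma kappa_gt0 J : nonzero_ideal J -> 0 < kappa J.
Proof. by move=> nJ; apply: lt_le_trans O_dens (kappa_ge nJ). Qed.

Lemma absnorm_inv_ideal_ge1 J x : nonzero_ideal J -> inv_ideal J x -> x != 0 ->
  1 <= absnorm E x * (ideal_norm J)%:R.
Proof.
move=> nJ Jx x0; have nxJ := nonzero_ideal_dilate nJ x0 Jx.
by rewrite -(ideal_norm_dilate O_dens nJ x0 nxJ) ler1n (ideal_norm_gt0 O_dens).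
Qed.

Lemma fractional_two_transversal A : fractional A ->
  exists2 s, two_transversal A s & size s = (2 ^ n)%N.
Proof.
move=> fA; have [sA _ _ _] := fA; have f2A := fractional_dilate fA (two_neq0 L).
have [s [s_inc AE size_s]] := fractional_index O_dens f2A fA (dilate2_sub sA).
exists s => //; apply/eqP; rewrite -(eqr_nat R) natrX; apply/eqP.
have A0 : density A != 0 by rewrite gt_eqF// (fractional_density_gt0 O_dens).
apply: (mulIf A0); move: size_s; rewrite (density_dilate O_dens fA (two_neq0 L)) absnorm2 => size_s.
by rewrite [in RHS]size_s [RHS]mulrC mulrA divfK// expf_neq0.
Qed.

Lemma inv_ideal_minimal_lattice J tau : nonzero_ideal J -> weight E tau ->
  \prod_i tau i = (ideal_norm J)%:R ^+ 2 -> minimal_lattice E tau n (inv_ideal J) (kappa J).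
Proof.
move=> nJ wt prod_tau; have fA := inv_ideal_fractional nJ; have [sA _ _ _] := fA.
have densA := fractional_has_density O_dens fA.
split => //.
- exact: has_density_theta_finite densA.
- exact: fractional_two_transversal.
- move=> x Jx x0; apply: sqnorm_ge_dim; first exact: wt.1.
  by rewrite prod_tau -exprMn exprn_ege1// absnorm_inv_ideal_ge1.
- exact: kappa_gt0.
- move=> t t0; have := has_density_cvg_scaled_theta wt densA t0.
  by rewrite /covol prod_tau sqrtr_sqr gtr0_norm ?N_gt0.
Qed.

(* Minkowski's bound on the discriminant, in a weak form. *)
Lemma dim_le_disc (d : nat) : (2 <= n)%N -> density O = (Num.sqrt d%:R)^-1 -> (n <= d)%N.
Proof.
move=> n2 O_densE; have nO := roi_ideal L.
have prod1 : \prod_(i < n) 1 = (ideal_norm O)%:R ^+ 2 :> R.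
  by rewrite big1// (ideal_norm_roi O_dens) expr1n.
have kappa_lt := kappa_sqrt2X_lt (inv_ideal_minimal_lattice nO (weight1 E) prod1) n2.
have sqrt2X0 : 0 <= Num.sqrt 2 ^+ n :> R by rewrite exprn_ge0// sqrtr_ge0.
have sqrtd0 : 0 < Num.sqrt d%:R :> R by rewrite -invr_gt0 -O_densE.
have sqrt_lt : Num.sqrt 2 ^+ n < 2 * Num.sqrt d%:R :> R.
  rewrite -ltr_pdivrMr// mulrC -O_densE; apply: le_lt_trans kappa_lt.
  by rewrite ler_wpM2r// kappa_ge.
have : (Num.sqrt 2 ^+ n) ^+ 2 < (2 * Num.sqrt d%:R) ^+ 2 :> R.
  by rewrite ltr_sqr ?nnegrE// mulr_ge0// ltW.
rewrite sqr_sqrtrX// exprMn sqr_sqrtr// -!natrX -natrM ltr_nat.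
case: (n) n2 => [//|[//|m]] _; have : (m < 2 ^ m)%N by exact: ltn_expl.
by rewrite !expnS; move: (2 ^ m)%N; clear; lia.
Qed.

End InverseIdealLattices.

(** * Unfolding over units and ideal classes *)

Section UnitUnfolding.
Variables (R : realType) (L : fieldExtType rat) (E : embedding_system R L).
Local Notation n := (\dim {:L}).
Local Notation O := (@ring_of_integers L).
Variable X : translation_space R n.
Local Notation T := (ts_type X).
Local Notation m := (ts_measure X).
Local Notation c := (@ts_coord R n X).
Local Notation conj := (conj_index E).
Implicit Types (J I : set L) (x y u : L) (v : T) (w : R).

(* weight_at v w runs through the conjugation-invariant weights of product
   e^(2 w).  The coordinate coord_sum and the differences c i - c (conj i) do not
   enter the weight; cutoff makes them integrable.  Multiplication by x becomes
   the translation by log_embedding x together with a shift of w by ln |N x|. *)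
Definition coord_sum v : R := \sum_i c i v.
Definition coord_dev i v : R := c i v + c (conj i) v - 2 / n%:R * coord_sum v.
Definition weight_at v w : 'I_n -> R := fun i => expR (coord_dev i v + 2 * w / n%:R).
Definition cutoff v : R := expR (- (`|coord_sum v| + \sum_i `|c i v - c (conj i) v|)).
Definition kernel v w x : R := expR (- (pi * sqnorm E (weight_at v w) x)).
Definition log_embedding x : 'I_n -> R :=
  fun i => ln (normc (E i x)) - ln (absnorm E x) / n%:R.

Lemma dim_gt0 : 0 < n%:R :> R.
Proof. by rewrite ltr0n; exact: (adim_gt0 {:L}). Qed.

Lemma sumr_const_dim (a : R) : \sum_(i < n) a = n%:R * a.
Proof. by rewrite sumr_const card_ord mulr_natl. Qed.

Lemma sum_conj_index (F : 'I_n -> R) : \sum_i F (conj i) = \sum_i F i.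
Proof. by rewrite [RHS](reindex_inj (inv_inj (conj_indexK E))). Qed.

Lemma weight_weight_at v w : weight E (weight_at v w).
Proof.
split => i; first exact: expR_gt0.
by rewrite /weight_at /coord_dev conj_indexK [c (conj i) v + _]addrC.
Qed.

Lemma sum_coord_dev v : \sum_i coord_dev i v = 0.
Proof.
rewrite /coord_dev sumrB big_split/= (sum_conj_index (fun i => c i v)) sumr_const_dim.
by rewrite -/(coord_sum v); field; rewrite gt_eqF// dim_gt0.
Qed.

Lemma prod_weight_at v w : \prod_i weight_at v w i = expR w ^+ 2.
Proof.
rewrite /weight_at -expR_sum -expRM_natl; congr expR.
by rewrite big_split/= sum_coord_dev add0r sumr_const_dim; field; rewrite gt_eqF// dim_gt0.
Qed.

Lemma weight_atD v w w' : weight_at v (w + w') = rescale (expR (2 * w' / n%:R)) (weight_at v w).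
Proof.
apply/funext => i; rewrite /rescale /weight_at -expRD; congr expR.
by rewrite mulrDr mulrDl addrA addrC.
Qed.

Lemma sum_log_embedding x : x != 0 -> \sum_i log_embedding x i = 0.
Proof.
move=> x0; rewrite /log_embedding sumrB sumr_const_dim.
have -> : \sum_i ln (normc (E i x)) = ln (absnorm E x).
  apply: expR_inj; rewrite expR_sum lnK ?posrE ?absnorm_gt0//.
  by apply: eq_bigr => i _; rewrite lnK// posrE normc_embedding_gt0.
by field; rewrite gt_eqF// dim_gt0.
Qed.

Lemma log_embedding_conj x i : log_embedding x (conj i) = log_embedding x i.
Proof. by rewrite /log_embedding embedding_conj normc_conj. Qed.

Lemma coord_sum_translate x v : x != 0 ->
  coord_sum (ts_translate (log_embedding x) v) = coord_sum v.
Proof.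
move=> x0; rewrite /coord_sum; under eq_bigr do rewrite ts_coord_translate.
by rewrite big_split/= sum_log_embedding// addr0.
Qed.

Lemma cutoff_translate x v : x != 0 -> cutoff (ts_translate (log_embedding x) v) = cutoff v.
Proof.
move=> x0; rewrite /cutoff coord_sum_translate//; congr (expR (- (_ + _))).
by apply: eq_bigr => i _; rewrite !ts_coord_translate log_embedding_conj; congr `|_|; ring.
Qed.

Lemma weight_at_translate x v w : x != 0 ->
  weight_at (ts_translate (log_embedding x) v) (w + ln (absnorm E x)) = twist E (weight_at v w) x.
Proof.
move=> x0; apply/funext => i.
rewrite /twist /weight_at /coord_dev coord_sum_translate// !ts_coord_translate log_embedding_conj.
have -> : normc (E i x) ^+ 2 = expR (2%:R * ln (normc (E i x))).
  by rewrite expRM_natl lnK// posrE normc_embedding_gt0.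
by rewrite -expRD; congr expR; rewrite /log_embedding; field; rewrite gt_eqF// dim_gt0.
Qed.

Lemma kernel_translate x y v w : x != 0 ->
  kernel (ts_translate (log_embedding x) v) (w + ln (absnorm E x)) y = kernel v w (x * y).
Proof. by move=> x0; rewrite /kernel sqnorm_twist weight_at_translate. Qed.

Lemma measurable_coord_sum : measurable_fun setT coord_sum.
Proof. by apply: measurable_sum => i; exact: measurable_ts_coord. Qed.

Lemma measurable_coord_dev i : measurable_fun setT (coord_dev i).
Proof.
apply: measurable_funB; first by apply: measurable_funD; exact: measurable_ts_coord.
by apply: measurable_funM => //; exact: measurable_coord_sum.
Qed.

Lemma measurable_cutoff : measurable_fun setT cutoff.
Proof.
apply: measurableT_comp => //; apply: measurableT_comp => //; apply: measurable_funD.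
  by apply: measurableT_comp => //; exact: measurable_coord_sum.
apply: measurable_sum => i; apply: measurableT_comp => //.
by apply: measurable_funB; exact: measurable_ts_coord.
Qed.

Lemma measurable_kernel w x : measurable_fun setT (fun v => kernel v w x).
Proof.
apply: measurableT_comp => //; apply: measurableT_comp => //.
apply: measurable_funM => //; apply: measurable_sum => i.
apply: measurable_funM => //; apply: measurableT_comp => //.
by apply: measurable_funD => //; exact: measurable_coord_dev.
Qed.

Lemma kernel_gt0 v w x : 0 < kernel v w x. Proof. exact: expR_gt0. Qed.
Lemma kernel_ge0 v w x : 0 <= kernel v w x. Proof. exact: expR_ge0. Qed.
Lemma cutoff_gt0 v : 0 < cutoff v. Proof. exact: expR_gt0. Qed.
Lemma cutoff_ge0 v : 0 <= cutoff v. Proof. exact: expR_ge0. Qed.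

Lemma cutoff_kernel_ge0 v w x : 0 <= cutoff v * kernel v w x.
Proof. exact: mulr_ge0 (cutoff_ge0 _) (kernel_ge0 _ _ _). Qed.

Lemma measurable_cutoff_kernel w x : measurable_fun setT (fun v => (cutoff v * kernel v w x)%:E).
Proof.
apply/measurable_EFinP.
by apply: measurable_funM; [exact: measurable_cutoff|exact: measurable_kernel].
Qed.

Definition arch_integral w : \bar R := (\int[m]_v (cutoff v * kernel v w 1)%:E)%E.

Lemma integral_cutoff_kernel w x : x != 0 ->
  (\int[m]_v (cutoff v * kernel v w x)%:E = arch_integral (w + ln (absnorm E x)))%E.
Proof.
move=> x0; rewrite /arch_integral -[RHS](ts_integral_translate (log_embedding x)).
- by apply: eq_integral => v _; rewrite cutoff_translate// kernel_translate// mulr1.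
- exact: measurable_cutoff_kernel.
- by move=> v; rewrite lee_fin cutoff_kernel_ge0.
Qed.

Definition units : set L := [set u | [/\ O u, O u^-1 & u != 0]].

Lemma units1 : units 1.
Proof. by split; rewrite ?invr1; [exact: roi1|exact: roi1|exact: oner_neq0]. Qed.

Lemma unitsM u u' : units u -> units u' -> units (u * u').
Proof.
by move=> [? ? ?] [? ? ?]; split; [exact: roiM|rewrite invfM; exact: roiM|rewrite mulf_neq0].
Qed.

Lemma unitsV u : units u -> units u^-1.
Proof. by move=> [? ? ?]; split; rewrite ?invrK ?invr_eq0. Qed.

Lemma countable_fieldExt (A : set L) : countable A.
Proof.
apply/countable_injP; exists (fun x : L => choice.pickle (rVof (vbasis {:L}) x)) => x y _ _.
by move=> /(pcan_inj choice.pickleK)/(can_inj (rVofK (vbasisP _))).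
Qed.

Hypothesis O_dens : 0 < density E O.

Lemma absnorm_units u : units u -> absnorm E u = 1.
Proof.
move=> [Ou Ou' u0]; have N0 := absnorm_gt0 E u0.
have uO : dilate u O = O.
  apply/seteqP; split => [_ [y Oy <-]|y Oy]; first exact: roiM.
  by exists (u^-1 * y); [exact: roiM|rewrite mulVKf].
have := density_dilate O_dens (roi_fractional L) u0; rewrite uO => densE.
by apply: (mulfI (lt0r_neq0 O_dens)); rewrite mulr1 {1}densE divfK ?gt_eqF.
Qed.

Lemma kernel_translate_units u y v w : units u ->
  kernel (ts_translate (log_embedding u) v) w y = kernel v w (u * y).
Proof.
move=> Uu; have [_ _ u0] := Uu.
by have := kernel_translate y v w u0; rewrite (absnorm_units Uu) ln1 addr0.
Qed.

Definition unit_theta v : \bar R := (\esum_(u in units) (kernel v 0 u)%:E)%E.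

Lemma unit_theta_gt0 v : (0 < unit_theta v)%E.
Proof.
apply: (@lt_le_trans _ _ (kernel v 0 1)%:E); first by rewrite lte_fin kernel_gt0.
rewrite -(@esum_set1 R _ (1 : L) (fun u => (kernel v 0 u)%:E)) ?lee_fin ?kernel_ge0//.
by apply: esum_setS => _ ->; exact: units1.
Qed.

Lemma unit_theta_fin_num v : unit_theta v \is a fin_num.
Proof.
have densO := has_density_gt0 O_dens.
rewrite ge0_fin_numE ?(ltW (unit_theta_gt0 v))//.
apply: le_lt_trans (has_density_theta_finite (weight_weight_at v 0) densO ltr01).
apply: (@le_trans _ _ (\esum_(u in O) (kernel v 0 u)%:E)%E).
  by apply: esum_setS => u [].
by apply: le_esum => u _; rewrite /theta_term mulr1.
Qed.

Lemma fine_unit_theta_gt0 v : 0 < fine (unit_theta v).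
Proof. by rewrite fine_gt0// unit_theta_gt0 -ge0_fin_numE ?unit_theta_fin_num ?ltW ?unit_theta_gt0. Qed.

Lemma unit_theta_translate u v : units u ->
  unit_theta (ts_translate (log_embedding u) v) = unit_theta v.
Proof.
move=> Uu; have [Ou Ou' u0] := Uu.
rewrite /unit_theta [RHS](@reindex_esum R _ _ units units (fun y => u * y)).
  by apply: eq_esum => y _; rewrite kernel_translate_units.
split; [by move=> y; exact: unitsM|by move=> y z _ _ /(mulfI u0)|].
by move=> y Uy; exists (u^-1 * y); [exact: unitsM (unitsV Uu) Uy|rewrite mulVKf].
Qed.

(* The translates of unit_partition by the units sum to 1: this replaces a
   fundamental domain, so that Dirichlet's unit theorem is not needed. *)
Definition unit_partition v : R := kernel v 0 1 / fine (unit_theta v).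

Lemma unit_partition_gt0 v : 0 < unit_partition v.
Proof. by rewrite divr_gt0 ?kernel_gt0 ?fine_unit_theta_gt0. Qed.

Lemma measurable_unit_partition : measurable_fun setT unit_partition.
Proof.
apply: measurable_funM; first exact: measurable_kernel.
have -> : (fun v => (fine (unit_theta v))^-1) = (fun v => expR (- ln (fine (unit_theta v)))).
  by apply/funext => v; rewrite expRN lnK// posrE fine_unit_theta_gt0.
apply: measurableT_comp => //; apply: measurableT_comp => //; apply: measurableT_comp => //.
apply: measurableT_comp => //; apply: measurable_esum; first exact: countable_fieldExt.
  by move=> u _; apply/measurable_EFinP; exact: measurable_kernel.
by move=> u v _; rewrite lee_fin kernel_ge0.
Qed.

Lemma unit_partition_sum v :
  (\esum_(u in units) (unit_partition (ts_translate (log_embedding u) v))%:E = 1)%E.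
Proof.
have theta0 := fine_unit_theta_gt0 v.
transitivity (\esum_(u in units) ((fine (unit_theta v))^-1%:E * (kernel v 0 u)%:E))%E.
  apply: eq_esum => u Uu.
  by rewrite /unit_partition unit_theta_translate// kernel_translate_units// mulr1 mulrC EFinM.
rewrite esumZl ?invr_ge0 ?ltW//; last by move=> u _; rewrite lee_fin kernel_ge0.
by rewrite -/(unit_theta v) -[X in (_ * X)%E]fineK ?unit_theta_fin_num// -EFinM mulVf// gt_eqF.
Qed.

Definition unit_cutoff v : R := cutoff v * unit_partition v.

Lemma unit_cutoff_gt0 v : 0 < unit_cutoff v.
Proof. by rewrite mulr_gt0 ?cutoff_gt0 ?unit_partition_gt0. Qed.

Lemma unit_cutoff_ge0 v : 0 <= unit_cutoff v.
Proof. exact: ltW (unit_cutoff_gt0 v). Qed.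

Lemma unit_cutoff_kernel_ge0 v w x : 0 <= unit_cutoff v * kernel v w x.
Proof. exact: mulr_ge0 (unit_cutoff_ge0 _) (kernel_ge0 _ _ _). Qed.

Lemma measurable_unit_cutoff : measurable_fun setT unit_cutoff.
Proof. by apply: measurable_funM; [exact: measurable_cutoff|exact: measurable_unit_partition]. Qed.

Lemma measurable_unit_cutoff_kernel w x :
  measurable_fun setT (fun v => (unit_cutoff v * kernel v w x)%:E).
Proof.
apply/measurable_EFinP.
by apply: measurable_funM; [exact: measurable_unit_cutoff|exact: measurable_kernel].
Qed.

Lemma integral_unit_cutoff_kernelV u x w : units u ->
  (\int[m]_v (unit_cutoff v * kernel v w (u^-1 * x))%:E =
   \int[m]_v ((cutoff v * kernel v w x)%:E *
     (unit_partition (ts_translate (log_embedding u) v))%:E))%E.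
Proof.
move=> Uu; have [_ _ u0] := Uu; rewrite -(ts_integral_translate (log_embedding u)).
- apply: eq_integral => v _; rewrite /unit_cutoff cutoff_translate// kernel_translate_units//.
  by rewrite mulVKf// -EFinM mulrAC.
- exact: measurable_unit_cutoff_kernel.
- by move=> v; rewrite lee_fin unit_cutoff_kernel_ge0.
Qed.

Lemma esum_units_unfold w x : x != 0 ->
  (\esum_(u in units) \int[m]_v (unit_cutoff v * kernel v w (u * x))%:E =
   arch_integral (w + ln (absnorm E x)))%E.
Proof.
move=> x0; rewrite -integral_cutoff_kernel//.
rewrite (@reindex_esum R _ _ units units (fun u => u^-1)); last first.
  split; [by move=> u; exact: unitsV|by move=> u u' _ _ /invr_inj|].
  by move=> u Uu; exists u^-1; [exact: unitsV|rewrite invrK].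
under eq_esum => u Uu do rewrite integral_unit_cutoff_kernelV//.
rewrite -integral_esum; last 3 first.
- exact: countable_fieldExt.
- move=> u _; apply: emeasurable_funM; first exact: measurable_cutoff_kernel.
  apply/measurable_EFinP; apply: (measurableT_comp measurable_unit_partition).
  exact: measurable_ts_translate.
- move=> u v _; rewrite -EFinM lee_fin.
  exact: mulr_ge0 (cutoff_kernel_ge0 _ _ _) (ltW (unit_partition_gt0 _)).
apply: eq_integral => v _; rewrite esumZl ?cutoff_kernel_ge0 ?unit_partition_sum ?mule1//.
by move=> u _; rewrite lee_fin ltW// unit_partition_gt0.
Qed.

End UnitUnfolding.

Section IdealClasses.
Variable L : fieldExtType rat.
Local Notation O := (@ring_of_integers L).
Implicit Types (J I : set L) (x y u : L).

Definition ideal_class I : set (set L) :=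
  [set J | nonzero_ideal J /\ exists2 x, x != 0 & J = dilate x I].

Lemma ideal_class_dilate I x : x != 0 -> ideal_class (dilate x I) = ideal_class I.
Proof.
move=> x0; apply/seteqP; split => J [nJ [y y0 JE]]; split => //.
  by exists (y * x); [rewrite mulf_neq0|rewrite JE dilateA].
by exists (y / x); [rewrite mulf_neq0 ?invr_eq0|rewrite JE dilateA divfK].
Qed.

Definition class_rep I : set L := xget set0 (ideal_class I).

Lemma class_repP I : nonzero_ideal I -> ideal_class I (class_rep I).
Proof.
move=> nI; apply: xgetPex; exists I; split => //.
by exists 1; [exact: oner_neq0|rewrite dilate1].
Qed.

Lemma class_rep_dilate I x : x != 0 -> class_rep (dilate x I) = class_rep I.
Proof. by move=> x0; rewrite /class_rep ideal_class_dilate. Qed.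

Definition class_gen I : L := xget 0 [set x | x != 0 /\ I = dilate x (class_rep I)].

Lemma class_genP I : nonzero_ideal I -> class_gen I != 0 /\ I = dilate (class_gen I) (class_rep I).
Proof.
move=> /class_repP[_ [x x0 repE]].
apply: (@xgetPex _ 0 [set y | y != 0 /\ I = dilate y (class_rep I)]).
by exists x^-1; split; [rewrite invr_eq0|rewrite [in RHS]repE dilateA mulVf// dilate1].
Qed.

Definition class_reps : set (set L) := [set J | nonzero_ideal J /\ class_rep J = J].

Lemma class_rep_reps I : nonzero_ideal I -> class_reps (class_rep I).
Proof.
move=> nI; have [nJ [x x0 repE]] := class_repP nI.
by split => //; rewrite {1}repE class_rep_dilate.
Qed.

Lemma dilate_unit u I : units u -> nonzero_ideal I -> dilate u I = I.
Proof.
move=> [Ou Ou' u0] [_ _ _ IM _]; apply/seteqP; split => [_ [z Iz <-]|z Iz]; first exact: IM.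
by exists (u^-1 * z); [exact: IM|rewrite mulVKf].
Qed.

Definition inv_ideal_neq0 J : set L := [set x | inv_ideal J x /\ x != 0].

Lemma inv_ideal0 J : inv_ideal J 0.
Proof. by move=> z _; rewrite mul0r; exact: roi0. Qed.

Lemma inv_ideal_class_gen I u : nonzero_ideal I -> O u ->
  inv_ideal (class_rep I) (u * class_gen I).
Proof.
move=> nI Ou z Jz; rewrite -mulrA; apply: roiM => //; have [IO _ _ _ _] := nI; apply: IO.
by rewrite [X in X _](class_genP nI).2; exists z.
Qed.

Lemma esum_inv_ideal (R : realType) (f : L -> \bar R) J : (forall x, 0 <= f x)%E ->
  (\esum_(x in inv_ideal J) f x = f 0%R + \esum_(x in inv_ideal_neq0 J) f x)%E.
Proof.
move=> f0; have -> : inv_ideal J = [set 0] `|` inv_ideal_neq0 J.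
  apply/seteqP; split => x; last by move=> [->|[]//]; exact: inv_ideal0.
  by have [->|x0] := eqVneq x 0; [left|right].
rewrite esum_setU// ?esum_set1//.
by apply/disj_setPS => x [-> []]; rewrite eqxx.
Qed.

Variables (R : realType) (E : embedding_system R L).
Hypothesis O_dens : 0 < density E O.

Lemma dilate_eq_unit J x y : nonzero_ideal J -> x != 0 -> y != 0 -> dilate x J = dilate y J ->
  units (x / y).
Proof.
have ratio_integral a b : nonzero_ideal J -> b != 0 -> dilate a J = dilate b J -> O (a / b).
  move=> nJ b0 abE; apply: (stabilizer_integral O_dens (nonzero_ideal_fractional nJ)) => z Jz.
  have : dilate a J (a * z) by exists z.
  by rewrite abE => -[t Jt tE]; rewrite mulrAC -tE [b * t]mulrC mulfK.
move=> nJ x0 y0 xyE; split; [exact: ratio_integral|rewrite invfM invrK mulrC; exact: ratio_integral|].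
by rewrite mulf_neq0 ?invr_eq0.
Qed.

Local Notation ideals := [set I : set L | nonzero_ideal I].

(* An integral ideal in the class of J is x J with x in the inverse of J, and x
   is unique up to units. *)
Lemma ideal_unit_bij :
  set_bij ([set: ideals] `*`` (fun=> @units L)) (class_reps `*`` inv_ideal_neq0)
  (fun p => (class_rep (val p.1), p.2 * class_gen (val p.1))).
Proof.
have nonzero (I : ideals) : nonzero_ideal (val I) := set_mem (valP I).
split.
- move=> [I u] [_ [Ou Ou' u0]] /=; split => /=; first exact: class_rep_reps (nonzero I).
  by split; [exact: inv_ideal_class_gen (nonzero I) Ou|rewrite mulf_neq0// (class_genP (nonzero I)).1].
- move=> [I u] [I' u']; rewrite !inE/= => -[_ Uu] [_ Uu'] [repE genE].
  have [gen0 IE] := class_genP (nonzero I); have [_ IE'] := class_genP (nonzero I').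
  have eqI : I = I'.
    apply: val_inj; rewrite -(dilate_unit Uu (nonzero I)) -(dilate_unit Uu' (nonzero I')).
    by rewrite [X in dilate u X]IE [X in dilate u' X]IE' !dilateA genE repE.
  by move: genE; rewrite eqI => /mulIf; rewrite eqI in gen0 => /(_ gen0) ->.
- move=> [J x] [[nJ repJ] [/= Jx x0]]; have nI := nonzero_ideal_dilate nJ x0 Jx.
  have [gen0 IE] := class_genP nI.
  have repI : class_rep (dilate x J) = J by rewrite class_rep_dilate.
  rewrite repI in IE; exists (SigSub (mem_set nI : dilate x J \in ideals), x / class_gen (dilate x J)).
    by split => //=; exact: dilate_eq_unit IE.
  by rewrite /= repI divfK.
Qed.

End IdealClasses.

Section ClassTheta.
Variables (R : realType) (L : fieldExtType rat) (E : embedding_system R L).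
Local Notation n := (\dim {:L}).
Local Notation O := (@ring_of_integers L).
Variable X : translation_space R n.
Local Notation T := (ts_type X).
Local Notation m := (ts_measure X).
Local Notation ideals := [set I : set L | nonzero_ideal I].
Local Notation kernel := (@kernel R L E X).
Local Notation arch_integral := (arch_integral E X).
Local Notation unit_cutoff := (@unit_cutoff R L E X).
Local Notation kappa := (kappa E).
Local Notation class_reps := (@class_reps L).
Implicit Types (J I : set L) (x : L) (v : T) (w : R).
Hypotheses (O_dens : 0 < density E O) (n2 : (2 <= n)%N).

Let cutoff0 v : 0 <= unit_cutoff v := unit_cutoff_ge0 O_dens v.
Let cutoff_kernel0 v w x : 0 <= unit_cutoff v * kernel v w x := unit_cutoff_kernel_ge0 O_dens v w x.
Let mcutoff : measurable_fun setT unit_cutoff := measurable_unit_cutoff O_dens.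

Definition ln_norm I : R := ln (ideal_norm I)%:R.
Definition ideal_theta w : \bar R :=
  (\esum_(I in [set: ideals]) arch_integral (w + ln_norm (val I)))%E.

Lemma ideal_norm_gt0R I : nonzero_ideal I -> 0 < (ideal_norm I)%:R :> R.
Proof. by move=> nI; rewrite ltr0n (ideal_norm_gt0 O_dens). Qed.

Lemma ln_norm_class I : nonzero_ideal I ->
  ln_norm I = ln_norm (class_rep I) + ln (absnorm E (class_gen I)).
Proof.
move=> nI; have [gen0 IE] := class_genP nI; have [nJ _] := class_rep_reps nI.
have := ideal_norm_dilate O_dens nJ gen0; rewrite -IE => /(_ nI); rewrite /ln_norm => ->.
by rewrite lnM ?posrE ?absnorm_gt0 ?ideal_norm_gt0R// addrC.
Qed.

Lemma ideal_theta_reps w : (ideal_theta w = \esum_(J in class_reps) \esum_(x in inv_ideal_neq0 J)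
  \int[m]_v (unit_cutoff v * kernel v (w + ln_norm J) x)%:E)%E.
Proof.
have int0 J x : (0 <= \int[m]_v (unit_cutoff v * kernel v (w + ln_norm J) x)%:E)%E.
  by apply: integral_ge0 => v _; rewrite lee_fin.
rewrite (@esum_esum R _ _ _ (@inv_ideal_neq0 L))// (reindex_esum _ _ _ _ (ideal_unit_bij O_dens)) /=.
rewrite -(@esum_esum R _ _ [set: ideals] (fun=> @units L) (fun (I : ideals) u => \int[m]_v
  (unit_cutoff v * kernel v (w + ln_norm (class_rep (val I))) (u * class_gen (val I)))%:E)%E)//.
apply: eq_esum => I _; have nI := set_mem (valP I); have [gen0 _] := class_genP nI.
rewrite ln_norm_class// addrA; apply: esym.
exact: (esum_units_unfold X O_dens (w + ln_norm (class_rep (val I))) gen0).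
Qed.

Definition theta_scale w : R := expR (2 * w / n%:R).
Definition fiber_theta J v w : R :=
  theta_fun E (weight_at E v (ln_norm J)) (inv_ideal J) (theta_scale w).

Let fiber_minimal J v (nJ : nonzero_ideal J) :
  minimal_lattice E (weight_at E v (ln_norm J)) n (inv_ideal J) (kappa J).
Proof.
apply: inv_ideal_minimal_lattice => //; first exact: weight_weight_at.
by rewrite prod_weight_at /ln_norm lnK// posrE ideal_norm_gt0R.
Qed.

Lemma theta_term_kernel J v w x :
  theta_term E (weight_at E v (ln_norm J)) (theta_scale w) x = kernel v (w + ln_norm J) x.
Proof. by rewrite /theta_term /kernel addrC weight_atD sqnorm_rescale mulrA. Qed.

Lemma fiber_thetaE J v w : nonzero_ideal J ->
  ((fiber_theta J v w)%:E = 1 + \esum_(x in inv_ideal_neq0 J) (kernel v (w + ln_norm J) x)%:E)%E.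
Proof.
move=> nJ; rewrite -(theta_seriesE (minimal_finite (fiber_minimal v nJ))) ?expR_gt0//.
rewrite /theta_series esum_inv_ideal => [|x]; last by rewrite lee_fin theta_term_ge0.
by rewrite theta_term0; apply: congr1; apply: eq_esum => x _; rewrite theta_term_kernel.
Qed.

Lemma fiber_theta_ge1 J v w : nonzero_ideal J -> 1 <= fiber_theta J v w.
Proof.
move=> nJ; rewrite -lee_fin fiber_thetaE//; apply: leeDl; apply: esum_ge0 => x _.
by rewrite lee_fin kernel_ge0.
Qed.

Lemma measurable_fiber_theta J w : nonzero_ideal J ->
  measurable_fun setT (fun v => fiber_theta J v w).
Proof.
move=> nJ; apply/measurable_EFinP.
under [EFin \o _]funext => v do rewrite /= fiber_thetaE//.
apply: emeasurable_funD => //; apply: measurable_esum; first exact: countable_fieldExt.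
  by move=> x _; apply/measurable_EFinP; exact: measurable_kernel.
by move=> x v _; rewrite lee_fin kernel_ge0.
Qed.

Definition class_theta J w : \bar R := (\int[m]_v (unit_cutoff v * (fiber_theta J v w - 1))%:E)%E.

Lemma ideal_theta_classes w : (ideal_theta w = \esum_(J in class_reps) class_theta J w)%E.
Proof.
rewrite ideal_theta_reps; apply: eq_esum => J [nJ _].
rewrite -integral_esum; last 3 first.
- exact: countable_fieldExt.
- by move=> x _; exact: measurable_unit_cutoff_kernel.
- by move=> x v _; rewrite lee_fin.
apply: eq_integral => v _; under eq_esum do rewrite EFinM.
rewrite esumZl//; last by move=> x _; rewrite lee_fin kernel_ge0.
rewrite [RHS]EFinM [(_ - _)%:E]EFinB.
by rewrite fiber_thetaE// [(1 + _ - 1)%E]addeAC -EFinB subrr add0e.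
Qed.

Definition cutoff_mass : \bar R := (\int[m]_v (unit_cutoff v)%:E)%E.

Lemma cutoff_mass_gt0 : (0 < cutoff_mass)%E.
Proof.
apply: integral_gt0; [exact/measurable_EFinP| |exact: ts_measure_gt0].
by move=> v; rewrite lte_fin (unit_cutoff_gt0 O_dens).
Qed.

Lemma integral_unit_cutoffM (a : R) : 0 <= a ->
  (\int[m]_v (unit_cutoff v * a)%:E = a%:E * cutoff_mass)%E.
Proof.
move=> a0; under eq_integral do rewrite mulrC EFinM.
by rewrite ge0_integralZl//; [exact/measurable_EFinP|move=> v _; rewrite lee_fin].
Qed.

Lemma integral_unit_cutoff_le (f g : T -> R) : measurable_fun setT f -> measurable_fun setT g ->
  (forall v, 0 <= f v) -> (forall v, f v <= g v) ->
  (\int[m]_v (unit_cutoff v * f v)%:E <= \int[m]_v (unit_cutoff v * g v)%:E)%E.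
Proof.
move=> mf mg f0 fg; apply: ge0_le_integral => //.
- by move=> v _; rewrite lee_fin mulr_ge0.
- by apply/measurable_EFinP; exact: measurable_funM.
- by apply/measurable_EFinP; exact: measurable_funM.
- by move=> v _; rewrite lee_fin ler_wpM2l.
Qed.

Lemma class_thetaD_mass J w : nonzero_ideal J ->
  (class_theta J w + cutoff_mass = \int[m]_v (unit_cutoff v * fiber_theta J v w)%:E)%E.
Proof.
move=> nJ; have mfiber := measurable_fiber_theta w nJ.
rewrite /class_theta /cutoff_mass -ge0_integralD//; last 4 first.
- by move=> v _; rewrite lee_fin mulr_ge0// subr_ge0 fiber_theta_ge1.
- by apply/measurable_EFinP; apply: measurable_funM => //; exact: measurable_funB.
- by move=> v _; rewrite lee_fin.
- exact/measurable_EFinP.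
by apply: eq_integral => v _; rewrite -EFinD; congr (_%:E); rewrite mulrBr mulr1 subrK.
Qed.

Definition theta_decay w : R := expR (- (pi * n%:R * (theta_scale w - 1 / 2))).
Definition theta_err : R := 32 * n%:R ^+ 2 * (n + 2)%:R / density E O ^+ 2.
Definition theta_err_at w : R := theta_err * theta_scale w * expR (- w).

Lemma theta_scale_ge1 w : 0 <= w -> 1 <= theta_scale w.
Proof. by move=> w0; rewrite -expR0 ler_expR divr_ge0 ?mulr_ge0. Qed.

Lemma theta_scale_le1 w : w <= 0 -> theta_scale w <= 1.
Proof.
by move=> w0; rewrite -expR0 ler_expR mulr_le0_ge0 ?invr_ge0// mulr_ge0_le0.
Qed.

Lemma sqrt_theta_scaleX w : Num.sqrt (theta_scale w) ^+ n = expR w.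
Proof.
have -> : theta_scale w = expR (w / n%:R) ^+ 2 by rewrite -expRM_natl mulrA.
rewrite sqrtr_sqr ger0_norm ?expR_ge0// -expRM_natl; congr expR.
by rewrite mulrC divfK// gt_eqF// dim_gt0.
Qed.

Lemma fiber_theta_decay J v w : nonzero_ideal J -> 0 <= w -> fiber_theta J v w - 1 <= theta_decay w.
Proof.
move=> nJ w0; rewrite lerBlDl; apply: theta_fun_decay_half (fiber_minimal v nJ) n2 _ _.
by apply: le_trans (theta_scale_ge1 w0); lra.
Qed.

Lemma theta_err_ge0 : 0 <= theta_err.
Proof. by rewrite divr_ge0 ?exprn_ge0 ?(ltW O_dens)// !mulr_ge0 ?exprn_ge0. Qed.

Lemma theta_err_at_ge0 w : 0 <= theta_err_at w.
Proof. by rewrite mulr_ge0 ?expR_ge0// mulr_ge0 ?theta_err_ge0 ?expR_ge0. Qed.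

Lemma fiber_theta_between J v w : nonzero_ideal J -> w <= 0 ->
  kappa J * expR (- w) <= fiber_theta J v w <= kappa J * expR (- w) + theta_err_at w.
Proof.
move=> nJ w0; have scale01 : 0 < theta_scale w <= 1 by rewrite expR_gt0 theta_scale_le1.
have /andP[] := scaled_theta_bounds (weight_weight_at E v (ln_norm J)).1 (fiber_minimal v nJ) n2
  erefl scale01.
rewrite /scaled_theta sqrt_theta_scaleX -/(fiber_theta J v w) => lo up.
have kappaO := kappa_ge O_dens nJ.
rewrite /theta_err_at expRN ler_pdivrMr ?expR_gt0// -mulrDl ler_pdivlMr ?expR_gt0//.
rewrite ![_ * expR w]mulrC lo/=; apply: (le_trans up); rewrite lerD2l ler_wpM2r ?expR_ge0//.
rewrite ler_wpM2l ?mulr_ge0 ?exprn_ge0// lef_pV2 ?posrE ?exprn_gt0 ?(lt_le_trans O_dens)//.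
by rewrite lerXn2r// nnegrE ltW// (lt_le_trans O_dens).
Qed.

Lemma kappa_expR_ge0 J w : nonzero_ideal J -> 0 <= kappa J * expR (- w).
Proof. by move=> nJ; rewrite mulr_ge0 ?expR_ge0// ltW// kappa_gt0. Qed.

Lemma class_theta_ge0 J w : nonzero_ideal J -> (0 <= class_theta J w)%E.
Proof.
move=> nJ; apply: integral_ge0 => v _.
by rewrite lee_fin mulr_ge0// subr_ge0 fiber_theta_ge1.
Qed.

Lemma class_theta_decay J w : nonzero_ideal J -> 0 <= w ->
  (class_theta J w <= (theta_decay w)%:E * cutoff_mass)%E.
Proof.
move=> nJ w0; rewrite -integral_unit_cutoffM ?expR_ge0//; apply: integral_unit_cutoff_le => //.
- by apply: measurable_funB => //; exact: measurable_fiber_theta.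
- by move=> v; rewrite subr_ge0 fiber_theta_ge1.
- by move=> v; exact: fiber_theta_decay.
Qed.

Lemma class_theta_lower J w : nonzero_ideal J -> w <= 0 ->
  ((expR (- w))%:E * ((kappa J)%:E * cutoff_mass) <= class_theta J w + cutoff_mass)%E.
Proof.
move=> nJ w0; rewrite class_thetaD_mass// muleA -EFinM mulrC -integral_unit_cutoffM ?kappa_expR_ge0//.
apply: integral_unit_cutoff_le => //; first exact: measurable_fiber_theta.
  by move=> v; exact: kappa_expR_ge0.
by move=> v; have /andP[] := fiber_theta_between v nJ w0.
Qed.

Lemma class_theta_upper J w : nonzero_ideal J -> w <= 0 ->
  (class_theta J w + cutoff_mass <=
   (expR (- w))%:E * ((kappa J)%:E * cutoff_mass) + (theta_err_at w)%:E * cutoff_mass)%E.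
Proof.
move=> nJ w0; rewrite class_thetaD_mass// muleA -EFinM mulrC -ge0_muleDl ?lee_fin; last 2 first.
- exact: kappa_expR_ge0.
- exact: theta_err_at_ge0.
rewrite -EFinD -integral_unit_cutoffM ?addr_ge0 ?theta_err_at_ge0 ?kappa_expR_ge0//.
apply: integral_unit_cutoff_le => //; first exact: measurable_fiber_theta.
  by move=> v; rewrite (le_trans ler01)// fiber_theta_ge1.
by move=> v; have /andP[] := fiber_theta_between v nJ w0.
Qed.

Lemma cutoff_mass_le_class_theta J w : nonzero_ideal J -> w <= 0 -> 2 <= density E O * expR (- w) ->
  (cutoff_mass <= class_theta J w)%E.
Proof.
move=> nJ w0 w_small; rewrite -[cutoff_mass]mul1e -integral_unit_cutoffM//.
apply: integral_unit_cutoff_le => //.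
  by apply: measurable_funB => //; exact: measurable_fiber_theta.
move=> v; have /andP[lo _] := fiber_theta_between v nJ w0; rewrite lerBrDr.
apply: le_trans lo; apply: le_trans w_small _.
by rewrite ler_wpM2r ?expR_ge0// kappa_ge.
Qed.

Definition total_mass : \bar R := (\esum_(J in class_reps) cutoff_mass)%E.
Definition total_residue : \bar R := (\esum_(J in class_reps) ((kappa J)%:E * cutoff_mass))%E.

Let mass0 : (0 <= cutoff_mass)%E := ltW cutoff_mass_gt0.

Let kappa_mass0 J : class_reps J -> (0 <= (kappa J)%:E * cutoff_mass)%E.
Proof. by move=> [nJ _]; rewrite mule_ge0// lee_fin ltW// kappa_gt0. Qed.

Lemma ideal_theta_decay w : 0 <= w -> (ideal_theta w <= (theta_decay w)%:E * total_mass)%E.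
Proof.
move=> w0; rewrite ideal_theta_classes -esumZl ?expR_ge0//; apply: le_esum => J [nJ _].
exact: class_theta_decay.
Qed.

Lemma ideal_theta_lower w : w <= 0 ->
  ((expR (- w))%:E * total_residue <= ideal_theta w + total_mass)%E.
Proof.
move=> w0; rewrite ideal_theta_classes /total_residue -esumZl ?expR_ge0//.
rewrite -esumD//; last by move=> J [nJ _]; exact: class_theta_ge0.
by apply: le_esum => J [nJ _]; exact: class_theta_lower.
Qed.

Lemma ideal_theta_upper w : w <= 0 -> (ideal_theta w + total_mass <=
  (expR (- w))%:E * total_residue + (theta_err_at w)%:E * total_mass)%E.
Proof.
have err0 := theta_err_at_ge0 w.
move=> w0; rewrite ideal_theta_classes /total_residue /total_mass -!esumZl ?expR_ge0//.
rewrite -!esumD//; last 3 first.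
- by move=> J repJ; rewrite mule_ge0 ?lee_fin ?expR_ge0// kappa_mass0.
- by move=> J _; rewrite mule_ge0.
- by move=> J [nJ _]; exact: class_theta_ge0.
by apply: le_esum => J [nJ _]; exact: class_theta_upper.
Qed.

(* This is where the finiteness of the class number is hidden: ideal_theta is finite. *)
Lemma total_mass_le w : w <= 0 -> 2 <= density E O * expR (- w) -> (total_mass <= ideal_theta w)%E.
Proof.
move=> w0 w_small; rewrite ideal_theta_classes; apply: le_esum => J [nJ _].
exact: cutoff_mass_le_class_theta.
Qed.

Lemma total_mass_gt0 : (0 < total_mass)%E.
Proof.
apply: (lt_le_trans cutoff_mass_gt0); rewrite -(@esum_set1 R _ (class_rep O) (fun=> cutoff_mass))//.
by apply: esum_setS => _ ->; exact: class_rep_reps (roi_ideal L).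
Qed.

Lemma total_residue_ge : ((density E O)%:E * total_mass <= total_residue)%E.
Proof.
rewrite /total_mass -(esumZl (ltW O_dens))//; apply: le_esum => J [nJ _].
by rewrite lee_wpmul2r// lee_fin kappa_ge.
Qed.

End ClassTheta.

Section ArchimedeanDecay.
Variables (R : realType) (L : fieldExtType rat) (E : embedding_system R L).
Local Notation n := (\dim {:L}).
Variable X : translation_space R n.
Local Notation T := (ts_type X).
Local Notation m := (ts_measure X).
Local Notation c := (@ts_coord R n X).
Local Notation conj := (conj_index E).
Local Notation arch_integral := (arch_integral E X).
Implicit Types (v : T) (w : R).

Lemma affine_le_expR (u : R) : 4 * u - 8 <= expR u.
Proof.
have exp0 := expR_ge0 u; have [u2|u2] := leP u (- 2); first by lra.
have -> : expR u = expR (u / 2) ^+ 2 by rewrite -expRM_natl; congr expR; field.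
have : (1 + u / 2) ^+ 2 <= expR (u / 2) ^+ 2.
  by rewrite lerXn2r ?nnegrE ?expR_ge0 ?expR_ge1Dx//; lra.
have := sqr_ge0 (u / 2 - 3); move: (expR _ ^+ 2) => s; rewrite !expr2; lra.
Qed.

Lemma slope_le_expR (k u : R) : 0 <= k <= 4 -> k * u - 8 <= expR u.
Proof.
move=> /andP[k0 k4]; have [u0|u0] := leP 0 u.
  by apply: le_trans (affine_le_expR u); rewrite lerD2r ler_wpM2r.
have : k * u <= 0 by rewrite mulr_ge0_le0// ltW.
by have := expR_ge0 u; lra.
Qed.

(* A slope slightly different from k / 2 on each side of p = 0 gains e |p|. *)
Lemma exp_tangent_le (p y k e : R) : 0 <= e -> e <= k / 2 -> k / 2 + e <= 4 ->
  k / 2 * p + k * y + e * `|p| - 2 * e * `|y| - 8 <= expR (p + 2 * y).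
Proof.
move=> e0 ek k4.
have ey_le : e * y <= e * `|y| by rewrite ler_wpM2l// ler_norm.
have ey_ge : - (e * y) <= e * `|y| by rewrite -mulrN ler_wpM2l// -normrN ler_norm.
have [p0|p0] := leP 0 p.
  have slope : 0 <= k / 2 + e <= 4 by lra.
  by have := slope_le_expR (p + 2 * y) slope; rewrite (ger0_norm p0); lra.
have slope : 0 <= k / 2 - e <= 4 by lra.
by have := slope_le_expR (p + 2 * y) slope; rewrite (ltr0_norm p0); lra.
Qed.

Lemma kernel1_le v w (k e : R) : 0 <= e -> e <= k / 2 -> k / 2 + e <= 4 ->
  kernel E v w 1 <= expR (8 * n%:R - k * w + 2 * e * `|w| - e * \sum_i `|coord_dev E i v|).
Proof.
move=> e0 ek k4; have n0 := dim_gt0 R L; rewrite ler_expR.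
have sqnorm1 : sqnorm E (weight_at E v w) 1 = \sum_i weight_at E v w i.
  by apply: eq_bigr => i _; rewrite rmorph1 normc1 expr1n mulr1.
have weight0 : 0 <= \sum_i weight_at E v w i by apply: sumr_ge0 => i _; exact: expR_ge0.
have pi_weight : \sum_i weight_at E v w i <= pi * sqnorm E (weight_at E v w) 1.
  by rewrite sqnorm1 ler_peMl// (le_trans _ (pi_ge3 R))// ler1n.
have : \sum_(i < n) (k / 2 * coord_dev E i v + k * (w / n%:R) + e * `|coord_dev E i v|
    - 2 * e * `|w / n%:R| - 8) <= \sum_i weight_at E v w i.
  apply: ler_sum => i _; apply: (le_trans (exp_tangent_le _ _ e0 ek k4)).
  by rewrite /weight_at mulrA.
rewrite !sumrB !big_split/= !sumr_const_dim -2!mulr_sumr sum_coord_dev mulr0 add0r.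
rewrite normrM normfV (gtr0_norm n0).
have -> : n%:R * (k * (w / n%:R)) = k * w by field; rewrite gt_eqF.
have -> : n%:R * (2 * e * (`|w| / n%:R)) = 2 * e * `|w| by field; rewrite gt_eqF.
move: pi_weight; lra.
Qed.

Lemma sum_coord_le v : 2 * \sum_i `|c i v| <= \sum_i `|coord_dev E i v| +
  \sum_i `|c i v - c (conj i) v| + 2 * `|coord_sum v|.
Proof.
have -> : 2 * `|coord_sum v| = \sum_(i < n) 2 / n%:R * `|coord_sum v|.
  by rewrite sumr_const_dim; field; rewrite gt_eqF// dim_gt0.
rewrite mulr_sumr -!big_split/=; apply: ler_sum => i _.
have -> : 2 * `|c i v| = `|coord_dev E i v + (c i v - c (conj i) v) + 2 / n%:R * coord_sum v|.
  by rewrite -[X in X * `|_|](@ger0_norm _ 2)// -normrM; congr `|_|; rewrite /coord_dev; ring.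
apply: (le_trans (ler_normD _ _)); rewrite normrM (@ger0_norm _ (2 / n%:R)) ?divr_ge0//.
by rewrite lerD2r ler_normD.
Qed.

Lemma cutoff_kernel1_le v w (k e : R) : 0 <= e -> e <= 1 / 2 -> e <= k / 2 -> k / 2 + e <= 4 ->
  cutoff E v * kernel E v w 1 <=
  expR (8 * n%:R) * expR (- (k * w) + 2 * e * `|w|) * expR (- (2 * e * \sum_i `|c i v|)).
Proof.
move=> e0 e_half ek k4.
apply: (le_trans (ler_wpM2l (cutoff_ge0 E v) (kernel1_le v w e0 ek k4))).
rewrite /cutoff -!expRD ler_expR; have coord_le := sum_coord_le v.
have diff0 : 0 <= \sum_i `|c i v - c (conj i) v| by apply: sumr_ge0.
set S := \sum_i `|c i v| in coord_le *; set P := \sum_i `|coord_dev E i v| in coord_le *.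
set D := \sum_i _ in coord_le diff0 *; set s := `|coord_sum v| in coord_le *.
have s0 : 0 <= s by exact: normr_ge0.
have slack : 0 <= e * (P + D + 2 * s - 2 * S) by rewrite mulr_ge0// subr_ge0.
have gap : 0 <= (1 / 2 - e) * (D + 2 * s) by rewrite mulr_ge0 ?subr_ge0// addr_ge0// mulr_ge0.
by rewrite -subr_ge0; lra.
Qed.

Lemma arch_integral_le (k e : R) : 0 < e -> e <= 1 / 2 -> e <= k / 2 -> k / 2 + e <= 4 ->
  exists2 C : R, 0 < C & forall w, (arch_integral w <= (C * expR (- (k * w) + 2 * e * `|w|))%:E)%E.
Proof.
move=> e0 e_half ek k4; have e2 : 0 < 2 * e by rewrite mulr_gt0.
pose tail v := (expR (- (2 * e * \sum_i `|c i v|)))%:E.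
have mtail : measurable_fun setT tail.
  apply/measurable_EFinP; apply: measurableT_comp => //; apply: measurableT_comp => //.
  apply: measurable_funM => //; apply: measurable_sum => i; apply: measurableT_comp => //.
  exact: measurable_ts_coord.
have tail0 v : (0 <= tail v)%E by rewrite lee_fin expR_ge0.
pose I := (\int[m]_v tail v)%E; have I0 : (0 <= I)%E by apply: integral_ge0.
have I_fin : I \is a fin_num by rewrite ge0_fin_numE// ts_integral_expR_abs.
exists (expR (8 * n%:R) * (fine I + 1)).
  by rewrite mulr_gt0 ?expR_gt0// ltr_pwDr// fine_ge0.
move=> w; set a := expR (8 * n%:R); set b := expR (- (k * w) + _).
have ab0 : 0 <= a * b by rewrite mulr_ge0 ?expR_ge0.
apply: (@le_trans _ _ (\int[m]_v ((a * b)%:E * tail v))%E).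
  apply: ge0_le_integral => //.
  - by move=> v _; rewrite lee_fin cutoff_kernel_ge0.
  - exact: measurable_cutoff_kernel.
  - exact: emeasurable_funM.
  - by move=> v _; rewrite -EFinM lee_fin cutoff_kernel1_le// ltW.
rewrite ge0_integralZl// -/I -[I]fineK// -EFinM lee_fin mulrAC ler_wpM2r ?expR_ge0//.
by rewrite ler_wpM2l ?expR_ge0// lerDl.
Qed.

Lemma arch_integral_ge0 w : (0 <= arch_integral w)%E.
Proof. by apply: integral_ge0 => v _; rewrite lee_fin cutoff_kernel_ge0. Qed.

Lemma arch_integral_gt0 w : (0 < arch_integral w)%E.
Proof.
apply: integral_gt0; [exact: measurable_cutoff_kernel| |exact: ts_measure_gt0].
by move=> v; rewrite lte_fin; exact: mulr_gt0 (cutoff_gt0 _ _) (kernel_gt0 _ _ _ _).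
Qed.

Lemma arch_integral_nonincreasing w w' : w <= w' -> (arch_integral w' <= arch_integral w)%E.
Proof.
move=> ww'; apply: ge0_le_integral => //.
- by move=> v _; rewrite lee_fin cutoff_kernel_ge0.
- exact: measurable_cutoff_kernel.
- exact: measurable_cutoff_kernel.
move=> v _; rewrite lee_fin ler_wpM2l ?cutoff_ge0//.
rewrite ler_expR lerN2 ler_wpM2l ?pi_ge0//; apply: ler_sum => i _.
by rewrite ler_wpM2r ?sqr_ge0// ler_expR lerD2l ler_wpM2r ?invr_ge0// ler_wpM2l.
Qed.

Lemma arch_integral_decay : exists2 C : R, 0 < C &
  (forall w, w <= 0 -> (arch_integral w <= (C * expR (- (w / 4)))%:E)%E) /\
  (forall w, 0 <= w -> (arch_integral w <= (C * expR (- (3 * w)))%:E)%E).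
Proof.
have [||||Cl Cl0 left_le] := @arch_integral_le (1 / 8) (1 / 16); [lra..|].
have [||||Cr Cr0 right_le] := @arch_integral_le 4 (1 / 2); [lra..|].
exists (Cl + Cr); first exact: addr_gt0; split => w w0.
- apply: (le_trans (left_le w)); rewrite lee_fin; apply: ler_pM.
  + exact: ltW.
  + exact: expR_ge0.
  + by rewrite lerDl ltW.
  + by rewrite ler_expR ler0_norm//; lra.
- apply: (le_trans (right_le w)); rewrite lee_fin; apply: ler_pM.
  + exact: ltW.
  + exact: expR_ge0.
  + by rewrite lerDr ltW.
  + by rewrite ler_expR ger0_norm//; lra.
Qed.

Lemma arch_integral_exp2_le : exists2 C : R, 0 < C &
  forall w, (arch_integral w <= (C * expR (- (2 * w)))%:E)%E.
Proof.
have [C C0 [left_le right_le]] := arch_integral_decay; exists C => // w.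
have [w0|/ltW w0] := leP 0 w; [apply: (le_trans (right_le w w0))|apply: (le_trans (left_le w w0))];
  by rewrite lee_fin ler_pM2l// ler_expR; lra.
Qed.

Lemma arch_integral_fin_num w : arch_integral w \is a fin_num.
Proof.
have [C _ arch_le] := arch_integral_exp2_le.
by rewrite ge0_fin_numE ?arch_integral_ge0// (le_lt_trans (arch_le w)) ?ltry.
Qed.

End ArchimedeanDecay.

Section IdealThetaFunction.
Variables (R : realType) (L : fieldExtType rat) (E : embedding_system R L).
Local Notation n := (\dim {:L}).
Local Notation O := (@ring_of_integers L).
Variable X : translation_space R n.
Local Notation ideals := [set I : set L | nonzero_ideal I].
Local Notation arch_integral := (arch_integral E X).
Local Notation ideal_theta := (ideal_theta E X).
Local Notation total_mass := (total_mass E X).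
Local Notation total_residue := (total_residue E X).
Implicit Types w : R.
Hypotheses (O_dens : 0 < density E O) (n2 : (2 <= n)%N).
Hypothesis ideals_summable :
  (\esum_(I in [set: ideals]) (expR (- (2 * ln_norm R (val I))))%:E < +oo)%E.

Lemma ideal_theta_ge0 w : (0 <= ideal_theta w)%E.
Proof. by apply: esum_ge0 => I _; exact: arch_integral_ge0. Qed.

Lemma ideal_theta_fin_num w : ideal_theta w \is a fin_num.
Proof.
have [C C0 arch_le] := arch_integral_exp2_le E X.
rewrite ge0_fin_numE ?ideal_theta_ge0//.
have Ce0 : 0 <= C * expR (- (2 * w)) by rewrite mulr_ge0 ?expR_ge0// ltW.
have Ce0E : (0 <= (C * expR (- (2 * w)))%:E)%E by rewrite lee_fin.
apply: le_lt_trans (lte_mul_pinfty Ce0E isT ideals_summable).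
rewrite -esumZl//; apply: le_esum => I _; apply: (le_trans (arch_le _)).
by rewrite -EFinM lee_fin -mulrA -expRD mulrDr opprD.
Qed.

Lemma total_mass_fin_num : total_mass \is a fin_num.
Proof.
rewrite ge0_fin_numE ?(ltW (total_mass_gt0 X O_dens))//.
pose w0 := Num.min 0 (- ln (2 / density E O)).
have w0_le0 : w0 <= 0 by rewrite ge_min lexx.
have w0_small : 2 <= density E O * expR (- w0).
  rewrite mulrC -ler_pdivrMr// -[leLHS]lnK ?posrE ?divr_gt0// ler_expR lerNr.
  by rewrite ge_min lexx orbT.
apply: (le_lt_trans (total_mass_le X O_dens n2 w0_le0 w0_small)).
by rewrite -ge0_fin_numE ?ideal_theta_ge0// ideal_theta_fin_num.
Qed.

Lemma total_residue_fin_num : total_residue \is a fin_num.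
Proof.
have residue0 : (0 <= total_residue)%E.
  apply: le_trans (total_residue_ge X O_dens).
  by rewrite mule_ge0 ?lee_fin ?(ltW O_dens)// ltW// total_mass_gt0.
rewrite ge0_fin_numE//; have := ideal_theta_lower X O_dens n2 (lexx 0).
rewrite oppr0 expR0 mul1e => /le_lt_trans; apply.
by rewrite -ge0_fin_numE ?adde_ge0 ?ideal_theta_ge0 ?(ltW (total_mass_gt0 X O_dens))//
  fin_numD ideal_theta_fin_num total_mass_fin_num.
Qed.

Definition arch_fun w : R := fine (arch_integral w).
Definition ideal_theta_fun w : R := fine (ideal_theta w).
Definition mass : R := fine total_mass.
Definition residue : R := fine total_residue.

Lemma mass_gt0 : 0 < mass.
Proof.
apply: fine_gt0; rewrite (total_mass_gt0 X O_dens) -ge0_fin_numE ?total_mass_fin_num//.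
exact: ltW (total_mass_gt0 X O_dens).
Qed.

Lemma residue_ge : density E O * mass <= residue.
Proof.
rewrite -lee_fin EFinM (fineK total_mass_fin_num) (fineK total_residue_fin_num).
exact: total_residue_ge.
Qed.

Lemma arch_fun_gt0 w : 0 < arch_fun w.
Proof.
apply: fine_gt0; rewrite arch_integral_gt0 -ge0_fin_numE ?arch_integral_ge0//.
exact: arch_integral_fin_num.
Qed.

Lemma arch_fun_nonincreasing w w' : w <= w' -> arch_fun w' <= arch_fun w.
Proof.
by move=> ww'; apply: fine_le (arch_integral_nonincreasing E X ww'); exact: arch_integral_fin_num.
Qed.

Lemma arch_fun_decay : exists C : R, (forall w, w <= 0 -> arch_fun w <= C * expR (- (w / 4))) /\
  (forall w, 0 <= w -> arch_fun w <= C * expR (- (3 * w))).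
Proof.
have [C _ [left_le right_le]] := arch_integral_decay E X; exists C; split => w w0.
  by rewrite -lee_fin fineK ?arch_integral_fin_num// left_le.
by rewrite -lee_fin fineK ?arch_integral_fin_num// right_le.
Qed.

Lemma ideal_theta_fun_sum w :
  (\esum_(I in [set: ideals]) (arch_fun (w + ln_norm R (val I)))%:E = (ideal_theta_fun w)%:E)%E.
Proof.
rewrite (fineK (ideal_theta_fin_num w)); apply: eq_esum => I _.
by rewrite fineK// arch_integral_fin_num.
Qed.

Lemma theta_decay_le w : 0 <= w -> theta_decay L w <= expR (- (6 * w)).
Proof.
move=> w0; have n0 := dim_gt0 R L; rewrite ler_expR lerN2.
have scale_ge : n%:R + 2 * w <= n%:R * theta_scale L w.
  have := ler_wpM2l (ltW n0) (expR_ge1Dx (2 * w / n%:R)).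
  by rewrite mulrDr mulr1 [n%:R * (_ / _)]mulrC divfK ?gt_eqF.
have exponent_ge0 : 0 <= n%:R * (theta_scale L w - 1 / 2) by rewrite mulrBr; lra.
have : 3 * (n%:R * (theta_scale L w - 1 / 2)) <= pi * (n%:R * (theta_scale L w - 1 / 2)).
  by rewrite ler_wpM2r// pi_ge3.
by rewrite -mulrA mulrBr; lra.
Qed.

Lemma ideal_theta_fun_decay w : 0 <= w -> ideal_theta_fun w <= mass * expR (- (6 * w)).
Proof.
move=> w0; apply: (@le_trans _ _ (mass * theta_decay L w)).
  rewrite -lee_fin EFinM (fineK (ideal_theta_fin_num w)) (fineK total_mass_fin_num) muleC.
  exact: ideal_theta_decay.
by rewrite ler_pM2l ?mass_gt0// theta_decay_le.
Qed.

Lemma ideal_theta_fun_asymp w : w <= 0 -> residue * expR (- w) <= ideal_theta_fun w + mass <=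
  residue * expR (- w) + theta_err_at E w * mass.
Proof.
move=> w0; apply/andP; split; rewrite -lee_fin !EFinD (fineK (ideal_theta_fin_num w))
  (fineK total_mass_fin_num) [(residue * _)%:E]EFinM (fineK total_residue_fin_num) muleC.
  exact: ideal_theta_lower.
rewrite [(theta_err_at E w * _)%:E]EFinM (fineK total_mass_fin_num).
exact: ideal_theta_upper.
Qed.

End IdealThetaFunction.

(** * Dirichlet series with a real zero *)

Section UnorderedSums.
Variables (R : realType) (I : choiceType).
Implicit Types (A B : {fset I}) (f : I -> R).

Lemma has_sum_approx (x : I -> R[i]) (l : R[i]) (e : R) : has_sum x l -> 0 < e ->
  exists A, forall B, (A `<=` B)%fset -> normc (l - \sum_(i <- B) x i) < e.
Proof.
move=> x_sum e0; have eC0 : 0 < (e%:C)%C :> R[i] by rewrite ltcR.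
move/cvgrPdist_lt : x_sum => /(_ totally_filter _ eC0) [A _ near_l]; exists A => B AB.
by have := near_l B AB; rewrite norm_normc ltcR /partial_sum (big_seq_fsetE _ B predT).
Qed.

Lemma le_sum_fset f A B : (forall i, 0 <= f i) -> (A `<=` B)%fset ->
  \sum_(i <- A) f i <= \sum_(i <- B) f i.
Proof.
move=> f0 /fsubsetP AB; rewrite (bigID (mem A) xpredT f (r := B))/= -[leLHS]addr0 lerD ?sumr_ge0//.
rewrite -[leRHS]big_filter le_eqVlt; apply/predU1l; apply: perm_big.
apply: uniq_perm; rewrite ?filter_uniq ?fset_uniq// => i; rewrite mem_filter.
by case: (boolP (i \in A)) => // /AB ->.
Qed.

Lemma sum_fset_le_esum f A :
  ((\sum_(i <- A) f i)%:E <= \esum_(i in [set: I]) (f i)%:E)%E.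
Proof.
have := @fsets_sum_le_esum R I [set: I] [set` A] (fun i => (f i)%:E)
  (conj (finite_fset A) (@subsetT _ _)).
by rewrite (fsbig_finite _ _ (finite_fset A)) set_fsetK sumEFin.
Qed.

Lemma esum_fset_approx f (l e : R) : \esum_(i in [set: I]) (f i)%:E = l%:E -> 0 < e ->
  exists A, l - e < \sum_(i <- A) f i.
Proof.
move=> suml e0; have sup_fin : ereal_sup [set (\sum_(i \in F) (f i)%:E)%E | F in fsets [set: I]]
    \is a fin_num by move: suml; rewrite /esum => ->.
have [_ [F [finF _] <-]] := ub_ereal_sup_adherent e0 sup_fin.
move: suml; rewrite {1}/esum => ->; rewrite (fsbig_finite _ _ finF)/= sumEFin -EFinB lte_fin.
by exists (fset_set F).
Qed.

Lemma countable_esum_le f (M : R) : (forall i, 0 < f i) ->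
  (\esum_(i in [set: I]) (f i)%:E <= M%:E)%E -> countable [set: I].
Proof.
move=> f0 fM.
have -> : [set: I] = \bigcup_(k in [set: nat]) [set i | k.+1%:R^-1 <= f i].
  apply/seteqP; split => // i _; exists (Num.truncn (f i)^-1) => //=.
  by rewrite -[leRHS]invrK lef_pV2 ?posrE ?invr_gt0//; exact: ltW (truncnS_gt _).
apply: bigcup_countable => // k _; apply: finite_set_countable; apply: contrapT => inf.
pose m := (Num.truncn (M * k.+1%:R)).+1.
have [B B_sub mB] := infinite_set_fset m inf.
have : ((\sum_(i <- B) f i)%:E <= M%:E)%E by exact: le_trans (sum_fset_le_esum _ _) fM.
rewrite lee_fin leNgt => /negP; apply.
have : m%:R * k.+1%:R^-1 <= \sum_(i <- B) f i.
  apply: (@le_trans _ _ (\sum_(i <- B) k.+1%:R^-1)).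
    rewrite big_const_seq count_predT iter_addr_0 -[leRHS]mulr_natl.
    by rewrite ler_wpM2r ?invr_ge0// ler_nat.
  by rewrite big_seq [leRHS]big_seq; apply: ler_sum => i /B_sub.
by apply: lt_le_trans; rewrite ltr_pdivlMr// truncnS_gt.
Qed.

End UnorderedSums.

Section DirichletLaplace.
Variables (R : realType) (I : choiceType).
Local Notation mu := (@lebesgue_measure R).
Implicit Types (A B : {fset I}) (s : R[i]) (w sg : R).

Variables (a : I -> R) (Z : R[i] -> R[i]).
Hypothesis Z_sum : forall s, 1 < cRe s -> has_sum (fun i => cexp (- s * ((a i)%:C)%C)) (Z s).

Lemma cexp_oppr_real sg i : cexp (- (sg%:C)%C * ((a i)%:C)%C) = ((expR (- (sg * a i)))%:C)%C.
Proof. by rewrite -cexp_real -rmorphN -rmorphM mulNr. Qed.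

Lemma dirichlet_esum_le sg : 1 < sg ->
  (\esum_(i in [set: I]) (expR (- (sg * a i)))%:E <= (cRe (Z (sg%:C)%C))%:E)%E.
Proof.
move=> sg1; apply: esum_le_ub => F [finF _].
rewrite (fsbig_finite _ _ finF)/= sumEFin lee_fin leNgt; apply/negP => Z_lt.
set S := \sum_(i <- _) _ in Z_lt.
have gap0 : 0 < S - cRe (Z (sg%:C)%C) by rewrite subr_gt0.
have [A near_Z] := has_sum_approx (Z_sum (s := (sg%:C)%C) sg1) gap0.
have := near_Z (A `|` fset_set F)%fset (fsubsetUl _ _).
have : S <= \sum_(i <- (A `|` fset_set F)%fset) expR (- (sg * a i)).
  by apply: le_sum_fset; [move=> i; exact: expR_ge0|exact: fsubsetUr].
under [in X in _ -> X]eq_bigr do rewrite cexp_oppr_real.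
rewrite -rmorph_sum; move: (\sum_(i <- _) _) => S' SS' /(le_lt_trans (normr_Re_le _)).
by rewrite complexReB /= ltr_norml => /andP[]; lra.
Qed.

Variables (phi psi : R -> R) (C : R).
Hypotheses (phi_gt0 : forall w, 0 < phi w) (phi_noninc : forall w w', w <= w' -> phi w' <= phi w).
Hypothesis phi_left : forall w, w <= 0 -> phi w <= C * expR (- (w / 4)).
Hypothesis phi_right : forall w, 0 <= w -> phi w <= C * expR (- (3 * w)).
Hypothesis psi_sum : forall w, (\esum_(i in [set: I]) (phi (w + a i))%:E = (psi w)%:E)%E.

Let phi_ge0 w : 0 <= phi w := ltW (phi_gt0 w).

Lemma measurable_phi : measurable_fun setT phi.
Proof. by apply: nonincreasing_measurable => // w w'; exact: phi_noninc. Qed.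

Lemma psi_ge0 w : 0 <= psi w.
Proof. by rewrite -lee_fin -psi_sum; apply: esum_ge0 => i _; rewrite lee_fin. Qed.

Lemma measurable_psi : measurable_fun setT psi.
Proof.
apply: nonincreasing_measurable => // w w' ww'; rewrite -lee_fin -!psi_sum.
by apply: le_esum => i _; rewrite lee_fin phi_noninc// lerD2r.
Qed.

Lemma laplace_integrable_phi sg : 1 / 4 < sg < 3 -> laplace_integrable phi sg.
Proof.
move=> /andP[sg_lo sg_up]; pose k := Num.min (sg - 1 / 4) (3 - sg).
have k0 : 0 < k by rewrite lt_min !subr_gt0 sg_lo.
have k_lo : k <= sg - 1 / 4 by rewrite ge_min lexx.
have k_up : k <= 3 - sg by rewrite ge_min lexx orbT.
have C0 : 0 <= C.
  by have := phi_left (lexx 0); rewrite mul0r oppr0 expR0 mulr1; apply: le_trans.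
apply: (laplace_integrable_exp_decay (B := C) measurable_phi k0) => w; rewrite ger0_norm//.
have bound e : phi w <= C * expR e -> e + sg * w <= - (k * `|w|) ->
    phi w * expR (sg * w) <= C * expR (- (k * `|w|)).
  move=> phi_le e_le; apply: le_trans (ler_wpM2r (expR_ge0 _) phi_le) _.
  by rewrite -mulrA -expRD ler_wpM2l// ler_expR.
have [w0|w0] := leP 0 w.
  apply: bound (phi_right w0) _; rewrite ger0_norm//.
  by have : 0 <= (3 - sg - k) * w; [rewrite mulr_ge0// subr_ge0|lra].
apply: bound (phi_left (ltW w0)) _; rewrite ltr0_norm//.
by have : (sg - 1 / 4 - k) * w <= 0; [rewrite mulr_ge0_le0 ?subr_ge0// ltW|lra].
Qed.

Definition mellin_phi sg : R := \int[mu]_w (phi w * expR (sg * w)).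

Lemma mellin_phi_ge0 sg : 0 <= mellin_phi sg.
Proof. by apply: Rintegral_ge0 => w _; rewrite mulr_ge0 ?expR_ge0. Qed.

Lemma integral_phi_shift sg b : 1 / 4 < sg < 3 ->
  (\int[mu]_w (phi (w + b) * expR (sg * w))%:E = (expR (- (sg * b)) * mellin_phi sg)%:E)%E.
Proof.
move=> sg_itv; have iphi := laplace_integrable_phi sg_itv.
have mphi : measurable_fun setT (fun w => (phi w * expR (sg * w))%:E).
  by have /integrableP[] := iphi.
have phi0 w : (0%:E <= (phi w * expR (sg * w))%:E)%E by rewrite lee_fin mulr_ge0 ?expR_ge0.
have shiftE w : phi (w + b) * expR (sg * w) =
    expR (- (sg * b)) * (phi (w + b) * expR (sg * (w + b))).
  by rewrite mulrCA -expRD; congr (_ * expR _); ring.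
under eq_integral do rewrite shiftE EFinM.
rewrite ge0_integralZl ?lee_fin ?expR_ge0//; last first.
  by apply: (measurableT_comp mphi); exact: measurable_shift.
rewrite (@ge0_integral_shift _ (fun w => (phi w * expR (sg * w))%:E))//.
by rewrite integral_laplace_integrable.
Qed.

Lemma integral_psi sg : 1 < sg < 3 -> (\int[mu]_w (psi w * expR (sg * w))%:E =
  \esum_(i in [set: I]) (expR (- (sg * a i)) * mellin_phi sg)%:E)%E.
Proof.
move=> /andP[sg1 sg3].
have cI : countable [set: I].
  by apply: (countable_esum_le _ (dirichlet_esum_le sg1)) => i; exact: expR_gt0.
transitivity (\int[mu]_w \esum_(i in [set: I]) (phi (w + a i) * expR (sg * w))%:E)%E.
  apply: eq_integral => w _; rewrite mulrC EFinM -psi_sum -esumZl ?expR_ge0//.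
    by apply: eq_esum => i _; rewrite -EFinM mulrC.
  by move=> i _; rewrite lee_fin.
rewrite integral_esum//.
- by apply: eq_esum => i _; rewrite integral_phi_shift//; lra.
- move=> i _; apply/measurable_EFinP; apply: measurable_funM; last exact: measurable_expR_affine.
  by apply: (measurableT_comp measurable_phi); exact: measurable_shift.
- by move=> i w _; rewrite lee_fin mulr_ge0 ?expR_ge0.
Qed.

Lemma laplace_integrable_psi sg : 1 < sg < 3 -> laplace_integrable psi sg.
Proof.
move=> sg13; have /andP[sg1 _] := sg13; apply/integrableP; split.
  apply/measurable_EFinP; apply: measurable_funM; first exact: measurable_psi.
  exact: measurable_expR_affine.
under eq_integral => w _ do rewrite /= ger0_norm ?mulr_ge0 ?expR_ge0 ?psi_ge0//.
rewrite integral_psi//; under eq_esum do rewrite mulrC EFinM.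
rewrite esumZl ?mellin_phi_ge0//.
apply: le_lt_trans (ltry (mellin_phi sg * cRe (Z (sg%:C)%C))).
by rewrite EFinM lee_wpmul2l ?lee_fin ?mellin_phi_ge0// dirichlet_esum_le.
Qed.

Definition psi_partial A w : R := \sum_(i <- A) phi (w + a i).

Lemma psi_partial_le A w : psi_partial A w <= psi w.
Proof. by rewrite -lee_fin -psi_sum; exact: sum_fset_le_esum. Qed.

Lemma laplace_psi_partial s A : 1 / 4 < cRe s < 3 ->
  laplace_integrable (psi_partial A) (cRe s) /\
  laplace (psi_partial A) s = (\sum_(i <- A) cexp (- s * ((a i)%:C)%C)) * laplace phi s.
Proof.
move=> /laplace_integrable_phi iphi; rewrite /psi_partial; move: (A : seq I) => r.
elim: r => [|i r [IHi IHl]].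
  have -> : (fun w => \sum_(i <- [::]) phi (w + a i)) = (fun w => 0 * phi w).
    by apply/funext => w; rewrite big_nil mul0r.
  by rewrite laplaceZ// big_nil !mul0r; split => //; exact: laplace_integrableZ.
have -> : (fun w => \sum_(j <- i :: r) phi (w + a j)) =
    (fun w => phi (w + a i) + \sum_(j <- r) phi (w + a j)).
  by apply/funext => w; rewrite big_cons.
have ishift := laplace_integrable_shift (a i) iphi.
split; first exact: laplace_integrableD.
by rewrite laplaceD// IHl laplace_shift// big_cons mulrDl.
Qed.

Lemma laplace_psi_partial_error s A : 1 < cRe s < 3 ->
  normc (laplace psi s - (\sum_(i <- A) cexp (- s * ((a i)%:C)%C)) * laplace phi s) <=
  2 * (\int[mu]_w (psi w * expR (cRe s * w)) -
       \sum_(i <- A) (expR (- (cRe s * a i)) * mellin_phi (cRe s))).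
Proof.
move=> s13; have s143 : 1 / 4 < cRe s < 3 by lra.
set x := cRe s in s13 s143 *; have ipsi := laplace_integrable_psi s13.
have [ipart lpart] := laplace_psi_partial A s143.
have partE : \int[mu]_w (psi_partial A w * expR (x * w)) =
    \sum_(i <- A) (expR (- (x * a i)) * mellin_phi x).
  have [_] := @laplace_psi_partial (x%:C)%C A s143.
  under [in RHS]eq_bigr do rewrite cexp_oppr_real.
  by rewrite !laplace_real -rmorph_sum -rmorphM mulr_suml => /complexI.
have idiff := laplace_integrableB ipsi ipart.
rewrite -lpart -laplaceB//; apply: le_trans (normc_laplace_le idiff) _.
rewrite ler_wpM2l// -partE -RintegralB//; apply: le_Rintegral => //.
- exact: integrable_abse idiff.
- exact: integrable_EFinB ipsi ipart.
by move=> w _; rewrite -mulrBl ger0_norm// mulr_ge0 ?expR_ge0// subr_ge0 psi_partial_le.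
Qed.

Lemma laplace_psi s : 1 < cRe s < 3 -> laplace psi s = Z s * laplace phi s.
Proof.
move=> s13; have /andP[s1 s3] := s13.
have int_psiE : (\esum_(i in [set: I]) (expR (- (cRe s * a i)) * mellin_phi (cRe s))%:E =
    (\int[mu]_w (psi w * expR (cRe s * w)))%:E)%E.
  by rewrite -integral_psi// integral_laplace_integrable//; exact: laplace_integrable_psi.
apply/eqP; rewrite -subr_eq0; apply/eqP.
apply: (@complex_eq0_small _ _ 1 (2 + normc (laplace phi s))) => // e /andP[e0 _].
have [A near_Z] := has_sum_approx (Z_sum s1) e0.
have [B near_int] := esum_fset_approx int_psiE e0.
have near_Z' := near_Z (A `|` B)%fset (fsubsetUl _ _).
have tail := laplace_psi_partial_error (A `|` B)%fset s13.
have grow : \sum_(i <- B) (expR (- (cRe s * a i)) * mellin_phi (cRe s)) <=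
    \sum_(i <- (A `|` B)%fset) (expR (- (cRe s * a i)) * mellin_phi (cRe s)).
  by apply: le_sum_fset; [move=> i; rewrite mulr_ge0 ?expR_ge0 ?mellin_phi_ge0|exact: fsubsetUr].
move: near_Z' tail; set S := \sum_(i <- _) cexp _ => near_Z' tail.
have -> : laplace psi s - Z s * laplace phi s =
    (laplace psi s - S * laplace phi s) - (Z s - S) * laplace phi s by ring.
apply: le_trans (le_normcB _ _) _; rewrite normcM mulrDr lerD//; first by lra.
by rewrite ler_wpM2r ?normc_ge0// ltW.
Qed.

End DirichletLaplace.

Section RealZero.
Variable R : realType.
Local Notation mu := (@lebesgue_measure R).
Implicit Types (s : R[i]) (w sg : R).

Lemma Rintegral_neg_indic_expR (x : R) : 0 < x -> \int[mu]_w (neg_indic w * expR (x * w)) = x^-1.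
Proof. by move=> x0; apply: complexI; rewrite -laplace_real laplace_neg_indic// fmorphV. Qed.

Variables (Z G : R[i] -> R[i]) (psi : R -> R) (V rho M q : R).
Hypothesis Z_holo : forall s, s != 1 -> holomorphic_at Z s.
Hypothesis G_holo : forall s, 1 / 4 < cRe s < 3 -> holomorphic_at G s.
Hypotheses (mpsi : measurable_fun setT psi) (psi0 : forall w, 0 <= psi w).
Hypothesis laplace_psiE : forall s, 1 < cRe s < 3 -> laplace psi s = Z s * G s.
Hypotheses (V0 : 0 < V) (M0 : 0 <= M) (q2 : 2 <= q).
Hypothesis psi_decay : forall w, 0 <= w -> psi w <= V * expR (- (6 * w)).
Hypothesis psi_asymp : forall w, w <= 0 -> rho * expR (- w) <= psi w + V <=
  rho * expR (- w) + M * expR (2 * w / q) * expR (- w) * V.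

Definition psi_pos w : R := (1 - neg_indic w) * psi w.
Definition psi_neg w : R := neg_indic w * (psi w + V - rho * expR (- w)).

Lemma measurable_psi_pos : measurable_fun setT psi_pos.
Proof. by apply: measurable_funM => //; apply: measurable_funB => //; exact: measurable_neg_indic. Qed.

Lemma measurable_psi_neg : measurable_fun setT psi_neg.
Proof.
apply: measurable_funM; first exact: measurable_neg_indic.
apply: measurable_funB; first exact: measurable_funD.
by apply: measurable_funM => //; apply: measurableT_comp => //; exact: measurableT_comp.
Qed.

Lemma psi_pos_lt0 w : w < 0 -> psi_pos w = 0.
Proof. by move=> w0; rewrite /psi_pos neg_indic1// subrr mul0r. Qed.

Lemma psi_pos_ge0E w : 0 <= w -> psi_pos w = psi w.
Proof. by move=> w0; rewrite /psi_pos neg_indic0// subr0 mul1r. Qed.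

Lemma psi_pos_ge0 w : 0 <= psi_pos w.
Proof. by have [w0|w0] := leP 0 w; [rewrite psi_pos_ge0E|rewrite psi_pos_lt0]. Qed.

Lemma psi_neg_itv w : 0 <= psi_neg w <= M * V * (neg_indic w * expR ((2 / q - 1) * w)).
Proof.
rewrite /psi_neg; have [w0|w0] := leP 0 w; first by rewrite neg_indic0// !mul0r mulr0 lexx.
rewrite neg_indic1// !mul1r lerBlDl subr_ge0; have /andP[-> psi_up] := psi_asymp (ltW w0).
apply: (le_trans psi_up); rewrite lerD2l -!mulrA ler_wpM2l// mulrA -expRD mulrC ler_wpM2l ?(ltW V0)//.
by rewrite ler_expR le_eqVlt; apply/predU1l; ring.
Qed.

Lemma laplace_integrable_psi_pos sg : sg < 5 -> laplace_integrable psi_pos sg.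
Proof.
move=> sg5; apply: (@laplace_integrable_exp_decay _ _ _ V 1 measurable_psi_pos) => // w.
rewrite mul1r (ger0_norm (psi_pos_ge0 _)); have [w0|w0] := leP 0 w; last first.
  by rewrite psi_pos_lt0// mul0r mulr_ge0 ?expR_ge0// ltW.
rewrite psi_pos_ge0E// ger0_norm//.
apply: le_trans (ler_wpM2r (expR_ge0 _) (psi_decay w0)) _.
rewrite -mulrA -expRD ler_pM2l// ler_expR.
by have : 0 <= (5 - sg) * w; [rewrite mulr_ge0// subr_ge0 ltW|lra].
Qed.

Lemma laplace_integrable_neg_indic_expR (c sg : R) : 0 < sg + c ->
  laplace_integrable (fun w => neg_indic w * expR (c * w)) sg.
Proof. by move=> sgc; apply: laplace_integrable_expR; exact: laplace_integrable_neg_indic. Qed.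

Lemma laplace_integrable_psi_neg sg : 1 - 2 / q < sg -> laplace_integrable psi_neg sg.
Proof.
move=> sg_gt; have idom : laplace_integrable (fun w => neg_indic w * expR ((2 / q - 1) * w)) sg.
  by apply: laplace_integrable_neg_indic_expR; lra.
apply: (laplace_integrable_le measurable_psi_neg _ (laplace_integrableZ (M * V) idom)) => w.
by have /andP[neg0 neg_le] := psi_neg_itv w; rewrite ger0_norm.
Qed.

Lemma laplace_psi_split s : 1 < cRe s < 3 -> laplace psi s =
  laplace psi_pos s + laplace psi_neg s + ((rho%:C)%C * (s - 1)^-1 - (V%:C)%C * (s - 0)^-1).
Proof.
move=> /andP[s1 s3]; have q0 : 0 < 2 / q by rewrite divr_gt0// (lt_le_trans _ q2).
have ipos : laplace_integrable psi_pos (cRe s) by apply: laplace_integrable_psi_pos; lra.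
have ineg : laplace_integrable psi_neg (cRe s) by apply: laplace_integrable_psi_neg; lra.
have i0 : laplace_integrable (@neg_indic R) (cRe s) by apply: laplace_integrable_neg_indic; lra.
have i1 : laplace_integrable (fun w => neg_indic w * expR (-1 * w)) (cRe s).
  by apply: laplace_integrable_neg_indic_expR; lra.
have iV := laplace_integrableZ V i0; have irho := laplace_integrableZ rho i1.
have -> : psi = fun w => psi_pos w + psi_neg w +
    (rho * (neg_indic w * expR (-1 * w)) - V * neg_indic w).
  by apply/funext => w; rewrite /psi_pos /psi_neg mulN1r; ring.
rewrite laplaceD//; [|exact: laplace_integrableD|exact: laplace_integrableB].
rewrite laplaceD// laplaceB// !laplaceZ// laplace_expR rmorphN rmorph1 subr0.
rewrite !laplace_neg_indic//; first by lra.
by rewrite complexReB /=; lra.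
Qed.

Lemma holomorphic_simple_pole (c p s : R[i]) : s != p ->
  holomorphic_at (fun z => c * (z - p)^-1) s.
Proof.
by move=> sp; apply: holomorphicM; [exact: holomorphic_cst|exact: holomorphic_inv_subr].
Qed.

Let mellin_defect s := Z s * G s -
  (laplace psi_pos s + laplace psi_neg s + ((rho%:C)%C * (s - 1)^-1 - (V%:C)%C * (s - 0)^-1)).

Lemma mellin_defect_holomorphic s : s != 1 -> 1 / 4 < cRe s < 3 -> 1 - 2 / q < cRe s ->
  holomorphic_at mellin_defect s.
Proof.
move=> s1 s_itv s_gt; have /andP[s_lo s_up] := s_itv.
apply: holomorphicB; first by apply: holomorphicM; [exact: Z_holo|exact: G_holo].
apply: holomorphicD; last first.
  apply: holomorphicB; apply: holomorphic_simple_pole => //.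
  by apply/eqP => s0; move: s_lo; rewrite s0 /=; lra.
apply: holomorphicD.
  apply: (@laplace_holomorphic _ psi_pos (1 / 4) 3) => // sg sg_itv.
  by apply: laplace_integrable_psi_pos; lra.
apply: (@laplace_holomorphic _ psi_neg (1 - 2 / q) 3); last by rewrite s_gt.
by move=> sg /andP[sg_gt _]; exact: laplace_integrable_psi_neg.
Qed.

(* Two overlapping discs, of radii proportional to the distance from beta
   to 1, lead from the half-plane of convergence around the pole to beta. *)
Lemma mellin_defect_eq0 (beta : R) : 0 < beta < 1 -> 1 - beta < 1 / (8 * q) ->
  mellin_defect (beta%:C)%C = 0.
Proof.
move=> /andP[b0 b1] beta_near; set d := 1 - beta in beta_near.
have d0 : 0 < d by rewrite subr_gt0.
have q0 : 0 < q by exact: lt_le_trans q2.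
have qV : 0 < q^-1 <= 1 / 2 by rewrite invr_gt0 q0/= div1r lef_pV2 ?posrE.
have d8 : 8 * d < q^-1.
  have qVE : 1 / (8 * q) = q^-1 / 8 by field; rewrite gt_eqF.
  by move: beta_near; rewrite qVE; lra.
have betaE : beta = 1 - d by rewrite /d; ring.
have holo s : s != 1 -> 1 - 99 / 10 * d <= cRe s -> cRe s <= 1 + 8 * d ->
    holomorphic_at mellin_defect s.
  by move=> s1 s_lo s_up; apply: mellin_defect_holomorphic => //; lra.
have converges s : 1 < cRe s < 3 -> mellin_defect s = 0.
  by move=> s13; rewrite /mellin_defect -laplace_psiE// -laplace_psi_split// subrr.
have d10 : 0 < d / 10 by lra.
have upper_disc z : normc (z - Complex (1 + d / 10) (8 * d)) < 79 / 10 * d -> mellin_defect z = 0.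
  move=> z_near; apply: (holomorphic_eq0_disc d10 _ _ z_near).
    move=> s /andP[/andP[/= s_lo s_up] /andP[i_lo i_up]]; apply: holo; try lra.
    by apply/eqP => s1; move: i_lo; rewrite s1 /=; lra.
  move=> h h_small; apply: converges; rewrite complexReD /=.
  by have := le_lt_trans (normr_Re_le h) h_small; rewrite ltr_norml => /andP[]; lra.
apply: (@holomorphic_eq0_disc _ _ (Complex (1 - 5 * d) (5 / 2 * d)) (49 / 10 * d) (d / 10) d10).
- move=> s /andP[/andP[/= s_lo s_up] /andP[i_lo i_up]]; apply: holo; try lra.
  by apply/eqP => s1; move: s_up; rewrite s1 /=; lra.
- move=> h h_small; apply: upper_disc.
  have -> : Complex (1 - 5 * d) (5 / 2 * d) + h - Complex (1 + d / 10) (8 * d) =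
      Complex (- (51 / 10) * d) (- (55 / 10) * d) + h.
    by apply: complex_eq; rewrite !(complexReD, complexImD, complexReB, complexImB) /=; lra.
  apply: (le_lt_trans (le_normcD _ _)).
  have : normc (Complex (- (51 / 10) * d) (- (55 / 10) * d)) < 76 / 10 * d.
    apply: normc_lt => /=; first by lra.
    by have dd : 0 < d ^+ 2 := exprn_gt0 2 d0; rewrite !exprMn; lra.
  by lra.
- by apply: normc_lt; [lra|rewrite complexReB complexImB /= betaE; nra].
Qed.

Lemma Rintegral_psi_pos_le (beta : R) : 0 < beta < 1 ->
  \int[mu]_w (psi_pos w * expR (beta * w)) <= V.
Proof.
move=> beta01; have ipos : laplace_integrable psi_pos beta by apply: laplace_integrable_psi_pos; lra.
rewrite -lee_fin -(integral_laplace_integrable ipos).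
apply: (@le_trans _ _ (\int[mu]_w (V%:E * (exponential_pdf 1 w)%:E))%E); last first.
  rewrite ge0_integralZl//; last 3 first.
  - by apply/measurable_EFinP; exact: measurable_exponential_pdf.
  - by move=> w _; rewrite lee_fin exponential_pdf_ge0.
  - by rewrite lee_fin ltW.
  by rewrite integral_exponential_pdf// mule1.
apply: ge0_le_integral => //.
- by move=> w _; rewrite lee_fin mulr_ge0 ?expR_ge0 ?psi_pos_ge0.
- apply/measurable_EFinP; apply: measurable_funM; first exact: measurable_psi_pos.
  exact: measurable_expR_affine.
- by apply: emeasurable_funM => //; apply/measurable_EFinP; exact: measurable_exponential_pdf.
move=> w _; rewrite -EFinM lee_fin; have [w0|w0] := leP 0 w; last first.
  by rewrite psi_pos_lt0// mul0r mulr_ge0 ?exponential_pdf_ge0// ltW.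
rewrite psi_pos_ge0E// exponential_pdfE//= mul1r.
apply: le_trans (ler_wpM2r (expR_ge0 _) (psi_decay w0)) _.
rewrite -mulrA -expRD ler_pM2l// ler_expR.
by have : 0 <= (1 - beta) * w; [rewrite mulr_ge0//; lra|lra].
Qed.

Lemma Rintegral_psi_neg_le (beta : R) : 1 - 2 / q < beta ->
  \int[mu]_w (psi_neg w * expR (beta * w)) <= M * V / (2 / q - (1 - beta)).
Proof.
move=> beta_gt; have rate0 : 0 < beta + (2 / q - 1) by lra.
rewrite (_ : 2 / q - (1 - beta) = beta + (2 / q - 1)); last by ring.
rewrite -(Rintegral_neg_indic_expR rate0) -RintegralZl//; last exact: laplace_integrable_neg_indic.
apply: le_Rintegral => //; first exact: laplace_integrable_psi_neg.
  by apply: integrable_EFinZl => //; exact: laplace_integrable_neg_indic.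
move=> w _; have /andP[_ neg_le] := psi_neg_itv w.
apply: le_trans (ler_wpM2r (expR_ge0 _) neg_le) _.
by rewrite -!mulrA -expRD -mulrDl [2 / q - 1 + beta]addrC.
Qed.

Lemma real_zero_bound (beta : R) : 0 < beta < 1 -> Z (beta%:C)%C = 0 ->
  1 - beta < 1 / (8 * q) -> rho / (1 - beta) <= M * V * q.
Proof.
move=> beta01 Z0 beta_near; have /andP[b0 b1] := beta01; have q0 : 0 < q by exact: lt_le_trans q2.
have d0 : 0 < 1 - beta by rewrite subr_gt0.
have dq : 1 - beta < q^-1.
  by apply: (lt_le_trans beta_near); rewrite div1r lef_pV2 ?posrE ?mulr_gt0//; lra.
have qV0 : 0 < q^-1 by rewrite invr_gt0.
have := mellin_defect_eq0 beta01 beta_near.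
rewrite /mellin_defect Z0 mul0r sub0r => /eqP; rewrite oppr_eq0 => /eqP.
rewrite !laplace_real subr0 -[X in (_%:C)%C - X](rmorph1 (real_complex R)).
set A := \int[mu]_w _; set B := \int[mu]_w _ => identityC.
have identity : A + B + (rho / (beta - 1) - V / beta) = 0.
  apply: complexI; rewrite rmorph0 -[RHS]identityC.
  by rewrite !(rmorphB, rmorphD, rmorphM, fmorphV) /= rmorph1.
have A_le : A <= V by exact: Rintegral_psi_pos_le.
have B_le : B <= M * V * q.
  have beta_gt : 1 - 2 / q < beta by lra.
  apply: (le_trans (Rintegral_psi_neg_le beta_gt)); rewrite ler_wpM2l ?mulr_ge0 ?(ltW V0)//.
  by rewrite -[leRHS]invrK lef_pV2 ?posrE//; lra.
have V_le : V <= V / beta by rewrite ler_pdivlMr// ler_piMr// ltW.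
have residueE : rho / (beta - 1) = - (rho / (1 - beta)) by rewrite -opprB invrN mulrN.
by rewrite residueE in identity; lra.
Qed.

End RealZero.

(** * The discriminant bound *)

Section ZeroNearOne.
Variables (R : realType) (L : fieldExtType rat) (E : embedding_system R L).
Local Notation n := (\dim {:L}).
Hypotheses (O_dens : 0 < density E (@ring_of_integers L)) (n2 : (2 <= n)%N).

Lemma zeta_zero_bound (zeta : R[i] -> R[i]) (beta : R) : is_dedekind_zeta L zeta ->
  0 < beta < 1 -> zeta (beta%:C)%C = 0 -> 1 - beta < 1 / (8 * n%:R) ->
  density E (@ring_of_integers L) / (1 - beta) <= theta_err E * n%:R.
Proof.
move=> [zeta_series zeta_holo] beta01 zeta0 near1; have /andP[_ beta_lt1] := beta01.
have zeta_sum s : 1 < cRe s -> has_sum (fun I : [set I : set L | nonzero_ideal I] =>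
    cexp (- s * ((ln_norm R (val I))%:C)%C)) (zeta s) by exact: zeta_series.
have summable := le_lt_trans (dirichlet_esum_le zeta_sum (ltr1n R 2)) (ltry _).
pose X := translation_spaceN R n.
have psi_sum := ideal_theta_fun_sum E X summable.
have phi_gt0 := arch_fun_gt0 E X; have phi_noninc := arch_fun_nonincreasing E X.
have [C [phi_left phi_right]] := arch_fun_decay E X.
have phi_holo s : 1 / 4 < cRe s < 3 -> holomorphic_at (laplace (arch_fun E X)) s.
  apply: laplace_holomorphic => sg sg_itv.
  exact: (laplace_integrable_phi phi_gt0 phi_noninc phi_left phi_right sg_itv).
have mass0 := mass_gt0 X O_dens n2 summable.
have := real_zero_bound zeta_holo phi_holo (measurable_psi phi_noninc psi_sum)
  (psi_ge0 phi_gt0 psi_sum) (laplace_psi zeta_sum phi_gt0 phi_noninc phi_left phi_right psi_sum)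
  mass0 (theta_err_ge0 O_dens) _ (ideal_theta_fun_decay X O_dens n2 summable)
  (ideal_theta_fun_asymp X O_dens n2 summable) beta01 zeta0 near1.
rewrite ler_nat => /(_ n2) residue_le; rewrite -(ler_pM2r mass0) mulrAC [leRHS]mulrAC.
apply: le_trans residue_le.
by rewrite ler_pM2r ?invr_gt0 ?subr_gt0// residue_ge.
Qed.

End ZeroNearOne.

(* Without an integral basis xget returns the zero tuple. *)
Lemma absolute_disc_junk (L : fieldExtType rat) : ~ (exists b, @integral_basis L b) ->
  absolute_disc L = 0.
Proof.
move=> no_basis; rewrite /absolute_disc xgetPN => [|b bP]; last by apply: no_basis; exists b.
rewrite /basis_disc (_ : \matrix_(i, j) _ = 0).
  by case: (\dim {:L}) (adim_gt0 {:L}) => // k _; rewrite det0 normr0.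
by apply/matrixP => i j; rewrite !mxE !nth_nseq !ltn_ord mul0r /field_trace !linear0.
Qed.

Lemma absolute_discE (L : fieldExtType rat) : (exists b, @integral_basis L b) ->
  exists2 b, @integral_basis L b & absolute_disc L = `|basis_disc b|.
Proof.
move=> [b bP]; exists (xget [tuple of nseq _ 0] (@integral_basis L)) => //.
by apply: xgetPex; exists b.
Qed.

Lemma dim_ge2 (L : fieldExtType rat) : {:L}%VS != 1%VS -> (2 <= \dim {:L})%N.
Proof.
apply: contraNT; rewrite -ltnNge ltnS => dim_le1.
by rewrite eq_sym eqEdim subvf dimv1.
Qed.

Section DiscriminantPower.
Variable R : realType.
Implicit Types (n d : nat) (delta : R).

Lemma natrX_sqrt_le_powR d : (0 < d)%N ->
  (d ^ 11)%:R * Num.sqrt d%:R <= (d%:R : R) `^ (117%:R / 10%:R).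
Proof.
move=> d_gt0; rewrite -powR12_sqrt// natrX -powR_mulrn// -powRD; last first.
  by rewrite pnatr_eq0 -lt0n d_gt0 implybT.
by apply: ler_powR; [rewrite ler1n|lra].
Qed.

Lemma expn11_ge d : (2 <= d)%N -> (64 * d ^ 5 <= d ^ 11)%N.
Proof.
by move=> d2; rewrite (_ : (11 = 6 + 5)%N)// expnD leq_mul// (_ : (64 = 2 ^ 6)%N)// leq_exp2r.
Qed.

Lemma disc_power_ge_far n d delta : (2 <= n)%N -> (n <= d)%N -> 1 / (8 * n%:R) <= delta ->
  (d%:R : R) `^ (- (117%:R / 10%:R)) <= delta.
Proof.
move=> n2 nd; apply: le_trans; have d2 := leq_trans n2 nd; have d_gt0 := ltnW d2.
have n_gt0 : 0 < 8 * n%:R :> R by rewrite mulr_gt0// ltr0n ltnW.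
rewrite powRN div1r lef_pV2 ?posrE ?powR_gt0 ?ltr0n//.
apply: le_trans (natrX_sqrt_le_powR d_gt0); apply: (@le_trans _ _ (d ^ 11)%:R).
  rewrite -natrM ler_nat (leq_trans _ (expn11_ge d2))// leq_mul//.
  by rewrite (leq_trans nd)// -[leqLHS]expn1 leq_pexp2l.
by rewrite ler_peMr// -[leLHS]sqrtr1 ler_wsqrtr// ler1n.
Qed.

Lemma disc_power_ge_near n d delta : (2 <= n)%N -> (n <= d)%N -> 0 < delta ->
  delta^-1 <= Num.sqrt d%:R * (32 * n%:R ^+ 2 * (n + 2)%:R * d%:R * n%:R) ->
  (d%:R : R) `^ (- (117%:R / 10%:R)) <= delta.
Proof.
move=> n2 nd delta0 inv_le; have d2 := leq_trans n2 nd; have d_gt0 := ltnW d2.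
rewrite powRN -[leRHS]invrK lef_pV2 ?posrE ?invr_gt0 ?powR_gt0 ?ltr0n//.
apply: le_trans (natrX_sqrt_le_powR d_gt0); apply: (le_trans inv_le).
rewrite mulrC ler_wpM2r ?sqrtr_ge0// -natrX -!natrM ler_nat.
apply: leq_trans (expn11_ge d2); apply: (@leq_trans (32 * d ^ 2 * (2 * d) * d * d)%N).
  by rewrite !leq_mul// ?leq_sqr// mul2n -addnn leq_add.
by apply: eq_leq; rewrite !expnS expn0; clear; lia.
Qed.

End DiscriminantPower.

Theorem theorem1p4 (R : realType) (L : fieldExtType rat)
    (L_neq_Q : {:L}%VS != 1%VS)
    (zeta_L : R[i] -> R[i]) (zeta_LP : is_dedekind_zeta L zeta_L)
    (beta1 : R) (beta1_01 : 0 < beta1 < 1)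
    (beta1_zero : zeta_L (beta1%:C)%C = 0) :
  1 - beta1 >= ratr (absolute_disc L) `^ (- (117%:R / 10%:R)).
Proof.
have /andP[_ beta1_lt1] := beta1_01; have gap0 : 0 < 1 - beta1 by rewrite subr_gt0.
have [/absolute_discE[b bP ->]|no_basis] := pselect (exists b, @integral_basis L b); last first.
  by rewrite absolute_disc_junk// rmorph0 powR0 ?ltW// lt_eqF//; lra.
have [E] := embedding_system_exists R L.
have n2 := dim_ge2 L_neq_Q; have [d d_gt0 discE] := integral_basis_disc_nat E bP.
have densE : density E (@ring_of_integers L) = (Num.sqrt d%:R)^-1.
  by rewrite (densityE (has_density_roi bP)) discE ratr_nat.
rewrite discE ratr_nat.
have sqrtd0 : 0 < Num.sqrt d%:R :> R by rewrite sqrtr_gt0 ltr0n.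
have O_dens : 0 < density E (@ring_of_integers L) by rewrite densE invr_gt0.
have nd := dim_le_disc O_dens n2 densE.
have [far|near1] := leP (1 / (8 * (\dim {:L})%:R)) (1 - beta1).
  exact: disc_power_ge_far far.
apply: (disc_power_ge_near n2 nd gap0).
have := zeta_zero_bound O_dens n2 zeta_LP beta1_01 beta1_zero near1.
by rewrite /theta_err densE ler_pdivrMl// exprVn invrK sqr_sqrtr.
Qed.
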